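(* (Positivity of the Laurent phenomenon.) Each cluster variable of an $\mathcal A$-cluster algebra is a Laurent polynomial with non-negative integer coefficients in the cluster variables of any given seed.
   Context: Put $[a]_+=\max(a,0)$. Fixed data: a lattice $N$ of rank $n$ with a skew-symmetric form $\{\cdot,\cdot\}:N\times N\to\mathbb Q$; a saturated sublattice $N_{uf}\subseteq N$; $I=\{1,\dots,n\}\supseteq I_{uf}$ with $|I_{uf}|=\operatorname{rank}N_{uf}$ (indices in $I\setminus I_{uf}$ are frozen); positive integers $d_i$ ($i\in I$) with gcd $1$; a finite-index sublattice $N^\circ\subseteq N$ with $\{N_{uf},N^\circ\}\subseteq\mathbb Z$ and $\{N,N_{uf}\cap N^\circ\}\subseteq\mathbb Z$. A seed is a basis $\mathbf s=(e_i)_{i\in I}$ of $N$ such that $(e_i)_{i\in I_{uf}}$ is a basis of $N_{uf}$ and $(d_ie_i)_{i\in I}$ is a basis of $N^\circ$; put $\epsilon_{ij}=\{e_i,e_j\}d_j$, and assume $\{e_i,\cdot\}\neq 0$ for $i\in I_{uf}$. Mutation at $k\in I_{uf}$ replaces $\mathbf s$ by $\mu_k(\mathbf s)=(e_i')$ with $e_k'=-e_k$, $e_i'=e_i+[\epsilon_{ik}]_+e_k$ for $i\ne k$. To an initial seed attach algebraically independent cluster variables $A_1,\dots,A_n$ (a transcendence basis of a field of rational functions over a field of characteristic $0$); mutation at $k$ replaces $A_k$ by $A_k'$ determined by the exchange relation $$A_kA_k'=\prod_{i\in I}A_i^{[\epsilon_{ki}]_+}+\prod_{i\in I}A_i^{[-\epsilon_{ki}]_+},$$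 and leaves $A_i$, $i\ne k$, unchanged. The cluster variables of the $\mathcal A$-cluster algebra (cluster algebra of geometric type) are all elements obtained in this way from the initial seed by finite sequences of mutations; the cluster variables of a seed are the $n$ elements attached to it (frozen ones included). *)

(* Defs.v *)
From HB Require Import structures.
From mathcomp Require Import all_boot all_order all_algebra.
From mathcomp Require Import mpoly.

Set Implicit Arguments.
Unset Strict Implicit.
Unset Printing Implicit Defensive.

Import Order.TTheory GRing.Theory Num.Theory.
Local Open Scope ring_scope.

Section Lattices.
Variable N : zmodType.

Definition is_Zbasis (J : finType) (b : J -> N) (L : {pred N}) : Prop :=
  (forall j, b j \in L) /\
  (forall v, v \in L -> exists! c : {ffun J -> int}, v = \sum_j b j *~ c j).

Definition has_rank (L : {pred N}) (r : nat) : Prop :=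
  exists b : 'I_r -> N, is_Zbasis b L.

Definition saturated (L : {pred N}) : Prop :=
  forall (m : int) (v : N), m != 0 -> v *~ m \in L -> v \in L.

(* The finite list s meets every coset of L. *)
Definition finite_index (L : {pred N}) : Prop :=
  exists s : seq N, forall v, exists2 w, w \in s & v - w \in L.

End Lattices.

(* The index set {1, ..., n} is represented by 'I_n. *)
Record fixed_data (N : zmodType) (n : nat) := FixedData {
  form : N -> N -> rat;
  Nuf : zmodClosed N;
  Iuf : {set 'I_n};
  dmult : 'I_n -> nat;
  Ncirc : zmodClosed N;
  lattice_rank : has_rank (predT : {pred N}) n;
  formDl : forall x y z, form (x + y) z = form x z + form y z;
  formDr : forall x y z, form x (y + z) = form x y + form x z;
  form_skew : forall x y, form x y = - form y x;
  Nuf_saturated : saturated Nuf;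
  Nuf_rank : has_rank Nuf #|Iuf|;
  dmult_gt0 : forall i, (0 < dmult i)%N;
  dmult_gcd : \big[gcdn/0%N]_(i < n) dmult i = 1%N;
  Ncirc_finite_index : finite_index Ncirc;
  form_uf_circ :
    forall x y, x \in Nuf -> y \in Ncirc -> form x y \is a Num.int;
  form_ufcirc :
    forall x y, y \in Nuf -> y \in Ncirc -> form x y \is a Num.int
}.

Section Seeds.
Variables (N : zmodType) (n : nat) (D : fixed_data N n).

Definition is_seed (e : 'I_n -> N) : Prop :=
  [/\ is_Zbasis e (predT : {pred N}),
      is_Zbasis (fun i : {i : 'I_n | i \in Iuf D} => e (val i)) (Nuf D),
      is_Zbasis (fun i => e i *+ dmult D i) (Ncirc D) &
      forall i, i \in Iuf D -> exists v, form D (e i) v != 0].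

Definition epsilon (e : 'I_n -> N) (i j : 'I_n) : rat :=
  form D (e i) (e j) * (dmult D j)%:R.

(* [a]_+ as a natural number.  It is only applied to +/- epsilon e i j with
   i or j in Iuf D, which is an integer when e is a seed, so that no rounding
   takes place. *)
Definition pos_part (a : rat) : nat := Num.truncn (Num.max a 0).

Definition mutate_basis (k : 'I_n) (e : 'I_n -> N) : 'I_n -> N :=
  fun i => if i == k then - e k else e i + e k *+ pos_part (epsilon e i k).

(* The exchange relation solved for A'_k; cluster variables are nonzero, being
   members of an algebraically independent family. *)
Definition mutate_cluster (F : fieldType) (k : 'I_n) (e : 'I_n -> N)
    (A : 'I_n -> F) : 'I_n -> F :=
  fun i => if i == k then
      (\prod_j A j ^+ pos_part (epsilon e k j) +
       \prod_j A j ^+ pos_part (- epsilon e k j)) / A k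
    else A i.

Record cluster_seed (F : fieldType) := ClusterSeed {
  seed_basis : 'I_n -> N;
  seed_vars : 'I_n -> F
}.

Definition mutate (F : fieldType) (s : cluster_seed F) (k : 'I_n) :=
  ClusterSeed (mutate_basis k (seed_basis s))
              (mutate_cluster k (seed_basis s) (seed_vars s)).

Definition mutation_reachable (F : fieldType) (s0 s : cluster_seed F) : Prop :=
  exists ks : seq 'I_n, all (fun k => k \in Iuf D) ks /\ s = foldl (@mutate F) s0 ks.

Definition is_cluster_variable (F : fieldType) (s0 : cluster_seed F) (x : F) :=
  exists s, mutation_reachable s0 s /\ exists i, x = seed_vars s i.

End Seeds.

Definition ratfun (K : fieldType) (n : nat) : fieldType :=
  {fraction {mpoly K[n]}}.

(* As ratfun K n has transcendence degree n over K, such an n-element family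
   is automatically a transcendence basis. *)
Definition alg_independent (K : fieldType) (n : nat)
    (A : 'I_n -> ratfun K n) : Prop :=
  forall p : {mpoly K[n]},
    mmap (fun c : K => tofrac (c%:MP : {mpoly K[n]})) A p = 0 -> p = 0.

(* S lists the exponent vectors (in Z^n) and c their coefficients. *)
Definition positive_Laurent (F : fieldType) (n : nat) (A : 'I_n -> F) (x : F) :
    Prop :=
  exists (S : seq {ffun 'I_n -> int}) (c : {ffun 'I_n -> int} -> nat),
    uniq S /\ x = \sum_(m <- S) (c m)%:R * \prod_i A i ^ m i.

(* Main.v *)
(** Following Gross, Hacking, Keel and Kontsevich, the coefficients of a cluster
    variable are wall functions of a consistent scattering diagram, which is encoded
    by words in wall crossings.  A letter (n, a) stands for the wall crossing
    y^m |-> y^m (1 + y^n)^(a om(n, m)), where om is the skew form; words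
    are compared through their logarithmic cocycle K, up to a given degree.  In
    every degree there is exactly one group element g such that, for every
    exponent n, the middle part of the factorization of g by the sign of
    om(n, -) carries along n the same weight as the initial letters (e_i, d_i).

    Positivity.  For a line of sight V generic in the hyperplane n^perp, consider
    the middle part of the factorization of g by the sign of V.  Its coefficient
    at n is the initial one if V lies far enough in the direction om(n, -).
    Moving V in that direction, the factorization only changes at finitely many
    joints, where a product ordered by slope is replaced by the product in the
    opposite order; the pentagon identity shows that this reordering, written in
    terms of letters, creates nonnegative coefficients only.

    Mutation.  A mutation at k acts on exponents by m_k |-> beta(m) - m_k, and
    carries the element g of a seed, with the letter (e_k, d_k) moved from one end
    to the other, to the element g of the mutated seed.

    Expansion.  Fix a seed having x as a cluster variable, and adjoin to its basis
    a vector e_o dual to x.  The part of K(g) of degree one in e_o is initially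
    the monomial y^(e_o); under mutation it changes exactly as the expansion of x
    does when the variables A_j are substituted, so its coefficients, which are
    nonnegative by positivity, are those of the Laurent expansion of x. *)

Require Import Defs.
From HB Require Import structures.
From mathcomp Require Import all_boot all_order all_algebra.
From mathcomp Require Import mpoly.
From mathcomp Require Import ring lra zify.
From Stdlib Require Import FunctionalExtensionality.

Set Implicit Arguments.
Unset Strict Implicit.
Unset Printing Implicit Defensive.

Import Order.TTheory GRing.Theory Num.Theory.
Local Open Scope ring_scope.

(** * Binomial coefficients with rational upper index *)

(** Three obstacles shape the proof. The form may be degenerate, so a word is not determined by its
    action on monomials; the cocycle still sees central walls, and a weight that is blind to a
    chosen letter isolates the rest of a word. Exponents are vectors of natural numbers, while a
    mutation sends m_k to beta(m) - m_k: one has to know beforehand that, once the letter e_k is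
    removed, only exponents with m_k <= beta(m) occur. This support bound is proved by induction on
    the weight ignoring e_k, and it is also what keeps the expansion of x finite under mutation,
    that is, the Laurent phenomenon. Finally, mutating a basis twice at k does not give it back;
    only the Gram matrix and the cluster return. Hence expansions are attached to these data alone,
    so that a chain of mutations can also be walked backward. Signs are not tracked along the chain:
    positivity is applied at its end, to the good elements of the last matrix. *)

Fixpoint binr (s : rat) (j : nat) : rat :=
  if j is i.+1 then binr s i * (s - i%:R) / i.+1%:R else 1.

Lemma binrS s j : j.+1%:R * binr s j.+1 = (s - j%:R) * binr s j.
Proof. by rewrite /= mulrC divfK ?pnatr_eq0 // mulrC. Qed.

Lemma binr0 j : binr 0 j = (j == 0)%N%:R.
Proof.
elim: j => [//|j IH]; rewrite /= IH; case: j {IH} => [|j] /=.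
  by rewrite subrr mulr0 mul0r.
by rewrite !mul0r.
Qed.

Lemma nS n : n.+1%:R = n%:R + 1 :> rat. Proof. by rewrite natr1. Qed.

Lemma binrD1 s j : binr (s + 1) j.+1 = binr s j.+1 + binr s j.
Proof.
elim: j => [|j IH]; first by rewrite /=; field.
have h n : (n.+1%:R : rat) != 0 by rewrite pnatr_eq0.
apply: (mulfI (h j.+1)); rewrite mulrDr !binrS IH.
have := binrS s j; set B1 := binr s j.+1; set B0 := binr s j => E.
have -> : (s + 1 - j.+1%:R) * (B1 + B0) = (s - j%:R) * B1 + (s - j%:R) * B0.
  by rewrite nS; ring.
by rewrite -E !nS; ring.
Qed.

Lemma binr_absorb s j : j.+1%:R * binr s j.+1 = s * binr (s - 1) j.
Proof.
elim: j => [|j IH]; first by rewrite /=; field.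
have h n : (n.+1%:R : rat) != 0 by rewrite pnatr_eq0.
rewrite binrS; apply: (mulfI (h j)).
rewrite mulrCA IH [RHS]mulrCA binrS nS; ring.
Qed.

(** Multiplying by [j.+1], written as i + (j.+1 - i), lets [binr_absorb] lower the index of one
    factor in each half. *)
Lemma Vandermonder s t j :
  \sum_(i < j.+1) binr s i * binr t (j - i) = binr (s + t) j.
Proof.
elim: j s t => [|j IH] s t; first by rewrite big_ord1 /= mulr1.
have h n : (n.+1%:R : rat) != 0 by rewrite pnatr_eq0.
apply: (mulfI (h j)); rewrite binr_absorb mulrDl.
have -> : binr (s + t - 1) j = binr ((s - 1) + t) j by congr binr; ring.
have E : s + t - 1 = s + (t - 1) by ring.
have -> : t * binr (s - 1 + t) j = t * binr (s + (t - 1)) j.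
  by congr (_ * binr _ _); ring.
rewrite -!IH !mulr_sumr.
transitivity (\sum_(i < j.+2) (i%:R * (binr s i * binr t (j.+1 - i))) +
  \sum_(i < j.+2) ((j.+1 - i)%:R * (binr s i * binr t (j.+1 - i)))).
  rewrite -big_split /=; apply: eq_bigr => i _.
  by rewrite -mulrDl -natrD subnKC // -ltnS.
congr (_ + _).
  rewrite big_ord_recl mul0r add0r; apply: eq_bigr => i _.
  by rewrite /bump /= ?add1n ?subSS mulrA binr_absorb mulrA.
rewrite big_ord_recr /= subnn mul0r addr0; apply: eq_bigr => i _.
by rewrite subSn -1?ltnS // mulrCA binr_absorb mulrCA.
Qed.

Lemma binr_nat (m j : nat) : binr m%:R j = 'C(m, j)%:R.
Proof.
elim: m j => [|m IH] [|j]; rewrite ?bin0 //.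
  by rewrite binr0 bin0n.
by rewrite -natr1 binrD1 !IH binS natrD.
Qed.

Lemma binr_int s j : s \is a Num.int -> binr s j \is a Num.int.
Proof.
have up : forall n j, binr n%:R j \is a Num.int.
  by move=> n i; rewrite binr_nat rpred_nat.
have dn : forall n j, binr (- n%:R) j \is a Num.int.
  elim=> [|n IH] {}j; first by rewrite oppr0 binr0 rpred_nat.
  elim: j => [|j IHj]; first exact: rpred1.
  have -> : binr (- n.+1%:R) j.+1 = binr (- n%:R) j.+1 - binr (- n.+1%:R) j.
    have -> : - n%:R = - n.+1%:R + 1 :> rat by rewrite nS; ring.
    by rewrite binrD1 addrK.
  by apply: rpredB.
case/intrP => z ->; case: z => n; first exact: up.
by rewrite NegzE mulrNz; apply: dn.
Qed.

(** Coefficient form of the logarithmic derivative: y d/dy of (1 + y)^s is s y/(1 + y) times (1 +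
    y)^s. It is what relates the action of a letter to its logarithm. *)
Lemma binr_alt s j :
  j%:R * binr s j = s * \sum_(i < j) (-1) ^+ i * binr s (j - i.+1).
Proof.
elim: j => [|j IH]; first by rewrite big_ord0 mul0r mulr0.
rewrite binrS big_ord_recl /= subSS subn0 expr0 mul1r mulrDr.
have -> : \sum_(i < j) (-1) ^+ bump 0 i * binr s (j.+1 - (bump 0 i).+1) =
  - \sum_(i < j) (-1) ^+ i * binr s (j - i.+1) :> rat.
  rewrite -sumrN; apply: eq_bigr => i _.
  by rewrite /bump /= ?add1n exprS ?subSS !mulNr mul1r.
by rewrite mulrN -IH mulrBl.
Qed.

Arguments binr : simpl never.

(** * Words of wall crossings and their cocycle *)

Section Monomials.
Variable r : nat.
Notation mon := 'X_{1..r}.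
Implicit Types (m n u v p q : mon).

Definition wt (phi : 'I_r -> rat) m : rat := locked (\sum_i (m i)%:R * phi i).

Lemma wtE phi m : wt phi m = \sum_i (m i)%:R * phi i.
Proof. by rewrite /wt -lock. Qed.

Lemma wtD phi m n : wt phi (m + n)%MM = wt phi m + wt phi n.
Proof.
by rewrite !wtE -big_split; apply: eq_bigr => i _; rewrite mnmDE natrD mulrDl.
Qed.

Lemma wt0 phi : wt phi 0%MM = 0.
Proof. by rewrite !wtE big1 // => i _; rewrite mnm0E mul0r. Qed.

Lemma wtMn phi m j : wt phi (m *+ j)%MM = j%:R * wt phi m.
Proof.
by rewrite !wtE mulr_sumr; apply: eq_bigr => i _; rewrite mulmnE natrM mulrCA mulrA.
Qed.

Lemma wtB phi m n : (n <= m)%MM -> wt phi (m - n)%MM = wt phi m - wt phi n.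
Proof. by move=> h; rewrite -{2}(submK h) wtD addrK. Qed.

Lemma wt1 phi i : wt phi U_(i)%MM = phi i.
Proof.
rewrite !wtE (bigD1 i) //= mnm1E eqxx mul1r big1 ?addr0 // => j ne.
by rewrite mnm1E eq_sym (negbTE ne) mul0r.
Qed.

Definition dg : 'I_r -> rat := fun=> 1.

Lemma wt_dg m : wt dg m = (mdeg m)%:R.
Proof. by rewrite !wtE mdegE natr_sum; apply: eq_bigr => i _; rewrite mulr1. Qed.

Lemma mdeg_le m n : (n <= m)%MM -> (mdeg n <= mdeg m)%N.
Proof. by move=> h; rewrite -(submK h) mdegD leq_addl. Qed.

Lemma mdeg_sub m n : (n <= m)%MM -> mdeg (m - n)%MM = (mdeg m - mdeg n)%N.
Proof. by move=> h; rewrite -{2}(submK h) mdegD addnK. Qed.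

Lemma mdeg_gt0 m : m != 0%MM -> (0 < mdeg m)%N.
Proof. by rewrite lt0n mdeg_eq0. Qed.

Lemma submn_eq m n u : (n <= m)%MM -> ((m - n)%MM == u) = (m == (u + n)%MM).
Proof. by move=> h; rewrite -(eqm_add2r n) submK. Qed.

Lemma mulmI n i j : n != 0%MM -> ((n *+ i)%MM == (n *+ j)%MM) = (i == j).
Proof.
move=> n0; apply/eqP/eqP => [|-> //] /(congr1 mdeg); rewrite !mdegMn => /eqP.
by rewrite eqn_pmul2l ?mdeg_gt0 // => /eqP.
Qed.

Lemma mulmDr n i j : (n *+ (i + j))%MM = (n *+ i + n *+ j)%MM.
Proof. by apply/mnmP => k; rewrite mnmDE !mulmnE mulnDr. Qed.

Lemma mulmA n i j : (n *+ i *+ j)%MM = (n *+ (i * j))%MM.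
Proof. by apply/mnmP => k; rewrite !mulmnE mulnA. Qed.

Lemma lem_eq m n : (n <= m)%MM -> mdeg n = mdeg m -> n = m.
Proof.
move=> h e; rewrite -(submK h).
have : mdeg (m - n)%MM == 0%N by rewrite mdeg_sub // e subnn.
by rewrite mdeg_eq0 => /eqP ->; rewrite add0m.
Qed.

Definition mons d : seq mon := map val (enum {: 'X_{1..r < d.+1}}).

Lemma mem_mons d m : (m \in mons d) = (mdeg m <= d)%N.
Proof.
apply/mapP/idP => [[u _ ->]|h]; first by rewrite -ltnS bmdeg.
by exists (BMultinom (h : mdeg m < d.+1)%N); rewrite ?mem_enum.
Qed.

Lemma mons_uniq d : uniq (mons d).
Proof. by rewrite map_inj_uniq ?enum_uniq //; apply: val_inj. Qed.

Lemma sum_mons1 d u (F : mon -> rat) :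
  \sum_(p <- mons d) (p == u)%:R * F p = if (mdeg u <= d)%N then F u else 0.
Proof.
case: ifPn => h.
  rewrite (bigD1_seq u) ?mem_mons ?mons_uniq //= eqxx mul1r big1 ?addr0 // => i.
  by move=> /negbTE ->; rewrite mul0r.
rewrite big_seq big1 // => p; rewrite mem_mons; case: eqP => [->|_ _]; last by rewrite mul0r.
by rewrite (negbTE h).
Qed.

Definition ser := mon -> rat.
Implicit Types (x y z : ser).

Definition delta u : ser := fun m => (m == u)%:R.

Lemma expand x d m : (mdeg m <= d)%N -> x m = \sum_(u <- mons d) x u * delta u m.
Proof.
move=> h; transitivity (\sum_(u <- mons d) (u == m)%:R * x u).
  by rewrite sum_mons1 h.
by apply: eq_bigr => u _; rewrite mulrC /delta eq_sym.
Qed.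

Lemma sum_conv (k N : nat) (F : nat -> nat -> rat) : (k < N)%N ->
  \sum_(i < N) \sum_(j < N) (k == i + j)%N%:R * F i j = \sum_(i < k.+1) F i (k - i)%N.
Proof.
move=> kN; rewrite (big_ord_widen N (fun i => F i (k - i)%N)) // [RHS]big_mkcond /=.
apply: eq_bigr => i _; rewrite ltnS; case: leqP => ik.
  rewrite (bigD1 (Ordinal (leq_ltn_trans (leq_subr i k) kN))) //= subnKC // eqxx.
  rewrite mul1r big1 ?addr0 // => j; rewrite -val_eqE /= => ne.
  case: eqP => [e|]; last by rewrite mul0r.
  by rewrite e addKn eqxx in ne.
rewrite big1 // => j _; case: eqP => [e|]; last by rewrite mul0r.
by rewrite e ltnNge leq_addr in ik.
Qed.

End Monomials.

Section Scattering.
Variables (r : nat) (W : 'I_r -> 'I_r -> rat).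
Hypothesis skewW : forall i j, W i j = - W j i.
Notation mon := 'X_{1..r}.
Notation ser := (ser r).
Implicit Types (m n u v p q : mon) (x y z : ser).

Definition omv n (i : 'I_r) : rat := \sum_j (n j)%:R * W j i.
Definition om n m : rat := wt (omv n) m.

Lemma om_sum n m : om n m = \sum_i \sum_j (n i)%:R * (m j)%:R * W i j.
Proof.
rewrite /om wtE exchange_big; apply: eq_bigr => j _ /=.
by rewrite mulr_sumr; apply: eq_bigr => i _; rewrite mulrA (mulrC _ (n i)%:R).
Qed.

Lemma omC n m : om n m = - om m n.
Proof.
rewrite !om_sum exchange_big -sumrN; apply: eq_bigr => i _ /=.
by rewrite -sumrN; apply: eq_bigr => j _; rewrite skewW mulrN (mulrC (n j)%:R).
Qed.

Lemma om_id n : om n n = 0.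
Proof. by have := omC n n; lra. Qed.

Lemma omDr n m p : om n (m + p)%MM = om n m + om n p.
Proof. exact: wtD. Qed.
Lemma omDl n m p : om (m + p)%MM n = om m n + om p n.
Proof. by rewrite omC omDr opprD -!omC. Qed.
Lemma omMr n m j : om n (m *+ j)%MM = j%:R * om n m.
Proof. exact: wtMn. Qed.
Lemma omMl n m j : om (m *+ j)%MM n = j%:R * om m n.
Proof. by rewrite omC omMr -mulrN -omC. Qed.
Lemma om0r n : om n 0%MM = 0. Proof. exact: wt0. Qed.
Lemma om0l n : om 0%MM n = 0. Proof. by rewrite omC om0r oppr0. Qed.
Lemma omBr n m p : (p <= m)%MM -> om n (m - p)%MM = om n m - om n p.
Proof. exact: wtB. Qed.

(* The letter (n, a) stands for y^m |-> y^m (1 + y^n)^(a om(n, m)). *)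
Definition letter := (mon * rat)%type.
Implicit Types (l : letter).

(** The exponent is evaluated at the target m instead of the source m - j n; both agree because
    [om n n = 0]. *)
Definition actl l x : ser := fun m =>
  \sum_(j < (mdeg m).+1 | (l.1 *+ j <= m)%MM)
     binr (l.2 * om l.1 m) j * x (m - l.1 *+ j)%MM.

Lemma actlE N l x m : (mdeg m <= N)%N -> actl l x m =
  \sum_(j < N.+1 | (l.1 *+ j <= m)%MM)
     binr (l.2 * om l.1 m) j * x (m - l.1 *+ j)%MM.
Proof.
move=> h; rewrite /actl.
rewrite (big_ord_widen_cond N.+1 (fun j => (l.1 *+ j <= m)%MM)
   (fun j => binr (l.2 * om l.1 m) j * x (m - l.1 *+ j)%MM)) //.
rewrite big_mkcond [RHS]big_mkcond; apply: eq_bigr => j _.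
case: ifPn => //=; case: ifP => //= h1; rewrite -leqNgt => h2.
case: (eqVneq l.1 0%MM) => [->|n0].
  by rewrite om0l mulr0 binr0 (gtn_eqF (leq_trans _ h2)) // mul0r.
have := mdeg_le h1; rewrite mdegMn => h3.
have := leq_trans h2 (leq_trans (leq_pmull j (mdeg_gt0 n0)) h3).
by rewrite ltnn.
Qed.

Lemma actl_delta N l u m : (mdeg m <= N)%N -> actl l (delta u) m =
  \sum_(j < N.+1) binr (l.2 * om l.1 u) j * delta (u + l.1 *+ j)%MM m.
Proof.
move=> h; rewrite (actlE _ _ h) big_mkcond; apply: eq_bigr => j _; rewrite /delta.
case: ifPn => h1; last first.
  by case: eqP => [e|]; [rewrite e lem_addl in h1 | rewrite mulr0].
rewrite submn_eq //; case: eqP => [->|]; last by rewrite !mulr0.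
by rewrite omDr omMr om_id mulr0 addr0.
Qed.

Lemma eq_actl l x y m : (forall u, (u <= m)%MM -> x u = y u) -> actl l x m = actl l y m.
Proof. by move=> h; apply: eq_bigr => j _; rewrite h ?lem_subr. Qed.

Lemma actl_sum (I : Type) (s : seq I) (c : I -> rat) (f : I -> ser) l m :
  actl l (fun p => \sum_(i <- s) c i * f i p) m = \sum_(i <- s) c i * actl l (f i) m.
Proof.
rewrite /actl (eq_bigr _ (fun j _ => mulr_sumr _ _ _ _)) exchange_big /=.
by apply: eq_bigr => i _; rewrite mulr_sumr; apply: eq_bigr => j _; rewrite mulrCA.
Qed.

Definition brk x y : ser := fun m =>
  \sum_(p <- mons r (mdeg m) | (p <= m)%MM) om p (m - p)%MM * x p * y (m - p)%MM.

Lemma eq_brk x y x' y' m : (forall u, (u <= m)%MM -> x u = x' u) ->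
  (forall u, (u <= m)%MM -> y u = y' u) -> brk x y m = brk x' y' m.
Proof. by move=> h h'; apply: eq_bigr => p pm; rewrite h ?h' ?lem_subr. Qed.

Lemma brk_suml (I : Type) (s : seq I) (c : I -> rat) (f : I -> ser) y m :
  brk (fun p => \sum_(i <- s) c i * f i p) y m = \sum_(i <- s) c i * brk (f i) y m.
Proof.
transitivity (\sum_(p <- mons r (mdeg m) | (p <= m)%MM) \sum_(i <- s)
   c i * (om p (m - p)%MM * f i p * y (m - p)%MM)).
  apply: eq_bigr => p _; rewrite mulr_sumr mulr_suml; apply: eq_bigr => i _; ring.
by rewrite exchange_big /=; apply: eq_bigr => i _; rewrite mulr_sumr.
Qed.

Lemma brk_sumr (I : Type) (s : seq I) (c : I -> rat) (f : I -> ser) x m :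
  brk x (fun p => \sum_(i <- s) c i * f i p) m = \sum_(i <- s) c i * brk x (f i) m.
Proof.
transitivity (\sum_(p <- mons r (mdeg m) | (p <= m)%MM) \sum_(i <- s)
   c i * (om p (m - p)%MM * x p * f i (m - p)%MM)).
  apply: eq_bigr => p _; rewrite mulr_sumr; apply: eq_bigr => i _; ring.
by rewrite exchange_big /=; apply: eq_bigr => i _; rewrite mulr_sumr.
Qed.

Lemma brk_delta u v m : brk (delta u) (delta v) m = om u v * delta (u + v)%MM m.
Proof.
rewrite /brk /delta.
transitivity (\sum_(p <- mons r (mdeg m)) (p == u)%:R * (om u v * (m == u + v)%MM%:R)).
  rewrite big_mkcond; apply: eq_bigr => p _; case: ifPn => h; last first.
    case: eqP => [pu|]; last by rewrite mul0r.
    case: eqP => [e|]; last by rewrite !mulr0.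
    by rewrite pu e lem_addr in h.
  case: eqP => [pu|]; last by rewrite mulr0 !mul0r.
  rewrite submn_eq // pu addmC; case: eqP => [->|_]; last by rewrite !mulr0.
  by rewrite (addmC u) addmK !mulr1 mul1r.
rewrite sum_mons1; case: ifPn => // h; case: eqP => [e|]; last by rewrite mulr0.
by rewrite e mdegD leq_addr in h.
Qed.

Lemma actl0 l x m : l.1 = 0%MM -> actl l x m = x m.
Proof.
move=> l0; rewrite /actl l0 big_mkcond big_ord_recl /= big1 ?addr0.
  rewrite mulm0n subm0 mul1r ifT //; apply/mnm_lepP => i; by rewrite mnm0E.
by move=> j _; case: ifP => // _; rewrite om0l mulr0 binr0 !mul0r.
Qed.

Lemma expand_ser x m u : (u <= m)%MM ->
  x u = \sum_(v <- mons r (mdeg m)) x v * delta v u.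
Proof. by move=> h; apply: expand (mdeg_le h). Qed.

Lemma actl_expand l x m p : (p <= m)%MM ->
  actl l x p = \sum_(v <- mons r (mdeg m)) x v * actl l (delta v) p.
Proof.
move=> h; rewrite -actl_sum; apply: eq_actl => u up.
exact/expand_ser/(lepm_trans up).
Qed.

(** The form at (u + i n, v + j n) is om(u, v) plus i om(n, v) - j om(n, u). The first term is
    summed by Vandermonde; after absorption of i and j the two corrections cancel. *)
Lemma poisson_delta l u v m :
  om u v * actl l (delta (u + v)%MM) m = brk (actl l (delta u)) (actl l (delta v)) m.
Proof.
case: (eqVneq l.1 0%MM) => [l0|n0].
  rewrite actl0 // -brk_delta; apply: eq_brk => p _; by rewrite actl0.
set N := mdeg m; set n := l.1 in n0 *; set s := l.2 * om n u; set t := l.2 * om n v.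
rewrite (actl_delta l (u + v)%MM (leqnn _)) -/n.
rewrite (@eq_brk _ _ (fun p => \sum_(i < N.+1) binr s i * delta (u + n *+ i)%MM p)
   (fun p => \sum_(j < N.+1) binr t j * delta (v + n *+ j)%MM p)); last 2 first.
- by move=> p pm; apply/actl_delta/mdeg_le.
- by move=> p pm; apply/actl_delta/mdeg_le.
rewrite brk_suml.
have E i j : om (u + n *+ i)%MM (v + n *+ j)%MM = om u v + i%:R * om n v - j%:R * om n u.
  by rewrite omDl !omDr !omMl !omMr om_id (omC u n); ring.
transitivity (\sum_(i < N.+1) \sum_(j < N.+1) delta (u + v + n *+ (i + j))%MM m *
   (binr s i * binr t j * (om u v + i%:R * om n v - j%:R * om n u))); last first.
  apply: eq_bigr => i _; rewrite brk_sumr mulr_sumr; apply: eq_bigr => j _.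
  rewrite brk_delta E.
  have -> : (u + n *+ i + (v + n *+ j))%MM = (u + v + n *+ (i + j))%MM.
    by rewrite mulmDr !addmA -(addmA u) (addmC (n *+ i)%MM) !addmA.
  ring.
have [k kN|no] := pickP (fun k : 'I_N.+1 => m == (u + v + n *+ k)%MM).
  have D j : delta (u + v + n *+ j)%MM m = (k == j :> nat)%:R.
    by rewrite /delta (eqP kN) eqm_add2l mulmI.
  rewrite [RHS](eq_bigr (fun i : 'I_N.+1 => \sum_(j < N.+1) (k == (i + j)%N :> nat)%:R *
     (binr s i * binr t j * (om u v + i%:R * om n v - j%:R * om n u)))); last first.
    by move=> i _; apply: eq_bigr => j _; rewrite D.
  rewrite (sum_conv (fun i j => binr s i * binr t j *
     (om u v + i%:R * om n v - j%:R * om n u))) //.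
  rewrite (bigD1 k) //= D eqxx mulr1 big1 ?addr0; last first.
    by move=> i /negbTE ik; rewrite D eq_sym -val_eqE /= in ik *; rewrite ik mulr0.
  transitivity (\sum_(i < k.+1) (om u v * (binr s i * binr t (k - i)) +
      (om n v * (i%:R * (binr s i * binr t (k - i))) -
       om n u * (binr s i * ((k - i)%:R * binr t (k - i)))))); last first.
    by apply: eq_bigr => i _; ring.
  rewrite big_split /= -mulr_sumr Vandermonder -[LHS]addr0; congr (_ + _).
    by rewrite omDr mulrDr.
  rewrite sumrB -!mulr_sumr.
  case: (nat_of_ord k) => [|k'].
    by rewrite !big_ord1 /= !mul0r !mulr0 subrr.
  rewrite big_ord_recl (_ : (nat_of_ord (@ord0 k'.+1))%:R = 0) // mul0r add0r.
  rewrite [X in _ - om n u * X]big_ord_recr /= subnn mul0r mulr0 addr0.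
  have -> : \sum_(i < k'.+1) (bump 0 i)%:R * (binr s (bump 0 i) * binr t (k'.+1 - bump 0 i))
     = s * binr (s - 1 + t) k'.
    rewrite -Vandermonder mulr_sumr; apply: eq_bigr => i _.
    by rewrite /bump add1n subSS mulrA binr_absorb mulrA.
  have -> : \sum_(i < k'.+1) binr s i * ((k'.+1 - i)%:R * binr t (k'.+1 - i))
     = t * binr (s + (t - 1)) k'.
    rewrite -Vandermonder mulr_sumr; apply: eq_bigr => i _.
    by rewrite subSn -1?ltnS // binr_absorb mulrCA.
  have -> : s - 1 + t = s + (t - 1) by ring.
  rewrite /s /t; ring.
rewrite [RHS]big1; last first.
  move=> i _; rewrite big1 // => j _.
  case: (leqP (i + j) N) => h; rewrite /delta.
    by have := no (Ordinal (h : i + j < N.+1)%N) => /= ->; rewrite mul0r.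
  case: eqP => [e|]; last by rewrite mul0r.
  have := congr1 mdeg e; rewrite !mdegD mdegMn => e'.
  have : (mdeg n * (i + j) <= N)%N by apply: leq_trans (leq_addl (mdeg u + mdeg v) _) _; rewrite -e'.
  by move/(leq_trans (leq_pmull (i + j) (mdeg_gt0 n0))); rewrite leqNgt h.
by rewrite big1 ?mulr0 // => j _; rewrite /delta no mulr0.
Qed.

Lemma poisson l x y m : actl l (brk x y) m = brk (actl l x) (actl l y) m.
Proof.
set M := mons r (mdeg m).
transitivity (\sum_(u <- M) x u * \sum_(v <- M) y v * (om u v * actl l (delta (u + v)%MM) m)).
  rewrite (@eq_actl l (brk x y) (fun p => \sum_(u <- M) x u *
      (\sum_(v <- M) y v * brk (delta u) (delta v) p))) => [|p pm]; last first.
    rewrite (@eq_brk _ _ (fun p => \sum_(u <- M) x u * delta u p)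
       (fun p => \sum_(v <- M) y v * delta v p)); last 2 first.
    - by move=> q qp; apply/expand_ser/(lepm_trans qp).
    - by move=> q qp; apply/expand_ser/(lepm_trans qp).
    by rewrite brk_suml; apply: eq_bigr => u _; rewrite brk_sumr.
  rewrite actl_sum; apply: eq_bigr => u _; rewrite actl_sum; congr (_ * _).
  apply: eq_bigr => v _; congr (_ * _).
  transitivity (actl l (fun p => \sum_(i <- [:: om u v]) i * delta (u + v)%MM p) m).
    by apply: eq_actl => q _; rewrite brk_delta big_seq1.
  by rewrite (actl_sum [:: om u v] id (fun=> delta (u + v)%MM)) big_seq1.
rewrite (@eq_brk (actl l x) (actl l y) (fun p => \sum_(u <- M) x u * actl l (delta u) p)
    (fun p => \sum_(v <- M) y v * actl l (delta v) p)); last 2 first.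
- by move=> p pm; apply: actl_expand.
- by move=> p pm; apply: actl_expand.
rewrite brk_suml; apply: eq_bigr => u _; rewrite brk_sumr; congr (_ * _).
by apply: eq_bigr => v _; rewrite poisson_delta.
Qed.

End Scattering.

(* Later sections use the plain names for the instances at a fixed matrix W. *)
Notation omW := om (only parsing).
Notation actlW := actl (only parsing).
Notation brkW := brk (only parsing).

Section Words.
Variables (r : nat) (W : 'I_r -> 'I_r -> rat).
Hypothesis skewW : forall i j, W i j = - W j i.
Notation mon := 'X_{1..r}.
Notation ser := (ser r).
Notation letter := (letter r).
Notation om := (om W).
Notation actl := (actl W).
Notation brk := (brk W).
Implicit Types (m n u v p q : mon) (x y z : ser) (l : letter) (w : seq letter).
Implicit Types (phi psi : 'I_r -> rat).

(* a phi(n) log(1 + y^n), for l = (n, a). *)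
Definition Kl phi l : ser := fun m =>
  \sum_(j < mdeg m) (m == l.1 *+ j.+1)%MM%:R * (l.2 * wt phi l.1 * ((-1) ^+ j / j.+1%:R)).

Lemma KlE N phi l m : (mdeg m <= N)%N -> Kl phi l m =
  \sum_(j < N) (l.2 * wt phi l.1 * ((-1) ^+ j / j.+1%:R)) * delta (l.1 *+ j.+1)%MM m.
Proof.
move=> h; rewrite /Kl /delta.
rewrite (big_ord_widen N (fun j => (m == l.1 *+ j.+1)%MM%:R *
   (l.2 * wt phi l.1 * ((-1) ^+ j / j.+1%:R)))) //.
rewrite big_mkcond; apply: eq_bigr => j _; rewrite mulrC.
case: ifPn => //; rewrite -leqNgt => h2.
case: (eqVneq l.1 0%MM) => [->|n0]; first by rewrite wt0 mulr0 !mul0r.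
case: eqP => [e|]; last by rewrite mulr0.
have := congr1 mdeg e; rewrite mdegMn => e2.
by have := leq_pmull j.+1 (mdeg_gt0 n0); rewrite -e2 ltnNge h2.
Qed.

Lemma Kl_om0 phi l n a b m : om n l.1 = 0 -> actl (n, a) (Kl phi (l.1, b)) m = Kl phi (l.1, b) m.
Proof.
move=> h; rewrite (KlE phi _ (leqnn _)).
rewrite (@eq_actl _ W _ _ (fun p => \sum_(j < mdeg m) (b * wt phi l.1 *
   ((-1) ^+ j / j.+1%:R)) * delta (l.1 *+ j.+1)%MM p)); last first.
  by move=> p pm; rewrite (KlE phi _ (mdeg_le pm)).
rewrite actl_sum; apply: eq_bigr => j _; congr (_ * _).
rewrite (actl_delta skewW _ _ (leqnn _)) big_ord_recl /= omMr h !mulr0.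
rewrite mulm0n addm0 mul1r big1 ?addr0 // => i _.
by rewrite binr0 mul0r.
Qed.

Lemma actl_lin l x y a b m :
  actl l (fun p => a * x p + b * y p) m = a * actl l x m + b * actl l y m.
Proof.
rewrite /actlW !mulr_sumr -big_split; apply: eq_bigr => j _ /=; ring.
Qed.

Lemma actlD l x y m : actl l (fun p => x p + y p) m = actl l x m + actl l y m.
Proof. by rewrite -[RHS]mul1r mulrDr -actl_lin; apply: eq_actl => u _; rewrite !mul1r. Qed.

Lemma actlB l x y m : actl l (fun p => x p - y p) m = actl l x m - actl l y m.
Proof.
rewrite -[RHS]mul1r mulrBr -mulNr -actl_lin; apply: eq_actl => u _.
by rewrite mul1r mulN1r.
Qed.

Lemma brkDl x x' y m : brk (fun p => x p + x' p) y m = brk x y m + brk x' y m.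
Proof. by rewrite -big_split; apply: eq_bigr => p _ /=; ring. Qed.
Lemma brkDr x y y' m : brk x (fun p => y p + y' p) m = brk x y m + brk x y' m.
Proof. by rewrite -big_split; apply: eq_bigr => p _ /=; ring. Qed.

(** On the string u + j n the left factor is j phi(n), and [binr_alt] turns j times a binomial
    coefficient into a convolution with the coefficients of the logarithm. *)
Lemma star_delta phi l u m :
  (wt phi m - wt phi u) * actl l (delta u) m = brk (Kl phi l) (actl l (delta u)) m.
Proof.
case: (eqVneq l.1 0%MM) => [l0|n0].
  rewrite (actl0 skewW) // /delta; case: eqP => [->|_]; last rewrite mulr0.
    rewrite subrr mul0r /brkW big1 // => p _.
    by rewrite (KlE phi l (leqnn _)) big1 ?mulr0 ?mul0r // => j _; rewrite l0 wt0 mulr0 !mul0r.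
  rewrite /brkW big1 // => p _.
  by rewrite (KlE phi l (leqnn _)) big1 ?mulr0 ?mul0r // => j _; rewrite l0 wt0 mulr0 !mul0r.
set N := mdeg m; set n := l.1 in n0 *; set s := l.2 * om n u.
rewrite (actl_delta skewW l u (leqnn _)) -/n -/s.
rewrite (@eq_brk _ _ _ _ (fun p => \sum_(i < N.+1) (l.2 * wt phi n * ((-1) ^+ i / i.+1%:R)) *
     delta (n *+ i.+1)%MM p)
   (fun p => \sum_(j < N.+1) binr s j * delta (u + n *+ j)%MM p)); last 2 first.
- by move=> p pm; apply: KlE; apply/leqW/mdeg_le.
- by move=> p pm; apply/(actl_delta skewW)/mdeg_le.
rewrite brk_suml.
have E i j : om (n *+ i.+1)%MM (u + n *+ j)%MM = i.+1%:R * om n u.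
  by rewrite omDr omMr !(omMl skewW) (om_id skewW); ring.
transitivity (\sum_(i < N.+1) \sum_(j < N.+1) delta (u + n *+ (i + j).+1)%MM m *
   (wt phi n * s * ((-1) ^+ i * binr s j))); last first.
  apply: eq_bigr => i _; rewrite brk_sumr mulr_sumr; apply: eq_bigr => j _.
  rewrite brk_delta E.
  have -> : (n *+ i.+1 + (u + n *+ j))%MM = (u + n *+ (i + j).+1)%MM.
    by rewrite -addSn mulmDr !addmA (addmC (n *+ _)%MM).
  rewrite /s; field.
  by rewrite addrC natr1 pnatr_eq0.
have [k kN|no] := pickP (fun k : 'I_N.+1 => m == (u + n *+ k)%MM).
  have D j : delta (u + n *+ j)%MM m = (k == j :> nat)%:R.
    by rewrite /delta (eqP kN) eqm_add2l mulmI.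
  rewrite (bigD1 k) //= D eqxx mulr1 big1 ?addr0; last first.
    by move=> i /negbTE ik; rewrite D eq_sym -val_eqE /= in ik *; rewrite ik mulr0.
  have -> : wt phi m - wt phi u = k%:R * wt phi n.
    by rewrite (eqP kN) wtD wtMn; ring.
  case: k D kN => -[|k] /= kN D _.
    rewrite mul0r mul0r big1 // => i _; rewrite big1 // => j _.
    by rewrite D /= mul0r.
  under eq_bigr => i _ do under eq_bigr => j _ do rewrite D eqSS.
  rewrite (sum_conv (fun i j => wt phi n * s * ((-1) ^+ i * binr s j))) ?(ltnW kN) //.
  rewrite -mulr_sumr mulrAC binr_alt mulrAC (mulrC _ (wt _ _)) mulrA; congr (_ * _).
rewrite [RHS]big1; last first.
  move=> i _; rewrite big1 // => j _.
  case: (ltnP (i + j) N) => h; rewrite /delta.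
    by have := no (Ordinal (h : (i + j).+1 < N.+1)%N) => /= ->; rewrite mul0r.
  case: eqP => [e|]; last by rewrite mul0r.
  have := congr1 mdeg e; rewrite mdegD mdegMn => e'.
  have : (mdeg n * (i + j).+1 <= N)%N by apply: leq_trans (leq_addl (mdeg u) _) _; rewrite -e'.
  by move/(leq_trans (leq_pmull (i + j).+1 (mdeg_gt0 n0))); rewrite ltnNge h.
by rewrite big1 ?mulr0 // => j _; rewrite /delta no mulr0.
Qed.

Lemma star_letter phi l x m :
  wt phi m * actl l x m - actl l (fun p => wt phi p * x p) m = brk (Kl phi l) (actl l x) m.
Proof.
rewrite (@eq_brk _ _ _ (actl l x) (Kl phi l) (fun p => \sum_(u <- mons r (mdeg m))
    x u * actl l (delta u) p)) //; last by move=> p pm; apply: actl_expand.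
rewrite brk_sumr !(actl_expand _ _ _ (lepm_refl m)) mulr_sumr -sumrB.
by apply: eq_bigr => u _; rewrite -star_delta; ring.
Qed.

Definition act w x : ser := foldr actl x w.

Fixpoint K phi w : ser :=
  if w is l :: w' then fun m => Kl phi l m + actl l (K phi w') m else fun=> 0.

Lemma eq_act w x y m : (forall u, (u <= m)%MM -> x u = y u) -> act w x m = act w y m.
Proof.
move=> h; elim: w m h => [|l w IH] m h /=; first by apply/h/lepm_refl.
by apply: eq_actl => u um; apply: IH => v vu; apply/h/(lepm_trans vu).
Qed.

Lemma act_lin w x y a b m :
  act w (fun p => a * x p + b * y p) m = a * act w x m + b * act w y m.
Proof.
elim: w m => [//|l w IH] m /=; rewrite -actl_lin.
by apply: eq_actl => u _; apply: IH.
Qed.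

Lemma act_sum (I : Type) (s : seq I) (c : I -> rat) (f : I -> ser) w m :
  act w (fun p => \sum_(i <- s) c i * f i p) m = \sum_(i <- s) c i * act w (f i) m.
Proof.
elim: w m => [//|l w IH] m /=; rewrite -actl_sum.
by apply: eq_actl => u _; apply: IH.
Qed.

Lemma act_expand w x m :
  act w x m = \sum_(v <- mons r (mdeg m)) x v * act w (delta v) m.
Proof. by rewrite -act_sum; apply: eq_act => u up; apply: expand_ser. Qed.

Lemma K_cat phi w1 w2 m : K phi (w1 ++ w2) m = K phi w1 m + act w1 (K phi w2) m.
Proof.
elim: w1 m => [|l w IH] m /=; first by rewrite add0r.
by rewrite -addrA -actlD; congr (_ + _); apply: eq_actl => u _; apply: IH.
Qed.

(* Phrases the fact that a word acts by Poisson automorphisms: its commutator with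
   the derivation of weight phi is the bracket with K phi w. *)
Lemma star phi w x m :
  wt phi m * act w x m - act w (fun p => wt phi p * x p) m = brk (K phi w) (act w x) m.
Proof.
elim: w m => [|l w IH] m /=.
  by rewrite subrr /brkW big1 // => p _; rewrite mulr0 mul0r.
rewrite brkDl -(poisson skewW) -star_letter.
rewrite -[RHS]addrA; congr (_ + _).
rewrite -(@eq_actl _ W _ _ _ _ (fun u _ => IH u)) actlB; ring.
Qed.

Lemma brk0l y m : brk (fun=> 0) y m = 0.
Proof. by rewrite /brkW big1 // => p _; rewrite mulr0 mul0r. Qed.

Lemma brk_KlKl phi psi l m : brk (Kl phi l) (Kl psi l) m = 0.
Proof.
rewrite (@eq_brk _ _ _ _ (fun p => \sum_(i < mdeg m) (l.2 * wt phi l.1 * ((-1) ^+ i / i.+1%:R)) *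
     delta (l.1 *+ i.+1)%MM p)
   (fun p => \sum_(i < mdeg m) (l.2 * wt psi l.1 * ((-1) ^+ i / i.+1%:R)) *
     delta (l.1 *+ i.+1)%MM p)); last 2 first.
- by move=> p pm; apply: KlE; apply/mdeg_le.
- by move=> p pm; apply: KlE; apply/mdeg_le.
rewrite brk_suml big1 // => i _; rewrite brk_sumr big1 ?mulr0 // => j _.
by rewrite brk_delta omMr (omMl skewW) (om_id skewW) !mulr0 mul0r mulr0.
Qed.

Lemma brkC x y m : brk x y m = - brk y x m.
Proof.
set M := mons r (mdeg m).
have E z t : brk z t m = \sum_(u <- M) z u * \sum_(v <- M) t v * (om u v * delta (u + v)%MM m).
  rewrite (@eq_brk _ _ _ _ (fun p => \sum_(u <- M) z u * delta u p)
       (fun p => \sum_(v <- M) t v * delta v p)); last 2 first.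
  - by move=> q qp; apply/expand_ser.
  - by move=> q qp; apply/expand_ser.
  rewrite brk_suml; apply: eq_bigr => u _; rewrite brk_sumr; congr (_ * _).
  by apply: eq_bigr => v _; rewrite brk_delta.
rewrite !E -sumrN.
under eq_bigr do rewrite mulr_sumr.
under [RHS]eq_bigr do rewrite mulr_sumr -sumrN.
rewrite exchange_big /=; apply: eq_bigr => u _; apply: eq_bigr => v _.
by rewrite (omC skewW v u) addmC; ring.
Qed.

(** Flatness: the derivations of weights phi and psi commute, hence so do their conjugates by a
    word. For a single letter the two logarithms are proportional and have bracket zero. *)
Lemma K_cross phi psi w m :
  wt phi m * K psi w m - wt psi m * K phi w m = brk (K phi w) (K psi w) m.
Proof.
elim: w m => [|l w IH] m /=; first by rewrite brk0l; ring.
rewrite brkDl !brkDr brk_KlKl -(poisson skewW).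
rewrite -(@eq_actl _ W _ _ _ _ (fun u _ => IH u)) actlB.
rewrite (brkC (actl l _)) -!star_letter.
suff e : wt phi m * Kl psi l m = wt psi m * Kl phi l m by rewrite !mulrDr e; ring.
rewrite !(KlE _ _ (leqnn _)) !mulr_sumr; apply: eq_bigr => j _; move: (nat_of_ord j) => i; rewrite /delta.
by case: eqP => [->|]; rewrite ?mulr0 // !wtMn; ring.
Qed.

Lemma K0 phi w : K phi w 0%MM = 0.
Proof.
elim: w => [//|l w IH] /=; rewrite /Kl /actlW mdeg0 big_ord0 add0r big_mkcond big_ord1.
by case: ifP => // _; rewrite mulm0n subm0 IH mulr0.
Qed.

(** Words act unitriangularly for divisibility of exponents. *)
Lemma act_tri w x m : (forall u, (u <= m)%MM -> u != m -> x u = 0) -> act w x m = x m.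
Proof.
move=> h.
have {h} : forall u, (u <= m)%MM -> act w x u = x u.
  elim: w => [//|l w IH] u um /=; rewrite /actlW big_mkcond big_ord_recl big1 => [|j _].
    rewrite /= addr0 mulm0n subm0 IH // mul1r ifT //.
    by apply/mnm_lepP => i; rewrite mnm0E.
  case: ifP => // hj; rewrite IH; last by apply: lepm_trans um; apply: lem_subr.
  case: (eqVneq l.1 0%MM) => [->|n0]; first by rewrite (om0l skewW) mulr0 binr0 !mul0r.
  rewrite h ?mulr0 //; first by apply: lepm_trans um; apply: lem_subr.
  apply/eqP => e; have := mdeg_le um; rewrite -e mdeg_sub // mdegMn leqNgt ltn_subrL.
  rewrite muln_gt0 mdeg_gt0 //= (leq_trans _ (mdeg_le hj)) // mdegMn muln_gt0 mdeg_gt0 //.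
by apply; apply: lepm_refl.
Qed.

Lemma act_delta_le w u m : (mdeg m <= mdeg u)%N -> act w (delta u) m = delta u m.
Proof.
move=> h; apply: act_tri => v vm ne; rewrite /delta; case: eqP => // e.
by move: ne; rewrite (lem_eq vm) ?eqxx //; apply/eqP; rewrite eqn_leq (mdeg_le vm) e.
Qed.

(* The cocycle for the total degree determines the action of a word, and its cocycle
   for every other weight, so this is equality in the group truncated at degree d. *)
Definition Keq d w w' := all (fun m => K (@dg r) w m == K (@dg r) w' m) (mons r d).

Lemma KeqP d w w' :
  reflect (forall m, (mdeg m <= d)%N -> K (@dg r) w m = K (@dg r) w' m) (Keq d w w').
Proof.
apply: (iffP allP) => h m; first by rewrite -mem_mons => /h/eqP.
by rewrite mem_mons => /h ->.
Qed.

(** [star] for the degree is a recursion: the coefficient at m is multiplied by deg m - deg u, and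
    the bracket involves only coefficients of smaller degree. *)
Lemma act_delta_det e w w' u m : Keq e w w' -> (mdeg m <= mdeg u + e)%N ->
  act w (delta u) m = act w' (delta u) m.
Proof.
move/KeqP=> h; have [k] := ubnP (mdeg m); elim: k m => // k IH m /ltnSE mk me.
case: (leqP (mdeg m) (mdeg u)) => mu; first by rewrite !act_delta_le.
have E ww : ((mdeg m)%:R - (mdeg u)%:R) * act ww (delta u) m =
    brk (K (@dg r) ww) (act ww (delta u)) m.
  rewrite -star wt_dg mulrBl; congr (_ - _).
  have -> : act ww (fun p => wt (@dg r) p * delta u p) m =
     act ww (fun p => (mdeg u)%:R * delta u p + 0 * delta u p) m.
    by apply: eq_act => p _; rewrite mul0r addr0 wt_dg /delta; case: eqP => [->|]; rewrite ?mulr0.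
  by rewrite act_lin mul0r addr0.
have nz : (mdeg m)%:R - (mdeg u)%:R != 0 :> rat by rewrite subr_eq0 eqr_nat gtn_eqF.
apply: (mulfI nz); rewrite !E; apply: eq_bigr => p pm.
case: (eqVneq p 0%MM) => [->|p0]; first by rewrite (om0l skewW) !mul0r.
have pgt := mdeg_gt0 p0; have ple := mdeg_le pm.
have qe := mdeg_sub pm.
case: (ltnP (mdeg (m - p)%MM) (mdeg u)) => qu.
  rewrite (act_delta_le w (ltnW qu)) (act_delta_le w' (ltnW qu)) /delta; case: eqP => [eq|]; last by rewrite !mulr0.
  by rewrite eq ltnn in qu.
rewrite h ?IH //; move: pgt ple qe mk me mu qu; clear;
  move: (mdeg (m - p)%MM) (mdeg p) (mdeg m) (mdeg u); lia.
Qed.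

Lemma act_det d w w' x y m : Keq d w w' -> (forall p, (mdeg p <= d)%N -> x p = y p) ->
  (mdeg m <= d)%N -> act w x m = act w' y m.
Proof.
move=> h hx md; rewrite !act_expand; apply: eq_big_seq => v; rewrite mem_mons => vm.
rewrite hx ?(leq_trans vm) //; congr (_ * _).
by apply: (act_delta_det h); rewrite (leq_trans md) // leq_addl.
Qed.

Lemma act_top e w x m : mdeg m = e.+1 ->
  act w x m = x m + \sum_(v <- mons r e) x v * act w (delta v) m.
Proof.
move=> me; rewrite act_expand me.
rewrite (bigID (fun v => (mdeg v <= e)%N)) /= addrC; congr (_ + _).
  transitivity (\sum_(v <- mons r e.+1) (v == m)%:R * x v).
    rewrite big_mkcond; apply: eq_big_seq => v; rewrite mem_mons => ve.
    case: ifPn => h; rewrite -ltnNge in h *.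
      rewrite act_delta_le; last by rewrite me.
      by rewrite /delta mulrC eq_sym.
    by case: eqP => [e'|]; [move: h; rewrite e' me -leqNgt ltnn | rewrite mul0r].
  by rewrite sum_mons1 me leqnn.
rewrite -big_filter; apply: perm_big; apply: uniq_perm.
- exact/filter_uniq/mons_uniq.
- exact: mons_uniq.
by move=> v; rewrite mem_filter !mem_mons; apply/andP/idP => [[]//|h]; rewrite h leqW.
Qed.

Lemma Keq_refl d w : Keq d w w. Proof. exact/KeqP. Qed.
Lemma Keq_sym d w w' : Keq d w w' -> Keq d w' w.
Proof. by move=> /KeqP h; apply/KeqP => m md; rewrite h. Qed.
Lemma Keq_trans d w2 w1 w3 : Keq d w1 w2 -> Keq d w2 w3 -> Keq d w1 w3.
Proof. by move=> /KeqP h /KeqP h'; apply/KeqP => m md; rewrite h ?h'. Qed.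
Lemma Keq_le d e w w' : (e <= d)%N -> Keq d w w' -> Keq e w w'.
Proof. by move=> ed /KeqP h; apply/KeqP => m me; apply/h/(leq_trans me). Qed.

Lemma Keq_cat d w1 w1' w2 w2' : Keq d w1 w1' -> Keq d w2 w2' -> Keq d (w1 ++ w2) (w1' ++ w2').
Proof.
move=> h1 h2; apply/KeqP => m md; rewrite !K_cat (KeqP _ _ _ h1) //.
by congr (_ + _); apply: (act_det h1) => //; apply/KeqP.
Qed.

(** [K_cross] against the degree expresses deg m times K phi at m through K of the degree and values
    of K phi in smaller degree. *)
Lemma K_det d phi w w' m : Keq d w w' -> (mdeg m <= d)%N -> K phi w m = K phi w' m.
Proof.
move/KeqP=> h; have [k] := ubnP (mdeg m); elim: k m => // k IH m /ltnSE mk md.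
case: (eqVneq m 0%MM) => [->|m0]; first by rewrite !K0.
have nz : (mdeg m)%:R != 0 :> rat by rewrite pnatr_eq0 mdeg_eq0.
apply: (mulfI nz).
have E ww : (mdeg m)%:R * K phi ww m = wt phi m * K (@dg r) ww m + brk (K (@dg r) ww) (K phi ww) m.
  by rewrite -K_cross wt_dg; ring.
rewrite !E h //; congr (_ + _); apply: eq_bigr => p pm.
case: (eqVneq p 0%MM) => [->|p0]; first by rewrite (om0l skewW) !mul0r.
have pgt := mdeg_gt0 p0; have ple := mdeg_le pm; have qe := mdeg_sub pm.
rewrite h ?IH //; move: pgt ple qe mk md; clear;
  move: (mdeg (m - p)%MM) (mdeg p) (mdeg m); lia.
Qed.

(** The same recursion with phi in place of the degree; it gives no information where phi vanishes,
    so agreement is assumed there. *)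
Lemma K_weight_det d phi psi w w' :
  (forall m, (mdeg m <= d)%N -> K phi w m = K phi w' m) ->
  (forall m, (mdeg m <= d)%N -> wt phi m = 0 -> K psi w m = K psi w' m) ->
  forall m, (mdeg m <= d)%N -> K psi w m = K psi w' m.
Proof.
move=> h h0 m; have [k] := ubnP (mdeg m); elim: k m => // k IH m /ltnSE mk md.
case: (eqVneq (wt phi m) 0) => [|m0]; first exact: h0.
apply: (mulfI m0).
have E ww : wt phi m * K psi ww m = wt psi m * K phi ww m + brk (K phi ww) (K psi ww) m.
  by rewrite -K_cross; ring.
rewrite !E h //; congr (_ + _); apply: eq_bigr => p pm.
case: (eqVneq p 0%MM) => [->|p0]; first by rewrite (om0l skewW) !mul0r.
have pgt := mdeg_gt0 p0; have ple := mdeg_le pm; have qe := mdeg_sub pm.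
rewrite h ?IH //; move: pgt ple qe mk md; clear;
  move: (mdeg (m - p)%MM) (mdeg p) (mdeg m); lia.
Qed.

Definition winv w : seq letter := rev [seq (l.1, - l.2) | l <- w].

Lemma actl_zero l m : actl l (fun=> 0) m = 0.
Proof. by rewrite /actlW big1 // => j _; rewrite mulr0. Qed.

Lemma K1 phi l m : K phi [:: l] m = Kl phi l m.
Proof. by rewrite /= actl_zero addr0. Qed.

Lemma K2 phi l l' m : K phi [:: l; l'] m = Kl phi l m + actl l (Kl phi l') m.
Proof. by congr (_ + _); apply: eq_actl => u _; apply: (K1 phi l'). Qed.

Lemma Keq_merge d n a b : Keq d [:: (n, a); (n, b)] [:: (n, a + b)].
Proof.
apply/KeqP => m _; rewrite K2 K1 (@Kl_om0 _ (n, b)) ?(om_id skewW) //.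
by rewrite !(KlE _ _ (leqnn _)) -big_split; apply: eq_bigr => j _ /=; ring.
Qed.

Lemma Keq_comm d n a n' b : om n n' = 0 -> Keq d [:: (n, a); (n', b)] [:: (n', b); (n, a)].
Proof.
move=> h; apply/KeqP => m _; rewrite !K2 (@Kl_om0 _ (n', b)) // (@Kl_om0 _ (n, a)) 1?addrC //.
by rewrite (omC skewW) h oppr0.
Qed.

Lemma Keq0 d n : Keq d [:: (n, 0)] [::].
Proof. by apply/KeqP => m _; rewrite K1 /Kl big1 // => j _; rewrite !mul0r mulr0. Qed.

Lemma winv_cat w w' : winv (w ++ w') = winv w' ++ winv w.
Proof. by rewrite /winv map_cat rev_cat. Qed.

Lemma winvK : involutive winv.
Proof.
move=> w; rewrite /winv map_rev revK -map_comp map_id_in // => l _ /=.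
by rewrite opprK -surjective_pairing.
Qed.

Lemma Keq_inv d w : Keq d (w ++ winv w) [::].
Proof.
elim: w => [|[n a] w IH]; first exact: Keq_refl.
have -> : ((n, a) :: w) ++ winv ((n, a) :: w) = [:: (n, a)] ++ (w ++ winv w) ++ [:: (n, - a)].
  by rewrite /winv /= rev_cons -cats1 -!catA.
apply: (@Keq_trans _ ([:: (n, a)] ++ [:: (n, - a)])).
  refine (Keq_cat (Keq_refl _ [:: (n, a)]) _).
  exact: (Keq_cat IH (Keq_refl _ [:: (n, - a)])).
refine (Keq_trans (Keq_merge _ n a (- a)) _); rewrite subrr; exact: Keq0.
Qed.

Lemma Keq_invl d w : Keq d (winv w ++ w) [::].
Proof. by rewrite -{2}(winvK w); apply: Keq_inv. Qed.

Lemma Keq_winv d w w' : Keq d w w' -> Keq d (winv w) (winv w').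
Proof.
move=> h; apply: (@Keq_trans _ (winv w ++ (w' ++ winv w'))).
  rewrite -{1}[winv w]cats0.
  exact: (Keq_cat (Keq_refl _ _) (Keq_sym (Keq_inv _ w'))).
rewrite catA -{2}[winv w']cat0s; refine (Keq_cat _ (Keq_refl _ _)).
exact: (Keq_trans (Keq_cat (Keq_refl _ _) (Keq_sym h)) (Keq_invl _ w)).
Qed.

End Words.

Notation KW := K (only parsing).
Notation KeqW := Keq (only parsing).
Notation actW := act (only parsing).

(** * Coordinates on the truncated group *)

Section Coordinates.
Variables (r : nat) (W : 'I_r -> 'I_r -> rat).
Hypothesis skewW : forall i j, W i j = - W j i.
Notation mon := 'X_{1..r}.
Notation ser := (ser r).
Notation letter := (letter r).
Notation om := (om W).
Notation actl := (actl W).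
Notation brk := (brk W).
Implicit Types (m n u v p q : mon) (x y z : ser) (l : letter) (w : seq letter).
Implicit Types (phi psi : 'I_r -> rat).
Notation act := (act W).
Notation K := (K W).
Notation Keq := (Keq W).
Notation dg := (@dg r).

(* Letters with coefficient 0 are trivial, and their exponents are not constrained. *)
Definition win (T : pred mon) w := all (fun l => (l.2 == 0) || T l.1) w.
Definition closed (T : pred mon) := forall m n, T m -> T n -> T (m + n)%MM.

Lemma win_sub (T T' : pred mon) w : (forall m, T m -> T' m) -> win T w -> win T' w.
Proof. by move=> h; apply: sub_all => l /orP[->//|/h ->]; rewrite orbT. Qed.

Lemma win_cat T w w' : win T (w ++ w') = win T w && win T w'.
Proof. exact: all_cat. Qed.

Lemma closedM T n j : closed T -> T n -> T (n *+ j.+1)%MM.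
Proof. by move=> cT Tn; elim: j => [//|j IH]; rewrite mulmS; apply: cT. Qed.

Lemma actl_coef0 l x m : l.2 = 0 -> actl l x m = x m.
Proof.
move=> l0; rewrite /actlW l0 big_mkcond big_ord_recl /= big1 ?addr0.
  by rewrite mulm0n subm0 mul1r ifT //; apply/mnm_lepP => i; rewrite mnm0E.
by move=> j _; case: ifP => // _; rewrite mul0r binr0 !mul0r.
Qed.

Lemma Kl_coef0 phi l m : l.2 = 0 -> Kl phi l m = 0.
Proof. by move=> l0; rewrite /Kl big1 // => j _; rewrite l0 !mul0r mulr0. Qed.

Lemma Kl_supp T phi l m : closed T -> T l.1 -> Kl phi l m != 0 -> T m.
Proof.
move=> cT Tl; apply: contraR => Tm; rewrite /Kl big1 // => j _.
by case: eqP => [e|]; [rewrite e closedM in Tm | rewrite mul0r].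
Qed.

Lemma actl_supp T l x m : closed T -> (l.2 == 0) || T l.1 ->
  (forall u, x u != 0 -> T u) -> actl l x m != 0 -> T m.
Proof.
move=> cT /orP[/eqP l0|Tl] hx; first by rewrite actl_coef0 //; apply: hx.
apply: contraR => Tm; rewrite /actlW big1 // => j hj.
case: (eqVneq (x (m - l.1 *+ j)%MM) 0) => [->|/hx Tu]; first by rewrite mulr0.
case/negP: Tm; have <- := submK hj; move: (nat_of_ord j) Tu => {j hj} [|i] Tu.
  by rewrite [X in (_ + X)%MM]mulm0n addm0.
exact: (cT _ _ Tu (closedM _ cT Tl)).
Qed.

Lemma act_supp T w x m : closed T -> win T w ->
  (forall u, x u != 0 -> T u) -> act w x m != 0 -> T m.
Proof.
move=> cT; elim: w m => [|l w IH] m /= hw hx; first exact: hx.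
by case/andP: hw => hl hw; apply: actl_supp => // u; apply: IH.
Qed.

Lemma K_supp T phi w m : closed T -> win T w -> K phi w m != 0 -> T m.
Proof.
move=> cT; elim: w m => [|l w IH] m /=; first by [].
case/andP => hl hw; apply: contraR => Tm.
have -> : actl l (K phi w) m = 0.
  by apply/eqP; apply: contraR Tm; apply: actl_supp => // u; apply: IH.
rewrite addr0; case/orP: hl => [/eqP l0|Tl]; first by rewrite Kl_coef0.
by apply: contraR Tm; apply: Kl_supp.
Qed.

Lemma K_suppN T phi w m : closed T -> win T w -> ~~ T m -> K phi w m = 0.
Proof. by move=> cT hw; apply: contraNeq; apply: K_supp. Qed.

Lemma Kl_big phi n a m : n != 0%MM -> (mdeg m <= mdeg n)%N ->
  Kl phi (n, a) m = (n == m)%:R * (a * wt phi m).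
Proof.
move=> n0 mn; have npos := mdeg_gt0 n0.
case: (posnP (mdeg m)) => [m0|mpos].
  rewrite /Kl m0 big_ord0; case: eqP => [e|]; last by rewrite mul0r.
  by rewrite e m0 in npos.
have [e me] : exists e, mdeg m = e.+1 by exists (mdeg m).-1; rewrite prednK.
rewrite /Kl me.
rewrite big_ord_recl mulm1n /= expr0 invr1 !mulr1 big1 ?addr0 => [|j _].
  by rewrite eq_sym; case: eqP => [->//|]; rewrite !mul0r.
case: eqP => [em|]; last by rewrite mul0r.
have := congr1 mdeg em; rewrite mdegMn => e'; move: mn; rewrite e' /bump /= add1n mulnS -[X in (_ <= X)%N]addn0.
by rewrite leq_add2l leqn0 muln_eq0 gtn_eqF.
Qed.

Lemma actl_big l x m : l.1 != 0%MM -> x 0%MM = 0 -> (mdeg m <= mdeg l.1)%N ->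
  actl l x m = x m.
Proof.
move=> n0 x0 mn; rewrite /actlW big_mkcond big_ord_recl big1 => [|j _].
  rewrite /= mulm0n subm0 mul1r addr0 ifT //.
  by apply/mnm_lepP => i; rewrite mnm0E.
case: ifP => // hj.
suff -> : (m - l.1 *+ lift ord0 j)%MM = 0%MM by rewrite x0 mulr0.
apply/eqP; rewrite -mdeg_eq0 mdeg_sub // mdegMn subn_eq0.
by rewrite (leq_trans mn) // leq_pmulr.
Qed.

(** Up to degree e + 1, a letter of degree greater than e is central: it acts trivially on cocycles,
    and only the linear term of its logarithm is visible. *)
Lemma K_top e phi w m : (mdeg m <= e.+1)%N ->
  K phi w m = K phi [seq l <- w | (mdeg l.1 <= e)%N] m +
    \sum_(l <- w | ~~ (mdeg l.1 <= e)%N && (l.1 == m)) l.2 * wt phi m.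
Proof.
move=> me; elim: w m me => [|l w IH] m me /=; first by rewrite big_nil addr0.
rewrite big_cons; case: ifPn => le /=.
  rewrite -addrA; congr (_ + _).
  set f := K phi [seq _ <- w | _] in IH *.
  rewrite (@eq_actl _ W _ _ (fun p => f p + \sum_(l <- w | ~~ (mdeg l.1 <= e)%N && (l.1 == p)) l.2 * wt phi p)).
    rewrite actlD; congr (_ + _).
    apply: (@act_tri _ _ skewW [:: l] (fun p => \sum_(l <- w | ~~ (mdeg l.1 <= e)%N && (l.1 == p)) l.2 * wt phi p)) => u um ne.
    have ue : (mdeg u <= e)%N.
      rewrite -ltnS; apply: leq_trans me; rewrite ltn_neqAle mdeg_le // andbT.
      by apply: contra_neq ne => /(lem_eq um).
    by rewrite big1 // => l' /andP[h /eqP e']; rewrite e' ue in h.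
  by move=> u um; apply: IH; apply: leq_trans (mdeg_le um) me.
have l0 : l.1 != 0%MM by apply: contraNneq le => ->; rewrite mdeg0.
rewrite -ltnNge in le.
rewrite actl_big //; [|by rewrite K0|exact: leq_trans me le].
have -> : Kl phi l m = (l.1 == m)%:R * (l.2 * wt phi m).
  by case: l l0 le => n a /= l0 le; rewrite Kl_big //; apply: leq_trans me le.
rewrite IH //; case: (l.1 == m); rewrite ?mul1r ?mul0r ?add0r //; ring.
Qed.

(* With a fixed duplicate-free L, the values of c are coordinates on the group. *)
Definition wL (L : seq mon) (c : mon -> rat) : seq letter := [seq (n, c n) | n <- L].

Lemma wL_cat L L' c : wL (L ++ L') c = wL L c ++ wL L' c.
Proof. exact: map_cat. Qed.

Lemma wL_win (T : pred mon) L c : (forall n, n \in L -> c n != 0 -> T n) -> win T (wL L c).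
Proof.
move=> h; apply/allP => l /mapP[n nL ->] /=.
by case: (eqVneq (c n) 0) => //= /h ->.
Qed.

Lemma wL_change e L c c' m : uniq L -> (forall n, n \in L -> (mdeg n <= e)%N -> c n = c' n) ->
  (mdeg m <= e.+1)%N -> K dg (wL L c') m - K dg (wL L c) m =
    if (m \in L) then (c' m - c m) * (mdeg m)%:R else 0.
Proof.
move=> uL h me; rewrite (K_top dg (wL L c') me) (K_top dg (wL L c) me).
have -> : [seq l <- wL L c' | (mdeg l.1 <= e)%N] = [seq l <- wL L c | (mdeg l.1 <= e)%N].
  by rewrite !filter_map; apply/eq_in_map => n; rewrite mem_filter /= => /andP[ne nL]; rewrite h.
rewrite addrAC opprD addrA addrN add0r addrC !big_map !wt_dg /=.
have E f : \sum_(n <- L | ~~ (mdeg n <= e)%N && (n == m)) f n * (mdeg m)%:R =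
    if (m \in L) && ~~ (mdeg m <= e)%N then f m * (mdeg m)%:R else 0 :> rat.
  rewrite big_mkcond /=; case: (boolP (m \in L)) => /= mL.
    rewrite (bigD1_seq m) //= eqxx andbT big1 ?addr0 // => n /negbTE ->.
    by rewrite andbF.
  rewrite big_seq big1 // => n nL; case: (eqVneq n m) => [e'|]; last by rewrite andbF.
  by rewrite e' (negbTE mL) in nL.
rewrite !E; case: (boolP (m \in L)) => /= mL; last by rewrite subrr.
case: ifPn => [_|/negPn me']; first by rewrite mulrBl.
by rewrite h // ?subrr mul0r.
Qed.

Lemma wL_uniq d L c c' n : uniq L -> 0%MM \notin L -> Keq d (wL L c) (wL L c') ->
  n \in L -> (mdeg n <= d)%N -> c n = c' n.
Proof.
move=> uL L0 /KeqP h; have [k] := ubnP (mdeg n); elim: k n => // k IH n /ltnSE nk nL nd.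
have n0 : n != 0%MM by apply: contraNneq L0 => <-.
have npos := mdeg_gt0 n0.
have hc p : p \in L -> (mdeg p <= (mdeg n).-1)%N -> c p = c' p.
  move=> pL pn; apply: IH => //; first by rewrite (leq_ltn_trans pn) // prednK.
  by rewrite (leq_trans pn) // (leq_trans (leq_pred _)).
have := wL_change uL hc (leqSpred (mdeg n)); rewrite -h // subrr nL => /esym/eqP.
by rewrite mulf_eq0 subr_eq0 pnatr_eq0 (gtn_eqF npos) orbF => /eqP.
Qed.

(** The exponents of 1 + y^n produced on M are integers; then the letter preserves integral series
    supported in M, although its coefficient may be fractional. *)
Definition adm (M : mon -> Prop) l := forall m, M m -> l.2 * om l.1 m \is a Num.int.
Definition wadm M w := forall l, l \in w -> adm M l.
Definition stab (M : mon -> Prop) (T : pred mon) := forall m n, M m -> T n -> M (m + n)%MM.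

Lemma stabM M T m n j : stab M T -> M m -> T n -> M (m + n *+ j)%MM.
Proof.
move=> st Mm Tn; elim: j => [|j IH]; first by rewrite mulm0n addm0.
by rewrite mulmSr addmA; apply: st.
Qed.

Lemma act_int M T w x : stab M T -> win T w -> wadm M w ->
  (forall m, x m != 0 -> M m) -> (forall m, x m \is a Num.int) ->
  forall m, (act w x m \is a Num.int) /\ (act w x m != 0 -> M m).
Proof.
move=> st; elim: w => [|l w IH] /=; first by move=> _ _ h h' m; split; auto.
case/andP => hl hw ha hM hi m.
have {}IH := IH hw (fun l' h => ha l' (mem_behead (s := l :: w) h)) hM hi.
case/orP: hl => [/eqP l0|Tl]; first by rewrite actl_coef0.
have hal := ha l (mem_head _ _).
split.
  apply: rpred_sum => j hj.
  case: (eqVneq (act w x (m - l.1 *+ j)%MM) 0) => [->|nz]; first by rewrite mulr0 rpred0.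
  apply: rpredM; last by case: (IH (m - l.1 *+ j)%MM).
  apply: binr_int; have := hal _ ((IH _).2 nz).
  by rewrite omBr // omMr (om_id skewW) mulr0 subr0.
have [/existsP[j /andP[hj nz]] _|no] := boolP [exists j : 'I_(mdeg m).+1,
     (l.1 *+ j <= m)%MM && (act w x (m - l.1 *+ j)%MM != 0)].
  suff: M (m - l.1 *+ j + l.1 *+ j)%MM by rewrite submK.
  exact: (stabM _ st ((IH _).2 nz) Tl).
rewrite /actlW big1 ?eqxx // => j hj.
have := no; rewrite negb_exists => /forallP/(_ j); rewrite hj /= negbK => /eqP ->.
by rewrite mulr0.
Qed.

(** If two words agree below the degree of n, their actions on y^m differ at m + n only by the
    bracket with the new term of the cocycle. This converts a defect of cocycles into a difference
    of action coefficients, whose integrality is known. *)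
Lemma act_delta_diff e w w' m n : Keq e w w' -> mdeg n = e.+1 ->
  (mdeg n)%:R * (act w (delta m) (m + n)%MM - act w' (delta m) (m + n)%MM) =
  om n m * (K dg w n - K dg w' n).
Proof.
move=> h ne.
have E ww : (mdeg n)%:R * act ww (delta m) (m + n)%MM =
    brk (K dg ww) (act ww (delta m)) (m + n)%MM.
  rewrite -(star skewW) wt_dg mdegD natrD.
  have -> : act ww (fun p => wt dg p * delta m p) (m + n)%MM =
     act ww (fun p => (mdeg m)%:R * delta m p + 0 * delta m p) (m + n)%MM.
    by apply: eq_act => p _; rewrite mul0r addr0 wt_dg /delta; case: eqP => [->|]; rewrite ?mulr0.
  by rewrite act_lin; ring.
rewrite mulrBr !E -sumrB.
transitivity (\sum_(p <- mons r (mdeg (m + n)%MM)) (p == n)%:R *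
   (om n m * (K dg w n - K dg w' n))); last first.
  by rewrite sum_mons1 mdegD leq_addl.
rewrite big_mkcond; apply: eq_bigr => p _; case: ifPn => pm; last first.
  by case: eqP => [e'|]; [rewrite e' lem_addl in pm | rewrite mul0r].
case: (eqVneq p 0%MM) => [->|p0].
  rewrite (om0l skewW) !mul0r subrr; case: eqP => [e'|]; last by rewrite mul0r.
  by move: ne; rewrite -e' mdeg0.
have := mdeg_sub pm; rewrite mdegD ne => dq.
case: (leqP (mdeg p) e) => pe.
  rewrite (KeqP _ _ _ _ h) // (act_delta_det skewW h); last first.
    move: dq (mdeg_gt0 p0); clear; move: (mdeg (m + n - p)%MM) (mdeg p) (mdeg m); lia.
  rewrite subrr; case: eqP => [e'|]; last by rewrite mul0r.
  by rewrite e' ne ltnn in pe.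
rewrite !(act_delta_le skewW); try by rewrite dq leq_subLR addnC leq_add2r.
rewrite /delta submn_eq // eqm_add2l eq_sym.
case: eqP => [->|_]; last by rewrite !mulr0 subrr mul0r.
by rewrite addmK; ring.
Qed.

(** Built degree by degree: the new coefficient at n is the defect of the cocycle divided by deg n,
    and it is admissible by [act_delta_diff]. The order of L is free; factorizations arise from
    listing exponents by sign. *)
Lemma coord_ex (M : mon -> Prop) (T : pred mon) d L w : closed T -> stab M T -> win T w ->
  uniq L -> (forall n, n != 0%MM -> (mdeg n <= d)%N -> T n -> n \in L) ->
  exists c : mon -> rat, [/\ forall n, c n != 0 -> T n /\ (0 < mdeg n <= d)%N, Keq d w (wL L c) &
     wadm M w -> forall n, adm M (n, c n)].
Proof.
move=> cT st hw uL hL.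
suff H e : (e <= d)%N -> exists c : mon -> rat, [/\ forall n, c n != 0 -> T n /\ (0 < mdeg n <= e)%N, Keq e w (wL L c) &
     wadm M w -> forall n, adm M (n, c n)] by apply: H.
elim: e => [_|e IH ed].
  exists (fun=> 0); split => [n|| _ n m _]; first by rewrite eqxx.
    by apply/KeqP => m; rewrite leqn0 mdeg_eq0 => /eqP ->; rewrite !K0.
  by rewrite mul0r rpred0.
have [c [cs ceq ca]] := IH (ltnW ed).
pose c' n := if mdeg n == e.+1 then (K dg w n - K dg (wL L c) n) / (mdeg n)%:R else c n.
have wc : win T (wL L c) by apply: wL_win => n _ /cs[].
have c0 n : mdeg n = e.+1 -> c n = 0.
  by move=> ne; apply/eqP; apply: contraT => /cs[_]; rewrite ne ltnn andbF.
exists c'; split.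
- move=> n; rewrite /c'; case: (eqVneq (mdeg n) e.+1) => [ne|_]; last first.
    by move=> nz; have [Tn /andP[-> h]] := cs _ nz; split => //; apply: leqW.
  rewrite ne leqnn => H; split => //; apply: contraR H => Tn.
  by rewrite !(K_suppN _ cT) // subrr mul0r.
- have cc n : n \in L -> (mdeg n <= e)%N -> c n = c' n.
    by rewrite /c' => _ ne; case: eqP => // e'; rewrite e' ltnn in ne.
  apply/KeqP => m me; have := wL_change uL cc me; move/eqP; rewrite subr_eq => /eqP ->.
  case: (leqP (mdeg m) e) => me'.
    rewrite (KeqP _ _ _ _ ceq) //; case: ifP => [mL|_]; last by rewrite add0r.
    by rewrite cc // subrr mul0r add0r.
  have ee : mdeg m = e.+1 by apply/eqP; rewrite eqn_leq me.
  have m0 : m != 0%MM by rewrite -mdeg_eq0 ee.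
  case: ifPn => [_|mL].
    by rewrite /c' ee eqxx c0 // subr0 divfK ?subrK // pnatr_eq0.
  have Tm : ~~ T m by apply: contra mL => Tm; apply: hL => //; rewrite ee.
  by rewrite add0r !(K_suppN _ cT).
- move=> wa n m Mm; rewrite /c' /=; case: eqP => [ne|_]; last exact: ca.
  have nz : (mdeg n)%:R != 0 :> rat by rewrite ne pnatr_eq0.
  rewrite mulrAC mulrC (mulrC _ (om _ _)) -(act_delta_diff m ceq ne) mulKf //.
  have dM p : delta m p != 0 -> M p by rewrite /delta; case: (eqVneq p m) => [->|]; rewrite ?eqxx.
  have di p : delta m p \is a Num.int by rewrite /delta rpred_nat.
  apply: rpredB; first by case: (act_int st hw wa dM di (m + n)%MM).
  have wa' : wadm M (wL L c) by move=> l /mapP[p _ ->]; apply: ca.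
  by case: (act_int st wc wa' dM di (m + n)%MM).
Qed.

End Coordinates.

(** * Factorization by the sign of a linear functional *)

Section LeadCoef.
Implicit Types p q : {poly rat}.

Lemma lcD_gt0 p q : 0 < lead_coef p -> 0 < lead_coef q -> 0 < lead_coef (p + q).
Proof.
move=> p0 q0; case: (ltngtP (size p) (size q)) => h.
- by rewrite lead_coefDr.
- by rewrite lead_coefDl.
have s : size (p + q) = size p.
  apply/eqP; rewrite eqn_leq (leq_trans (size_polyD _ _)) -?h ?maxnn //=.
  rewrite leqNgt; apply/negP => h1.
  have : (p + q)`_(size p).-1 = 0.
    by apply: nth_default; rewrite -ltnS prednK // (leq_ltn_trans _ h1).
  rewrite coefD {2}h -!lead_coefE => /eqP; rewrite gt_eqF //; exact: addr_gt0.
by rewrite lead_coefE s coefD {2}h -!lead_coefE addr_gt0.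
Qed.

End LeadCoef.

Section Factorization.
Variables (r : nat) (W : 'I_r -> 'I_r -> rat).
Hypothesis skewW : forall i j, W i j = - W j i.
Notation mon := 'X_{1..r}.
Notation ser := (ser r).
Notation letter := (letter r).
Notation om := (om W).
Notation actl := (actl W).
Implicit Types (m n u p q : mon) (x y z : ser) (l : letter) (w : seq letter).
Implicit Types (phi psi : 'I_r -> rat).
Notation act := (act W).
Notation K := (K W).
Notation Keq := (Keq W).
Notation dg := (@dg r).
Notation "'wL'" := (@wL r).

(* Functionals with values in {poly rat}, ordered by the sign of the leading
   coefficient: 'X is infinitely large, so that p * 'X + q is a perturbation of p. *)
Definition vfun := mon -> {poly rat}.
Implicit Types (v : vfun).
Definition addv v := forall m n, v (m + n)%MM = v m + v n.
Definition neg v m := lead_coef (v m) < 0.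
Definition zer v m := v m == 0.
Definition pos v m := 0 < lead_coef (v m).
Definition vom n : vfun := fun m => (om n m)%:P.

Lemma addv_vom n : addv (vom n).
Proof. by move=> m p; rewrite /vom omDr polyCD. Qed.

Lemma zer_vom n m : zer (vom n) m = (om n m == 0).
Proof. by rewrite /zer /vom polyC_eq0. Qed.
Lemma neg_vom n m : neg (vom n) m = (om n m < 0).
Proof. by rewrite /neg /vom lead_coefC. Qed.
Lemma pos_vom n m : pos (vom n) m = (0 < om n m).
Proof. by rewrite /pos /vom lead_coefC. Qed.

Lemma sgnP v m : [|| neg v m, zer v m | pos v m].
Proof. by rewrite /neg /zer /pos -lead_coef_eq0; case: ltrgt0P. Qed.
Lemma neg_zer v m : neg v m -> zer v m = false.
Proof. by rewrite /neg /zer -lead_coef_eq0; case: ltrgt0P. Qed.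
Lemma pos_zer v m : pos v m -> zer v m = false.
Proof. by rewrite /pos /zer -lead_coef_eq0; case: ltrgt0P. Qed.
Lemma neg_pos v m : neg v m -> pos v m = false.
Proof. by rewrite /neg /pos; case: ltrgt0P. Qed.
Lemma negN v m : neg (fun p => - v p) m = pos v m.
Proof. by rewrite /neg /pos lead_coefN oppr_lt0. Qed.
Lemma posN v m : pos (fun p => - v p) m = neg v m.
Proof. by rewrite /neg /pos lead_coefN oppr_gt0. Qed.
Lemma zerN v m : zer (fun p => - v p) m = zer v m.
Proof. by rewrite /zer oppr_eq0. Qed.
Lemma addvN v : addv v -> addv (fun p => - v p).
Proof. by move=> h m n; rewrite h opprD. Qed.
Lemma addv0 v : addv v -> v 0%MM = 0.
Proof. by move=> h; apply: (addIr (v 0%MM)); rewrite -h add0m add0r. Qed.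
Lemma addvM v m j : addv v -> v (m *+ j)%MM = v m *+ j.
Proof.
move=> h; elim: j => [|j IH]; first by rewrite mulm0n addv0.
by rewrite mulmS h IH mulrS.
Qed.
Lemma addvB v m n : addv v -> (n <= m)%MM -> v (m - n)%MM = v m - v n.
Proof. by move=> h nm; rewrite -{2}(submK nm) h addrK. Qed.

Lemma closed_pos v : addv v -> closed (pos v).
Proof. by move=> h m n; rewrite /pos h; apply: lcD_gt0. Qed.
Lemma closed_neg v : addv v -> closed (neg v).
Proof. by move=> h m n; rewrite -!(posN v); apply/closed_pos/addvN. Qed.
Lemma closed_zer v : addv v -> closed (zer v).
Proof. by move=> h m n; rewrite /zer h => /eqP-> /eqP->; rewrite addr0. Qed.
Definition npos v m := neg v m || zer v m.
Lemma closed_npos v : addv v -> closed (npos v).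
Proof.
move=> h m n /orP[a|/eqP a] /orP[b|/eqP b]; rewrite /npos.
- by rewrite closed_neg.
- by rewrite /neg h b addr0 -/(neg v m) a.
- by rewrite /neg h a add0r -/(neg v n) b.
- by rewrite /zer h a b addr0 eqxx orbT.
Qed.
Lemma closed_pred1 : closed (@predT mon). Proof. by []. Qed.

Definition monp d := [seq m <- mons r d | m != 0%MM].
Lemma mem_monp d m : (m \in monp d) = (m != 0%MM) && (mdeg m <= d)%N.
Proof. by rewrite mem_filter mem_mons. Qed.
Lemma monp_uniq d : uniq (monp d). Proof. exact/filter_uniq/mons_uniq. Qed.

Lemma uniq3 v L : uniq L -> uniq (filter (neg v) L ++ filter (zer v) L ++ filter (pos v) L).
Proof.
move=> u; rewrite !cat_uniq !filter_uniq //= andbT; apply/andP; split.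
  apply/hasPn => m; rewrite mem_cat !mem_filter => /orP[] /andP[h _]; apply/negP => /andP[h' _].
    by rewrite (neg_zer h') in h.
  by rewrite (neg_pos h') in h.
apply/hasPn => m; rewrite !mem_filter => /andP[h _]; apply/negP => /andP[h' _].
by rewrite (pos_zer h) in h'.
Qed.

Lemma mem3 v L m : (m \in filter (neg v) L ++ filter (zer v) L ++ filter (pos v) L) = (m \in L).
Proof.
rewrite !mem_cat !mem_filter -!andb_orl.
by case: (m \in L); rewrite ?andbT ?andbF //; apply: sgnP.
Qed.

Lemma factor_coord (M : mon -> Prop) (T : pred mon) d v w : addv v -> closed T -> stab M T -> win T w ->
  exists c : mon -> rat, [/\ forall n, c n != 0 -> T n,
     Keq d w (wL (filter (neg v) (monp d)) c ++ wL (filter (zer v) (monp d)) c ++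
              wL (filter (pos v) (monp d)) c) &
     wadm W M w -> forall n, adm W M (n, c n)].
Proof.
move=> av cT st hw.
have hL n : n != 0%MM -> (mdeg n <= d)%N -> T n ->
    n \in filter (neg v) (monp d) ++ filter (zer v) (monp d) ++ filter (pos v) (monp d).
  by move=> n0 nd _; rewrite mem3 mem_monp n0.
have [c [cs ceq ca]] := coord_ex skewW cT st hw (uniq3 v (monp_uniq d)) hL.
exists c; split => //; first by move=> n /cs[].
by rewrite -!wL_cat.
Qed.

Lemma factor_ex (M : mon -> Prop) (T : pred mon) d v w : addv v -> closed T -> stab M T -> win T w ->
  exists A B Z, [/\ win (predI T (neg v)) A, win (predI T (zer v)) B, win (predI T (pos v)) Z,
    Keq d w (A ++ B ++ Z) & wadm W M w -> [/\ wadm W M A, wadm W M B & wadm W M Z]].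
Proof.
move=> av cT st hw; have [c [cs ceq ca]] := factor_coord d av cT st hw.
exists (wL (filter (neg v) (monp d)) c), (wL (filter (zer v) (monp d)) c),
  (wL (filter (pos v) (monp d)) c); split=> //.
- by apply: wL_win => n; rewrite mem_filter /= => /andP[-> _] /cs ->.
- by apply: wL_win => n; rewrite mem_filter /= => /andP[-> _] /cs ->.
- by apply: wL_win => n; rewrite mem_filter /= => /andP[-> _] /cs ->.
by move=> /ca h; split=> l /mapP[n _ ->].
Qed.

(** In the first degree where the factors may differ, the cocycle of a product is additive up to a
    common term: the corrections by the action only use lower degrees. *)
Lemma K3_top e A B Z A' B' Z' m : Keq e A A' -> Keq e B B' -> Keq e Z Z' -> mdeg m = e.+1 ->
  K dg (A ++ B ++ Z) m - K dg (A' ++ B' ++ Z') m =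
  (K dg A m - K dg A' m) + (K dg B m - K dg B' m) + (K dg Z m - K dg Z' m).
Proof.
have two w1 w1' w2 w2' : Keq e w1 w1' -> Keq e w2 w2' -> mdeg m = e.+1 ->
    K dg (w1 ++ w2) m - K dg (w1' ++ w2') m =
    (K dg w1 m - K dg w1' m) + (K dg w2 m - K dg w2' m).
  move=> h1 h2 me; rewrite !K_cat !(act_top skewW _ _ me).
  have -> : \sum_(v <- mons r e) K dg w2 v * act w1 (delta v) m =
            \sum_(v <- mons r e) K dg w2' v * act w1' (delta v) m.
    apply: eq_big_seq => v; rewrite mem_mons => ve.
    rewrite (KeqP _ _ _ _ h2) //; case: (eqVneq v 0%MM) => [->|v0]; first by rewrite K0 !mul0r.
    congr (_ * _); apply: (act_delta_det skewW h1).
    by rewrite me -add1n leq_add2r mdeg_gt0.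
  ring.
move=> hA hB hZ me; rewrite two //; last exact: (Keq_cat skewW).
by rewrite two // addrA.
Qed.

(** By [K3_top] the differences in the new degree add up to zero, and each exponent has a single
    sign, so that at most one of them can be nonzero there. *)
Lemma factor_uniq d v A B Z A' B' Z' : addv v ->
  win (neg v) A -> win (zer v) B -> win (pos v) Z ->
  win (neg v) A' -> win (zer v) B' -> win (pos v) Z' ->
  Keq d (A ++ B ++ Z) (A' ++ B' ++ Z') -> [/\ Keq d A A', Keq d B B' & Keq d Z Z'].
Proof.
move=> av hA hB hZ hA' hB' hZ' h.
suff H e : (e <= d)%N -> [/\ Keq e A A', Keq e B B' & Keq e Z Z'] by apply: H.
elim: e => [_|e IH ed].
  by split; apply/KeqP => m; rewrite leqn0 mdeg_eq0 => /eqP ->; rewrite !K0.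
have {IH} [eA eB eZ] := IH (ltnW ed).
suff H m : mdeg m = e.+1 -> [/\ K dg A m = K dg A' m, K dg B m = K dg B' m & K dg Z m = K dg Z' m].
  by split; apply/KeqP => m; rewrite leq_eqVlt => /orP[/eqP/H[]//|];
     [move/KeqP: eA|move/KeqP: eB|move/KeqP: eZ]; apply.
move=> me; have := K3_top eA eB eZ me; rewrite (KeqP _ _ _ _ h) ?me // subrr.
have cn := closed_neg av; have cz := closed_zer av; have cp := closed_pos av.
have kn := K_suppN W dg cn; have kz := K_suppN W dg cz; have kp := K_suppN W dg cp.
case/or3P: (sgnP v m) => s.
- have z := negbT (neg_zer s); have p := negbT (neg_pos s).
  rewrite (kz _ _ hB z) (kz _ _ hB' z) (kp _ _ hZ p) (kp _ _ hZ' p) subrr !addr0.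
  by move/esym/eqP; rewrite subr_eq0 => /eqP.
- have z : ~~ neg v m by apply: contraL s => /neg_zer ->.
  have p : ~~ pos v m by apply: contraL s => /pos_zer ->.
  rewrite (kn _ _ hA z) (kn _ _ hA' z) (kp _ _ hZ p) (kp _ _ hZ' p) subrr !addr0 add0r.
  by move/esym/eqP; rewrite subr_eq0 => /eqP.
have z := negbT (pos_zer s); have p : ~~ neg v m by apply: contraL s => /neg_pos ->.
rewrite (kz _ _ hB z) (kz _ _ hB' z) (kn _ _ hA p) (kn _ _ hA' p) subrr !add0r.
by move/esym/eqP; rewrite subr_eq0 => /eqP.
Qed.

Lemma actl_zer v l x m : addv v -> (l.2 == 0) || neg v l.1 ->
  (forall u, x u != 0 -> npos v u) -> zer v m -> actl l x m = x m.
Proof.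
move=> av /orP[/eqP l0|nl] hx zm; first by rewrite actl_coef0.
rewrite /actlW big_mkcond big_ord_recl big1 => [|j _].
  rewrite /= mulm0n subm0 mul1r addr0 ifT //.
  by apply/mnm_lepP => i; rewrite mnm0E.
case: ifP => // hj.
suff /eqP -> : x (m - l.1 *+ lift ord0 j)%MM == 0 by rewrite mulr0.
have h : pos v (m - l.1 *+ lift ord0 j)%MM.
  rewrite -negN /neg addvB // (eqP zm) sub0r opprK addvM //.
  have := closedM j (closed_neg av) nl.
  by rewrite /neg addvM.
apply: contraTT h => /hx /orP[/neg_pos ->//|z]; apply/negP => /pos_zer.
by rewrite z.
Qed.

Lemma act_zer v w x m : addv v -> win (neg v) w ->
  (forall u, x u != 0 -> npos v u) -> zer v m -> act w x m = x m.
Proof.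
move=> av; elim: w m => [//|l w IH] m /= /andP[hl hw] hx zm.
rewrite (actl_zer av hl) ?IH // => u; apply: (act_supp (closed_npos av)) => //.
by apply: win_sub hw => p; rewrite /npos => ->.
Qed.

(** A negative letter can reach an exponent with v = 0 only from one with v > 0, and such exponents
    do not occur. The zero set is thus a face on which negative letters are invisible. *)
Lemma K_zer phi v w m : addv v -> win (npos v) w -> zer v m ->
  K phi w m = K phi [seq l <- w | zer v l.1] m.
Proof.
move=> av; elim: w m => [//|l w IH] m /= /andP[hl hw] zm.
case: ifPn => /= zl.
  congr (_ + _).
  rewrite /actlW; apply: eq_bigr => j hj; rewrite IH //.
  by rewrite /zer addvB // addvM // (eqP zm) (eqP zl) mul0rn subrr.
have hl' : (l.2 == 0) || neg v l.1 by case/or3P: hl zl => [->|->|->]; rewrite ?orbT.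
rewrite (actl_zer av hl') //; last by move=> u; apply: (K_supp (closed_npos av)).
rewrite IH // -[RHS]add0r; congr (_ + _).
case/orP: hl' => [/eqP l0|nl]; first by rewrite Kl_coef0.
apply/eqP; apply: contraLR zm => /(Kl_supp (closed_neg av) nl) h.
by rewrite (neg_zer h).
Qed.

(** The middle part of the factorization is read off by deleting the negative letters in place,
    without recomputing coefficients. *)
Lemma absorb_l d v w : addv v -> win (npos v) w ->
  exists2 A, win (neg v) A & Keq d w (A ++ [seq l <- w | zer v l.1]).
Proof.
move=> av hw; have st : stab (fun=> True) (npos v) by [].
have [A [B [Z [hA hB hZ h _]]]] := factor_ex d av (closed_npos av) st hw.
have {hA}hA : win (neg v) A by apply: win_sub hA => m /andP[].
have {}hB : win (zer v) B by apply: win_sub hB => m /andP[].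
have hZ0 : Keq d Z [::].
  apply/KeqP => m _; apply: (K_suppN _ _ (T := pred0)) => //.
  apply: win_sub hZ => m' /andP[/orP[h1|h1] h2]; first by rewrite /= (neg_pos h1) in h2.
  by rewrite /= (pos_zer h2) in h1.
exists A => //; apply: (Keq_trans h); apply: (Keq_cat skewW (Keq_refl _ _ _)).
rewrite -[X in Keq _ _ X]cats0; refine (Keq_cat skewW _ hZ0).
have hAB : win (npos v) (A ++ B).
  rewrite win_cat; apply/andP; split; first by apply: win_sub hA => m'; rewrite /npos => ->.
  by apply: win_sub hB => m'; rewrite /npos => ->; rewrite orbT.
have wf : win (zer v) [seq l <- w | zer v l.1].
  by apply/allP => l; rewrite mem_filter => /andP[-> _]; rewrite orbT.
apply/KeqP => m md; case: (boolP (zer v m)) => zm; last first.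
  by rewrite (K_suppN _ _ (closed_zer av) hB zm) (K_suppN _ _ (closed_zer av) wf zm).
rewrite -(K_zer _ av hw zm) (KeqP _ _ _ _ h) // catA.
have -> : K dg ((A ++ B) ++ Z) m = K dg (A ++ B) m.
  have hh := Keq_cat skewW (Keq_refl W d (A ++ B)) hZ0; rewrite cats0 in hh.
  exact: (KeqP _ _ _ _ hh).
rewrite [RHS]K_cat (K_suppN _ _ (closed_neg av) hA) ?add0r; last first.
  by apply: contraL zm => /neg_zer ->.
apply/esym/(act_zer av hA) => // u hu.
by rewrite /npos (K_supp (closed_zer av) hB hu) orbT.
Qed.

Lemma absorb_r d v w : addv v -> win (predC (neg v)) w ->
  exists2 Z, win (pos v) Z & Keq d w ([seq l <- w | zer v l.1] ++ Z).
Proof.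
move=> av hw; have av' := addvN av.
have hw' : win (npos (fun p => - v p)) (winv w).
  apply/allP => l; rewrite mem_rev => /mapP[l' /(allP hw) h ->] /=.
  rewrite oppr_eq0 /npos negN zerN; case/orP: h => [->//|/= h].
  by have := sgnP v l'.1; rewrite (negbTE h) /= orbC => ->; rewrite orbT.
have [A hA h] := absorb_l d av' hw'.
exists (winv A).
  apply/allP => l; rewrite mem_rev => /mapP[l' /(allP hA) hl ->] /=.
  by rewrite oppr_eq0 -negN.
have := Keq_winv skewW h; rewrite winvK winv_cat => {}h.
apply: (Keq_trans h); apply: (Keq_cat skewW) (Keq_refl _ _ _).
suff -> : winv [seq l <- winv w | zer (fun p => - v p) l.1] = [seq l <- w | zer v l.1].
  exact: Keq_refl.
rewrite /winv filter_rev filter_map map_rev revK -map_comp.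
rewrite (@eq_filter _ _ (fun l => zer v l.1)); last by move=> l /=; rewrite zerN.
by rewrite map_id_in // => l _ /=; rewrite opprK -surjective_pairing.
Qed.

End Factorization.

Notation vomW := vom (only parsing).

(** * Consistent elements *)

Section Good.
Variables (r : nat) (W : 'I_r -> 'I_r -> rat).
Hypothesis skewW : forall i j, W i j = - W j i.
Notation mon := 'X_{1..r}.
Notation ser := (ser r).
Notation letter := (letter r).
Notation om := (om W).
Implicit Types (m n u p q : mon) (x y z : ser) (l : letter) (w : seq letter).
Implicit Types (phi psi : 'I_r -> rat).
Notation K := (K W).
Notation Keq := (Keq W).
Notation "'wL'" := (@wL r).
Notation vfun := (vfun r).
Implicit Types (v : vfun).
Notation vom := (vom W).
Notation wadm := (wadm W).
Notation adm := (adm W).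

(* For pairwise commuting letters, the coefficient of y^n in the logarithm of the
   product is proportional to lam n w. *)
Definition lamc (j : nat) : rat := (-1) ^+ j / (j.+1%:R) ^+ 2.
Definition lam n w : rat :=
  \sum_(l <- w) \sum_(j < mdeg n) (n == l.1 *+ j.+1)%MM%:R * (l.2 * lamc j).
Definition mu w n : rat := \sum_(l <- w | l.1 == n) l.2.

Lemma lam_cat n w w' : lam n (w ++ w') = lam n w + lam n w'.
Proof. exact: big_cat. Qed.
Lemma mu_cat n w w' : mu (w ++ w') n = mu w n + mu w' n.
Proof. exact: big_cat. Qed.

(** Letters orthogonal to n act trivially at the exponent n, so logarithms add up there. The squares
    in [lamc] are those of the dilogarithm, whose derivative of weight phi is the logarithm. *)
Lemma K_lam phi n w : win (fun m => om m n == 0) w -> K phi w n = wt phi n * lam n w.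
Proof.
rewrite /lam; elim: w => [|l w IH] /=; first by rewrite big_nil mulr0.
case/andP => hl hw; rewrite big_cons mulrDr -IH //; congr (_ + _).
  rewrite /Kl mulr_sumr; apply: eq_bigr => j _; move: (nat_of_ord j) => i.
  case: eqP => [->|_]; last by rewrite !mul0r mulr0.
  rewrite wtMn /lamc !mul1r; field.
  by rewrite addrC natr1 pnatr_eq0.
case/orP: hl => [/eqP l0|/eqP l0]; first by rewrite actl_coef0.
rewrite /actlW big_mkcond big_ord_recl big1 => [|j _].
  rewrite /= mulm0n subm0 mul1r addr0 ifT //.
  by apply/mnm_lepP => i; rewrite mnm0E.
by case: ifP => // _; rewrite l0 mulr0 binr0 !mul0r.
Qed.

Lemma lam_mu m w : lam m w = \sum_(n <- mons r (mdeg m)) \sum_(j < mdeg m)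
  (m == n *+ j.+1)%MM%:R * (mu w n * lamc j).
Proof.
rewrite /lam /mu exchange_big [RHS]exchange_big; apply: eq_bigr => j _ /=.
transitivity (\sum_(n <- mons r (mdeg m)) \sum_(l <- w)
   (n == l.1)%:R * ((m == l.1 *+ j.+1)%MM%:R * (l.2 * lamc j))).
  rewrite exchange_big; apply: eq_bigr => l _; rewrite sum_mons1.
  case: ifPn => // h; case: eqP => [e|_]; last by rewrite mul0r.
  by rewrite e mdegMn leq_pmulr in h.
apply: eq_bigr => n _; rewrite mulr_suml mulr_sumr [RHS]big_mkcond.
apply: eq_bigr => l _ /=; rewrite eq_sym; case: eqP => [->|_]; first by rewrite mul1r.
by rewrite mul0r.
Qed.

(** The dilogarithm starts with coefficient 1, and its other terms reach m only from proper divisors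
    of m. *)
Lemma lam_diff m w w' : (0 < mdeg m)%N ->
  (forall n j, m = (n *+ j.+2)%MM -> mu w n = mu w' n) ->
  lam m w - lam m w' = mu w m - mu w' m.
Proof.
move=> mpos h; rewrite !lam_mu -sumrB.
transitivity (\sum_(n <- mons r (mdeg m)) (n == m)%:R * (mu w m - mu w' m)); last first.
  by rewrite sum_mons1 leqnn.
apply: eq_bigr => n _; rewrite -sumrB.
have [e me] : exists e, mdeg m = e.+1 by exists (mdeg m).-1; rewrite prednK.
rewrite me big_ord_recl mulm1n /= [X in _ + X]big1 => [|j _].
  rewrite addr0 /lamc expr0 expr1n invr1 !mulr1 eq_sym.
  by case: eqP => [->|_]; rewrite ?mul1r // !mul0r subrr.
case: eqP => [em|_]; last by rewrite !mul0r subrr.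
by rewrite (h n j) ?subrr // em.
Qed.

Lemma mu_wL L c n : uniq L -> mu (wL L c) n = if n \in L then c n else 0.
Proof.
move=> u; rewrite /mu big_map /= big_mkcond; case: ifPn => nL.
  rewrite (bigD1_seq n) //= eqxx big1 ?addr0 // => m /negbTE ->; by [].
by rewrite big_seq big1 // => m mL; case: eqP => // e; rewrite e (negbTE nL) in mL.
Qed.

Lemma adm_mu (M : mon -> Prop) w n : wadm M w -> adm M (n, mu w n).
Proof.
move=> h m Mm; rewrite /mu /= mulr_suml big_mkcond big_seq; apply: rpred_sum => l lw.
case: eqP => [<-|_]; last exact: rpred0.
exact: h Mm.
Qed.

Lemma Keq_perm_top d w w' : (0 < d)%N ->
  [seq l <- w | (mdeg l.1 < d)%N] = [seq l <- w' | (mdeg l.1 < d)%N] ->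
  perm_eq w w' -> Keq d w w'.
Proof.
case: d => // e _ h p; apply/KeqP => m me.
have h' : [seq l <- w | (mdeg l.1 <= e)%N] = [seq l <- w' | (mdeg l.1 <= e)%N] by exact: h.
rewrite (K_top skewW _ w me) (K_top skewW _ w' me) h'; congr (_ + _).
exact: perm_big.
Qed.

Variables (ini : seq letter).

(* ini is the word of the initial walls. *)
Definition Good_at g n := exists A B Z,
  [/\ win (neg (vom n)) A, win (zer (vom n)) B, win (pos (vom n)) Z,
      Keq (mdeg n) g (A ++ B ++ Z) & lam n B = lam n ini].
Definition Good g d := forall n, n != 0%MM -> (mdeg n <= d)%N -> Good_at g n.

Lemma win_zer n B : win (zer (vom n)) B -> win (fun m => om m n == 0) B.
Proof. by apply: win_sub => m; rewrite zer_vom (omC skewW) oppr_eq0. Qed.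

Lemma lam_Keq n B B' : n != 0%MM -> win (zer (vom n)) B -> win (zer (vom n)) B' ->
  Keq (mdeg n) B B' -> lam n B = lam n B'.
Proof.
move=> n0 hB hB' /KeqP/(_ n (leqnn _)); rewrite !K_lam ?win_zer // => /mulfI; apply.
by rewrite wt_dg pnatr_eq0 mdeg_eq0.
Qed.

Lemma Good_lam g n d A B Z : n != 0%MM -> Good_at g n -> (mdeg n <= d)%N ->
  win (neg (vom n)) A -> win (zer (vom n)) B -> win (pos (vom n)) Z ->
  Keq d g (A ++ B ++ Z) -> lam n B = lam n ini.
Proof.
move=> n0 [A' [B' [Z' [hA' hB' hZ' h' <-]]]] nd hA hB hZ /(Keq_le nd) h.
have [_ hBB _] := factor_uniq skewW (addv_vom W n) hA hB hZ hA' hB' hZ' (Keq_trans (Keq_sym h) h').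
exact: lam_Keq.
Qed.

Lemma Good_le g d e : (e <= d)%N -> Good g d -> Good g e.
Proof. by move=> ed h n n0 ne; apply: h => //; apply: leq_trans ed. Qed.

(** At a new exponent m the outer parts of the factorization along m vanish because om(m, m) = 0,
    and the middle part is prescribed there by [lam m ini]. *)
Lemma Good_uniq g g' d : Good g d -> Good g' d -> Keq d g g'.
Proof.
elim: d => [_ _|d IH hg hg'].
  by apply/KeqP => m; rewrite leqn0 mdeg_eq0 => /eqP ->; rewrite !K0.
have {}IH := IH (Good_le (leqnSn d) hg) (Good_le (leqnSn d) hg').
apply/KeqP => m; rewrite leq_eqVlt => /orP[/eqP md|]; last by move/KeqP: IH; apply.
have m0 : m != 0%MM by rewrite -mdeg_eq0 md.
have [A [B [Z [hA hB hZ h hl]]]] := hg _ m0 (eq_leq md).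
have [A' [B' [Z' [hA' hB' hZ' h' hl']]]] := hg' _ m0 (eq_leq md).
rewrite md in h h'.
have [eA eB eZ] := factor_uniq skewW (addv_vom W m) hA hB hZ hA' hB' hZ'
   (Keq_trans (Keq_sym (Keq_le (leqnSn d) h)) (Keq_trans IH (Keq_le (leqnSn d) h'))).
have md1 : (mdeg m <= d.+1)%N by rewrite md.
rewrite (KeqP _ _ _ _ h) // (KeqP _ _ _ _ h') //.
apply/eqP; rewrite -subr_eq0 (K3_top skewW eA eB eZ md).
have zm : zer (vom m) m by rewrite zer_vom (om_id skewW).
have nm : ~~ neg (vom m) m by apply: contraL zm => /neg_zer ->.
have pm : ~~ pos (vom m) m by apply: contraL zm => /pos_zer ->.
have cn := closed_neg (addv_vom W m); have cp := closed_pos (addv_vom W m).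
rewrite (K_suppN _ _ cn hA nm) (K_suppN _ _ cn hA' nm) (K_suppN _ _ cp hZ pm) (K_suppN _ _ cp hZ' pm).
rewrite !K_lam ?win_zer // hl hl'; apply/eqP; ring.
Qed.

Lemma win1 (T : pred mon) l : T l.1 -> win T [:: l].
Proof. by move=> h; rewrite /win /= h orbT. Qed.

(* A letter of degree at least mdeg n is central up to degree mdeg n, so that it can be
   moved to the part of the factorization where it belongs. *)
Lemma insert_top n A B Z n' a : n != 0%MM -> (mdeg n <= mdeg n')%N ->
  win (neg (vom n)) A -> win (zer (vom n)) B -> win (pos (vom n)) Z ->
  exists A' B' Z', [/\ win (neg (vom n)) A', win (zer (vom n)) B', win (pos (vom n)) Z',
   Keq (mdeg n) ((A ++ B ++ Z) ++ [:: (n', a)]) (A' ++ B' ++ Z') &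
   lam n B' = lam n B + (n' == n)%:R * a].
Proof.
move=> n0 nn hA hB hZ; have npos := mdeg_gt0 n0.
have fl : [seq l <- [:: (n', a)] | (mdeg l.1 < mdeg n)%N] = [::] by rewrite /= ltnNge nn.
have ne (b : bool) : b -> zer (vom n) n' = ~~ b -> (n' == n)%:R * a = 0.
  move=> hb; case: eqP => [->|_ _]; last by rewrite mul0r.
  by rewrite zer_vom (om_id skewW) eqxx hb.
case/or3P: (sgnP (vom n) n') => s.
- exists (A ++ [:: (n', a)]), B, Z; split=> //; first by rewrite win_cat hA win1.
    apply: Keq_perm_top => //; first by rewrite !filter_cat fl !cats0.
    by rewrite -!catA perm_cat2l catA perm_catC.
  by rewrite (ne true) ?addr0 // (neg_zer s).
- exists A, (B ++ [:: (n', a)]), Z; split=> //; first by rewrite win_cat hB win1.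
    apply: Keq_perm_top => //; first by rewrite !filter_cat fl !cats0.
    by rewrite -!catA !perm_cat2l perm_catC.
  rewrite lam_cat; congr (_ + _); rewrite /lam big_seq1 /=.
  have [e me] : exists e, mdeg n = e.+1 by exists (mdeg n).-1; rewrite prednK.
  rewrite me big_ord_recl mulm1n /= big1 ?addr0 => [|j _].
    by rewrite /lamc expr0 expr1n invr1 !mulr1 eq_sym.
  case: eqP => [em|_]; last by rewrite mul0r.
  have := congr1 mdeg em; rewrite mdegMn /bump /= add1n => e'.
  have n'pos := leq_trans npos nn.
  by move: nn; rewrite e' leqNgt -{1}[mdeg n']muln1 ltn_pmul2l.
exists A, B, (Z ++ [:: (n', a)]); split=> //; first by rewrite win_cat hZ win1.
  by rewrite -!catA; apply: Keq_refl.
by rewrite (ne true) ?addr0 // (pos_zer s).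
Qed.

Lemma Good_at_add g n n' a : n != 0%MM -> n' != n -> (mdeg n <= mdeg n')%N ->
  Good_at g n -> Good_at (g ++ [:: (n', a)]) n.
Proof.
move=> n0 ne nn [A [B [Z [hA hB hZ h hl]]]].
have [A' [B' [Z' [hA' hB' hZ' h' hl']]]] := insert_top a n0 nn hA hB hZ.
exists A', B', Z'; split=> //; last by rewrite hl' hl (negbTE ne) mul0r addr0.
exact: Keq_trans (Keq_cat skewW h (Keq_refl _ _ _)) h'.
Qed.

Notation MT := (fun _ : mon => True).
Hypothesis ini_adm : wadm MT ini.

Lemma om_multiple n n' j : n = (n' *+ j.+1)%MM -> forall m, om n m = j.+1%:R * om n' m.
Proof. by move=> -> m; rewrite (omMl skewW). Qed.

(** A divisor n' of n defines the same signs as n, so goodness in lower degree already fixes the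
    coefficients of the middle part at all proper divisors. The defect of [lam] at n is then one of
    [mu], removed by a single letter. *)
Lemma Good_at_fix g e n : n != 0%MM -> mdeg n = e.+1 -> Good g e -> wadm MT g ->
  exists a, Good_at (g ++ [:: (n, a)]) n /\ adm MT (n, a).
Proof.
move=> n0 ne hg ha.
have wT : win predT g by apply/allP => l _; rewrite orbT.
have av := addv_vom W n.
have sT : stab MT predT by [].
have cT : closed (@predT mon) by [].
have [c [_ ceq ca]] := factor_coord skewW (mdeg n) av cT sT wT.
set A := wL _ c in ceq; set B := wL _ c in ceq; set Z := wL _ c in ceq.
have hA : win (neg (vom n)) A by apply: wL_win => m; rewrite mem_filter => /andP[].
have hB : win (zer (vom n)) B by apply: wL_win => m; rewrite mem_filter => /andP[].
have hZ : win (pos (vom n)) Z by apply: wL_win => m; rewrite mem_filter => /andP[].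
have muE n' j : n = (n' *+ j.+2)%MM -> mu B n' = mu ini n'.
  have [k] := ubnP (mdeg n'); elim: k n' j => // k IH n' j /ltnSE nk en.
  have n'0 : n' != 0%MM by apply: contraNneq n0 => n'0; rewrite en n'0; apply/eqP/mnmP => i; rewrite mulmnE mnm0E mul0n.
  have n'pos := mdeg_gt0 n'0.
  have nlt : (mdeg n' <= e)%N by rewrite -ltnS -ne en mdegMn -[X in (X < _)%N]muln1 ltn_pmul2l.
  have sg (P : rat -> bool) m : (forall a b : rat, 0 < a -> P (a * b) = P b) -> P (om n m) = P (om n' m).
    by move=> hP; rewrite (om_multiple en) hP // ltr0Sn.
  have negE m : neg (vom n) m = neg (vom n') m.
    by rewrite !neg_vom (sg (fun t => t < 0)) // => a b a0; rewrite pmulr_rlt0.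
  have posE m : pos (vom n) m = pos (vom n') m.
    by rewrite !pos_vom (sg (fun t => 0 < t)) // => a b a0; rewrite pmulr_rgt0.
  have zerE m : zer (vom n) m = zer (vom n') m.
    by rewrite !zer_vom (sg (fun t => t == 0)) // => a b a0; rewrite mulf_eq0 gt_eqF.
  have L : lam n' B = lam n' ini.
    apply: (@Good_lam g n' (mdeg n) A B Z) => //; first exact: hg.
    - by rewrite ne ltnW.
    - by apply: win_sub hA => m; rewrite negE.
    - by apply: win_sub hB => m; rewrite zerE.
    - by apply: win_sub hZ => m; rewrite posE.
  have := lam_diff n'pos (w := B) (w' := ini); rewrite L subrr => h.
  apply/esym/eqP; rewrite -subr_eq0 -oppr_eq0 opprB -h // => n'' i en'.
  (* This index plus 2 is (i + 2)(j + 2), the quotient of n by n''. *)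
  apply: (IH n'' (i + i + j + j + i * j + 2)%N).
    by rewrite (leq_trans _ nk) // en' mdegMn -[X in (X < _)%N]muln1 ltn_pmul2l //;
       apply: mdeg_gt0; apply: contraNneq n'0 => n'0; rewrite en' n'0; apply/eqP/mnmP => q; rewrite mulmnE mnm0E mul0n.
  by rewrite en en' mulmA; congr (_ *+ _)%MM; ring.
have npos : (0 < mdeg n)%N by rewrite ne.
exists (mu ini n - mu B n); split.
  have [A' [B' [Z' [hA' hB' hZ' h' hl']]]] := insert_top (mu ini n - mu B n) n0 (leqnn _) hA hB hZ.
  exists A', B', Z'; split=> //; first exact: Keq_trans (Keq_cat skewW ceq (Keq_refl _ _ _)) h'.
  rewrite hl' eqxx mul1r.
  have := lam_diff npos (w := B) (w' := ini) muE; lra.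
have h1 := adm_mu n ini_adm.
have h2 : adm MT (n, mu B n) by apply: adm_mu => l /mapP[m _ ->]; apply: ca.
by move=> m Mm; rewrite /= mulrBl; apply: rpredB; [apply: h1|apply: h2].
Qed.

(** The exponents of one degree are corrected one at a time: a letter of that degree is central in
    the truncation and disturbs goodness at no other exponent of degree at most its own. *)
Lemma Good_ex d : exists g, Good g d /\ wadm MT g.
Proof.
elim: d => [|d [g [hg ha]]].
  by exists [::]; split => // n; rewrite -mdeg_eq0 leqn0 => /negbTE ->.
suff H (s : seq mon) : uniq s -> (forall n, n \in s -> mdeg n = d.+1) ->
    exists g, [/\ Good g d, wadm MT g & forall n, n \in s -> Good_at g n].
  have [|n|g' [h1 h2 h3]] := H [seq n <- mons r d.+1 | mdeg n == d.+1].
  - exact/filter_uniq/mons_uniq.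
  - by rewrite mem_filter => /andP[/eqP].
  exists g'; split=> // n n0; rewrite leq_eqVlt => /orP[/eqP nd|nd].
    by apply: h3; rewrite mem_filter mem_mons nd eqxx leqnn.
  exact: h1.
elim: s => [_ _|n s IH /= /andP[ns us] hs]; first by exists g.
have [|g' [h1 h2 h3]] := IH us; first by move=> m ms; apply: hs; rewrite inE ms orbT.
have nd : mdeg n = d.+1 by apply: hs; rewrite mem_head.
have n0 : n != 0%MM by rewrite -mdeg_eq0 nd.
have [a [ha1 ha2]] := Good_at_fix n0 nd h1 h2.
exists (g' ++ [:: (n, a)]); split.
- move=> m m0 md; apply: Good_at_add; rewrite ?nd ?leqW //.
    by apply: contraTneq md => <-; rewrite nd ltnn.
  exact: h1.
- by move=> l; rewrite mem_cat inE => /orP[/h2//|/eqP ->].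
move=> m; rewrite inE => /orP[/eqP ->//|ms].
have md : mdeg m = d.+1 by apply: hs; rewrite inE ms orbT.
apply: Good_at_add; rewrite ?nd ?md //; first by rewrite -mdeg_eq0 md.
  by apply: contraNneq ns => ->.
exact: h3.
Qed.

End Good.

(** * Reordering of positive words *)

Section Sorting.
Variables (r : nat) (W : 'I_r -> 'I_r -> rat).
Hypothesis skewW : forall i j, W i j = - W j i.
Notation mon := 'X_{1..r}.
Notation ser := (ser r).
Notation letter := (letter r).
Notation om := (om W).
Implicit Types (m n u p q : mon) (x y z : ser) (l : letter) (w : seq letter).
Implicit Types (phi psi : 'I_r -> rat).
Notation Keq := (Keq W).
Notation "'wL'" := (@wL r).
Notation vfun := (vfun r).
Implicit Types (v : vfun).

Lemma Keq_dropbig d w : Keq d w [seq l <- w | (mdeg l.1 <= d)%N].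
Proof.
apply/KeqP => m md; rewrite (K_top skewW _ w (leqW md)) big1 ?addr0 // => l.
by case/andP => h /eqP e; rewrite e md in h.
Qed.

Lemma Keq_big d l : (d < mdeg l.1)%N -> Keq d [:: l] [::].
Proof. by move=> h; have := Keq_dropbig d [:: l]; rewrite /= leqNgt h. Qed.

Lemma Keq_zero d w : (forall l, l \in w -> l.2 = 0) -> Keq d w [::].
Proof.
elim: w => [|[n a] w IH] h; first exact: Keq_refl.
have /= a0 := h (n, a) (mem_head _ _); rewrite a0.
apply: (Keq_trans (Keq_cat skewW (Keq0 W d n) (Keq_refl _ _ w))).
by apply: IH => l lw; apply: h; rewrite inE lw orbT.
Qed.

Lemma Keq_cons d l w w' : Keq d w w' -> Keq d (l :: w) (l :: w').
Proof. by move=> h; apply: (Keq_cat skewW (Keq_refl W d [:: l]) h). Qed.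

Lemma Keq_swapl d l l' w : Keq d [:: l; l'] [:: l'; l] -> Keq d (l :: l' :: w) (l' :: l :: w).
Proof. by move=> h; apply: (Keq_cat skewW h (Keq_refl W d w)). Qed.

Section Abstract.
Variables (d : nat) (al : letter -> Prop) (sl : mon -> rat).
Notation srt := (pairwise (fun l l' : letter => sl l.1 <= sl l'.1)).

Hypothesis swapH : forall l2 l1, al l2 -> al l1 -> sl l1.1 < sl l2.1 ->
  exists w, [/\ forall l, l \in w -> [/\ al l, sl l.1 <= sl l2.1 & (mdeg l1.1 < mdeg l.1)%N] &
    Keq d [:: l2; l1] (l1 :: rcons w l2)].

(** Insertion, by induction on the codegree of l: passing a letter of larger slope creates only
    letters of larger degree, which are inserted recursively. The last clause bounds all slopes, so
    that the letter [l2] just passed can still be put at the end. *)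
Lemma sort_append w l : srt w -> (forall l', l' \in w -> al l') -> al l ->
  exists w', [/\ srt w', forall l', l' \in w' -> al l', Keq d (rcons w l) w' &
     forall c, sl l.1 <= c -> (forall l', l' \in w -> sl l'.1 <= c) ->
        forall l', l' \in w' -> sl l'.1 <= c].
Proof.
have [k] := ubnP (d.+1 - mdeg l.1); elim: k l w => // k IHk l w /ltnSE hk.
case: (leqP (mdeg l.1) d) => dl; last first.
  move=> sw aw _; exists w; split=> //.
  rewrite -cats1 -[X in Keq _ _ X]cats0.
  by apply: (Keq_cat skewW (Keq_refl _ _ _)); apply: Keq_big.
elim/last_ind: w => [|w l2 IHw] sw aw ha.
  exists [:: l]; split=> //; first by move=> l'; rewrite inE => /eqP ->.
    exact: Keq_refl.
  by move=> c lc _ l'; rewrite inE => /eqP ->.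
move: sw; rewrite pairwise_rcons => /andP[/allP wl2 sw].
have al2 : al l2 by apply: aw; rewrite mem_rcons mem_head.
have aw' l' : l' \in w -> al l' by move=> h; apply: aw; rewrite mem_rcons inE h orbT.
case: (leP (sl l2.1) (sl l.1)) => h.
  exists (rcons (rcons w l2) l); split=> //.
  - rewrite !pairwise_rcons all_rcons h sw /= andbT.
    by apply/andP; split; apply/allP => l' /wl2 // h'; apply: le_trans h.
  - by move=> l'; rewrite mem_rcons inE => /orP[/eqP ->//|/aw].
  - exact: Keq_refl.
  by move=> c lc hc l'; rewrite mem_rcons inE => /orP[/eqP ->//|/hc].
have [W0 [hW0 eW0]] := swapH al2 ha h.
have [w1 [sw1 aw1 ew1 bw1]] := IHw sw aw' ha.
have bw1' := bw1 (sl l2.1) (ltW h) wl2.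
have : exists w2, [/\ srt w2, forall l', l' \in w2 -> al l', Keq d (w1 ++ W0) w2 &
   forall l', l' \in w2 -> sl l'.1 <= sl l2.1].
  elim/last_ind: (W0) hW0 => [_|s l3 IHs hs].
    by exists w1; split=> //; rewrite cats0; apply: Keq_refl.
  have [l' l's|w2 [sw2 aw2 ew2 bw2]] := IHs; first by apply: hs; rewrite mem_rcons inE l's orbT.
  have [|a3 b3 d3] := hs l3; first by rewrite mem_rcons mem_head.
  have [|w3 [sw3 aw3 ew3 bw3]] := IHk l3 w2 _ sw2 aw2 a3.
    by apply: leq_trans hk; apply: ltn_sub2l.
  exists w3; split=> //; last exact: bw3.
  rewrite -cats1 catA; apply: Keq_trans ew3; rewrite -cats1.
  exact: (Keq_cat skewW ew2 (Keq_refl _ _ _)).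
case=> w2 [sw2 aw2 ew2 bw2].
exists (rcons w2 l2); split.
- by rewrite pairwise_rcons sw2 andbT; apply/allP.
- by move=> l'; rewrite mem_rcons inE => /orP[/eqP ->//|/aw2].
- rewrite -!cats1 -catA /=.
  apply: (Keq_trans (Keq_cat skewW (Keq_refl _ _ w) eW0)).
  rewrite -cat_rcons -(cats1 W0) catA.
  refine (Keq_cat skewW _ (Keq_refl _ _ [:: l2])).
  by apply: Keq_trans ew2; apply: (Keq_cat skewW ew1 (Keq_refl _ _ _)).
move=> c lc hc l'; rewrite mem_rcons inE => /orP[/eqP ->|/bw2 h'].
  by apply: hc; rewrite mem_rcons mem_head.
by apply: le_trans h' _; apply: hc; rewrite mem_rcons mem_head.
Qed.

Lemma sort_word w : (forall l, l \in w -> al l) ->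
  exists w', [/\ srt w', forall l, l \in w' -> al l & Keq d w w'].
Proof.
elim/last_ind: w => [_|w l IH hw]; first by exists [::]; split=> //; apply: Keq_refl.
have [l' lw|w1 [s1 a1 e1]] := IH; first by apply: hw; rewrite mem_rcons inE lw orbT.
have [|w2 [s2 a2 e2 _]] := sort_append s1 a1 (l := l); first by apply: hw; rewrite mem_rcons mem_head.
exists w2; split=> //; apply: Keq_trans e2; rewrite -!cats1.
exact: (Keq_cat skewW e1 (Keq_refl _ _ _)).
Qed.

Hypothesis commH : forall l l', al l -> al l' -> sl l.1 = sl l'.1 -> om l.1 l'.1 = 0.

Lemma mu_notin w n : (forall l, l \in w -> l.1 != n) -> mu w n = 0.
Proof.
move=> h; rewrite /mu big_seq_cond big1 // => l /andP[/h] /negbTE ->; by [].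
Qed.

Lemma merge_head n w : srt w -> (forall l, l \in w -> al l) -> (forall l, l \in w -> sl n <= sl l.1) ->
  Keq d w ((n, mu w n) :: [seq l <- w | l.1 != n]).
Proof.
elim: w => [|[m a] w IH] /=.
  by move=> _ _ _; rewrite /mu big_nil; apply: (Keq_sym (Keq0 W d n)).
case/andP=> /allP hm sw aw nw.
have aw' l : l \in w -> al l by move=> h; apply: aw; rewrite inE h orbT.
have nw' l : l \in w -> sl n <= sl l.1 by move=> h; apply: nw; rewrite inE h orbT.
have {IH} IH := IH sw aw' nw'.
rewrite /mu big_cons /=; case: (eqVneq m n) => [->|mn] /=.
  apply: (Keq_trans (Keq_cons (n, a) IH)).
  exact: (Keq_cat skewW (Keq_merge skewW d n a (mu w n)) (Keq_refl W d _)).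
apply: (Keq_trans (Keq_cons (m, a) IH)); apply: Keq_swapl.
case: (boolP (has (fun l => l.1 == n) w)) => [/hasP[l lw /eqP ln]|].
  apply: (Keq_comm skewW); rewrite -ln.
  have e : sl (m, a).1 = sl l.1.
    by apply/eqP; rewrite eq_le (hm _ lw) /= ln; apply: (nw _ (mem_head _ _)).
  exact: (commH (aw _ (mem_head _ _)) (aw' _ lw) e).
move/hasPn => h; rewrite (mu_notin h).
have h0 := Keq0 W d n.
apply: (Keq_trans (Keq_cons (m, a) h0)).
exact: (Keq_sym (Keq_cat skewW h0 (Keq_refl W d [:: (m, a)]))).
Qed.

Lemma merge_sorted (L : seq mon) w : srt w -> (forall l, l \in w -> al l) ->
  uniq L -> pairwise (fun m m' => sl m <= sl m') L -> (forall l, l \in w -> l.1 \in L) ->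
  Keq d w (wL L (mu w)).
Proof.
elim: L w => [|n L IH] w sw aw /=.
  move=> _ _ hL; case: w sw aw hL => [|l w] _ _ hL; first exact: Keq_refl.
  by have := hL l (mem_head _ _).
case/andP=> nL uL /andP[/allP hn sL] hL.
apply: (Keq_trans (@merge_head n w sw aw _)).
  by move=> l /hL; rewrite inE => /orP[/eqP ->//|/hn].
apply: Keq_cons; set w' := [seq l <- w | _].
have -> : wL L (mu w) = wL L (mu w').
  apply/eq_in_map => m mL; congr (_, _); rewrite /mu big_filter_cond.
  apply: eq_bigl => l; case: (eqVneq l.1 m) => [->|]; rewrite ?andbF //.
  by rewrite andbT; apply/esym; apply: contraNneq nL => <-.
apply: IH => //.
- by apply: subseq_pairwise sw; apply: filter_subseq.
- by move=> l; rewrite mem_filter => /andP[_ /aw].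
by move=> l; rewrite mem_filter => /andP[ne /hL]; rewrite inE (negbTE ne).
Qed.

End Abstract.
End Sorting.

(** * The pentagon identity *)

Lemma binr_neg y t : binr (- y.+1%:R) t = (-1) ^+ t * 'C(y + t, t)%:R.
Proof.
elim: t => [|t IH]; first by rewrite addn0 bin0 mulr1.
have h : (t.+1%:R : rat) != 0 by rewrite pnatr_eq0.
apply: (mulfI h); rewrite binrS IH addnS.
have E : t.+1%:R * 'C((y + t).+1, t.+1)%:R = (y.+1%:R + t%:R) * 'C(y + t, t)%:R :> rat.
  by rewrite -natrM -mul_bin_diag natrM -natrD addSn.
have -> : t.+1%:R * ((-1) ^+ t.+1 * 'C((y + t).+1, t.+1)%:R) =
  - (-1) ^+ t * (t.+1%:R * 'C((y + t).+1, t.+1)%:R) :> rat by rewrite exprS; ring.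
by rewrite E; ring.
Qed.

Section Pentagon.
Variables (r : nat) (W : 'I_r -> 'I_r -> rat).
Hypothesis skewW : forall i j, W i j = - W j i.
Notation mon := 'X_{1..r}.
Notation letter := (letter r).
Notation om := (om W).
Notation actl := (actl W).
Implicit Types (m n u p q : mon) (l : letter) (w : seq letter).
Implicit Types (phi psi : 'I_r -> rat).
Notation K := (K W).
Notation Keq := (Keq W).
Notation dg := (@dg r).
Notation vfun := (vfun r).
Implicit Types (v : vfun).

Variables (n1 n2 : mon).
Notation k := (om n2 n1).
Hypothesis k0 : k != 0.

(* This weight vanishes on n2, is 1 on n1, and determines a word up to its letters
   parallel to n2, so that the pentagon identity is checked for K psi1 only. *)
Definition psi1 (i : 'I_r) : rat := k^-1 * omv W n2 i.

Lemma wtZ c phi m : wt (fun i => c * phi i) m = c * wt phi m.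
Proof. by rewrite !wtE mulr_sumr; apply: eq_bigr => i _; rewrite mulrCA. Qed.

Lemma wt_psi1 m : wt psi1 m = k^-1 * om n2 m.
Proof. exact: wtZ. Qed.

Lemma psi1_n1 : wt psi1 n1 = 1.
Proof. by rewrite wt_psi1 mulVf. Qed.
Lemma psi1_n2 : wt psi1 n2 = 0.
Proof. by rewrite wt_psi1 (om_id skewW) mulr0. Qed.

Lemma span_inj x x' y y' :
  ((n1 *+ x + n2 *+ y)%MM == (n1 *+ x' + n2 *+ y')%MM) = (x == x') && (y == y').
Proof.
apply/eqP/andP => [e|[/eqP -> /eqP ->]] //.
have := congr1 (om n2) e; rewrite !omDr !omMr (om_id skewW) !mulr0 !addr0 => /(mulIf k0)/eqP.
have := congr1 (om n1) e; rewrite !omDr !omMr (om_id skewW) !mulr0 !add0r (omC skewW n1).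
by move/(mulIf _)/eqP; rewrite oppr_eq0 !eqr_nat => ->.
Qed.

Lemma n1_neq0 : n1 != 0%MM.
Proof. by apply: contraNneq k0 => ->; rewrite om0r. Qed.
Lemma n2_neq0 : n2 != 0%MM.
Proof. by apply: contraNneq k0 => ->; rewrite (om0l skewW). Qed.

Lemma sum_pick (N M a b : nat) (F : nat -> nat -> rat) : (a < N)%N -> (b < M)%N ->
  \sum_(i < N) \sum_(j < M) F i j * ((i == a :> nat) && (j == b :> nat))%:R = F a b.
Proof.
move=> aN bM; rewrite (bigD1 (Ordinal aN)) //= (bigD1 (Ordinal bM)) //= !eqxx mulr1.
rewrite big1 ?addr0 => [|j]; last first.
  by rewrite -val_eqE /= => /negbTE ->; rewrite ?andbF mulr0.
rewrite big1 ?addr0 // => i; rewrite -val_eqE /= => /negbTE ->.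
by rewrite big1 // => j _; rewrite mulr0.
Qed.

(** At (x + 1) n1 + y n2 the left side is, up to 1/k and sign, 'C(x + 1, y)/(x + 1). On the right, y
    = 0 comes from the letter n1, and y > 0 from the single term y (n1 + n2) of the logarithm of n1
    + n2; equality is absorption. *)
Lemma pentagon1 m : K psi1 [:: (n2, k^-1); (n1, k^-1)] m =
  K psi1 [:: (n1, k^-1); ((n1 + n2)%MM, k^-1); (n2, k^-1)] m.
Proof.
pose f (i : nat) : rat := (-1) ^+ i / i.+1%:R.
have z2 a p : Kl psi1 (n2, a) p = 0.
  by rewrite /Kl big1 // => j _; rewrite psi1_n2 mulr0 !mul0r mulr0.
have ez l x p : (forall u, x u = 0) -> actl l x p = 0.
  by move=> h; rewrite -(actl_zero W l p); apply: eq_actl.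
have k12 : om n1 n2 = - k by rewrite (omC skewW).
set N := mdeg m.
have L : K psi1 [:: (n2, k^-1); (n1, k^-1)] m =
   \sum_(i < N) \sum_(j < N.+1) (k^-1 * f i * binr i.+1%:R j) * delta (n1 *+ i.+1 + n2 *+ j)%MM m.
  rewrite K2 z2 add0r.
  rewrite (@eq_actl _ W _ _ (fun p => \sum_(i < N) (k^-1 * f i) * delta (n1 *+ i.+1)%MM p)); last first.
    by move=> p pm; rewrite (KlE psi1 _ (mdeg_le pm)) /= psi1_n1 mulr1.
  rewrite actl_sum; apply: eq_bigr => i _; rewrite (actl_delta skewW _ _ (leqnn _)) mulr_sumr.
  apply: eq_bigr => j _; rewrite /= omMr mulrA; congr (_ * binr _ _ * _).
  by rewrite mulrCA mulVf // mulr1.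
have R : K psi1 [:: (n1, k^-1); ((n1 + n2)%MM, k^-1); (n2, k^-1)] m =
   \sum_(i < N) (k^-1 * f i) * delta (n1 *+ i.+1)%MM m +
   \sum_(i < N) \sum_(j < N.+1) (k^-1 * f i * binr (- i.+1%:R) j) *
      delta (n1 *+ (i + j).+1 + n2 *+ i.+1)%MM m.
  have -> : K psi1 [:: (n1, k^-1); ((n1 + n2)%MM, k^-1); (n2, k^-1)] m =
     Kl psi1 (n1, k^-1) m + actl (n1, k^-1) (K psi1 [:: ((n1 + n2)%MM, k^-1); (n2, k^-1)]) m by [].
  rewrite (KlE psi1 _ (leqnn _)) /= psi1_n1 mulr1; congr (_ + _).
  rewrite (@eq_actl _ W _ _ (fun p => \sum_(i < N) (k^-1 * f i) * delta ((n1 + n2) *+ i.+1)%MM p)); last first.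
    move=> p pm; rewrite (ez _ _ p) ?addr0.
      by rewrite (KlE psi1 _ (mdeg_le pm)) /= wtD psi1_n1 psi1_n2 addr0 mulr1.
    by move=> u; rewrite z2 add0r actl_zero.
  rewrite actl_sum; apply: eq_bigr => i _; rewrite (actl_delta skewW _ _ (leqnn _)) mulr_sumr.
  apply: eq_bigr => j _; rewrite /= omMr omDr (om_id skewW) add0r k12 mulrA; congr (_ * binr _ _ * _).
    by rewrite mulrCA mulrN mulVf // mulrN1.
  congr (delta _ m); apply/mnmP => q; rewrite !(mnmDE, mulmnE); ring.
rewrite L R.
have [/existsP[x /existsP[y /eqP em]]|no] := boolP [exists x : 'I_N, [exists y : 'I_N.+1,
    m == (n1 *+ x.+1 + n2 *+ y)%MM]]; last first.
  have no' x y : m == (n1 *+ x.+1 + n2 *+ y)%MM = false.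
    apply: contraNF no => /eqP em; have := congr1 mdeg em; rewrite mdegD !mdegMn -/N => eN.
    have hx : (x < N)%N by rewrite eN; apply: leq_trans (leq_addr _ _); apply: leq_pmull; exact: mdeg_gt0 n1_neq0.
    have hy : (y < N.+1)%N by rewrite ltnS eN; apply: leq_trans (leq_addl _ _); apply: leq_pmull; exact: mdeg_gt0 n2_neq0.
    by apply/existsP; exists (Ordinal hx); apply/existsP; exists (Ordinal hy); apply/eqP.
  rewrite [LHS]big1 => [|i _]; last by rewrite big1 // => j _; rewrite /delta no' mulr0.
  rewrite [X in _ = X + _]big1 => [|i _]; last first.
    by have := no' i 0%N; rewrite mulm0n addm0 /delta => ->; rewrite mulr0.
  by rewrite [X in _ = _ + X]big1 ?addr0 // => i _; rewrite big1 // => j _; rewrite /delta no' mulr0.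
have D i : delta (n1 *+ i.+1)%MM m = ((i == x :> nat) && (0 == y :> nat)%N)%:R.
  have -> : (n1 *+ i.+1)%MM = (n1 *+ i.+1 + n2 *+ 0)%MM by rewrite mulm0n addm0.
  by rewrite /delta em span_inj eqSS (eq_sym (nat_of_ord x)) (eq_sym (nat_of_ord y)).
rewrite (eq_bigr (fun i : 'I_N => \sum_(j < N.+1) (k^-1 * f i * binr i.+1%:R j) *
    ((i == x :> nat) && (j == y :> nat))%:R)); last first.
  move=> i _; apply: eq_bigr => j _; rewrite /delta em span_inj eqSS.
  by rewrite (eq_sym (nat_of_ord x)) (eq_sym (nat_of_ord y)).
rewrite (sum_pick (fun i j => k^-1 * f i * binr i.+1%:R j) (ltn_ord x) (ltn_ord y)).
rewrite [X in _ = X + _](eq_bigr (fun i : 'I_N => (k^-1 * f i) * ((i == x :> nat) && (0 == y :> nat)%N)%:R)); last first.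
  by move=> i _; rewrite D.
rewrite [X in _ = _ + X](eq_bigr (fun i : 'I_N => \sum_(j < N.+1) (k^-1 * f i * binr (- i.+1%:R) j) *
    ((i + j == x)%N && (i.+1 == y :> nat))%:R)); last first.
  move=> i _; apply: eq_bigr => j _; rewrite /delta em span_inj eqSS.
  by rewrite (eq_sym (nat_of_ord x)) (eq_sym (nat_of_ord y)).
case: (nat_of_ord y) (ltn_ord y) => [|y'] hy.
  rewrite (bigD1 x) //= !eqxx !mulr1 big1 => [|i].
    rewrite big1 ?addr0 // => i _; rewrite big1 // => j _; by rewrite andbF mulr0.
  by rewrite -val_eqE /= => /negbTE ->; rewrite mulr0.
rewrite [X in _ = X + _]big1 ?add0r => [|i _]; last by rewrite andbF mulr0.
case: (leqP y' x) => h; last first.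
  rewrite binr_nat bin_small // mulr0 big1 // => i _; rewrite big1 // => j _.
  case: eqP => [e|]; last by rewrite mulr0.
  case: eqP => [e'|]; last by rewrite mulr0.
  by move: h; rewrite -e -(succn_inj e') ltnNge leq_addr.
have hb : (x - y' < N.+1)%N by apply: leq_ltn_trans (leq_subr _ _) (leqW (ltn_ord x)).
rewrite (eq_bigr (fun i : 'I_N => \sum_(j < N.+1) (k^-1 * f i * binr (- i.+1%:R) j) *
    ((i == y' :> nat) && (j == (x - y')%N :> nat))%:R)); last first.
  move=> i _; apply: eq_bigr => j _; congr (_ * _%:R).
  rewrite eqSS andbC; case: (eqVneq (nat_of_ord i) y') => //= ->.
  by have -> : (nat_of_ord j == (x - y')%N) = (y' + j == x)%N by rewrite -(eqn_add2l y') subnKC.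
rewrite (sum_pick (fun i j => k^-1 * f i * binr (- i.+1%:R) j) _ hb) //.
rewrite -!mulrA; congr (_ * _); rewrite /f binr_neg subnKC // bin_sub //.
have hx : (x.+1%:R : rat) != 0 by rewrite pnatr_eq0.
have hy' : (y'.+1%:R : rat) != 0 by rewrite pnatr_eq0.
have es : x.+1%:R - 1 = x%:R :> rat by rewrite -natr1 addrK.
have E := binr_absorb x.+1%:R y'; rewrite es !binr_nat in E.
rewrite binr_nat.
have -> : 'C(x.+1, y'.+1)%:R = x.+1%:R * 'C(x, y')%:R / y'.+1%:R :> rat.
  by rewrite -E mulrAC mulfV // mul1r.
have -> : (-1) ^+ x = (-1) ^+ y' * (-1) ^+ (x - y') :> rat by rewrite -exprD subnKC.
by field; rewrite !(addrC 1) !natr1 hx hy'.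
Qed.

(** Where [psi1] has weight zero nothing was compared yet; by [K_zer] for the functional - [psi1]
    both words reduce there to the letter n2. *)
Lemma pentagon d : Keq d [:: (n2, k^-1); (n1, k^-1)]
  [:: (n1, k^-1); ((n1 + n2)%MM, k^-1); (n2, k^-1)].
Proof.
apply/KeqP => m md; apply: (K_weight_det skewW (d := d) (phi := psi1)) => // [p _|p _ p0].
  exact: pentagon1.
pose v : vfun := fun u => - (wt psi1 u)%:P.
have av : addv v by move=> a b; rewrite /v wtD polyCD opprD.
have zE u : zer v u = (wt psi1 u == 0) by rewrite /zer /v oppr_eq0 polyC_eq0.
have nE u : npos v u = (0 <= wt psi1 u).
  by rewrite /npos zE /neg /v lead_coefN lead_coefC oppr_lt0 le0r orbC.
rewrite (@K_zer _ W dg v [:: (n2, k^-1); (n1, k^-1)]) //; first last.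
- by rewrite zE p0.
- by rewrite /win /= !nE psi1_n1 psi1_n2 lexx ler01 !orbT.
rewrite (@K_zer _ W dg v [:: (n1, k^-1); ((n1 + n2)%MM, k^-1); (n2, k^-1)]) //; first last.
- by rewrite zE p0.
- by rewrite /win /= !nE wtD psi1_n1 psi1_n2 addr0 lexx ler01 !orbT.
by rewrite /= !zE wtD psi1_n1 psi1_n2 addr0 oner_eq0 eqxx.
Qed.

End Pentagon.

(** * Exchanging two letters with arbitrary nonnegative coefficients *)

Section Span.
Variables (r : nat) (W : 'I_r -> 'I_r -> rat).
Hypothesis skewW : forall i j, W i j = - W j i.
Notation mon := 'X_{1..r}.
Notation letter := (letter r).
Notation om := (om W).
Notation actl := (actl W).
Implicit Types (m n u p q : mon) (l : letter) (w : seq letter).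
Implicit Types (phi psi : 'I_r -> rat).
Notation Keq := (Keq W).
Notation dg := (@dg r).
Notation "'wL'" := (@wL r).
Notation vfun := (vfun r).
Implicit Types (v : vfun).
Notation vom := (vom W).
Notation wadm := (wadm W).

Lemma Keq_high d l2 l1 : (d < mdeg l1.1 + mdeg l2.1)%N -> Keq d [:: l2; l1] [:: l1; l2].
Proof.
have H l l' m : (mdeg m < mdeg l.1 + mdeg l'.1)%N -> actl l (Kl dg l') m = Kl dg l' m.
  move=> hm; rewrite /actlW big_mkcond big_ord_recl big1 => [|j _].
    rewrite /= mulm0n subm0 mul1r addr0 ifT //.
    by apply/mnm_lepP => i; rewrite mnm0E.
  case: ifP => // hj; suff -> : Kl dg l' (m - l.1 *+ lift ord0 j)%MM = 0 by rewrite mulr0.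
  rewrite /Kl big1 // => i _; case: eqP => [e|_]; last by rewrite mul0r.
  have := congr1 mdeg e; move: (nat_of_ord i) => i'; rewrite !mdegMn => e2.
  have := mdeg_sub hj; rewrite e2 mdegMn; have := mdeg_le hj; rewrite mdegMn /= /bump add1n.
  move: hm; clear; move: (nat_of_ord j) => j'; move: (mdeg m) (mdeg l.1) (mdeg l'.1); nia.
move=> h; apply/KeqP => m md; rewrite !K2 !H 1?addrC //.
  by apply: leq_ltn_trans md h.
by rewrite addnC; apply: leq_ltn_trans md h.
Qed.

Lemma Keq_nseq d n b (p : nat) : Keq d (nseq p (n, b)) [:: (n, p%:R * b)].
Proof.
elim: p => [|p IH]; first by rewrite mul0r; apply: Keq_sym; apply: Keq0.
have -> : p.+1%:R * b = b + p%:R * b by rewrite -natr1 mulrDl mul1r addrC.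
exact: (Keq_trans (Keq_cons skewW (n, b) IH) (Keq_merge skewW d n b _)).
Qed.

Section TwoVectors.
Variables (n1 n2 : mon).
Notation k := (om n2 n1).
Hypothesis k_gt0 : 0 < k.

Let k0 : k != 0. Proof. by rewrite gt_eqF. Qed.
Let n10 : n1 != 0%MM := n1_neq0 k0.
Let n20 : n2 != 0%MM := n2_neq0 skewW k0.
Let d1 := mdeg_gt0 n10.
Let d2 := mdeg_gt0 n20.

Definition spn m := (m != 0%MM) && [exists x : 'I_(mdeg m).+1, [exists y : 'I_(mdeg m).+1,
  m == (n1 *+ x + n2 *+ y)%MM]].

Lemma spnP m : reflect (m != 0%MM /\ exists x y : nat, m = (n1 *+ x + n2 *+ y)%MM) (spn m).
Proof.
apply: (iffP andP) => [[m0 /existsP[x /existsP[y /eqP e]]]|[m0 [x [y e]]]].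
  by split=> //; exists x, y.
split=> //.
have em := congr1 mdeg e; rewrite mdegD !mdegMn in em.
have hx : (x < (mdeg m).+1)%N by rewrite ltnS em; apply: leq_trans (leq_addr _ _); apply: leq_pmull.
have hy : (y < (mdeg m).+1)%N by rewrite ltnS em; apply: leq_trans (leq_addl _ _); apply: leq_pmull.
by apply/existsP; exists (Ordinal hx); apply/existsP; exists (Ordinal hy); apply/eqP.
Qed.

Lemma spn_comb x y : (0 < x + y)%N -> spn (n1 *+ x + n2 *+ y)%MM.
Proof.
move=> h; apply/spnP; split; last by exists x, y.
rewrite -mdeg_eq0 mdegD !mdegMn addn_eq0 !muln_eq0 (gtn_eqF d1) (gtn_eqF d2) /=.
by rewrite -addn_eq0 gtn_eqF.
Qed.

Lemma comb_add x y x' y' : ((n1 *+ x + n2 *+ y) + (n1 *+ x' + n2 *+ y'))%MM =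
  (n1 *+ (x + x') + n2 *+ (y + y'))%MM.
Proof. by apply/mnmP => i; rewrite !(mnmDE, mulmnE); ring. Qed.

Lemma spn_closed : closed spn.
Proof.
move=> m m' /spnP[m0 [x [y e]]] /spnP[m0' [x' [y' e']]].
rewrite e e' comb_add; apply: spn_comb.
case: x y e => [|x] [|y] e //; rewrite ?addn_gt0 ?orbT //.
by move: m0; rewrite e !mulm0n addm0 eqxx.
Qed.

Lemma om_comb x y x' y' : om (n1 *+ x + n2 *+ y)%MM (n1 *+ x' + n2 *+ y')%MM =
  k * (y%:R * x'%:R - x%:R * y'%:R).
Proof.
by rewrite omDr !(omDl skewW) !omMr !(omMl skewW) !(om_id skewW) (omC skewW n1 n2); ring.
Qed.

Lemma om_n1 x y : om n1 (n1 *+ x + n2 *+ y)%MM = - (k * y%:R).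
Proof. by rewrite omDr !omMr (om_id skewW) (omC skewW n1 n2); ring. Qed.
Lemma om_n2 x y : om n2 (n1 *+ x + n2 *+ y)%MM = k * x%:R.
Proof. by rewrite omDr !omMr (om_id skewW); ring. Qed.

(** On the cone of n1 and n2 the numerator is k times the n2-coordinate; dividing by the degree
    makes it a function of the ray. *)
Definition slp m : rat := - om n1 m / (mdeg m)%:R.

Lemma slp_lt m m' : spn m -> spn m' -> (slp m < slp m') = (0 < om m' m).
Proof.
move=> /spnP[m0 [x [y e]]] /spnP[m0' [x' [y' e']]].
have dm := mdeg_gt0 m0; have dm' := mdeg_gt0 m0'.
rewrite /slp ltr_pdivrMr ?ltr0n // mulrAC ltr_pdivlMr ?ltr0n //.
rewrite e e' !om_n1 om_comb !mdegD !mdegMn !natrD !natrM -subr_gt0.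
have -> : - - (k * y'%:R) * ((mdeg n1)%:R * x%:R + (mdeg n2)%:R * y%:R) -
  - - (k * y%:R) * ((mdeg n1)%:R * x'%:R + (mdeg n2)%:R * y'%:R) =
  (mdeg n1)%:R * (k * (y'%:R * x%:R - x'%:R * y%:R)) by ring.
by rewrite pmulr_rgt0 // ltr0n.
Qed.

Lemma slp_eq m m' : spn m -> spn m' -> slp m = slp m' -> om m m' = 0.
Proof.
move=> s s' e; have := slp_lt s s'; have := slp_lt s' s; rewrite e ltxx.
rewrite (omC skewW m' m) oppr_gt0; case: ltrgt0P => //.
Qed.

Lemma slp_le m m' : spn m -> spn m' -> (slp m <= slp m') = (om m m' <= 0).
Proof. by move=> s s'; rewrite leNgt slp_lt // -leNgt. Qed.

End TwoVectors.

(* After rescaling the coefficients are natural numbers a1, a2, and single copies of n1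
   and n2 are exchanged by the pentagon identity; the letters to be reordered
   afterwards have a larger degree. *)
Lemma swap_pos d e n1 n2 a1 a2 : 0 < om n2 n1 -> 0 <= a1 -> 0 <= a2 ->
  a1 * om n2 n1 \is a Num.int -> a2 * om n2 n1 \is a Num.int ->
  (d.+1 - (mdeg n1 + mdeg n2) <= e)%N ->
  exists w, [/\ forall l, l \in w -> 0 <= l.2 /\ exists x y, l.1 = (n1 *+ x.+1 + n2 *+ y.+1)%MM,
    Keq d [:: (n2, a2); (n1, a1)] ((n1, a1) :: rcons w (n2, a2)) &
    forall l m, l \in w -> a1 * om n1 m \is a Num.int -> a2 * om n2 m \is a Num.int ->
       l.2 * om l.1 m \is a Num.int].
Proof.
elim: e n1 n2 a1 a2 => [|e IH] n1 n2 a1 a2 k_gt0 a10 a20 i1 i2 he.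
  exists [::]; split=> //; apply: Keq_high.
  by rewrite /= -subn_eq0 -leqn0.
set k := om n2 n1 in k_gt0 i1 i2.
have k0 : k != 0 by rewrite gt_eqF.
have n10 := n1_neq0 k0; have n20 := n2_neq0 skewW k0.
have d1 := mdeg_gt0 n10; have d2 := mdeg_gt0 n20.
have inj := span_inj skewW k0.
pose S := spn n1 n2.
(* The exponents n1 and n2 occur only as single copies with coefficient 1/k, so that this pair is
   exchanged by one pentagon; any other pair to be exchanged has larger total degree and falls under
   the induction hypothesis. *)
pose al l := [/\ S l.1, 0 <= l.2, (l.2 * om l.1 n1 \is a Num.int) /\ (l.2 * om l.1 n2 \is a Num.int),
   l.1 = n1 -> l.2 = k^-1 & l.1 = n2 -> l.2 = k^-1].
have swapH l2 l1 : al l2 -> al l1 -> slp n1 l1.1 < slp n1 l2.1 ->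
   exists w, [/\ forall l, l \in w -> [/\ al l, slp n1 l.1 <= slp n1 l2.1 & (mdeg l1.1 < mdeg l.1)%N] &
    Keq d [:: l2; l1] (l1 :: rcons w l2)].
  move: l2 l1 => [m2 b2] [m1 b1] [/= s2 p2 [j21 j22] e21 e22] [/= s1 p1 [j11 j12] e11 e12].
  rewrite (slp_lt k_gt0) // => hk.
  have [m20 [x2 [y2 em2]]] := spnP k_gt0 _ s2; have [m10 [x1 [y1 em1]]] := spnP k_gt0 _ s1.
  have dm1 := mdeg_gt0 m10; have dm2 := mdeg_gt0 m20.
  have inS x y : S (m1 *+ x.+1 + m2 *+ y.+1)%MM.
    by apply: (spn_closed k_gt0); apply: closedM => //; apply: (spn_closed k_gt0).
  have degs x y : (mdeg m1 < mdeg (m1 *+ x.+1 + m2 *+ y.+1)%MM)%N.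
    rewrite mdegD !mdegMn; apply: leq_ltn_trans (leq_pmulr (mdeg m1) (ltn0Sn x)) _.
    by rewrite -[X in (X < _)%N]addn0 ltn_add2l muln_gt0 dm2.
  have slps x y : slp n1 (m1 *+ x.+1 + m2 *+ y.+1)%MM <= slp n1 m2.
    rewrite (slp_le k_gt0) // (omDl skewW) !(omMl skewW) (om_id skewW) mulr0 addr0.
    by rewrite (omC skewW) mulrN oppr_le0 mulr_ge0 ?ler0n // ltW.
  have hxy : (0 < x1)%N && (0 < y2)%N.
    move: hk; rewrite em2 em1 (om_comb) pmulr_rgt0 // -!natrM subr_gt0 ltr_nat.
    by case: x1 {em1 s1 inS degs slps} => [|x1]; case: y2 {em2 s2} => [|y2]; rewrite ?muln0 ?mul0n ?ltn0.
  case/andP: hxy => hx1 hy2.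
  case: (boolP ((m2 == n2) && (m1 == n1))) => [/andP[/eqP E2 /eqP E1]|nb].
    rewrite E2 E1 in e11 e22 *; rewrite e11 // e22 //.
    exists [:: ((n1 + n2)%MM, k^-1)]; split; last exact: (pentagon skewW k0).
    move=> l; rewrite inE => /eqP -> /=.
    have := inS 0%N 0%N; have := degs 0%N 0%N; have := slps 0%N 0%N.
    rewrite !mulm1n E1 E2 => h1 h2 h3; split=> //; split=> //=.
      by rewrite invr_ge0 ltW.
    rewrite !(omDl skewW) !(om_id skewW) add0r addr0 -/k mulVf // (omC skewW) mulrN mulVf //.
  have hdeg : (mdeg n1 + mdeg n2 < mdeg m1 + mdeg m2)%N.
    rewrite em1 em2 !mdegD !mdegMn.
    case: (ltnP (mdeg n1 + mdeg n2) (mdeg n1 * x1 + mdeg n2 * y1 + (mdeg n1 * x2 + mdeg n2 * y2))) => // h.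
    have [E1 E2] : (x1 + x2 = 1 /\ y1 + y2 = 1)%N by move: h d1 d2 hx1 hy2; clear; nia.
    have [X1 X2] : x1 = 1%N /\ x2 = 0%N by move: E1 hx1; clear; lia.
    have [Y1 Y2] : y1 = 0%N /\ y2 = 1%N by move: E2 hy2; clear; lia.
    case/negP: nb; rewrite em1 em2 Y1 Y2 X1 X2.
    by rewrite !mulm0n !mulm1n addm0 add0m !eqxx.
  have int_comb b m x y : b * om m n1 \is a Num.int -> b * om m n2 \is a Num.int ->
      b * om m (n1 *+ x + n2 *+ y)%MM \is a Num.int.
    move=> h1 h2; rewrite omDr !omMr mulrDr !(mulrCA b).
    by apply: rpredD; apply: rpredM => //; apply: rpred_nat.
  have [|||w [hw ew aw]] := IH m1 m2 b1 b2 hk p1 p2.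
  - by rewrite (omC skewW) mulrN rpredN em2; apply: int_comb.
  - by rewrite em1; apply: int_comb.
  - by move: he hdeg; clear; lia.
  exists w; split=> // l lw; have [l0 [x [y el]]] := hw l lw.
  have dl : (mdeg n1 + mdeg n2 < mdeg l.1)%N.
    rewrite el mdegD !mdegMn; apply: leq_trans hdeg _.
    by apply: leq_add; rewrite leq_pmulr.
  split; [split| |]; rewrite ?el //; rewrite -?el.
  - by split; apply: aw.
  - by move=> E; rewrite E ltnNge leq_addr in dl.
  by move=> E; rewrite E ltnNge leq_addl in dl.
have natof a : 0 <= a -> a * k \is a Num.int -> exists q : nat, a = q%:R * k^-1.
  move=> a0 ai; have : a * k \is a Num.nat by rewrite -intrEge0 // mulr_ge0 // ltW.
  by case/natrP => q eq_; exists q; rewrite -eq_ mulfK.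
have [q1 e1] := natof _ a10 i1; have [q2 e2] := natof _ a20 i2.
have k12 : om n1 n2 = - k by rewrite (omC skewW).
have spc x y : (0 < x + y)%N -> S (n1 *+ x + n2 *+ y)%MM by apply: (spn_comb k_gt0).
have Sn1 : S n1 by have := spc 1%N 0%N isT; rewrite mulm1n mulm0n addm0.
have Sn2 : S n2 by have := spc 0%N 1%N isT; rewrite mulm1n mulm0n add0m.
have al1 : al (n1, k^-1).
  split=> //=; first by rewrite invr_ge0 ltW.
  by rewrite (om_id skewW) mulr0 k12 mulrN mulVf // rpredN rpred0 rpred1.
have al2 : al (n2, k^-1).
  split=> //=; first by rewrite invr_ge0 ltW.
  by rewrite (om_id skewW) mulr0 -/k mulVf // rpred0 rpred1.
pose u := nseq q2 (n2, k^-1) ++ nseq q1 (n1, k^-1).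
have alu l : l \in u -> al l by rewrite mem_cat !mem_nseq => /orP[] /andP[_ /eqP ->].
have [w0 [sw0 aw0 ew0]] := sort_word skewW swapH alu.
pose w1 := [seq l <- w0 | (mdeg l.1 <= d)%N].
have sw1 : pairwise (fun l l' : letter => slp n1 l.1 <= slp n1 l'.1) w1.
  by apply: subseq_pairwise sw0; apply: filter_subseq.
have aw1 l : l \in w1 -> al l by rewrite mem_filter => /andP[_ /aw0].
have commH l l' : al l -> al l' -> slp n1 l.1 = slp n1 l'.1 -> om l.1 l'.1 = 0.
  by move=> [h _ _ _ _] [h' _ _ _ _]; apply: (slp_eq k_gt0).
pose M := [seq m <- monp r d | S m].
have uM : uniq M by apply/filter_uniq/monp_uniq.
have mM m : (m \in M) = S m && (mdeg m <= d)%N.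
  rewrite mem_filter mem_monp andbA; congr (_ && _).
  by apply/andP/idP => [[]//|h]; split=> //; case/andP: h.
(* In order of slope: the multiples of n1 come first, those of n2 last, and the interior of the cone
   in between. *)
pose L1 := [seq m <- M | om n1 m == 0].
pose L2 := [seq m <- M | om n2 m == 0].
pose int m := (om n1 m != 0) && (om n2 m != 0).
pose Li := sort (fun m m' => slp n1 m <= slp n1 m') [seq m <- M | int m].
pose L := L1 ++ Li ++ L2.
have m1 m : m \in L1 = (om n1 m == 0) && (m \in M) by rewrite mem_filter.
have m2 m : m \in L2 = (om n2 m == 0) && (m \in M) by rewrite mem_filter.
have mi m : m \in Li = int m && (m \in M) by rewrite mem_sort mem_filter.
have Sxy m : S m -> exists x y, [/\ om n1 m = - (k * y%:R), om n2 m = k * x%:R,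
     m = (n1 *+ x + n2 *+ y)%MM & (0 < x + y)%N].
  case/(spnP k_gt0) => m0 [x [y e']]; exists x, y.
  rewrite {1 2}e' (om_n1) (om_n2); split=> //.
  by rewrite lt0n; apply: contra m0; rewrite e' addn_eq0 => /andP[/eqP-> /eqP->]; rewrite !mulm0n addm0.
have excl m : S m -> om n1 m == 0 -> om n2 m == 0 -> false.
  case/Sxy => x [y [-> -> _ h]]; rewrite oppr_eq0 !mulf_eq0 (negbTE k0) !pnatr_eq0 /=.
  by move=> /eqP y0 /eqP x0; rewrite x0 y0 in h.
have le1 m : S m -> om n1 m <= 0.
  by case/Sxy => x [y [-> _ _ _]]; rewrite oppr_le0 mulr_ge0 ?ler0n // ltW.
have ge2 m : S m -> 0 <= om n2 m.
  by case/Sxy => x [y [_ -> _ _]]; rewrite mulr_ge0 ?ler0n // ltW.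
have uL : uniq L.
  have u1 : uniq L1 by apply: filter_uniq.
  have u2 : uniq L2 by apply: filter_uniq.
  have u3 : uniq Li by rewrite sort_uniq; apply: filter_uniq.
  rewrite !cat_uniq u1 u2 u3 /= andbT; apply/andP; split.
    apply/hasPn => m; rewrite mem_cat mi m1 m2 => /orP[/andP[/andP[h _] _]|/andP[h mm]].
      by rewrite (negbTE h).
    by apply/negP => /andP[h' _]; move: mm; rewrite mM => /andP[sm _]; have := excl _ sm h' h.
  by apply/hasPn => m; rewrite mi m2 => /andP[h _]; rewrite /int h andbF.
have mL m : (m \in L) = (m \in M).
  rewrite !mem_cat m1 m2 mi /int -!andb_orl; case: (m \in M); rewrite ?andbF ?andbT //.
  by case: (om n1 m == 0) => //=; case: (om n2 m == 0).
have trs : transitive (fun m m' => slp n1 m <= slp n1 m') by move=> a b c; apply: le_trans.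
have sL : pairwise (fun m m' => slp n1 m <= slp n1 m') L.
  have low m m' : m \in L1 -> m' \in M -> slp n1 m <= slp n1 m'.
    rewrite m1 => /andP[/eqP h _]; rewrite mM => /andP[sm' _]; rewrite /slp h oppr0 mul0r.
    by rewrite divr_ge0 ?ler0n // oppr_ge0 le1.
  have high m m' : m \in M -> m' \in L2 -> slp n1 m <= slp n1 m'.
    rewrite m2 !mM => /andP[sm _] /andP[h2 /andP[sm' _]]; rewrite (slp_le k_gt0) //.
    case/Sxy: sm => x [y [_ _ -> _]]; case/Sxy: sm' => x' [y' [_ e' e'' _]].
    move: h2; rewrite e' mulf_eq0 (negbTE k0) pnatr_eq0 /= => /eqP x'0.
    by rewrite e'' (om_comb) x'0 mulr0 sub0r mulrN oppr_le0 mulr_ge0 ?mulr_ge0 ?ler0n // ltW.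
  rewrite !pairwise_cat; apply/and5P; split.
  - by apply/allrelP => m m' h; rewrite mem_cat mi m2 => /orP[] /andP[_ h']; apply: low.
  - apply/(pairwiseP 0%MM) => i j; rewrite !inE => hi hj _; apply: low; first exact: mem_nth.
    by have := mem_nth 0%MM hj; rewrite m1 => /andP[].
  - by apply/allrelP => m m'; rewrite mi => /andP[_ h] h'; apply: high.
  - by rewrite -sorted_pairwise //; apply: sort_sorted => a b; apply: le_total.
  apply/(pairwiseP 0%MM) => i j; rewrite !inE => hi hj _; apply: high; last exact: mem_nth.
  by have := mem_nth 0%MM hi; rewrite m2 => /andP[].
pose c := mu w1.
have ew1 : Keq d w1 (wL L c).
  apply: (merge_sorted skewW d commH) => // l lw; rewrite mL mM.
  by have [h _ _ _ _] := aw1 _ lw; move: lw; rewrite h mem_filter => /andP[].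
have c_ge0 m : 0 <= c m.
  by rewrite /c /mu big_seq_cond; apply: sumr_ge0 => l /andP[/aw1[_ h _ _ _] _].
pose u0 := [:: (n2, a2); (n1, a1)].
have eu0 : Keq d u0 (wL L c).
  apply: Keq_trans ew1; apply: (Keq_trans (w2 := w0)); last exact: Keq_dropbig.
  apply: Keq_trans ew0; apply: Keq_sym; rewrite /u0 e1 e2.
  exact: (Keq_cat skewW (Keq_nseq d n2 _ q2) (Keq_nseq d n1 _ q1)).
have noneF (P : pred mon) s : (forall m, m \in s -> ~~ P m) -> [seq m <- s | P m] = [::].
  by move=> h; rewrite (@eq_in_filter _ P pred0) ?filter_pred0 // => m /h/negbTE.
have wLf (P : pred mon) s : [seq l <- wL s c | P l.1] = wL [seq m <- s | P m] c.
  by rewrite filter_map.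
(* Each boundary ray is the face cut out by a functional of constant sign on the cone. Applying
   [K_zer] to both words identifies the extreme block of the sorted word with the given letter. *)
have part v s l : addv v -> win (npos v) u0 -> win (npos v) (wL L c) ->
    [seq l <- u0 | zer v l.1] = [:: l] -> [seq m <- L | zer v m] = s -> Keq d [:: l] (wL s c).
  move=> av h1 h2 f1 f2; apply/KeqP => m md.
  have z1 : win (zer v) [:: l].
    by rewrite -f1; apply/allP => l'; rewrite mem_filter => /andP[-> _]; rewrite orbT.
  have z2 : win (zer v) (wL s c).
    by apply: wL_win => m'; rewrite -f2 mem_filter => /andP[].
  case: (boolP (zer v m)) => zm; last by rewrite !(K_suppN _ _ (closed_zer av) _ zm).
  by rewrite -f1 -f2 -wLf -(K_zer W dg av h1 zm) -(K_zer W dg av h2 zm) (KeqP _ _ _ _ eu0).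
have ML m : m \in L -> S m by rewrite mL mM => /andP[].
have E1 : Keq d [:: (n1, a1)] (wL L1 c).
  apply: (part (vom n1)); first exact: addv_vom.
  - rewrite /win /= /npos !neg_vom !zer_vom (om_id skewW) eqxx !orbT andbT k12.
    by rewrite oppr_lt0 k_gt0 orbT.
  - apply: wL_win => m /ML /le1; rewrite /npos neg_vom zer_vom; by case: ltrgt0P.
  - by rewrite /= !zer_vom (om_id skewW) eqxx k12 oppr_eq0 (negbTE k0).
  rewrite !filter_cat [X in _ ++ X ++ _]noneF ?[X in _ ++ _ ++ X]noneF ?cats0 /=.
  - apply/all_filterP/allP => m; rewrite m1 zer_vom => /andP[]//.
  - by move=> m; rewrite m2 mM zer_vom => /andP[h /andP[sm _]]; apply/negP => h'; have := excl _ sm h' h.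
  by move=> m; rewrite mi zer_vom => /andP[/andP[]].
have E2 : Keq d [:: (n2, a2)] (wL L2 c).
  apply: (part (fun m => - vom n2 m)); first exact/addvN/addv_vom.
  - rewrite /win /= /npos !negN !zerN !pos_vom !zer_vom (om_id skewW) eqxx !orbT andTb -/k.
    by rewrite k_gt0 orbT.
  - apply: wL_win => m /ML /ge2; rewrite /npos negN zerN pos_vom zer_vom; by case: ltrgt0P.
  - by rewrite /= !zerN !zer_vom (om_id skewW) eqxx -/k (negbTE k0).
  rewrite !filter_cat [X in X ++ _ ++ _]noneF ?[X in _ ++ X ++ _]noneF /=.
  - apply/all_filterP/allP => m; rewrite m2 zerN zer_vom => /andP[]//.
  - by move=> m; rewrite mi zerN zer_vom => /andP[/andP[]].
  by move=> m; rewrite m1 mM zerN zer_vom => /andP[h /andP[sm _]]; apply/negP => h'; have := excl _ sm h h'.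
have main : Keq d u0 ((n1, a1) :: rcons (wL Li c) (n2, a2)).
  apply: (Keq_trans eu0); rewrite /L !wL_cat -cats1 -cat1s.
  apply: (Keq_cat skewW (Keq_sym E1)); apply: (Keq_cat skewW (Keq_refl _ _ _) (Keq_sym E2)).
exists (wL Li c); split=> //.
  move=> l /mapP[m]; rewrite mi => /andP[/andP[h1 h2]]; rewrite mM => /andP[/Sxy[x [y [o1 o2 em _]]] _] ->.
  split; first exact: c_ge0.
  move: h1 h2; rewrite o1 o2 oppr_eq0 !mulf_eq0 (negbTE k0) !pnatr_eq0 /=.
  by case: x em {o2} => // x; case: y {o1} => // y em _ _; exists x, y.
(* Sorting into single copies only controls integrality on n1 and n2. On all of [Mt] it follows from
   uniqueness of coordinates: the interior block equals the word [u'], whose letters are admissible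
   on [Mt]. *)
pose Mt m := (a1 * om n1 m \is a Num.int) /\ (a2 * om n2 m \is a Num.int).
have cS : closed S by apply: (spn_closed k_gt0).
have stS : stab Mt S.
  move=> m m' [h1 h2] /Sxy[x [y [o1 o2 _ _]]]; rewrite /Mt !omDr !mulrDr o1 o2.
  rewrite mulrN !mulrA; split; first by rewrite rpredB // rpredM // rpred_nat.
  by rewrite rpredD // rpredM // rpred_nat.
pose u' := (n1, - a1) :: rcons u0 (n2, - a2).
have wSu : win S u' by rewrite /win /= Sn1 Sn2 !orbT.
have wau : wadm Mt u'.
  move=> l; rewrite !inE => /or4P[] /eqP -> m [h1 h2] //=; by rewrite mulNr rpredN.
have cov n : n != 0%MM -> (mdeg n <= d)%N -> S n -> n \in L by move=> _ nd sn; rewrite mL mM sn.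
have [c' [_ ceq ca]] := coord_ex skewW cS stS wSu uL cov.
have eu' : Keq d u' (wL Li c).
  have h1 : Keq d u' ((n1, - a1) :: rcons ((n1, a1) :: rcons (wL Li c) (n2, a2)) (n2, - a2)).
    by apply: Keq_cons => //; have := Keq_cat skewW main (Keq_refl W d [:: (n2, - a2)]); rewrite !cats1.
  apply: (Keq_trans h1).
  have -> : (n1, - a1) :: rcons ((n1, a1) :: rcons (wL Li c) (n2, a2)) (n2, - a2) =
    [:: (n1, - a1); (n1, a1)] ++ wL Li c ++ [:: (n2, a2); (n2, - a2)].
    by rewrite /= -!cats1 -catA.
  have z1 : Keq d [:: (n1, - a1); (n1, a1)] [::].
    by apply: (Keq_trans (Keq_merge skewW _ _ _ _)); rewrite addNr; apply: Keq0.
  have z2 : Keq d [:: (n2, a2); (n2, - a2)] [::].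
    by apply: (Keq_trans (Keq_merge skewW _ _ _ _)); rewrite subrr; apply: Keq0.
  have := Keq_cat skewW z1 (Keq_cat skewW (Keq_refl W d (wL Li c)) z2).
  by rewrite cats0.
pose c2 m := if m \in Li then c m else 0.
have ec2 : Keq d (wL L c2) (wL Li c).
  rewrite /L !wL_cat.
  have -> : wL Li c2 = wL Li c by apply/eq_in_map => m h; rewrite /c2 h.
  have z1 : Keq d (wL L1 c2) [::].
    apply: (Keq_zero skewW) => l /mapP[m h ->] /=; rewrite /c2 ifF //.
    by move: h; rewrite m1 mi /int => /andP[-> _].
  have z2 : Keq d (wL L2 c2) [::].
    apply: (Keq_zero skewW) => l /mapP[m h ->] /=; rewrite /c2 ifF //.
    by move: h; rewrite m2 mi /int => /andP[-> _]; rewrite andbF.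
  have := Keq_cat skewW z1 (Keq_cat skewW (Keq_refl W d (wL Li c)) z2).
  by rewrite cats0.
have L0 : 0%MM \notin L by rewrite mL mM /S /spn eqxx.
move=> l m /mapP[n nLi ->] /= h1 h2.
have nM : n \in M by move: nLi; rewrite mi => /andP[].
have nL : n \in L by rewrite mL.
have nd : (mdeg n <= d)%N by move: nM; rewrite mM => /andP[].
have := wL_uniq skewW uL L0 (Keq_trans ec2 (Keq_trans (Keq_sym eu') ceq)) nL nd.
rewrite /c2 nLi => ->; exact: (ca wau).
Qed.

End Span.

(** * Generic lines of sight *)

Lemma lead_MXaddC (p : {poly rat}) c : lead_coef (p * 'X + c%:P) = if p == 0 then c else lead_coef p.
Proof.
case: eqP => [->|/eqP p0]; first by rewrite mul0r add0r lead_coefC.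
rewrite lead_coefDl ?lead_coefMX // size_mulX // size_polyC.
by rewrite ltnS (leq_trans (leq_b1 _)) // size_poly_gt0.
Qed.

Lemma split3 (T : eqType) (f : T -> rat) t (s : seq T) : pairwise (fun a b => f a <= f b) s ->
  s = [seq a <- s | f a < t] ++ [seq a <- s | f a == t] ++ [seq a <- s | t < f a].
Proof.
elim: s => //= a s IH /andP[/allP h /IH {}IH].
have no (P : pred T) : (forall b, b \in s -> ~~ P b) -> [seq b <- s | P b] = [::].
  by move=> h'; rewrite (@eq_in_filter _ P pred0) ?filter_pred0 // => b /h'/negbTE.
case: (ltrgtP (f a) t) => c /=; first by rewrite {1}IH.
  have E1 : [seq b <- s | f b < t] = [::].
    by apply: no => b /h hb; rewrite -leNgt ltW // (lt_le_trans c).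
  have E2 : [seq b <- s | f b == t] = [::].
    by apply: no => b /h hb; rewrite gt_eqF // (lt_le_trans c).
  by rewrite {1}IH E1 E2.
have E1 : [seq b <- s | f b < t] = [::] by apply: no => b /h hb; rewrite -leNgt -c.
by rewrite {1}IH E1.
Qed.

Section Positivity.
Variables (r : nat) (W : 'I_r -> 'I_r -> rat).
Hypothesis skewW : forall i j, W i j = - W j i.
Notation mon := 'X_{1..r}.
Notation letter := (letter r).
Notation om := (om W).
Implicit Types (m n u p q : mon) (l : letter) (w : seq letter).
Implicit Types (phi psi : 'I_r -> rat).
Notation Keq := (Keq W).
Notation "'wL'" := (@wL r).
Notation vfun := (vfun r).
Implicit Types (v : vfun).
Notation adm := (adm W).
Notation MT := (fun _ : mon => True).

Lemma Keq_filter d (P : pred letter) w : (forall l, l \in w -> ~~ P l -> Keq d [:: l] [::]) ->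
  Keq d w (filter P w).
Proof.
elim: w => [|l w IH] h /=; first exact: Keq_refl.
have {}IH : Keq d w (filter P w) by apply: IH => l' h'; apply: h; rewrite inE h' orbT.
case: ifPn => hl; first exact: (Keq_cons skewW).
exact: (Keq_cat skewW (h _ (mem_head _ _) hl) IH).
Qed.

Lemma Keq_0letter d a : Keq d [:: (0%MM, a)] [::].
Proof. by apply/KeqP => m _; rewrite K1 /Kl big1 // => j _; rewrite wt0 mulr0 mul0r mulr0. Qed.

Definition proper d (l : letter) := [&& l.2 != 0, l.1 != 0%MM & (mdeg l.1 <= d)%N].

Lemma Keq_proper d w : Keq d w (filter (proper d) w).
Proof.
apply: Keq_filter => -[n a] _; rewrite /proper.
case: (eqVneq (n, a).2 0) => [/= -> _|_]; first exact: (Keq0 W).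
case: (eqVneq (n, a).1 0%MM) => [/= -> _|_]; first exact: Keq_0letter.
by rewrite /= -ltnNge => h; apply: (Keq_big skewW).
Qed.

Lemma mu_proper d w m : m != 0%MM -> (mdeg m <= d)%N -> mu (filter (proper d) w) m = mu w m.
Proof.
move=> m0 md; rewrite /mu big_filter_cond big_mkcond [RHS]big_mkcond.
apply: eq_bigr => l _; rewrite /proper; case: (eqVneq l.1 m) => [->|_]; last by rewrite andbF.
by rewrite m0 md andbT; case: (eqVneq l.2 0) => //= ->.
Qed.

Lemma win_proper (T : pred mon) d w l : win T w -> l \in filter (proper d) w -> T l.1.
Proof.
move=> /allP h; rewrite mem_filter => /andP[/and3P[l2 _ _] /h].
by rewrite (negbTE l2).
Qed.

Lemma mu_ge0 w n : (forall l, l \in w -> 0 <= l.2) -> 0 <= mu w n.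
Proof. by move=> h; rewrite /mu big_seq_cond; apply: sumr_ge0 => l /andP[/h]. Qed.

(** The identity assumed on S makes the sign of om equal to the comparison of the slopes beta/deg,
    as in a plane. Hence any two letters in the wrong order can be exchanged by [swap_pos], and the
    new slopes lie between the old ones. *)
Lemma ordered_pos d (S : pred mon) (beta : mon -> rat) C w : 0 < C ->
  (forall m, S m -> m != 0%MM) -> closed S ->
  (forall m m', S m -> S m' -> C * om m' m = (mdeg m)%:R * beta m' - (mdeg m')%:R * beta m) ->
  (forall l, l \in w -> [/\ S l.1, 0 <= l.2 & adm MT l]) ->
  exists w', [/\ pairwise (fun l l' : letter => beta l.1 / (mdeg l.1)%:R <= beta l'.1 / (mdeg l'.1)%:R) w',
    forall l, l \in w' -> [/\ S l.1, 0 <= l.2 & adm MT l] & Keq d w w'].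
Proof.
move=> C0 S0 cS h2 hw; pose sl m := beta m / (mdeg m)%:R.
have sl_le m m' : S m -> S m' -> (sl m <= sl m') = (0 <= om m' m).
  move=> sm sm'; have dm := mdeg_gt0 (S0 _ sm); have dm' := mdeg_gt0 (S0 _ sm').
  rewrite /sl ler_pdivrMr ?ltr0n // mulrAC ler_pdivlMr ?ltr0n // -subr_ge0.
  by rewrite [X in X - _]mulrC [X in _ - X]mulrC -h2 // pmulr_rge0.
have sl_lt m m' : S m -> S m' -> (sl m < sl m') = (0 < om m' m).
  move=> sm sm'; rewrite ltNge sl_le // (omC skewW) oppr_ge0 -ltNge //.
apply: (sort_word skewW (al := fun l => [/\ S l.1, 0 <= l.2 & adm MT l]) (sl := sl)) => //.
move=> [n2 a2] [n1 a1] [/= s2 p2 i2] [/= s1 p1 i1]; rewrite sl_lt // => hk.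
have [||w0 [hw0 ew0 aw0]] := swap_pos skewW hk p1 p2 _ _ (leqnn (d.+1 - (mdeg n1 + mdeg n2))).
- by rewrite (omC skewW) mulrN rpredN; apply: i1.
- exact: i2.
have d1 := mdeg_gt0 (S0 _ s1); have d2 := mdeg_gt0 (S0 _ s2).
exists w0; split=> // l lw; have [l0 [x [y e]]] := hw0 l lw.
have sl0 : S l.1 by rewrite e; exact: cS (closedM x cS s1) (closedM y cS s2).
split.
- by split=> // m _; apply: aw0 => //; [apply: i1|apply: i2].
- rewrite -/(sl _) -/(sl _) sl_le // e omDr !omMr (om_id skewW) mulr0 addr0.
  by rewrite mulr_ge0 ?ler0n // ltW.
rewrite e mdegD !mdegMn; apply: leq_ltn_trans (leq_pmulr (mdeg n1) (ltn0Sn x)) _.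
by rewrite -[X in (X < _)%N]addn0 ltn_add2l muln_gt0 d2.
Qed.

Definition lin (V : 'I_r -> {poly rat}) (u : 'I_r -> rat) : {poly rat} := \sum_i u i *: V i.
Definition vl V : vfun := fun m => lin V (fun i => (m i)%:R).

(** The condition on rational vectors forces exponents with V = 0 to be parallel to n; their letters
    commute, so that the coefficients of the middle part are well defined ([gen_mu]). *)
Definition generic V n := vl V n = 0 /\
  forall f, lin V f = 0 -> exists c, forall i, f i = c * (n i)%:R.

Lemma addv_vl V : addv (vl V).
Proof.
move=> m n; rewrite /vl /lin -big_split; apply: eq_bigr => i _.
by rewrite mnmDE natrD scalerDl.
Qed.

Lemma om_coord m p : om m p = \sum_i (m i)%:R * om U_(i)%MM p.
Proof.
rewrite om_sum; apply: eq_bigr => i _; rewrite om_sum.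
rewrite [X in _ = _ * X](bigD1 i) //= [X in _ * (_ + X)]big1 => [|j ne].
  rewrite addr0 mulr_sumr; by apply: eq_bigr => j _; rewrite mnm1E eqxx mul1r mulrA.
by rewrite big1 // => q _; rewrite mnm1E eq_sym (negbTE ne) !mul0r.
Qed.

Lemma par_om m m' n c c' p : (forall i, (m i)%:R = c * (n i)%:R) ->
  (forall i, (m' i)%:R = c' * (n i)%:R :> rat) -> om m p = c * om n p /\ om m m' = 0.
Proof.
move=> h h'.
have H q : om m q = c * om n q.
  by rewrite om_coord (om_coord n) mulr_sumr; apply: eq_bigr => i _; rewrite h mulrA.
split=> //; rewrite H (omC skewW) om_coord.
have -> : \sum_i (m' i)%:R * om U_(i)%MM n = c' * om n n.
  by rewrite (om_coord n n) mulr_sumr; apply: eq_bigr => i _; rewrite h' mulrA.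
by rewrite (om_id skewW) mulr0 oppr0 mulr0.
Qed.

Lemma generic_comm V n m m' : generic V n -> zer (vl V) m -> zer (vl V) m' -> om m m' = 0.
Proof.
move=> [_ h] /eqP/h[c hc] /eqP/h[c' hc']; exact: (par_om m hc hc').2.
Qed.

Lemma generic_par V n m : m != 0%MM -> generic V n -> zer (vl V) m -> generic V m.
Proof.
move=> m0 [hn h] /eqP zm; have [c hc] := h _ zm; split=> // f /h[c' hc'].
have c0 : c != 0.
  apply: contraNneq m0 => c0; apply/eqP/mnmP => i; rewrite mnm0E; apply/eqP.
  by rewrite -(eqr_nat rat) hc c0 mul0r.
by exists (c' / c) => i; rewrite hc' hc mulrA divfK.
Qed.

Lemma gen_mu V n e B B' m : generic V n -> win (zer (vl V)) B -> win (zer (vl V)) B' ->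
  Keq e B B' -> m != 0%MM -> (mdeg m <= e)%N -> mu B m = mu B' m.
Proof.
move=> gen hB hB' h m0 me.
case: (boolP (zer (vl V) m)) => zm; last first.
  have z w : win (zer (vl V)) w -> mu w m = 0.
    move=> /allP hw; rewrite /mu big_seq_cond big1 // => l /andP[/hw h1 /eqP h2].
    by move: h1; rewrite h2 (negbTE zm) orbF => /eqP.
  by rewrite !z.
pose L := [seq q <- monp r e | zer (vl V) q].
have uL : uniq L by apply/filter_uniq/monp_uniq.
have L0 : 0%MM \notin L by rewrite mem_filter mem_monp eqxx andbF.
have pt (T : Type) (s : seq T) : pairwise (fun _ _ => (0 : rat) <= 0) s.
  by elim: s => //= a s ->; rewrite andbT; elim: s.
have H w : win (zer (vl V)) w -> Keq e w (wL L (mu (filter (proper e) w))).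
  move=> hw; apply: (Keq_trans (Keq_proper e w)).
  apply: (merge_sorted skewW e (al := fun l => zer (vl V) l.1) (sl := fun=> 0)) => //.
  - by move=> l l' h1 h2 _; apply: (generic_comm gen).
  - by move=> l; apply: win_proper.
  move=> l hl; rewrite mem_filter mem_monp (win_proper hw hl).
  by move: hl; rewrite mem_filter => /andP[/and3P[_ -> ->]].
have := wL_uniq skewW uL L0 (Keq_trans (Keq_sym (H _ hB)) (Keq_trans h (H _ hB'))) _ me.
by rewrite !mu_proper // => -> //; rewrite mem_filter mem_monp zm m0 me.
Qed.

End Positivity.

(** * Positivity *)

Section LineOfSight.
Variables (r : nat) (W : 'I_r -> 'I_r -> rat).
Hypothesis skewW : forall i j, W i j = - W j i.
Notation mon := 'X_{1..r}.
Notation letter := (letter r).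
Notation om := (om W).
Implicit Types (m n u p q : mon) (l : letter) (w : seq letter).
Implicit Types (phi psi : 'I_r -> rat).
Notation Keq := (Keq W).
Notation vfun := (vfun r).
Implicit Types (v : vfun).
Notation vom := (vom W).
Notation wadm := (wadm W).
Notation MT := (fun _ : mon => True).
Variables (g ini : seq letter) (D : nat).
Hypothesis good_g : Good W ini g D.
Hypothesis adm_g : wadm MT g.
Hypothesis ini_ge0 : forall n, 0 <= mu ini n.

(** Signs are required only of the finitely many exponents visible up to degree e: moving a
    functional preserves signs on these only. *)
Definition prp e (T : pred mon) : pred mon := fun m => (m != 0%MM) && (mdeg m <= e)%N ==> T m.

Definition lf e v A B Z := [/\ win (prp e (neg v)) A, win (prp e (zer v)) B,
  win (prp e (pos v)) Z & Keq e g (A ++ B ++ Z)].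

Lemma win_prp e T w : win T w -> win (prp e T) w.
Proof. by apply: win_sub => m h; apply/implyP. Qed.

Lemma prp_le e e' T w : (e <= e')%N -> win (prp e' T) w -> win (prp e T) w.
Proof.
move=> ee; apply: win_sub => m /implyP h; apply/implyP => /andP[m0 me].
by apply: h; rewrite m0 (leq_trans me).
Qed.

Lemma prp_win e T w : win (prp e T) w -> win T (filter (proper e) w).
Proof.
move=> /allP h; apply/allP => l; rewrite mem_filter => /andP[/and3P[_ a b] /h].
by rewrite /prp a b.
Qed.

Lemma lf_le e e' v A B Z : (e <= e')%N -> lf e' v A B Z -> lf e v A B Z.
Proof. by move=> ee [a b c d]; split; [exact: prp_le a|exact: prp_le b|exact: prp_le c|exact: Keq_le d]. Qed.

Lemma lf_proper e v A B Z : lf e v A B Z -> Keq e g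
  (filter (proper e) A ++ filter (proper e) B ++ filter (proper e) Z).
Proof.
case=> _ _ _ h; apply: (Keq_trans h).
by rewrite -!filter_cat; apply: (Keq_proper skewW).
Qed.

Lemma lf_mu e V n A B Z A' B' Z' m : generic V n -> lf e (vl V) A B Z -> lf e (vl V) A' B' Z' ->
  m != 0%MM -> (mdeg m <= e)%N -> mu B m = mu B' m.
Proof.
move=> gen h h' m0 me.
have k := lf_proper h; have k' := lf_proper h'.
case: h => /prp_win a /prp_win b /prp_win c _; case: h' => /prp_win a' /prp_win b' /prp_win c' _.
have [_ h _] := factor_uniq skewW (addv_vl V) a b c a' b' c' (Keq_trans (Keq_sym k) k').
by rewrite -(mu_proper B m0 me) (gen_mu skewW gen b b' h m0 me) mu_proper.
Qed.

Lemma lf_ex e v : addv v -> exists A B Z, lf e v A B Z.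
Proof.
move=> av; have wg : win predT g by apply/allP => l _; rewrite orbT.
have st : stab MT (predT : pred mon) by [].
have [A [B [Z [a b c h _]]]] := factor_ex skewW e av (@closed_pred1 r) st wg.
exists A, B, Z; split=> //; apply: win_prp; [move: a|move: b|move: c]; by apply: win_sub => m /andP[].
Qed.

Definition pos_upto e := forall V n A B Z, n != 0%MM -> generic V n -> lf e (vl V) A B Z ->
  forall m, m != 0%MM -> (mdeg m <= e)%N -> 0 <= mu B m.

Lemma mu_out (T : pred mon) e w m : win (prp e T) w -> m != 0%MM -> (mdeg m <= e)%N -> ~~ T m -> mu w m = 0.
Proof.
move=> /allP hw m0 me Tm; rewrite /mu big_seq_cond big1 // => l /andP[/hw h1 /eqP h2].
by move: h1; rewrite /prp h2 m0 me (negbTE Tm) orbF => /eqP.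
Qed.

Lemma pos_step e : pos_upto e ->
  (forall V n A B Z, mdeg n = e.+1 -> generic V n -> lf e.+1 (vl V) A B Z -> 0 <= mu B n) ->
  pos_upto e.+1.
Proof.
move=> Pe top V n A B Z n0 gen h m m0; rewrite leq_eqVlt => /orP[/eqP me|/ltnSE me]; last first.
  exact: (Pe _ _ _ _ _ n0 gen (lf_le (leqnSn e) h)).
case: (boolP (zer (vl V) m)) => zm; first exact: (top _ _ _ _ _ me (generic_par m0 gen zm) h).
by case: h => _ b _ _; rewrite (mu_out b m0) // me.
Qed.

Lemma mul0_mn j : (0 *+ j)%MM = 0%MM :> mon.
Proof. by apply/mnmP => i; rewrite mulmnE mnm0E. Qed.

Lemma lam_out (T : pred mon) n w : win T w -> (forall q i, n = (q *+ i.+1)%MM -> ~~ T q) -> lam n w = 0.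
Proof.
move=> /allP hw h; rewrite /lam big_seq big1 // => l /hw lw; rewrite big1 // => i _.
case: eqP => [/h /negbTE hT|_]; last by rewrite mul0r.
by move: lw; rewrite hT orbF => /eqP ->; rewrite !(mul0r, mulr0).
Qed.

Lemma vl_mul V n q i : vl V n = 0 -> n = (q *+ i.+1)%MM -> vl V q = 0.
Proof.
move=> + e; rewrite e (addvM _ _ (addv_vl V)) => /eqP.
by rewrite -scaler_nat scaler_eq0 pnatr_eq0 /= => /eqP.
Qed.

Lemma generic_om V n m : generic V n -> zer (vl V) m -> om n m = 0.
Proof. by move=> gen zm; apply: (generic_comm skewW gen) => //; rewrite /zer gen.1. Qed.

(* V and om(n, -) have compatible signs: both factorizations have the same middle part
   along n. *)
Lemma flow_base V n A B Z : n != 0%MM -> (mdeg n <= D)%N -> generic V n ->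
  lf (mdeg n) (vl V) A B Z ->
  (forall m, m != 0%MM -> (mdeg m <= mdeg n)%N -> 0 <= om n m * lead_coef (vl V m)) ->
  mu B n = mu ini n.
Proof.
move=> n0 nD gen h cr.
have [A0 [B0 [Z0 [hA0 hB0 hZ0 e0 _]]]] := good_g n0 nD.
have st : stab MT (zer (vom n)) by [].
have [A1 [B1 [Z1 [hA1 hB1 hZ1 e1 _]]]] :=
  factor_ex skewW (mdeg n) (addv_vl V) (closed_zer (addv_vom W n)) st hB0.
have hA1' : win (zer (vom n)) A1 by apply: win_sub hA1 => m /andP[].
have hZ1' : win (zer (vom n)) Z1 by apply: win_sub hZ1 => m /andP[].
have {}hA1 : win (neg (vl V)) A1 by apply: win_sub hA1 => m /andP[].
have hB1' : win (zer (vom n)) B1 by apply: win_sub hB1 => m /andP[].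
have {}hB1 : win (zer (vl V)) B1 by apply: win_sub hB1 => m /andP[].
have {}hZ1 : win (pos (vl V)) Z1 by apply: win_sub hZ1 => m /andP[].
(* Outer letters have om(n, -) nonzero, hence V nonzero by genericity, with the same sign by
   assumption; only the middle part needs to be factored again. *)
have h1 : lf (mdeg n) (vl V) (A0 ++ A1) B1 (Z1 ++ Z0).
  split.
  - rewrite win_cat (win_prp _ hA1) andbT; apply: win_sub hA0 => m.
    rewrite neg_vom => hm; apply/implyP => /andP[m0 md].
    have := cr m m0 md; rewrite nmulr_rge0 // /neg lt_neqAle => ->; rewrite andbT lead_coef_eq0.
    by apply: contraTneq hm => z; rewrite (generic_om gen) ?ltxx //; apply/eqP.
  - exact: win_prp.
  - rewrite win_cat (win_prp _ hZ1) /=; apply: win_sub hZ0 => m.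
    rewrite pos_vom => hm; apply/implyP => /andP[m0 md].
    have := cr m m0 md; rewrite pmulr_rge0 // /pos lt_neqAle => ->; rewrite andbT eq_sym lead_coef_eq0.
    by apply: contraTneq hm => z; rewrite (generic_om gen) ?ltxx //; apply/eqP.
  apply: (Keq_trans e0); rewrite -!catA; apply: (Keq_cat skewW (Keq_refl _ _ _)).
  by rewrite !catA; apply: (Keq_cat skewW _ (Keq_refl _ _ _)); rewrite -!catA.
rewrite (lf_mu gen h h1 n0 (leqnn _)).
(* The parts split off from [B0] contain no letter parallel to n, so [B1] carries the whole weight
   along every divisor of n; the coefficient at n then follows by [lam_diff]. *)
have hl n' j : n = (n' *+ j.+1)%MM -> lam n' B1 = lam n' ini.
  move=> en; have om' := om_multiple skewW en.
  have j0 : 0 < j.+1%:R :> rat by rewrite ltr0n.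
  have n'0 : n' != 0%MM by apply: contraNneq n0 => z; rewrite en z mul0_mn.
  have dn' : (mdeg n' <= mdeg n)%N by rewrite en mdegMn leq_pmulr.
  have gn' := good_g n'0 (leq_trans dn' nD).
  have sA : win (neg (vom n')) A0.
    by apply: win_sub hA0 => m; rewrite !neg_vom om' pmulr_rlt0.
  have sB w : win (zer (vom n)) w -> win (zer (vom n')) w.
    by apply: win_sub => m; rewrite !zer_vom om' mulf_eq0 gt_eqF.
  have sZ : win (pos (vom n')) Z0.
    by apply: win_sub hZ0 => m; rewrite !pos_vom om' pmulr_rgt0.
  rewrite -(Good_lam skewW n'0 gn' dn' sA (sB _ hB0) sZ e0).
  have z1 w (v : pred mon) : win v w -> (forall m, v m -> ~~ zer (vl V) m) -> lam n' w = 0.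
    move=> hw hv; apply: lam_out hw _ => q i eq; apply/negP => /hv /negP; apply.
    by rewrite /zer (vl_mul (vl_mul gen.1 en) eq).
  have zA : lam n' A1 = 0 by apply: (z1 _ _ hA1) => m /neg_zer ->.
  have zZ : lam n' Z1 = 0 by apply: (z1 _ _ hZ1) => m /pos_zer ->.
  have := lam_Keq skewW n'0 (sB _ hB0) _ (Keq_le dn' e1); rewrite !lam_cat zA zZ add0r addr0 => -> //.
  by rewrite !win_cat !sB.
have [k] := ubnP (mdeg n).
suff H k' n' j : n = (n' *+ j.+1)%MM -> (mdeg n' < k')%N -> mu B1 n' = mu ini n'.
  by move=> _; apply: (H (mdeg n).+1 n 0%N).
elim: k' n' j => // k' IH n' j en /ltnSE hk.
have n'0 : n' != 0%MM by apply: contraNneq n0 => z; rewrite en z mul0_mn.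
have := lam_diff (m := n') (w := B1) (w' := ini) (mdeg_gt0 n'0).
rewrite (hl _ _ en) subrr => /(_ _)/esym/eqP; rewrite subr_eq0 => H; apply/eqP/H => q i eq.
apply: (IH _ (i.+2 * j.+1).-1); first by rewrite en eq mulmA.
apply: leq_trans hk; rewrite eq mdegMn ltn_Pmulr // mdeg_gt0 //.
by apply: contraNneq n'0 => z; rewrite eq z mul0_mn.
Qed.

End LineOfSight.

(** * Moving the line of sight through a joint *)

Lemma MXaddC_eq0 (p : {poly rat}) c : p * 'X + c%:P = 0 -> p = 0 /\ c = 0.
Proof.
move=> h; split; last by have := congr1 (fun q : {poly rat} => q`_0) h; rewrite coefD coefMX coefC coef0 add0r.
apply/polyP => i; have := congr1 (fun q : {poly rat} => q`_i.+1) h.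
by rewrite coefD coefMX coefC !coef0 addr0.
Qed.

Section Flow.
Variables (r : nat) (W : 'I_r -> 'I_r -> rat).
Hypothesis skewW : forall i j, W i j = - W j i.
Notation mon := 'X_{1..r}.
Notation letter := (letter r).
Notation om := (om W).
Implicit Types (m n u p q : mon) (l : letter) (w : seq letter).
Implicit Types (phi psi : 'I_r -> rat).
Notation vfun := (vfun r).
Implicit Types (v : vfun).
Notation mf m := (fun i => (m i)%:R : rat).
(** The form extended to rational vectors in the second argument, as needed to describe kernels. *)
Definition omf m f : rat := \sum_i f i * om m U_(i)%MM.

Lemma omf_mf m p : omf m (mf p) = om m p.
Proof. by rewrite (omC skewW) om_coord -sumrN; apply: eq_bigr => i _; rewrite (omC skewW m) mulrN. Qed.

Lemma lin_shift V m s f : lin (fun i => V i + om m U_(i)%MM *: s) f = lin V f + omf m f *: s.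
Proof.
rewrite /lin scaler_suml -big_split; apply: eq_bigr => i _.
by rewrite scalerDr scalerA.
Qed.

(** V decides the sign, and om(m, -) breaks the ties on its kernel. *)
Definition pert V m i : {poly rat} := V i * 'X + (om m U_(i)%MM)%:P.

Lemma lin_pert V m f : lin (pert V m) f = lin V f * 'X + (omf m f)%:P.
Proof.
rewrite /lin mulr_suml rmorph_sum -big_split; apply: eq_bigr => i _ /=.
by rewrite /pert scalerDr scalerAl polyCM mul_polyC.
Qed.

Lemma vl_pert V m p : vl (pert V m) p = vl V p * 'X + (om m p)%:P.
Proof. by rewrite /vl lin_pert omf_mf. Qed.

Variables (V : 'I_r -> {poly rat}) (n : mon) (s : {poly rat}).
Hypothesis gen : generic V n.
Hypothesis n0 : n != 0%MM.

(* V moved to the joint at distance s in the direction om(n, -). *)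
Definition bend i := V i + om n U_(i)%MM *: s.

Lemma vl_V1 m : vl bend m = vl V m + om n m *: s.
Proof. by rewrite /vl lin_shift omf_mf. Qed.

(** The kernel of the bent functional is at most a plane: on it V takes values in the multiples of
    s, so a suitable combination of two vectors is killed by V, hence parallel to n. *)
Lemma V1_kernel f h : lin bend f = 0 -> lin bend h = 0 ->
  exists c, forall i, omf n h * f i - omf n f * h i = c * (n i)%:R.
Proof.
rewrite !lin_shift => hf hh; apply: gen.2.
have -> : lin V (fun i => omf n h * f i - omf n f * h i) = omf n h *: lin V f - omf n f *: lin V h.
  rewrite /lin !scaler_sumr -sumrB; apply: eq_bigr => i _.
  by rewrite scalerBl !scalerA.
move/eqP: hf; rewrite addr_eq0 => /eqP ->; move/eqP: hh; rewrite addr_eq0 => /eqP ->.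
by rewrite !scalerN !scalerA mulrC subrr.
Qed.

Lemma omf_lin m a f b h : omf m (fun i => a * f i - b * h i) = a * omf m f - b * omf m h.
Proof. by rewrite /omf !mulr_sumr -sumrB; apply: eq_bigr => i _; rewrite mulrBl !mulrA. Qed.

Lemma omf_ext m c f p : (forall i, f i = c * (p i)%:R) -> omf m f = c * om m p.
Proof.
by move=> h; rewrite -omf_mf /omf mulr_sumr; apply: eq_bigr => i _; rewrite h mulrA.
Qed.

Lemma omf_skew m c f p : (forall i, (m i)%:R = c * (p i)%:R :> rat) -> omf m f = c * omf p f.
Proof.
move=> h; rewrite /omf mulr_sumr; apply: eq_bigr => i _.
have [|-> _] := par_om skewW (m' := 0%MM) (c' := 0) U_(i)%MM h.
  by move=> j; rewrite mnm0E mul0r.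
by rewrite mulrCA.
Qed.

Lemma V1_par m : m != 0%MM -> zer (vl bend) m -> om n m = 0 ->
  exists2 c : rat, c != 0 & forall i, (m i)%:R = c * (n i)%:R.
Proof.
move=> m0 /eqP; rewrite vl_V1 => + e; rewrite e scale0r addr0 => /gen.2[c hc].
exists c => //; apply: contraNneq m0 => c0; apply/eqP/mnmP => i; rewrite mnm0E; apply/eqP.
by rewrite -(eqr_nat rat) hc c0 mul0r.
Qed.

(* The perturbation of the bent functional by om(m, -) sees the walls through the joint
   on both sides of m, so that the coefficient at m is known to be nonnegative by
   induction. *)
Lemma generic_pert m : m != 0%MM -> zer (vl bend) m -> generic (pert bend m) m.
Proof.
move=> m0 zm; split; first by rewrite vl_pert (eqP zm) mul0r (om_id skewW) addr0.
move=> f; rewrite lin_pert => /MXaddC_eq0[hf om0].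
case: (eqVneq (om n m) 0) => [e|e].
  have [c c0 hc] := V1_par m0 zm e.
  have := omf_skew f hc; rewrite om0 => /esym/eqP; rewrite mulf_eq0 (negbTE c0) /= => /eqP e'.
  move: hf; rewrite lin_shift e' scale0r addr0 => /gen.2[c' hc'].
  by exists (c' / c) => i; rewrite hc' hc mulrA divfK.
have [c hc] := V1_kernel hf (eqP zm); rewrite omf_mf in hc.
have := omf_ext m hc; rewrite omf_lin om0 omf_mf (om_id skewW) !mulr0 subrr => /esym/eqP.
rewrite mulf_eq0 (omC skewW m) oppr_eq0 (negbTE e) orbF => /eqP c0.
exists (omf n f / om n m) => i; apply: (mulfI e); rewrite mulrA mulrCA divff // mulr1.
by apply/eqP; rewrite -subr_eq0 hc c0 mul0r.
Qed.

(** Pairing the linear relation between m, m' and n with m computes its coefficient at n, and taking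
    degrees gives the identity. It is the hypothesis of [ordered_pos]. *)
Lemma V1_slope m m' : m != 0%MM -> zer (vl bend) m -> zer (vl bend) m' ->
  (mdeg n)%:R * om m' m = (mdeg m)%:R * om m' n - (mdeg m')%:R * om m n.
Proof.
move=> m0 zm zm'.
have sdeg (p : mon) : \sum_i (p i)%:R = (mdeg p)%:R :> rat by rewrite mdegE natr_sum.
case: (eqVneq (om n m) 0) => [e|e].
  have [c c0 hc] := V1_par m0 zm e.
  have -> : om m' m = c * om m' n by rewrite -(omf_mf m' m); apply: omf_ext.
  have -> : (mdeg m)%:R = c * (mdeg n)%:R.
    by rewrite -!sdeg mulr_sumr; apply: eq_bigr.
  by rewrite (omC skewW m n) e; ring.
have [c hc] := V1_kernel (eqP zm') (eqP zm); rewrite !omf_mf in hc.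
have h1 := omf_ext m hc; rewrite omf_lin !omf_mf (om_id skewW) mulr0 subr0 in h1.
have h2 : om n m * (mdeg m')%:R - om n m' * (mdeg m)%:R = c * (mdeg n)%:R.
  by rewrite -!sdeg !mulr_sumr -sumrB; apply: eq_bigr => i _; rewrite hc.
rewrite (omC skewW m n) in h1 *; rewrite (omC skewW m' n) (omC skewW m' m).
have {}h1 : c = - om m m' by apply: (mulIf e); rewrite mulNr mulrC -[LHS]opprK -mulNr mulrC -mulrN -h1; ring.
by rewrite h1 in h2; lra.
Qed.

End Flow.

Section FlowStep.
Variables (r : nat) (W : 'I_r -> 'I_r -> rat).
Hypothesis skewW : forall i j, W i j = - W j i.
Notation mon := 'X_{1..r}.
Notation letter := (letter r).
Notation om := (om W).
Implicit Types (m n u p q : mon) (l : letter) (w : seq letter).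
Implicit Types (phi psi : 'I_r -> rat).
Notation vfun := (vfun r).
Implicit Types (v : vfun).
Notation pert := (pert W).
Notation bend := (bend W).

Section Joint.
Variables (V : 'I_r -> {poly rat}) (n : mon) (s : {poly rat}) (d : nat).
Hypothesis gen : generic V n.
Hypothesis s0 : 0 < lead_coef s.
Hypothesis smin : forall m, m != 0%MM -> (mdeg m <= d)%N -> om n m * lead_coef (vl V m) < 0 ->
  0 <= lead_coef (- (om n m)^-1 *: vl V m - s).

Lemma V1_joint m : om n m != 0 -> vl (bend V n s) m = - om n m *: (- (om n m)^-1 *: vl V m - s).
Proof.
move=> x0; rewrite (vl_V1 skewW) scalerBr scalerA mulrNN divff // scale1r.
by rewrite scaleNr opprK.
Qed.

(** As s is at most every crossing time, no wall is crossed on the way except those passing through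
    the joint itself. *)
Lemma V1_sign m : m != 0%MM -> (mdeg m <= d)%N -> ~~ zer (vl (bend V n s)) m ->
  Num.sg (lead_coef (vl V m)) = Num.sg (lead_coef (vl (bend V n s) m)).
Proof.
move=> m0 md nz.
have [x0|x0] := eqVneq (om n m) 0; first by rewrite (vl_V1 skewW) x0 scale0r addr0.
have vm0 : lead_coef (vl V m) != 0.
  by rewrite lead_coef_eq0; apply: contra x0 => z; rewrite (generic_om skewW gen).
case: (ltrP (om n m * lead_coef (vl V m)) 0) => h.
  have := smin m0 md h; rewrite le_eqVlt => /orP[|h'].
    move/eqP/esym/eqP; rewrite lead_coef_eq0 => /eqP z; move: nz.
    by rewrite /zer V1_joint // z scaler0 eqxx.
  rewrite V1_joint // lead_coefZ sgrM (gtr0_sg h') mulr1 sgrN.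
  move: h x0 vm0; case: (ltrgt0P (om n m)) => // hx + _.
    by rewrite pmulr_rlt0 // => k _; rewrite (gtr0_sg hx) ltr0_sg.
  by rewrite nmulr_rlt0 // => k _; rewrite (ltr0_sg hx) gtr0_sg // opprK.
rewrite (vl_V1 skewW); move: h; rewrite le_eqVlt eq_sym mulf_eq0 (negbTE x0) (negbTE vm0) /=.
case: (ltrgt0P (om n m)) x0 => // hx _.
  rewrite pmulr_rgt0 // => k; rewrite (gtr0_sg k) gtr0_sg // lcD_gt0 // lead_coefZ.
  exact: mulr_gt0.
rewrite nmulr_rgt0 // => k; rewrite (ltr0_sg k) ltr0_sg // -oppr_gt0 -lead_coefN opprD -scaleNr.
by rewrite lcD_gt0 // ?lead_coefN ?oppr_gt0 // lead_coefZ mulr_gt0 // oppr_gt0.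
Qed.

Lemma neg_sg v m : neg v m = (Num.sg (lead_coef (v m)) == -1).
Proof. by rewrite sgr_cp0. Qed.
Lemma pos_sg v m : pos v m = (Num.sg (lead_coef (v m)) == 1).
Proof. by rewrite sgr_cp0. Qed.

Lemma V1_neg m : m != 0%MM -> (mdeg m <= d)%N -> neg (vl (bend V n s)) m -> neg (vl V) m.
Proof.
by move=> m0 md h; move: (h); rewrite !neg_sg V1_sign // (neg_zer h).
Qed.
Lemma V1_pos m : m != 0%MM -> (mdeg m <= d)%N -> pos (vl (bend V n s)) m -> pos (vl V) m.
Proof.
by move=> m0 md h; move: (h); rewrite !pos_sg V1_sign // (pos_zer h).
Qed.

Lemma V1_zer m : zer (vl (bend V n s)) m -> vl V m = om m n *: s.
Proof.
by rewrite /zer (vl_V1 skewW) addr_eq0 => /eqP ->; rewrite (omC skewW m) scaleNr.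
Qed.

Lemma lead_pert p m : lead_coef (vl (pert (bend V n s) p) m) =
  if zer (vl (bend V n s)) m then om p m else lead_coef (vl (bend V n s) m).
Proof. by rewrite (vl_pert skewW) lead_MXaddC. Qed.

Lemma zer_pert p m : zer (vl (pert (bend V n s) p)) m = zer (vl (bend V n s)) m && (om p m == 0).
Proof.
rewrite {1}/zer -lead_coef_eq0 lead_pert; case: ifP => //= h; rewrite lead_coef_eq0.
by move: h; rewrite /zer => ->.
Qed.

(** The exponents that still have to change sign on the way to the position where [flow_base]
    applies. *)
Definition crossings U := [seq m <- monp r d | om n m * lead_coef (vl U m) < 0].

(** On the joint the perturbed functional has the sign of om(n, -), so m0 leaves the list; off the
    joint no sign has changed. *)
Lemma crossings_lt m0 : m0 \in crossings V -> s = - (om n m0)^-1 *: vl V m0 ->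
  (size (crossings (pert (bend V n s) n)) < size (crossings V))%N.
Proof.
move=> m0c es; have x0 : om n m0 != 0.
  by apply: contraTneq m0c; rewrite mem_filter => ->; rewrite mul0r ltxx.
have z0 : zer (vl (bend V n s)) m0 by rewrite /zer V1_joint // -es subrr scaler0.
apply: (@uniq_leq_size _ (m0 :: _)) => [|m].
  rewrite /= filter_uniq ?monp_uniq // andbT mem_filter lead_pert z0.
  by rewrite negb_and -leNgt -expr2 sqr_ge0.
rewrite inE => /orP[/eqP -> //|]; rewrite mem_filter mem_monp => /andP[h /andP[m'0 md]].
rewrite mem_filter mem_monp m'0 md andbT; move: h; rewrite lead_pert; case: ifPn => z.
  by rewrite ltNge -expr2 sqr_ge0.
by rewrite andbT -sgr_lt0 sgrM -V1_sign // -sgrM sgr_lt0.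
Qed.

End Joint.

Lemma min_lead (T : eqType) (f : T -> {poly rat}) (L : seq T) : L != [::] ->
  exists2 a, a \in L & forall b, b \in L -> 0 <= lead_coef (f b - f a).
Proof.
elim: L => // a [_ _|b L /(_ isT) [c cL hc] _].
  by exists a => [|b]; rewrite ?mem_head // inE => /eqP ->; rewrite subrr lead_coef0.
have tr (x y : {poly rat}) : 0 <= lead_coef x -> 0 <= lead_coef y -> 0 <= lead_coef (x + y).
  rewrite le_eqVlt => /orP[|p0]; first by rewrite eq_sym lead_coef_eq0 => /eqP ->; rewrite add0r.
  rewrite le_eqVlt => /orP[|q0]; first by rewrite eq_sym lead_coef_eq0 => /eqP ->; rewrite addr0 ltW.
  exact/ltW/lcD_gt0.
case: (ltrP (lead_coef (f a - f c)) 0) => h; last first.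
  by exists c => [|p]; rewrite inE ?cL ?orbT // => /orP[/eqP ->|/hc].
exists a => [|p]; first exact: mem_head.
rewrite inE => /orP[/eqP ->|/hc h']; first by rewrite subrr lead_coef0.
rewrite -(subrK (f c) (f p)) -addrA; apply: tr => //.
by rewrite -opprB lead_coefN oppr_ge0 ltW.
Qed.

End FlowStep.

Section FlowConclusion.
Variables (r : nat) (W : 'I_r -> 'I_r -> rat).
Hypothesis skewW : forall i j, W i j = - W j i.
Notation mon := 'X_{1..r}.
Notation letter := (letter r).
Notation om := (om W).
Implicit Types (m n u p q : mon) (l : letter) (w : seq letter).
Implicit Types (phi psi : 'I_r -> rat).
Notation Keq := (Keq W).
Notation "'wL'" := (@wL r).
Notation vfun := (vfun r).
Implicit Types (v : vfun).
Notation wadm := (wadm W).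
Notation MT := (fun _ : mon => True).
Notation pert := (pert W).
Notation bend := (bend W).
Variables (g ini : seq letter) (D : nat).
Hypothesis good_g : Good W ini g D.
Hypothesis adm_g : wadm MT g.
Hypothesis ini_ge0 : forall n, 0 <= mu ini n.
Notation lf := (lf W g).
Notation pos_upto := (pos_upto W g).

Lemma filter_wL (P : pred mon) L c : [seq l <- wL L c | P l.1] = wL (filter P L) c.
Proof. by rewrite /wL filter_map. Qed.

Lemma perm3 (T : eqType) (f : T -> rat) (t : seq T) :
  perm_eq t ([seq a <- t | f a < 0] ++ [seq a <- t | f a == 0] ++ [seq a <- t | 0 < f a]).
Proof.
apply/seq.permP => P; rewrite !count_cat !count_filter; elim: t => //= a t ->.
case: (ltrgt0P (f a)) => _; rewrite ?andbT ?andbF; lia.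
Qed.

Lemma filterC_swap (T : Type) (P Q : pred T) (t : seq T) : filter P (filter Q t) = filter Q (filter P t).
Proof. by rewrite -!filter_predI; apply: eq_filter => a /=; rewrite andbC. Qed.

Section Step.
Variables (V : 'I_r -> {poly rat}) (n : mon) (s : {poly rat}) (e : nat).
Hypothesis gen : generic V n.
Hypothesis nd : mdeg n = e.+1.
Hypothesis s0 : 0 < lead_coef s.
Hypothesis smin : forall m, m != 0%MM -> (mdeg m <= e.+1)%N -> om n m * lead_coef (vl V m) < 0 ->
  0 <= lead_coef (- (om n m)^-1 *: vl V m - s).
Hypothesis Pe : pos_upto e.
Hypothesis IH : forall A B Z, lf e.+1 (vl (pert (bend V n s) n)) A B Z -> 0 <= mu B n.
Notation v1 := (vl (bend V n s)).

(* At the joint, the walls through it appear in the order of their slopes on one side,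
   and in the opposite order on the other side; letters of top degree are central. *)
Lemma flow_step A B Z : lf e.+1 (vl V) A B Z -> 0 <= mu B n.
Proof.
move=> hABZ.
have n0 : n != 0%MM by rewrite -mdeg_eq0 nd.
have wg : win predT g by apply/allP => l _; rewrite orbT.
have st : stab MT (predT : pred mon) by [].
have [A1 [B1 [Z1 [hA1 hB1 hZ1 e1 /(_ adm_g)[_ aB1 _]]]]] :=
  factor_ex skewW e.+1 (addv_vl (bend V n s)) (@closed_pred1 r) st wg.
have {}hA1 : win (neg v1) A1 by apply: win_sub hA1 => m /andP[].
have {}hB1 : win (zer v1) B1 by apply: win_sub hB1 => m /andP[].
have {}hZ1 : win (pos v1) Z1 by apply: win_sub hZ1 => m /andP[].
pose tl m : rat := om n m / (mdeg m)%:R.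
pose L := sort (fun m m' => tl m <= tl m') [seq m <- monp r e.+1 | zer v1 m].
have uL : uniq L by rewrite sort_uniq filter_uniq ?monp_uniq.
have memL m : (m \in L) = [&& zer v1 m, m != 0%MM & (mdeg m <= e.+1)%N].
  by rewrite mem_sort mem_filter mem_monp.
have pL : pairwise (fun m m' => tl m <= tl m') L.
  rewrite -sorted_pairwise; last by move=> x y z; apply: le_trans.
  by apply: sort_sorted => x y; apply: le_total.
have st1 : stab MT (zer v1) by [].
have [|c [cs e2 ac]] := coord_ex skewW (d := e.+1) (closed_zer (addv_vl (bend V n s))) st1 hB1 uL.
  by move=> m m0 md zm; rewrite memL zm m0.
have {}ac := ac aB1.
have slope := V1_slope skewW (s := s) gen.
have C0 : 0 < (mdeg n)%:R :> rat by rewrite ltr0n nd.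
have tl_lt m m' : m \in L -> m' \in L -> (tl m < tl m') = (0 < om m m').
  rewrite !memL => /and3P[z1 m0 _] /and3P[z1' m0' _].
  have dm : 0 < (mdeg m)%:R :> rat by rewrite ltr0n mdeg_gt0.
  have dm' : 0 < (mdeg m')%:R :> rat by rewrite ltr0n mdeg_gt0.
  rewrite /tl ltr_pdivrMr // mulrAC ltr_pdivlMr // -(pmulr_rgt0 _ C0) slope //.
  rewrite !(omC skewW _ n) subr_gt0 !mulrN ltrN2 mulrC [X in _ < X]mulrC //.
(* Seen from the perturbation at p, letters of slope below, equal to and above that of p are
   negative, zero and positive. Thus [c p] is a middle coefficient, nonnegative by [Pe] in degree at
   most e and by [IH] for p = n. *)
have cpos p : p \in L -> (mdeg p <= e)%N \/ p = n -> 0 <= c p.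
  move=> pL' hp; have := pL'; rewrite memL => /and3P[zp p0 pd].
  have lfp : lf e.+1 (vl (pert (bend V n s) p)) (A1 ++ wL [seq a <- L | tl a < tl p] c)
     (wL [seq a <- L | tl a == tl p] c) (wL [seq a <- L | tl p < tl a] c ++ Z1).
    split.
    - rewrite win_cat; apply/andP; split.
        apply: win_sub hA1 => m hm; apply/implyP => _.
        by rewrite /neg (lead_pert skewW) (neg_zer hm).
      apply: wL_win => m; rewrite mem_filter => /andP[h mL] _; apply/implyP => _.
      move: (mL); rewrite memL => /andP[zm _]; rewrite /neg (lead_pert skewW) zm.
      by rewrite (omC skewW) oppr_lt0 -tl_lt.
    - apply: wL_win => m; rewrite mem_filter => /andP[/eqP h mL] _; apply/implyP => _.
      move: (mL); rewrite memL => /andP[zm _]; rewrite (zer_pert skewW) zm /=.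
      by rewrite eq_le !leNgt -tl_lt // h ltxx -oppr_gt0 -(omC skewW) -tl_lt // h ltxx.
    - rewrite win_cat andbC; apply/andP; split.
        apply: win_sub hZ1 => m hm; apply/implyP => _.
        by rewrite /pos (lead_pert skewW) (pos_zer hm).
      apply: wL_win => m; rewrite mem_filter => /andP[h mL] _; apply/implyP => _.
      move: (mL); rewrite memL => /andP[zm _]; rewrite /pos (lead_pert skewW) zm.
      by rewrite -tl_lt.
    apply: (Keq_trans e1); rewrite -!catA; apply: (Keq_cat skewW (Keq_refl _ _ _)).
    rewrite !catA; apply: (Keq_cat skewW _ (Keq_refl _ _ _)).
    by rewrite -!wL_cat -catA -split3.
  have mup : mu (wL [seq a <- L | tl a == tl p] c) p = c p.
    by rewrite mu_wL ?filter_uniq // mem_filter eqxx pL'.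
  have gp := generic_pert skewW gen p0 zp.
  rewrite -mup; case: hp => [hp|hp]; first exact: (Pe p0 gp (lf_le (leqnSn e) lfp)).
  move: lfp;  rewrite hp => lfp; exact: (IH lfp).
(* In degree e + 1 the sign is known at n only; these letters are central in the truncation, so they
   are moved to the end and kept out of the reordering. *)
pose low m := (mdeg m <= e)%N.
pose lo := wL (filter low L) c; pose top := wL (filter (predC low) L) c.
have e3 : Keq e.+1 (wL L c) (lo ++ top).
  apply: (Keq_perm_top skewW) => //; last by rewrite -wL_cat perm_map // perm_sym perm_filterC.
  have f0 : [seq l <- top | (mdeg l.1 < e.+1)%N] = [::].
    rewrite (filter_wL (fun m => mdeg m < e.+1)%N) -filter_predI.
    by rewrite (@eq_filter _ _ pred0) ?filter_pred0 // => m /=; rewrite /low ltnS andbN.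
  rewrite filter_cat f0 cats0 !(filter_wL (fun m => mdeg m < e.+1)%N) -filter_predI.
  by congr wL; apply: eq_filter => m /=; rewrite /low ltnS andbb.
pose S : pred mon := fun m => zer v1 m && (m != 0%MM).
have cS : closed S.
  move=> m m' /andP[z1 m0] /andP[z1' _]; rewrite /S closed_zer //=; last exact: addv_vl.
  by rewrite -mdeg_eq0 mdegD addn_eq0 mdeg_eq0 (negbTE m0).
have S0 m : S m -> m != 0%MM by case/andP.
have sl m m' : S m -> S m' -> (mdeg n)%:R * om m' m = (mdeg m)%:R * om m' n - (mdeg m')%:R * om m n.
  by move=> /andP[z1 m0] /andP[z1' _]; apply: slope.
have [|w' [sw' aw' e4]] := ordered_pos skewW e.+1 C0 S0 cS sl (w := lo).
  move=> l /mapP[m]; rewrite mem_filter => /andP[lm mL] -> /=.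
  by move: (mL); rewrite memL => /and3P[z1 m0 _]; split; [rewrite /S z1|apply: cpos => //; left|].
have {sw'} : pairwise (fun l l' : letter => om l.1 n / (mdeg l.1)%:R <= om l'.1 n / (mdeg l'.1)%:R) w' by [].
set bl := fun l : letter => om l.1 n / (mdeg l.1)%:R => sw'.
pose w2 := w' ++ top.
have e5 : Keq e.+1 w2 ([seq l <- w2 | bl l < 0] ++ [seq l <- w2 | bl l == 0] ++ [seq l <- w2 | 0 < bl l]).
  apply: (Keq_perm_top skewW) => //; last exact: perm3.
  have f0 : [seq l <- top | (mdeg l.1 < e.+1)%N] = [::].
    rewrite (filter_wL (fun m => mdeg m < e.+1)%N) -filter_predI.
    by rewrite (@eq_filter _ _ pred0) ?filter_pred0 // => m /=; rewrite /low ltnS andbN.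
  rewrite /w2 [LHS]filter_cat f0 cats0 !filter_cat.
  rewrite !(filterC_swap (fun l : letter => (mdeg l.1 < e.+1)%N) _ top) f0 /= !cats0.
  rewrite !(filterC_swap (fun l : letter => (mdeg l.1 < e.+1)%N) _ w').
  by apply: split3; apply: pairwise_filter.
have Sw2 l : l \in w2 -> S l.1 /\ (l.1 = n -> 0 <= l.2).
  rewrite mem_cat => /orP[/aw'[Sl p _]|/mapP[m]]; first by [].
  rewrite mem_filter => /andP[_ mL] -> /=; move: (mL); rewrite memL /S => /and3P[-> -> _].
  by split=> // h; apply: cpos => //; right.
(* At the joint V(m) = om(m, n) s: the order seen from V is that of the opposite slope. *)
have sgV m a : S m -> Num.sg (lead_coef (vl V m)) = Num.sg (bl (m, a)).
  move=> /andP[zm m0]; rewrite (V1_zer skewW zm) lead_coefZ sgrM (gtr0_sg s0) mulr1 sgrM.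
  by rewrite [Num.sg _^-1]gtr0_sg ?mulr1 // invr_gt0 ltr0n mdeg_gt0.
have h2 : lf e.+1 (vl V) (A1 ++ [seq l <- w2 | bl l < 0]) [seq l <- w2 | bl l == 0]
   ([seq l <- w2 | 0 < bl l] ++ Z1).
  split.
  - rewrite win_cat; apply/andP; split.
      apply: win_sub hA1 => m hm; apply/implyP => /andP[m0 md].
      exact: (V1_neg skewW gen s0 smin m0 md hm).
    apply/allP => -[m a]; rewrite mem_filter => /andP[h /Sw2[Sm _]].
    rewrite -[(m, a).1]/m in Sm *.
    by rewrite /prp /neg -(sgr_lt0 (lead_coef _)) (sgV _ a Sm) sgr_lt0 h implybT orbT.
  - apply/allP => -[m a]; rewrite mem_filter => /andP[h /Sw2[Sm _]].
    rewrite -[(m, a).1]/m in Sm *.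
    by rewrite /prp /zer -lead_coef_eq0 -(sgr_eq0 (lead_coef _)) (sgV _ a Sm) sgr_eq0 h implybT orbT.
  - rewrite win_cat andbC; apply/andP; split.
      apply: win_sub hZ1 => m hm; apply/implyP => /andP[m0 md].
      exact: (V1_pos skewW gen s0 smin m0 md hm).
    apply/allP => -[m a]; rewrite mem_filter => /andP[h /Sw2[Sm _]].
    rewrite -[(m, a).1]/m in Sm *.
    by rewrite /prp /pos -(sgr_gt0 (lead_coef _)) (sgV _ a Sm) sgr_gt0 h implybT orbT.
  apply: (Keq_trans e1); rewrite -!catA; apply: (Keq_cat skewW (Keq_refl _ _ _)).
  rewrite !catA; apply: (Keq_cat skewW _ (Keq_refl _ _ _)); rewrite -!catA.
  apply: (Keq_trans e2); apply: (Keq_trans e3).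
  by apply: Keq_trans e5; apply: (Keq_cat skewW e4 (Keq_refl _ _ _)).
have ne : (mdeg n <= e.+1)%N by rewrite nd.
rewrite (lf_mu skewW gen hABZ h2 n0 ne) /mu big_seq_cond.
by apply: sumr_ge0 => l; rewrite mem_filter => /andP[/andP[_ /Sw2[_ h]] /eqP /h].
Qed.

End Step.

(** Induction on the number of crossings, one joint at a time; without crossings the coefficient is
    the initial one. *)
Lemma flow e k V n A B Z : (e < D)%N -> pos_upto e -> mdeg n = e.+1 -> generic V n ->
  lf e.+1 (vl V) A B Z -> (size (crossings W n e.+1 V) < k)%N -> 0 <= mu B n.
Proof.
move=> eD Pe nd; elim: k V A B Z => // k IH V A B Z gen h.
have n0 : n != 0%MM by rewrite -mdeg_eq0 nd.
case: (eqVneq (crossings W n e.+1 V) [::]) => [no _|ne].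
  have nD : (mdeg n <= D)%N by rewrite nd.
  rewrite -nd in h; rewrite (flow_base skewW good_g n0 nD gen h) // nd.
  move=> m m0 md; rewrite leNgt; apply/negP => lt0.
  have : m \in crossings W n e.+1 V by rewrite mem_filter lt0 mem_monp m0.
  by rewrite no.
have [m0 m0c hm] := min_lead (fun m => - (om n m)^-1 *: vl V m) ne.
(* The first time at which V + s om(n, -) vanishes on an exponent still to be crossed. *)
move=> /ltnSE hk; pose s := - (om n m0)^-1 *: vl V m0.
have s0 : 0 < lead_coef s.
  move: m0c; rewrite mem_filter => /andP[h0 _]; rewrite /s lead_coefZ mulNr oppr_gt0.
  have x0 : om n m0 != 0 by apply: contraTneq h0 => ->; rewrite mul0r ltxx.
  rewrite -(nmulr_rgt0 _ (x := - (om n m0) ^+ 2)); last by rewrite oppr_lt0 exprn_even_gt0.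
  by rewrite mulNr oppr_gt0 expr2 mulrA mulfK.
have smin m : m != 0%MM -> (mdeg m <= e.+1)%N -> om n m * lead_coef (vl V m) < 0 ->
    0 <= lead_coef (- (om n m)^-1 *: vl V m - s).
  by move=> m1 md h1; apply: hm; rewrite mem_filter h1 mem_monp m1.
apply: (flow_step gen nd s0 smin Pe _ h) => A' B' Z' h'.
have nz : zer (vl (bend V n s)) n.
  by rewrite /zer (vl_V1 skewW) gen.1 (om_id skewW) scale0r addr0.
apply: (IH _ _ _ _ (generic_pert skewW gen n0 nz) h').
by apply: leq_trans hk; apply: (crossings_lt skewW gen s0 smin m0c).
Qed.

Lemma positivity e : (e <= D)%N -> pos_upto e.
Proof.
elim: e => [_|e IH eD].
  by move=> V n A B Z _ _ _ m m0; rewrite leqn0 mdeg_eq0 (negbTE m0).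
have Pe := IH (ltnW eD); refine (pos_step Pe _) => V n A B Z nd gen h.
exact: (flow eD Pe nd gen h (leqnn _)).
Qed.

End FlowConclusion.

(** * Invariance under mutation *)

Section Support.
Variables (r : nat) (W : 'I_r -> 'I_r -> rat).
Hypothesis skewW : forall i j, W i j = - W j i.
Notation mon := 'X_{1..r}.
Notation letter := (letter r).
Notation actl := (actl W).
Notation brk := (brk W).
Implicit Types (m n u p q : mon) (l : letter) (w : seq letter).
Implicit Types (phi psi : 'I_r -> rat).
Notation K := (K W).
Notation Keq := (Keq W).
Notation dg := (@dg r).
Notation "'wL'" := (@wL r).
Notation vfun := (vfun r).
Implicit Types (v : vfun).
Notation vom := (vom W).
(** The recursion of [K_weight_det], applied to supports: the bracket of two series supported in a
    closed set stays in it. *)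
Lemma K_weight_supp d (T : pred mon) phi psi w : closed T ->
  (forall m, (mdeg m <= d)%N -> K phi w m != 0 -> T m) ->
  (forall m, (mdeg m <= d)%N -> wt phi m = 0 -> K psi w m != 0 -> T m) ->
  forall m, (mdeg m <= d)%N -> K psi w m != 0 -> T m.
Proof.
move=> cT h h0 m; have [k] := ubnP (mdeg m); elim: k m => // k IH m /ltnSE mk md.
apply: contraR => Tm; case: (eqVneq (wt phi m) 0) => e.
  by apply: contraR Tm; apply: h0.
have km : K phi w m = 0 by apply/eqP; apply: contraR Tm; apply: h.
have := K_cross skewW phi psi w m; rewrite km mulr0 subr0 => hc.
suff z : brk (K phi w) (K psi w) m = 0 by move/eqP: hc; rewrite z mulf_eq0 (negbTE e).
have zp p : (mdeg p <= mdeg m)%N -> ~~ T p -> K phi w p = 0.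
  by move=> pm Tp; apply/eqP; apply: contraR Tp; apply: h; apply: leq_trans md.
have zq p : (mdeg p < mdeg m)%N -> ~~ T p -> K psi w p = 0.
  move=> pm Tp; apply/eqP; apply: contraR Tp; apply: IH; first exact: leq_trans mk.
  exact: leq_trans (ltnW pm) md.
rewrite /brkW; apply: big1 => p pm.
case: (eqVneq p 0%MM) => [->|p0]; first by rewrite (om0l skewW) !mul0r.
case: (boolP (T p)) => Tp; last by rewrite (zp p (mdeg_le pm) Tp) mulr0 mul0r.
rewrite (zq (m - p)%MM) ?mulr0 // ?mdeg_sub //.
  by have := mdeg_gt0 p0; have := mdeg_le pm; clear; lia.
by apply: contra Tm => Tq; rewrite -(submK pm); apply: cT.
Qed.

Lemma wt_ge0 phi m : (forall i, 0 <= phi i) -> 0 <= wt phi m.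
Proof. by move=> h; rewrite wtE; apply: sumr_ge0 => i _; rewrite mulr_ge0. Qed.

Lemma wt_eq0_le phi m u : (forall i, 0 <= phi i) -> (u <= m)%MM -> wt phi m = 0 -> wt phi u = 0.
Proof.
move=> h um e; apply/eqP; rewrite eq_le wt_ge0 // andbT -e -(submK um) wtD.
by rewrite lerDr wt_ge0.
Qed.

Lemma K_wt0 phi w m : (forall i, 0 <= phi i) -> wt phi m = 0 -> K phi w m = 0.
Proof.
move=> h; elim: w m => //= l w IH m e; rewrite (@eq_actl _ W _ _ (fun=> 0)).
  rewrite actl_zero addr0 /Kl big1 // => j _; case: eqP => [em|]; last by rewrite mul0r.
  rewrite (wt_eq0_le h _ e) ?(mulr0, mul0r) // em.
  by apply/mnm_lepP => i; rewrite mulmnE leq_pmulr.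
by move=> u um; apply: IH; apply: wt_eq0_le e.
Qed.

Lemma K_wt_filter D phi w m : (forall i, 0 <= D i) -> wt D m = 0 ->
  K phi w m = K phi [seq l <- w | wt D l.1 == 0] m.
Proof.
move=> D0 e; pose v : vfun := fun q => - (wt D q)%:P.
have av : addv v by move=> p q; rewrite /v wtD polyCD opprD.
have zv q : zer v q = (wt D q == 0) by rewrite /zer /v oppr_eq0 polyC_eq0.
have hw : win (npos v) w.
  apply/allP => l _; rewrite /npos zv /neg /v lead_coefN lead_coefC oppr_lt0.
  by have := wt_ge0 l.1 D0; rewrite le_eqVlt eq_sym => /orP[] ->; rewrite !orbT.
rewrite (K_zer W phi av hw) ?zv ?e //; congr (K _ _ _); apply: eq_filter => l.
by rewrite zv.
Qed.

(** In coordinates, a nonzero coefficient of least degree outside T could not be cancelled in the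
    cocycle at its own exponent. *)
Lemma word_of_support d (T : pred mon) w : closed T ->
  (forall m, (mdeg m <= d)%N -> K dg w m != 0 -> T m) ->
  exists2 w', win T w' & Keq d w w'.
Proof.
move=> cT h; have wg : win predT w by apply/allP => l _; rewrite orbT.
have st : stab (fun=> True) (predT : pred mon) by [].
have hL n : n != 0%MM -> (mdeg n <= d)%N -> predT n -> n \in monp r d by rewrite mem_monp => -> ->.
have [c [cs e _]] := coord_ex skewW (@closed_pred1 r) st wg (monp_uniq r d) hL.
exists (wL (monp r d) c) => //; apply: wL_win => n nL.
have nd : (mdeg n <= d)%N by move: nL; rewrite mem_monp => /andP[].
have [k] := ubnP (mdeg n); elim: k n nL nd => // k IH n nL nd /ltnSE nk.
have n0 : n != 0%MM by move: nL; rewrite mem_monp => /andP[].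
apply: contraR => Tn.
have kn : K dg (wL (monp r d) c) n = 0.
  by rewrite -(KeqP _ _ _ _ e) //; apply/eqP; apply: contraR Tn; apply: h.
have en : (mdeg n <= (mdeg n).-1.+1)%N by rewrite prednK // mdeg_gt0.
move: kn; rewrite (K_top skewW _ _ en) (K_suppN _ _ cT _ Tn).
  rewrite add0r (big_rem (n, c n)) /=; last by apply: map_f.
  rewrite -ltnNge prednK ?mdeg_gt0 // leqnn eqxx /= big_seq_cond big1.
    rewrite addr0 => /eqP; rewrite mulf_eq0 => /orP[//|]; rewrite wt_dg pnatr_eq0 mdeg_eq0.
    by rewrite (negbTE n0).
  move=> l; rewrite mem_rem_uniq ?inE; last by rewrite map_inj_uniq ?monp_uniq // => ? ? [].
  case/andP => /andP[ne /mapP[q _ el]] /andP[_ /eqP lq].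
  by rewrite el in ne lq; move: ne; rewrite /= -lq eqxx.
apply/allP => l; rewrite mem_filter => /andP[ld /mapP[q qL el]].
case: (eqVneq l.2 0) => //= l2; rewrite el in l2 ld *; apply: IH => //.
- by move: qL; rewrite mem_monp => /andP[].
- by apply: leq_trans nk; rewrite -(prednK (mdeg_gt0 n0)).
Qed.

(* Modulo the letters of weight at least wt phi m, the word h lives on S; the only letter
   that can contribute at m is (m, _), which sits in the middle part B. *)
Lemma supp_step (phi : 'I_r -> rat) (S : pred mon) h m A B Z : (forall i, 0 <= phi i) -> closed S ->
  (forall n, S n -> 0 < wt phi n) ->
  (forall u, (mdeg u <= mdeg m)%N -> wt phi u = 0 -> K dg h u = 0) ->
  (forall u, (mdeg u <= mdeg m)%N -> wt phi u < wt phi m -> K phi h u != 0 -> S u) ->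
  0 < wt phi m -> ~~ S m -> win (neg (vom m)) A -> win (zer (vom m)) B -> win (pos (vom m)) Z ->
  Keq (mdeg m) h (A ++ B ++ Z) -> lam m B = 0 -> K phi h m = 0.
Proof.
move=> phi0 cS Sp h0 hS m0 Sm hA hB hZ e lB.
have mn0 : m != 0%MM by apply: contraTneq m0 => ->; rewrite wt0 ltxx.
pose T : pred mon := fun u => (0 < wt phi u) && (S u || (wt phi m <= wt phi u)).
have cT : closed T.
  move=> p q /andP[p0 hp] /andP[q0 hq]; rewrite /T wtD addr_gt0 //=.
  case/orP: hp => hp; last by rewrite (le_trans hp) ?orbT // lerDl ltW.
  case/orP: hq => hq; last by rewrite (le_trans hq) ?orbT // lerDr ltW.
  by rewrite cS.
have [w hw ew] : exists2 w, win T w & Keq (mdeg m) h w.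
  apply: word_of_support => //; apply: (K_weight_supp (phi := phi)) => // u um; last first.
    by move=> /h0 -> //; rewrite eqxx.
  move=> ku; have up : 0 < wt phi u.
    by rewrite lt_neqAle wt_ge0 // andbT eq_sym; apply: contraNneq ku => z; rewrite K_wt0.
  by rewrite /T up; case: (lerP (wt phi m) (wt phi u)) => hu; rewrite ?orbT // hS.
have KT w' : win T w' -> K phi w' m = mu w' m * wt phi m.
  elim: w' => [|l w' IH] /=; first by rewrite /mu big_nil mul0r.
  case/andP=> hl hw'; rewrite /mu big_cons -/(mu w' m).
  case: (eqVneq l.2 0) hl => [l0 _|l0 /= Tl].
    rewrite actl_coef0 // IH // /Kl big1 => [|j _]; last by rewrite l0 !mul0r mulr0.
    by rewrite add0r; case: ifP => //; rewrite l0 add0r.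
  have ak : actl l (K phi w') m = K phi w' m.
    rewrite /actlW big_mkcond big_ord_recl big1 => [|j _].
      by rewrite /= mulm0n subm0 mul1r addr0 ifT //; apply/mnm_lepP => i; rewrite mnm0E.
    case: ifP => // le; apply/eqP; rewrite mulf_eq0; apply/orP; right; apply/negPn/negP => nz.
    have /andP[up hu] := K_supp cT hw' nz; case/andP: (Tl) => lp Tl'.
    move: nz up hu le; rewrite lift0; move: (nat_of_ord j) => i nz up hu le.
    have em := submK le; have em' := congr1 (wt phi) em; rewrite wtD wtMn in em'.
    have li : wt phi l.1 <= i.+1%:R * wt phi l.1.
      by rewrite -natr1 mulrDl mul1r lerDr mulr_ge0 ?ler0n // ltW.
    case/orP: Tl' => Tl'; last by lra.
    case/orP: hu => hu; last by lra.
    by case/negP: Sm; rewrite -em; exact: cS hu (closedM i cS Tl').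
  rewrite ak IH //; case: (eqVneq l.1 m) => [e1|ne].
    rewrite mulrDl; congr (_ + _).
    by rewrite [l in Kl _ l]surjective_pairing Kl_big ?e1 // eqxx mul1r.
  rewrite -[RHS]add0r; congr (_ + _).
  rewrite /Kl big1 // => j _; case: eqP => [e1|]; last by rewrite mul0r.
  move: e1; move: (nat_of_ord j) => i e1; exfalso; case/andP: Tl => lp /orP[Sl|].
    by case/negP: Sm; rewrite e1; exact: closedM.
  case: i e1 => [|i] e1; first by move: ne; rewrite e1 mulm1n eqxx.
  by rewrite e1 wtMn -natr1 mulrDl mul1r gerDr leNgt mulr_gt0 ?ltr0n.
have st : stab (fun=> True) T by [].
have [A' [B' [Z' [hA' hB' hZ' e' _]]]] := factor_ex skewW (mdeg m) (addv_vom W m) cT st hw.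
have wA : win (neg (vom m)) A' by apply: win_sub hA' => n /andP[].
have wB : win (zer (vom m)) B' by apply: win_sub hB' => n /andP[].
have wZ : win (pos (vom m)) Z' by apply: win_sub hZ' => n /andP[].
have e2 := Keq_trans ew e'.
have [_ eB _] := factor_uniq skewW (addv_vom W m) hA hB hZ wA wB wZ (Keq_trans (Keq_sym e) e2).
have lB' : lam m B' = 0 by rewrite -(lam_Keq skewW mn0 hB wB eB).
have TB : win T B' by apply: win_sub hB' => n /andP[].
have TA : win T A' by apply: win_sub hA' => n /andP[].
have TZ : win T Z' by apply: win_sub hZ' => n /andP[].
rewrite (K_det skewW phi e2) // KT; last by rewrite !win_cat TA TB TZ.
have muz (P : pred mon) w' : win P w' -> ~~ P m -> mu w' m = 0.
  move=> /allP hw' Pm; rewrite /mu big_seq_cond big1 // => l /andP[/hw' h1 /eqP h2].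
  by move: h1; rewrite h2 (negbTE Pm) orbF => /eqP.
rewrite !mu_cat (muz _ _ wA) ?(muz _ _ wZ) ?add0r ?addr0; last first.
- by rewrite neg_vom (om_id skewW) ltxx.
- by rewrite pos_vom (om_id skewW) ltxx.
have -> : mu B' m = lam m B'.
  rewrite /mu /lam big_mkcond; apply: eq_big_seq => l /(allP TB).
  case: (eqVneq l.2 0) => [-> _|_ /= Tl].
    by rewrite if_same big1 // => j _; rewrite mul0r mulr0.
  rewrite -(prednK (mdeg_gt0 mn0)) big_ord_recl mulm1n big1 => [|j _].
    by rewrite addr0 eq_sym; case: eqP => _; rewrite ?mul0r // mul1r /lamc expr0 expr1n invr1 !mulr1.
  case: eqP => [em|]; last by rewrite mul0r.
  move: em; rewrite lift0; move: (nat_of_ord j) => i em; exfalso.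
  case/andP: Tl => lp /orP[Sl|]; first by case/negP: Sm; rewrite em; exact: closedM.
  by rewrite em wtMn -natr1 mulrDl mul1r gerDr leNgt mulr_gt0 ?ltr0n.
by rewrite lB' mul0r.
Qed.

End Support.

(** * The support of a good element stripped of the letter e_k *)

Section MutSupport.
Variables (r : nat) (W : 'I_r -> 'I_r -> rat).
Hypothesis skewW : forall i j, W i j = - W j i.
Notation mon := 'X_{1..r}.
Notation letter := (letter r).
Notation om := (om W).
Notation actl := (actl W).
Implicit Types (m n u p q : mon) (l : letter) (w : seq letter).
Implicit Types (phi psi : 'I_r -> rat).
Notation act := (act W).
Notation K := (K W).
Notation Keq := (Keq W).
Notation dg := (@dg r).
Notation vfun := (vfun r).
Implicit Types (v : vfun).
Notation vom := (vom W).
Lemma lam_zero m w : (forall l, l \in w -> l.2 = 0) -> lam m w = 0.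
Proof.
move=> h; rewrite /lam big_seq big1 // => l /h ->.
by rewrite big1 // => j _; rewrite mul0r mulr0.
Qed.

Lemma lam_cons m l w : lam m (l :: w) = lam m [:: l] + lam m w.
Proof. by rewrite -lam_cat. Qed.

Lemma lam1_om m n a : om m n != 0 -> lam m [:: (n, a)] = 0.
Proof.
move=> h; apply: (lam_out (T := fun q => q == n)) => [|q i e]; first by rewrite /win /= eqxx orbT.
by apply: contra h => /eqP <-; rewrite e (omMl skewW) (om_id skewW) mulr0.
Qed.

Lemma filter_other (P Q : pred mon) A : win P A -> (forall m, P m -> ~~ Q m) ->
  forall l, l \in [seq l <- A | Q l.1] -> l.2 = 0.
Proof.
move=> /allP hA h l; rewrite mem_filter => /andP[Ql /hA /orP[/eqP //|/h]].
by rewrite Ql.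
Qed.

(** The sign condition puts the new letter into the left or the middle part, so Z is untouched and
    [absorb_l] applies. *)
Lemma fact_cons m n a A B Z d : om m n <= 0 -> win (neg (vom m)) A -> win (zer (vom m)) B ->
  exists A' B', [/\ win (neg (vom m)) A', win (zer (vom m)) B',
    Keq d ((n, a) :: A ++ B ++ Z) (A' ++ B' ++ Z) & lam m B' = lam m B + lam m [:: (n, a)]].
Proof.
move=> mn hA hB.
have hw : win (npos (vom m)) ((n, a) :: A).
  apply/andP; split; last by apply: win_sub hA => q h; rewrite /npos h.
  by apply/orP; right; rewrite /npos neg_vom zer_vom orbC -le_eqVlt.
have [A' hA' e] := absorb_l skewW d (addv_vom W m) hw.
exists A', ([seq l <- (n, a) :: A | zer (vom m) l.1] ++ B); split=> //.
- rewrite win_cat hB andbT; apply/allP => l; rewrite mem_filter => /andP[-> _].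
  by rewrite orbT.
- rewrite -cat_cons -[X in Keq _ _ (A' ++ X)]catA catA.
  exact: (Keq_cat skewW e (Keq_refl _ _ _)).
have z : lam m [seq l <- A | zer (vom m) l.1] = 0.
  by apply/lam_zero/(filter_other hA) => q /neg_zer ->.
rewrite lam_cat addrC /=; case: ifPn => h; first by rewrite lam_cons z addr0.
by rewrite z lam1_om // -zer_vom.
Qed.

Lemma fact_rcons m n a A B Z d : 0 <= om m n -> win (zer (vom m)) B -> win (pos (vom m)) Z ->
  exists B' Z', [/\ win (zer (vom m)) B', win (pos (vom m)) Z',
    Keq d ((A ++ B ++ Z) ++ [:: (n, a)]) (A ++ B' ++ Z') & lam m B' = lam m B + lam m [:: (n, a)]].
Proof.
move=> mn hB hZ.
have hw : win (predC (neg (vom m))) (Z ++ [:: (n, a)]).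
  rewrite win_cat; apply/andP; split.
    apply: win_sub hZ => q; rewrite /= pos_vom neg_vom -leNgt; exact: ltW.
  by rewrite /win /= neg_vom -leNgt mn orbT.
have [Z' hZ' e] := absorb_r skewW d (addv_vom W m) hw.
exists (B ++ [seq l <- Z ++ [:: (n, a)] | zer (vom m) l.1]), Z'; split=> //.
- rewrite win_cat hB; apply/allP => l; rewrite mem_filter => /andP[-> _].
  by rewrite orbT.
- by rewrite -!catA; do 2!apply: (Keq_cat skewW (Keq_refl _ _ _)).
have z : lam m [seq l <- Z | zer (vom m) l.1] = 0.
  apply/lam_zero/(filter_other hZ) => q; rewrite pos_vom zer_vom => h; by rewrite gt_eqF.
rewrite lam_cat filter_cat lam_cat z add0r /=; case: ifPn => h //.
by rewrite lam1_om ?addr0 -?zer_vom // /lam big_nil addr0.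
Qed.

Variables (k : 'I_r) (dd : 'I_r -> nat) (U : seq 'I_r).
Hypothesis uU : uniq U.
Hypothesis kU : k \in U.
Hypothesis dk0 : (0 < dd k)%N.
Definition inis : seq letter := [seq (U_(i)%MM, (dd i)%:R) | i <- U].
Notation dk := ((dd k)%:R : rat).
Definition Ek (a : rat) : letter := (U_(k)%MM, a).
(** This weight does not see the letter e_k and, unlike the degree, is preserved by the mutation of
    exponents. *)
Definition Dk : 'I_r -> rat := fun i => (i != k)%:R.
Definition beta (b : 'I_r -> nat) m : nat := (\sum_i m i * b i)%N.

(** The nonzero exponents whose mutation beta(m) - m_k is again a natural number. *)
Definition Sb b m := (m != 0%MM) && (m k <= beta b m)%N.

Lemma Dk_ge0 i : 0 <= Dk i. Proof. exact: ler0n. Qed.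

Lemma Dk_nat m : wt Dk m = (mdeg m - m k)%N%:R.
Proof.
rewrite wtE mdegE (bigD1 k) //= [X in _ = (X - _)%N%:R](bigD1 k) //= addKn natr_sum.
rewrite /Dk eqxx mulr0 add0r; apply: eq_bigr => i ik; by rewrite ik mulr1.
Qed.

Lemma Dk_eq0 m : wt Dk m = 0 -> m = (U_(k) *+ m k)%MM.
Proof.
move=> h; apply/mnmP => i; rewrite mulmnE mnm1E.
case: (eqVneq k i) => [<-|ik]; first by rewrite mul1n.
move: h; rewrite wtE (bigD1 i) //= {1}/Dk eq_sym ik mulr1 => /eqP; rewrite addr_eq0 => /eqP h.
apply/eqP; rewrite mul0n -(eqr_nat rat) eq_le ler0n andbT h oppr_le0.
by apply: sumr_ge0 => q _; rewrite mulr_ge0 ?ler0n.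
Qed.

Lemma beta_add b m n : beta b (m + n)%MM = (beta b m + beta b n)%N.
Proof. by rewrite /beta -big_split; apply: eq_bigr => i _; rewrite mnmDE mulnDl. Qed.

Lemma beta_mul b m j : beta b (m *+ j)%MM = (beta b m * j)%N.
Proof. by rewrite /beta big_distrl; apply: eq_bigr => i _; rewrite mulmnE /= mulnAC. Qed.

Lemma beta_k b : beta b U_(k)%MM = b k.
Proof.
rewrite /beta (bigD1 k) //= big1 ?addn0 => [|i ik]; first by rewrite mnm1E eqxx mul1n.
by rewrite mnm1E eq_sym (negbTE ik).
Qed.

Lemma closed_Sb b : closed (Sb b).
Proof.
move=> m n /andP[m0 hm] /andP[n0 hn]; rewrite /Sb beta_add mnmDE leq_add // andbT.
by rewrite -mdeg_eq0 mdegD addn_eq0 mdeg_eq0 (negbTE m0).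
Qed.

Lemma Sb_D b m : b k = 0%N -> Sb b m -> 0 < wt Dk m.
Proof.
move=> bk /andP[m0 hm]; rewrite lt_neqAle (wt_ge0 _ Dk_ge0) andbT eq_sym.
apply: contra m0 => /eqP/Dk_eq0 e; move: hm; rewrite e beta_mul beta_k bk mul0n leqn0 -e.
by move=> /eqP e'; rewrite e e' mulm0n.
Qed.

Lemma Ek_act a phi w m : actl (Ek a) (K phi w) m =
  \sum_(j < (m k).+1) binr (a * om U_(k)%MM m) j * K phi w (m - U_(k) *+ j)%MM.
Proof.
rewrite /actlW /=.
have le j : (U_(k) *+ j <= m)%MM = (j <= m k)%N.
  apply/mnm_lepP/idP => [/(_ k)|h i]; first by rewrite mulmnE mnm1E eqxx mul1n.
  by rewrite mulmnE mnm1E; case: eqP => [<-|]; rewrite ?mul1n.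
have mk : (m k <= mdeg m)%N by rewrite mdegE (bigD1 k) //= leq_addr.
rewrite [RHS](@big_ord_widen _ _ _ _ (mdeg m).+1 (fun j => binr (a * om U_(k)%MM m) j * K phi w (m - U_(k) *+ j)%MM)) //.
by apply: eq_bigl => j; rewrite le.
Qed.

Variables (b bp : 'I_r -> nat).
Hypothesis hb : forall i, (b i)%:R - (bp i)%:R = W i k * dk.
Hypothesis bk : b k = 0%N.
Hypothesis bpk : bp k = 0%N.

Lemma om1 i j : om U_(i)%MM U_(j)%MM = W i j.
Proof.
rewrite /omW wt1 /omv (bigD1 i) //= mnm1E eqxx mul1r big1 ?addr0 // => q qi.
by rewrite mnm1E eq_sym (negbTE qi) mul0r.
Qed.

Lemma om_beta m : om m U_(k)%MM * dk = (beta b m)%:R - (beta bp m)%:R.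
Proof.
rewrite om_coord mulr_suml !natr_sum -sumrB; apply: eq_bigr => i _.
rewrite -mulrA om1 -hb mulrBr !natrM //.
Qed.

Variables (g : seq letter) (d : nat).
Hypothesis good_g : Good W inis g d.
Notation H := (Ek (- dk) :: g).
Notation Hp := (g ++ [:: Ek (- dk)]).
Notation inik := [seq l <- inis | l.1 != U_(k)%MM].

Lemma lam_ini m : lam m inis = lam m inik + lam m [:: Ek dk].
Proof.
rewrite /inis; move: uU kU; elim: U => // i V IH /= /andP[iV uV]; rewrite inE => kV.
case: (eqVneq k i) kV => [ki _|ne /= kV]; last first.
  by rewrite eq_mnm1 eq_sym ne /= [LHS]lam_cons [X in _ = X + _]lam_cons IH // addrA.
rewrite -ki eqxx /= [LHS]lam_cons [LHS]addrC; congr (lam m _ + _); rewrite (_ : [seq _ <- _ | _] = [seq (U_(i)%MM, (dd i)%:R) | i <- V]) //.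
apply/all_filterP/allP => l /mapP[j jV ->] /=; rewrite eq_mnm1.
by apply: contraNneq iV => jk; rewrite -ki -jk.
Qed.

Lemma lam_Ek m a : lam m [:: Ek a; Ek (- a)] = 0.
Proof.
rewrite /lam big_cons big_seq1 -big_split big1 // => j _ /=; ring.
Qed.

Lemma lam_iniE m : lam m inis + lam m [:: Ek (- dk)] = lam m inik.
Proof. by rewrite lam_ini -addrA -lam_cat lam_Ek addr0. Qed.

(** For this sign of om(m, e_k) the letter e_k belongs to the left or middle part, so it can be
    cancelled from the left end; the middle weight then loses the contribution of e_k. *)
Lemma goodH m : m != 0%MM -> (mdeg m <= d)%N -> om m U_(k)%MM <= 0 -> exists A B Z,
  [/\ win (neg (vom m)) A, win (zer (vom m)) B, win (pos (vom m)) Z,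
      Keq (mdeg m) H (A ++ B ++ Z) & lam m B = lam m inik].
Proof.
move=> m0 md mk; have [A [B [Z [hA hB hZ e hl]]]] := good_g m0 md.
have [A' [B' [hA' hB' e' hl']]] := fact_cons (- dk) Z (mdeg m) mk hA hB.
exists A', B', Z; split=> //; last by rewrite hl' hl lam_iniE.
exact: Keq_trans (Keq_cons skewW _ e) e'.
Qed.

Lemma goodHp m : m != 0%MM -> (mdeg m <= d)%N -> 0 <= om m U_(k)%MM -> exists A B Z,
  [/\ win (neg (vom m)) A, win (zer (vom m)) B, win (pos (vom m)) Z,
      Keq (mdeg m) Hp (A ++ B ++ Z) & lam m B = lam m inik].
Proof.
move=> m0 md mk; have [A [B [Z [hA hB hZ e hl]]]] := good_g m0 md.
have [B' [Z' [hB' hZ' e' hl']]] := fact_rcons (- dk) A (mdeg m) mk hB hZ.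
exists A, B', Z'; split=> //; last by rewrite hl' hl lam_iniE.
exact: Keq_trans (Keq_cat skewW e (Keq_refl _ _ _)) e'.
Qed.

Lemma lam_inik m : m != 0%MM -> wt Dk m = 0 \/ (0 < m k)%N -> lam m inik = 0.
Proof.
move=> m0 h; apply: (lam_out (T := fun q => q k == 0%N)).
  apply/allP => l; rewrite mem_filter => /andP[h1 /mapP[i _ e]].
  by move: h1; rewrite e /= mnm1E eq_mnm1 => /negbTE ->; rewrite orbT.
move=> q i e; apply/negP => /eqP qk; have mk : m k = 0%N by rewrite e mulmnE qk.
by case: h => [/Dk_eq0|]; rewrite mk // mulm0n => z; rewrite z eqxx in m0.
Qed.

Lemma K_Dk0 phi w m : wt Dk m = 0 -> K phi w m = K phi [seq l <- w | wt Dk l.1 == 0] m.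
Proof. exact: K_wt_filter Dk_ge0. Qed.

(** Here m is a multiple of e_k, so only letters parallel to e_k are visible; they are orthogonal to
    m and can only sit in the middle part. *)
Lemma K0_of_fact h m A B Z : m != 0%MM -> wt Dk m = 0 ->
  win (neg (vom m)) A -> win (zer (vom m)) B -> win (pos (vom m)) Z ->
  Keq (mdeg m) h (A ++ B ++ Z) -> lam m B = 0 -> K dg h m = 0.
Proof.
move=> m0 mD hA hB hZ e lB.
have om0 q : wt Dk q == 0 -> om m q = 0.
  by move=> /eqP/Dk_eq0 ->; rewrite (Dk_eq0 mD) (omMl skewW) omMr (om_id skewW) !mulr0.
have nz (P : pred mon) w : win P w -> (forall q, P q -> om m q != 0) ->
    Keq (mdeg m) [seq l <- w | wt Dk l.1 == 0] [::].
  move=> hw hP; apply/(Keq_zero skewW)/(filter_other (Q := fun q => wt Dk q == 0) hw) => q /hP.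
  by apply: contra => /om0 ->.
have zA := nz _ _ hA; have zZ := nz _ _ hZ.
rewrite (K_det skewW _ e) // K_Dk0 // !filter_cat.
rewrite (K_det skewW dg (w' := [::] ++ [seq l <- B | wt Dk l.1 == 0] ++ [::]) (d := mdeg m)) //; last first.
  apply: (Keq_cat skewW); first by apply: zA => q; rewrite neg_vom => h'; rewrite lt_eqF.
  apply: (Keq_cat skewW (Keq_refl _ _ _)).
  by apply: zZ => q; rewrite pos_vom => h'; rewrite gt_eqF.
rewrite cats0 /= -K_Dk0 // (K_lam dg) ?lB ?mulr0 //.
by apply: win_sub hB => q; rewrite zer_vom (omC skewW q) oppr_eq0.
Qed.

Lemma Kl_Ek a m : Kl Dk (Ek a) m = 0.
Proof.
rewrite /Kl big1 // => j _; rewrite wt1 /Dk eqxx mulr0 mul0r mulr0 //.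
Qed.

Lemma K_Ek a w m : K Dk (Ek a :: w) m = actl (Ek a) (K Dk w) m.
Proof. by rewrite /= Kl_Ek add0r. Qed.

Lemma K_rcons_Ek a w m : K Dk (w ++ [:: Ek a]) m = K Dk w m.
Proof.
rewrite K_cat (@eq_act _ W _ _ (fun=> 0)) => [|u _]; last by rewrite K1 Kl_Ek.
suff -> : act w (fun=> 0) m = 0 by rewrite addr0.
elim: w m => //= l w IH m; rewrite (@eq_actl _ W _ _ (fun=> 0)) ?actl_zero // => u _; exact: IH.
Qed.

Lemma Keq_Ek e a w : Keq e (Ek a :: Ek (- a) :: w) w.
Proof.
apply: (Keq_cat skewW (w1 := [:: Ek a; Ek (- a)]) (w1' := [::]) _ (Keq_refl _ _ _)).
by apply: (Keq_trans (Keq_merge skewW _ _ _ _)); rewrite subrr; apply: (Keq0 W).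
Qed.

Lemma K_g_H m : K Dk g m = actl (Ek dk) (K Dk H) m.
Proof.
rewrite -[RHS]K_Ek; apply: (K_det skewW Dk _ (leqnn (mdeg m))).
exact/Keq_sym/Keq_Ek.
Qed.

Lemma beta_sub c m j : c k = 0%N -> (j <= m k)%N -> beta c (m - U_(k) *+ j)%MM = beta c m.
Proof.
move=> ck jk; have le : (U_(k) *+ j <= m)%MM.
  by apply/mnm_lepP => i; rewrite mulmnE mnm1E; case: eqP => [<-|]; rewrite ?mul1n.
by rewrite -[in RHS](submK le) beta_add beta_mul beta_k ck addn0.
Qed.

(** On an e_k-string the letter multiplies by a polynomial of degree beta c' - beta c, which raises
    the bound on m_k from beta c to beta c'. *)
Lemma transfer phi w a (c c' : 'I_r -> nat) m : c k = 0%N ->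
  a * om U_(k)%MM m = (beta c' m)%:R - (beta c m)%:R -> (beta c m <= beta c' m)%N ->
  (forall j, (j <= m k)%N -> K phi w (m - U_(k) *+ j)%MM != 0 -> Sb c (m - U_(k) *+ j)%MM) ->
  actl (Ek a) (K phi w) m != 0 -> (m k <= beta c' m)%N.
Proof.
move=> ck e le h; apply: contraNT; rewrite -ltnNge => lt.
rewrite Ek_act e -natrB //; apply/eqP/big1 => -[j /= jm] _.
rewrite binr_nat; case: (leqP j (beta c' m - beta c m)) => hj; last by rewrite bin_small ?mul0r.
suff -> : K phi w (m - U_(k) *+ j)%MM = 0 by rewrite mulr0.
apply/eqP; apply: contraTT lt => /(h _ jm)/andP[_].
rewrite beta_sub // mnmBE mulmnE mnm1E eqxx mul1n -leqNgt => h1.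
by move: h1 hj le; clear; move: (beta c m) (beta c' m) (m k); lia.
Qed.

(** Induction on the weight [Dk]. [supp_step] gives each claim on one half-space for the sign of
    om(m, e_k), where the stripped word is good; [transfer] carries the other claim to the same
    half-space, as H and g differ by the letter e_k. *)
Lemma mut_support m : (mdeg m <= d)%N ->
  (K Dk H m != 0 -> Sb b m) /\ (K Dk g m != 0 -> Sb bp m).
Proof.
have [N] := ubnP (mdeg m - m k)%N; elim: N m => // N IH.
have nz w u : K Dk w u != 0 -> u != 0%MM by apply: contraNneq => ->; rewrite K0.
have low w (c : 'I_r -> nat) u m : (forall q, (mdeg q <= d)%N -> (mdeg q - q k < N)%N ->
     K Dk w q != 0 -> Sb c q) -> (mdeg m <= d)%N -> (mdeg m - m k <= N)%N ->
   (mdeg u <= mdeg m)%N -> wt Dk u < wt Dk m -> K Dk w u != 0 -> Sb c u.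
  move=> h md mN um lt; apply: h; first exact: leq_trans md.
  by apply: leq_trans mN; move: lt; rewrite !Dk_nat ltr_nat.
have eqs m : om U_(k)%MM m * dk = (beta bp m)%:R - (beta b m)%:R.
  by rewrite (omC skewW) mulNr om_beta opprB.
have dkp : 0 < dk by rewrite ltr0n.
have sg m : (om m U_(k)%MM <= 0) = (beta b m <= beta bp m)%N.
  by rewrite -(pmulr_lle0 _ dkp) om_beta subr_le0 ler_nat.
have sg' m : (0 <= om m U_(k)%MM) = (beta bp m <= beta b m)%N.
  by rewrite -(pmulr_lge0 _ dkp) om_beta subr_ge0 ler_nat.
have P1 m : (mdeg m - m k <= N)%N -> (mdeg m <= d)%N -> (beta b m <= beta bp m)%N ->
    K Dk H m != 0 -> Sb b m.
  move=> mN md le nK; apply: contraR nK => nS.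
  case: (eqVneq (wt Dk m) 0) => [z|Dm]; first by rewrite K_wt0 // => i; apply: Dk_ge0.
  have m0 : m != 0%MM by apply: contraNneq Dm => ->; rewrite wt0.
  have mk : (0 < m k)%N by move: nS; rewrite /Sb m0 /= -ltnNge; apply: leq_trans.
  have [|A [B [Z [hA hB hZ e hl]]]] := goodH m0 md; first by rewrite sg.
  rewrite (lam_inik m0) in hl; last by right.
  apply/eqP; apply: (supp_step skewW Dk_ge0 (@closed_Sb b) _ _ _ _ nS hA hB hZ e hl).
  - by move=> n; apply: Sb_D.
  - move=> u um z; case: (eqVneq u 0%MM) => [->|u0]; first by rewrite K0.
    have ud := leq_trans um md.
    have [|A' [B' [Z' [hA' hB' hZ' e' hl']]]] := goodH u0 ud.
      by rewrite (Dk_eq0 z) (omMl skewW) (om_id skewW) mulr0.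
    by apply: (K0_of_fact u0 z hA' hB' hZ' e'); rewrite hl' lam_inik //; left.
  - by move=> u um; apply: (low _ _ _ m) => // q qd qN; apply: (IH q qN qd).1.
  - by rewrite lt_neqAle eq_sym Dm wt_ge0 // => i; apply: Dk_ge0.
have P2 m : (mdeg m - m k <= N)%N -> (mdeg m <= d)%N -> (beta bp m <= beta b m)%N ->
    K Dk g m != 0 -> Sb bp m.
  move=> mN md le nK; apply: contraR nK => nS.
  case: (eqVneq (wt Dk m) 0) => [z|Dm]; first by rewrite K_wt0 // => i; apply: Dk_ge0.
  have m0 : m != 0%MM by apply: contraNneq Dm => ->; rewrite wt0.
  have mk : (0 < m k)%N by move: nS; rewrite /Sb m0 /= -ltnNge; apply: leq_trans.
  have [|A [B [Z [hA hB hZ e hl]]]] := goodHp m0 md; first by rewrite sg'.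
  rewrite (lam_inik m0) in hl; last by right.
  (* A letter e_k at the right end is invisible to the weight [Dk], so g may be replaced by g
     stripped on the right. *)
  rewrite -(K_rcons_Ek (- dk)).
  apply/eqP; apply: (supp_step skewW Dk_ge0 (@closed_Sb bp) _ _ _ _ nS hA hB hZ e hl).
  - by move=> n; apply: Sb_D.
  - move=> u um z; case: (eqVneq u 0%MM) => [->|u0]; first by rewrite K0.
    have ud := leq_trans um md.
    have [|A' [B' [Z' [hA' hB' hZ' e' hl']]]] := goodHp u0 ud.
      by rewrite (Dk_eq0 z) (omMl skewW) (om_id skewW) mulr0.
    by apply: (K0_of_fact u0 z hA' hB' hZ' e'); rewrite hl' lam_inik //; left.
  - move=> u um; apply: (low _ _ _ m) => // q qd qN.
    by rewrite K_rcons_Ek; apply: (IH q qN qd).2.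
  - by rewrite lt_neqAle eq_sym Dm wt_ge0 // => i; apply: Dk_ge0.
move=> m /ltnSE mN md.
have sub j : (j <= m k)%N -> [/\ (mdeg (m - U_(k) *+ j)%MM <= d)%N,
    (mdeg (m - U_(k) *+ j)%MM - (m - U_(k) *+ j)%MM k <= N)%N,
    beta b (m - U_(k) *+ j)%MM = beta b m & beta bp (m - U_(k) *+ j)%MM = beta bp m].
  move=> jm; have le : (U_(k) *+ j <= m)%MM.
    by apply/mnm_lepP => i; rewrite mulmnE mnm1E; case: eqP => [<-|]; rewrite ?mul1n.
  have mk : (m k <= mdeg m)%N by rewrite mdegE (bigD1 k) //= leq_addr.
  split; rewrite ?beta_sub //; rewrite mdeg_sub // mdegMn mdeg1 mul1n.
    exact: leq_trans (leq_subr _ _) md.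
  rewrite mnmBE mulmnE mnm1E eqxx mul1n; apply: leq_trans mN.
  by move: jm mk; clear; lia.
have [le|/ltnW le] := leqP (beta b m) (beta bp m).
  split=> [|nK]; first exact: P1.
  rewrite /Sb (nz _ _ nK) /=; move: nK; rewrite K_g_H.
  apply: (transfer (c := b)) => //; first by rewrite mulrC eqs.
  by move=> j /sub[h1 h2 h3 h4]; apply: P1; rewrite ?h3 ?h4.
split=> [nK|]; last exact: P2.
rewrite /Sb (nz _ _ nK) /=; move: nK; rewrite K_Ek.
apply: (transfer (c := bp)) => //; first by rewrite mulNr mulrC eqs opprB.
by move=> j /sub[h1 h2 h3 h4]; apply: P2; rewrite ?h3 ?h4.
Qed.

End MutSupport.

Notation DkW := Dk (only parsing).
Notation SbW := Sb (only parsing).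
Notation betaW := beta (only parsing).

(** * Transport of words to the mutated form *)

Section Transport.
Variables (r : nat) (W : 'I_r -> 'I_r -> rat).
Hypothesis skewW : forall i j, W i j = - W j i.
Notation mon := 'X_{1..r}.
Notation ser := (ser r).
Notation letter := (letter r).
Notation om := (om W).
Notation actl := (actl W).
Implicit Types (m n u p q : mon) (l : letter) (w : seq letter).
Implicit Types (phi psi : 'I_r -> rat).
Notation K := (K W).
Notation Keq := (Keq W).
Notation dg := (@dg r).
Notation vfun := (vfun r).
Implicit Types (v : vfun).
Variables (k : 'I_r).
Notation beta := (@beta r).
Notation Sb c := (Sb k c).
Definition eta (i : 'I_r) : rat := if i == k then -1 else 1.
(* The matrix of the form in the basis e_k' = - e_k, e_i' = e_i + c_i e_k, where c k = 0;
   tau gives the coordinates in that basis. *)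
Definition mutW (c : 'I_r -> nat) i j : rat :=
  eta i * eta j * W i j + eta i * (c j)%:R * W i k + (c i)%:R * eta j * W k j.
(** The dual change of coordinates on weights, so that [wt_sig] holds. *)
Definition sig (c : 'I_r -> nat) (X : 'I_r -> rat) i : rat := eta i * X i + (c i)%:R * X k.
Definition tau (c : 'I_r -> nat) m : mon :=
  [multinom if i == k then (beta c m - m k)%N else m i | i < r].
Definition tw c w : seq letter := [seq (tau c l.1, l.2) | l <- w].

Lemma mutW_skew c i j : mutW c i j = - mutW c j i.
Proof. by rewrite /mutW (skewW j i) (skewW j k) (skewW k i); ring. Qed.

Lemma W0 : W k k = 0. Proof. by have := skewW k k; lra. Qed.

Section OneSide.
Variable c : 'I_r -> nat.
Hypothesis ck : c k = 0%N.
Notation W' := (mutW c).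
Notation tau := (tau c).
Notation tw := (tw c).
Definition S0 m := (m k <= beta c m)%N.

Lemma tauE m i : tau m i = if i == k then (beta c m - m k)%N else m i.
Proof. exact: mnmE. Qed.

Lemma beta_tau m : beta c (tau m) = beta c m.
Proof.
rewrite /betaW; apply: eq_bigr => i _; rewrite tauE; case: eqP => // ->.
by rewrite ck !muln0.
Qed.

Lemma S0_tau m : S0 (tau m).
Proof. by rewrite /S0 beta_tau tauE eqxx leq_subr. Qed.

Lemma tauK m : S0 m -> tau (tau m) = m.
Proof.
move=> h; apply/mnmP => i; rewrite !tauE beta_tau; case: eqP => // ->.
by rewrite eqxx subKn.
Qed.

Lemma tauD m n : S0 m -> S0 n -> tau (m + n)%MM = (tau m + tau n)%MM.
Proof.
rewrite /S0 => hm hn; apply/mnmP => i; rewrite mnmDE !tauE beta_add !mnmDE; case: eqP => // _.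
by move: hm hn; clear; lia.
Qed.

Lemma S0D m n : S0 m -> S0 n -> S0 (m + n)%MM.
Proof. by rewrite /S0 beta_add mnmDE; apply: leq_add. Qed.

Lemma S0M m j : S0 m -> S0 (m *+ j)%MM.
Proof. by rewrite /S0 beta_mul mulmnE => h; rewrite leq_mul2r h orbT. Qed.

Lemma tau0 : tau 0%MM = 0%MM.
Proof.
apply/mnmP => i; rewrite tauE !mnm0E; case: eqP => // _.
by rewrite subn0 /betaW big1 // => j _; rewrite mnm0E.
Qed.

Lemma tauM m j : S0 m -> tau (m *+ j)%MM = (tau m *+ j)%MM.
Proof.
move=> h; elim: j => [|j IH]; first by rewrite !mulm0n tau0.
by rewrite !mulmS tauD ?IH //; apply: S0M.
Qed.

Lemma tau_eq m n : S0 m -> S0 n -> (tau m == tau n) = (m == n).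
Proof.
by move=> hm hn; apply/eqP/eqP => [e|-> //]; rewrite -(tauK hm) e tauK.
Qed.

Lemma Sb_S0 m : Sb c m -> S0 m. Proof. by case/andP. Qed.

Lemma Sb_tau m : Sb c m -> Sb c (tau m).
Proof.
move=> /andP[m0 hm]; rewrite /SbW -/(S0 _) S0_tau andbT; apply: contra m0 => /eqP e.
by rewrite -(tauK hm) e tau0.
Qed.

Lemma wt_sig X m : S0 m -> wt (sig c X) (tau m) = wt X m.
Proof.
move=> hm; rewrite !wtE (bigD1 k) //= [in RHS](bigD1 k) //= tauE eqxx /sig ck mul0r addr0 {1}/eta eqxx.
have -> : \sum_(i < r | i != k) (tau m i)%:R * (eta i * X i + (c i)%:R * X k) =
   \sum_(i < r | i != k) (m i)%:R * X i + (beta c m)%:R * X k.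
  have -> : beta c m = (\sum_(i < r | i != k) m i * c i)%N.
    by rewrite /betaW (bigD1 k) //= ck muln0 add0n.
  rewrite natr_sum mulr_suml -big_split.
  by apply: eq_bigr => i ik; rewrite tauE /eta (negbTE ik) mul1r mulrDr natrM mulrA.
by rewrite natrB //; ring.
Qed.

Lemma sigK X i : sig c (sig c X) i = X i.
Proof.
rewrite /sig ck /eta eqxx; case: eqP => [->|_]; rewrite ?ck; ring.
Qed.

Lemma eq_wt X Y m : (forall i, X i = Y i) -> wt X m = wt Y m.
Proof. by move=> h; rewrite !wtE; apply: eq_bigr => i _; rewrite h. Qed.

Lemma omv_tau m i : S0 m -> omv W' (tau m) i = sig c (omv W m) i.
Proof.
move=> hm; have E j : omv W m j = wt (sig c (fun h => W h j)) (tau m).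
  by rewrite wt_sig // wtE.
rewrite /sig !E !wtE !mulr_sumr -big_split; apply: eq_bigr => j _ /=.
by rewrite /mutW /sig W0; ring.
Qed.

Lemma om_tau m n : S0 m -> S0 n -> omW W' (tau m) (tau n) = om m n.
Proof.
by move=> hm hn; rewrite /omW (eq_wt _ (fun i => omv_tau i hm)) wt_sig.
Qed.

(** On [S0], [tau] is an additive involution and maps strings to strings; terms for which m - j n
    leaves [S0] are killed by the vanishing of x and x'. *)
Lemma actl_tau n a (x x' : ser) m : S0 n -> S0 m ->
  (forall u, S0 u -> x' (tau u) = x u) -> (forall u, ~~ S0 u -> x u = 0) ->
  (forall u, ~~ S0 u -> x' u = 0) ->
  actlW W' (tau n, a) x' (tau m) = actl (n, a) x m.
Proof.
move=> hn hm ex zx zx'; pose N := maxn (mdeg m) (mdeg (tau m)).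
rewrite (actlE (mutW_skew c) (N := N)) ?leq_maxr // (actlE skewW (N := N)) ?leq_maxl //= om_tau //.
rewrite big_mkcond [RHS]big_mkcond; apply: eq_bigr => -[j /= _] _.
pose u := (m - n *+ j)%MM; pose u' := (tau m - tau n *+ j)%MM.
have A1 : (n *+ j <= m)%MM -> S0 u -> (tau n *+ j <= tau m)%MM /\ u' = tau u.
  move=> le hu; have e : tau m = (tau u + tau n *+ j)%MM.
    by rewrite -tauM // -tauD ?submK //; apply: S0M.
  by split; [rewrite e lem_addl|rewrite /u' e addmK].
have A2 : (tau n *+ j <= tau m)%MM -> S0 u' -> (n *+ j <= m)%MM /\ S0 u.
  move=> le hu; have e : m = (tau u' + n *+ j)%MM.
    rewrite -[LHS](tauK hm) -(submK le) tauD //; last by apply/S0M/S0_tau.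
    by rewrite (tauM _ (S0_tau n)) tauK.
  by split; [rewrite e lem_addl|rewrite /u e addmK S0_tau].
case: (boolP ((n *+ j <= m)%MM && S0 u)) => [/andP[le hu]|no].
  by have [le' eu] := A1 le hu; rewrite le le' -/u -/u' eu ex.
have -> : (if (n *+ j <= m)%MM then binr (a * om n m) j * x (m - n *+ j)%MM else 0) = 0.
  by case: ifP no => //= _ /zx; rewrite /u => ->; rewrite mulr0.
case: ifP => // le'; case: (boolP (S0 u')) => hu'; last by rewrite zx' // mulr0.
by have [h1 h2] := A2 le' hu'; rewrite h1 h2 in no.
Qed.

Lemma closed_S0 : closed S0. Proof. exact: S0D. Qed.

Lemma K_tau phi w m : (forall l, l \in w -> S0 l.1) -> S0 m ->
  KW W' (sig c phi) (tw w) (tau m) = K phi w m.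
Proof.
elim: w m => //= -[n a] w IH m hw hm.
have hn : S0 n by apply: (hw (n, a)); apply: mem_head.
have hw' l : l \in w -> S0 l.1 by move=> h; apply: hw; rewrite inE h orbT.
congr (_ + _).
  pose N := maxn (mdeg m) (mdeg (tau m)).
  rewrite (KlE _ _ (N := N)) ?leq_maxr // (KlE _ _ (N := N)) ?leq_maxl //=.
  by apply: eq_bigr => j _; rewrite wt_sig // /delta -tauM // tau_eq //; apply: S0M.
apply: actl_tau => // u hu; first exact: IH.
  by apply: (K_suppN _ _ closed_S0 _ hu); apply/allP => l /hw' ->; rewrite orbT.
apply: (K_suppN _ _ closed_S0 _ hu); apply/allP => l /mapP[l' _ ->] /=.
by rewrite S0_tau orbT.
Qed.

Lemma K_tau_out phi w m : ~~ S0 m -> KW W' phi (tw w) m = 0.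
Proof.
move=> hm; apply: (K_suppN _ _ closed_S0 _ hm); apply/allP => l /mapP[l' _ ->] /=.
by rewrite S0_tau orbT.
Qed.

(** Mutation changes degrees by at most this factor, which is the loss of truncation depth in a
    transport. *)
Lemma mdeg_tau m : S0 m -> (mdeg m <= (1 + \sum_i c i) * mdeg (tau m))%N.
Proof.
move=> hm; have b1 : (beta c m <= (\sum_i c i) * mdeg (tau m))%N.
  rewrite -beta_tau /betaW big_distrl; apply: leq_sum => i _ /=.
  by rewrite mulnC leq_mul // mdegE (bigD1 i) //= leq_addr.
have b2 : (mdeg m <= mdeg (tau m) + m k)%N.
  rewrite !mdegE (bigD1 k) //= [X in (_ <= X + _)%N](bigD1 k) //= addnC.
  rewrite leq_add2r; apply: leq_trans (leq_addl _ _).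
  by apply/eq_leq/eq_bigr => i ik; rewrite tauE (negbTE ik).
by rewrite mulnDl mul1n (leq_trans b2) // leq_add2l (leq_trans hm).
Qed.

Lemma eq_K (V : 'I_r -> 'I_r -> rat) phi psi w m : (forall i, phi i = psi i) ->
  KW V phi w m = KW V psi w m.
Proof.
move=> h; elim: w m => //= l w IH m; congr (_ + _); last by apply: eq_actl.
by apply: eq_bigr => j _; rewrite (eq_wt _ h).
Qed.

Lemma Keq_tau d w w' : (forall l, l \in w -> S0 l.1) -> (forall l, l \in w' -> S0 l.1) ->
  Keq ((1 + \sum_i c i) * d)%N w w' -> KeqW W' d (tw w) (tw w').
Proof.
move=> hw hw' h; apply/KeqP => m md; case: (boolP (S0 m)) => hm; last by rewrite !K_tau_out.
have E t : (forall l, l \in t -> S0 l.1) -> KW W' dg (tw t) m = K (sig c dg) t (tau m).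
  move=> hv; rewrite -K_tau ?S0_tau // tauK //; apply: eq_K => i; by rewrite sigK.
rewrite !E //; apply: (K_det skewW _ h).
by apply: leq_trans (mdeg_tau (S0_tau m)) _; rewrite tauK // leq_mul.
Qed.

End OneSide.

End Transport.

Notation S0W := S0 (only parsing).
Notation sigW := sig (only parsing).

(* Reversing coefficients in degree B turns the multiplication by (1 + y)^N into itself,
   because 'C(N, j) = 'C(N, N - j). *)
Lemma palindrome (N B i : nat) (f : nat -> rat) : (forall j, (B < j)%N -> f j = 0) ->
  (if (i <= B + N)%N then \sum_(j < (B + N - i).+1) 'C(N, j)%:R * f (B + N - i - j)%N else 0) =
  \sum_(j < i.+1) 'C(N, j)%:R * (if (i - j <= B)%N then f (B - (i - j))%N else 0).
Proof.
move=> h; case: leqP => hi; last first.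
  rewrite big1 // => -[j /= ji] _; case: ifP => [hj|]; last by rewrite mulr0.
  by rewrite bin_small ?mul0r //; lia.
pose T j : rat := if (i <= B + j)%N then 'C(N, j)%:R * f (B + j - i)%N else 0.
transitivity (\sum_(j < N.+1) T j).
  transitivity (\sum_(j < N.+1) T (N - j)%N); last first.
    by rewrite (reindex_inj rev_ord_inj) /=; apply: eq_bigr => j _; rewrite subSS subKn // -ltnS.
  transitivity (\sum_(j < maxn (B + N - i).+1 N.+1 | (j < (B + N - i).+1)%N) ('C(N, j)%:R * f (B + N - i - j)%N : rat)).
    by rewrite -(big_ord_widen _ (fun j => 'C(N, j)%:R * f (B + N - i - j)%N : rat)) // leq_maxl.
  rewrite [RHS](big_ord_widen _ (fun j => T (N - j)%N) (leq_maxr (B + N - i).+1 _)).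
  rewrite big_mkcond [RHS]big_mkcond; apply: eq_bigr => -[j /= _] _.
  rewrite /T !ltnS; case: (leqP j N) => jN.
    rewrite bin_sub // (_ : (i <= B + (N - j))%N = (j <= B + N - i)%N); last by lia.
    by case: ifP => // _; congr (_ * f _); lia.
  by rewrite bin_small // mul0r if_same.
transitivity (\sum_(j < maxn i.+1 N.+1 | (j < N.+1)%N) T j).
  by rewrite -(big_ord_widen _ T) // leq_maxr.
rewrite [RHS](big_ord_widen _ (fun j => 'C(N, j)%:R * (if (i - j <= B)%N then f (B - (i - j))%N else 0) : rat) (leq_maxl _ N.+1)).
rewrite big_mkcond [RHS]big_mkcond; apply: eq_bigr => -[j /= _] _.
rewrite /T !ltnS; case: (leqP j i) => ji; case: (leqP j N) => jN.
- rewrite (_ : (i <= B + j)%N = (i - j <= B)%N); last by lia.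
  by case: ifP => hh; rewrite ?mulr0 //; congr (_ * f _); lia.
- by rewrite bin_small // mul0r.
- by case: ifP => // _; rewrite h ?mulr0 //; lia.
- by [].
Qed.

Section PalindromicTransport.
Variables (r : nat) (W : 'I_r -> 'I_r -> rat).
Hypothesis skewW : forall i j, W i j = - W j i.
Notation mon := 'X_{1..r}.
Notation ser := (ser r).
Notation letter := (letter r).
Implicit Types (m n u p q : mon) (l : letter) (w : seq letter).
Implicit Types (phi psi : 'I_r -> rat).
Notation vfun := (vfun r).
Implicit Types (v : vfun).
Variables (k : 'I_r).
Notation beta := (@beta r).
Notation S0 c := (S0 k c).
Notation tau := (tau k).

Lemma Ek_le m j : (U_(k) *+ j <= m)%MM = (j <= m k)%N.
Proof.
apply/mnm_lepP/idP => [/(_ k)|h i]; first by rewrite mulmnE mnm1E eqxx mul1n.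
by rewrite mulmnE mnm1E; case: eqP => [<-|]; rewrite ?mul1n.
Qed.

Lemma beta_tau2 c c' m : c' k = 0%N -> beta c' (tau c m) = beta c' m.
Proof.
move=> ck; rewrite /betaW; apply: eq_bigr => i _; rewrite tauE; case: eqP => // ->.
by rewrite ck !muln0.
Qed.

(** On the e_k-string through m, parametrized by v, the two mutations are the reversals in degrees
    beta c and beta c'; this is the situation of [palindrome]. *)
Lemma palK c c' (F F' : ser) m : c k = 0%N -> c' k = 0%N -> (beta c m <= beta c' m)%N ->
  (forall u, ~~ S0 c u -> F u = 0) ->
  (S0 c' m -> F' (tau c' m) = \sum_(j < (tau c' m k).+1) 'C(beta c' m - beta c m, j)%:R * F (tau c' m - U_(k) *+ j)%MM) ->
  (if S0 c' m then F' (tau c' m) else 0) =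
  \sum_(j < (m k).+1) 'C(beta c' m - beta c m, j)%:R *
     (if S0 c (m - U_(k) *+ j)%MM then F (tau c (m - U_(k) *+ j)%MM) else 0).
Proof.
move=> ck ck' le zF hF.
pose v i : mon := [multinom if q == k then i else m q | q < r].
have vk i : v i k = i by rewrite mnmE eqxx.
have bv i (d : 'I_r -> nat) : d k = 0%N -> beta d (v i) = beta d m.
  by move=> dk; rewrite /betaW; apply: eq_bigr => q _; rewrite mnmE; case: eqP => // ->; rewrite dk !muln0.
have vsub i j : (v i - U_(k) *+ j)%MM = v (i - j)%N.
  apply/mnmP => q; rewrite mnmBE mulmnE mnm1E !mnmE eq_sym.
  by case: eqP => _; rewrite ?mul1n ?mul0n ?subn0.
have vm : m = v (m k) by apply/mnmP => q; rewrite mnmE; case: eqP => // ->.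
have vtau d i : d k = 0%N -> tau d (v i) = v (beta d m - i)%N.
  by move=> dk; apply/mnmP => q; rewrite tauE bv // !mnmE eqxx; case: eqP.
have S0v d i : d k = 0%N -> S0 d (v i) = (i <= beta d m)%N by move=> dk; rewrite /S0W bv // vk.
have eB : beta c' m = (beta c m + (beta c' m - beta c m))%N by rewrite subnKC.
transitivity (if (m k <= beta c m + (beta c' m - beta c m))%N then
   \sum_(j < (beta c m + (beta c' m - beta c m) - m k).+1) 'C(beta c' m - beta c m, j)%:R *
     F (v (beta c m + (beta c' m - beta c m) - m k - j)%N) else 0).
  rewrite -!eB [m in S0 c' m]vm S0v //; case: ifP => // hm.
  rewrite hF; last by rewrite vm S0v // vk.
  have -> : tau c' m = v (beta c' m - m k)%N by rewrite {1}vm vtau.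
  by rewrite vk; apply: eq_bigr => j _; rewrite vsub.
rewrite (@palindrome _ _ _ (fun i => F (v i))) => [|j hj]; last by apply: zF; rewrite S0v // -ltnNge.
have em i : (m - U_(k) *+ i)%MM = v (m k - i)%N by rewrite {1}vm vsub.
by apply: eq_bigr => j _; rewrite em S0v // vtau.
Qed.

(** The bases defined by b and bp differ by the transvection e_i -> e_i + W(i, k) d_k e_k, an
    isometry of the form. *)
Lemma mutW_eq (b bp : 'I_r -> nat) (dk : rat) : b k = 0%N -> bp k = 0%N ->
  (forall i, (b i)%:R - (bp i)%:R = W i k * dk) -> forall i j, mutW W k b i j = mutW W k bp i j.
Proof.
move=> bk bpk hb i j; rewrite /mutW; apply/eqP; rewrite -subr_eq0; apply/eqP.
have e1 : (b j)%:R = (bp j)%:R + W j k * dk by rewrite -hb; ring.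
have e2 : (b i)%:R = (bp i)%:R + W i k * dk by rewrite -hb; ring.
rewrite e1 e2 (skewW k j) /eta; case: (eqVneq i k) => [->|_]; case: (eqVneq j k) => [->|_];
  by rewrite ?(W0 skewW); ring.
Qed.

End PalindromicTransport.

Section TransportedFactor.
Variables (r : nat) (W : 'I_r -> 'I_r -> rat).
Hypothesis skewW : forall i j, W i j = - W j i.
Notation mon := 'X_{1..r}.
Notation letter := (letter r).
Notation om := (om W).
Implicit Types (m n u p q : mon) (l : letter) (w : seq letter).
Implicit Types (phi psi : 'I_r -> rat).
Notation Keq := (Keq W).
Notation vfun := (vfun r).
Implicit Types (v : vfun).
Notation vom := (vom W).
Variables (k : 'I_r) (dd : 'I_r -> nat) (U : seq 'I_r).
Notation beta := (@beta r).
Notation Sb c := (Sb k c).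
Notation S0 c := (S0 k c).
Notation tau := (tau k).
Notation sig := (sig k).
Notation tw := (tw k).
Notation Dk := (Dk k).
Notation inis := (@inis r dd U).
Notation inik := [seq l <- inis | l.1 != U_(k)%MM].

Lemma beta1 c i : beta c U_(i)%MM = c i.
Proof.
rewrite /betaW (bigD1 i) //= big1 ?addn0 => [|j ji]; first by rewrite mnm1E eqxx mul1n.
by rewrite mnm1E eq_sym (negbTE ji).
Qed.

Lemma lam_inik_both c co m : (forall i, (c i * co i = 0)%N) -> (0 < beta c m)%N -> (0 < beta co m)%N ->
  lam m inik = 0.
Proof.
move=> cc c0 co0; apply: (lam_out (T := fun q => (beta c q == 0%N) || (beta co q == 0%N))).
  apply/allP => l; rewrite mem_filter => /andP[_ /mapP[i _ ->]] /=.
  by rewrite !beta1 -muln_eq0 cc eqxx orbT.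
move=> q i e; rewrite negb_or -!lt0n; move: c0 co0; rewrite e !beta_mul !muln_gt0.
by case/andP=> -> _ /andP[-> _].
Qed.

Lemma inik_Sb c l : l \in inik -> Sb c l.1.
Proof.
rewrite mem_filter => /andP[h /mapP[i _ e]]; rewrite e [_.1]/= in h *; rewrite eq_mnm1 in h.
move/negbTE: h => ik.
by rewrite /SbW mnm1_eq0 mnm1E ik.
Qed.

(** If beta c vanishes at m, then [tau] fixes m; otherwise both beta are positive and m is parallel
    to no basis vector. *)
Lemma lam_inik_tau c co m : c k = 0%N -> (forall i, (c i * co i = 0)%N) -> co k = 0%N ->
  Sb c m -> (beta c m <= beta co m)%N -> lam (tau c m) inik = lam m inik.
Proof.
move=> ck cc cok /andP[m0 hm] le; case: (posnP (beta c m)) => [z|c0].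
  suff -> : tau c m = m by [].
  apply/mnmP => i; rewrite tauE; case: eqP => // ->.
  by move: hm; rewrite z leqn0 => /eqP ->.
have co0 := leq_trans c0 le.
by rewrite !(lam_inik_both cc) // beta_tau2.
Qed.

Lemma filter_nz d (T : pred mon) w : win T w ->
  (forall l, l \in [seq l <- w | l.2 != 0] -> T l.1) /\ Keq d w [seq l <- w | l.2 != 0].
Proof.
move=> hw; split=> [l|]; first by rewrite mem_filter => /andP[l2 /(allP hw)]; rewrite (negbTE l2).
by apply: (Keq_filter skewW) => -[n a] _ /negPn/eqP /= ->; apply: (Keq0 W).
Qed.

Lemma sig_Dk c i : c k = 0%N -> sig c Dk i = Dk i.
Proof.
by move=> ck; rewrite /sigW /DkW /eta eqxx mulr0 addr0; case: eqP => _; rewrite ?mulr0 ?mul1r.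
Qed.

(** Factor [hc] by the functional om'(m', -) read through [tau], and transport the parts. Their
    middle weights are compared through [Dk], which has the same nonzero value at m' and at its
    mutation. *)
Lemma side c co m' hc : c k = 0%N -> co k = 0%N -> (forall i, (c i * co i = 0)%N) ->
  (beta c m' <= beta co m')%N -> m' != 0%MM -> (forall l, l \in hc -> Sb c l.1) ->
  (Sb c m' -> exists A B Z, [/\ win (neg (vom (tau c m'))) A, win (zer (vom (tau c m'))) B,
     win (pos (vom (tau c m'))) Z, Keq (mdeg (tau c m')) hc (A ++ B ++ Z) & lam (tau c m') B = lam (tau c m') inik]) ->
  exists A B Z, [/\ win (neg (vomW (mutW W k c) m')) A, win (zer (vomW (mutW W k c) m')) B,
     win (pos (vomW (mutW W k c) m')) Z, KeqW (mutW W k c) (mdeg m') (tw c hc) (A ++ B ++ Z) & lam m' B = lam m' inik].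
Proof.
move=> ck cok cc le m'0 hSb good; set W' := mutW W k c.
have skW' : forall i j, W' i j = - W' j i by apply: mutW_skew.
pose Y := omv W' m'; pose v : vfun := fun n => (wt (sig c Y) n)%:P.
have av : addv v by move=> p q; rewrite /v wtD polyCD.
have vE n : S0 c n -> omW W' m' (tau c n) = wt (sig c Y) n.
  move=> hn; rewrite -(wt_sig ck _ hn) /omW; apply: eq_wt => i; by rewrite sigK.
pose d := ((1 + \sum_i c i) * mdeg m')%N.
have hw : win (Sb c) hc by apply/allP => l /hSb ->; rewrite orbT.
have st : stab (fun=> True) (Sb c) by [].
have [A [B [Z [hA hB hZ e _]]]] := factor_ex skewW d av (@closed_Sb _ k c) st hw.
have [sA eA] := filter_nz d hA; have [sB eB] := filter_nz d hB; have [sZ eZ] := filter_nz d hZ.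
set A1 := [seq l <- A | l.2 != 0] in sA eA; set B1 := [seq l <- B | l.2 != 0] in sB eB.
set Z1 := [seq l <- Z | l.2 != 0] in sZ eZ.
have e1 : Keq d hc (A1 ++ B1 ++ Z1).
  by apply: (Keq_trans e); apply: (Keq_cat skewW eA); apply: (Keq_cat skewW eB eZ).
have twin (P Q : pred mon) w : (forall l, l \in w -> predI (Sb c) P l.1) ->
    (forall n, Sb c n -> P n -> Q (tau c n)) -> win Q (tw c w).
  move=> h hPQ; apply/allP => l /mapP[l' /h /andP[h1 h2] ->] /=.
  by rewrite hPQ ?orbT.
have hA1 : win (neg (vomW W' m')) (tw c A1).
  by apply: twin sA _ => n /Sb_S0 hn; rewrite neg_vom vE // /neg lead_coefC.
have hB1 : win (zer (vomW W' m')) (tw c B1).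
  by apply: twin sB _ => n /Sb_S0 hn; rewrite zer_vom vE // /zer polyC_eq0.
have hZ1 : win (pos (vomW W' m')) (tw c Z1).
  by apply: twin sZ _ => n /Sb_S0 hn; rewrite pos_vom vE // /pos lead_coefC.
exists (tw c A1), (tw c B1), (tw c Z1); split=> //.
  rewrite -!map_cat; apply: (Keq_tau skewW ck _ _ e1) => l.
    by move/hSb/Sb_S0.
  by rewrite !mem_cat => /or3P[/sA|/sB|/sZ] /andP[/Sb_S0].
(* Outside [Sb c] no letter is parallel to m', and both weights are zero. *)
case: (boolP (Sb c m')) => hm'; last first.
  have out w : win (Sb c) w -> lam m' w = 0.
    move=> hw'; apply: (lam_out hw') => q i em; apply: contra hm' => hq.
    by rewrite em; apply: (closedM _ (@closed_Sb _ k c)).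
  rewrite !out //; first by apply/allP => l /inik_Sb ->; rewrite orbT.
  by apply: twin sB _ => n hn _; apply: Sb_tau.
pose m := tau c m'; have em : tau c m = m' by rewrite /m tauK // Sb_S0.
have hm : Sb c m by apply: Sb_tau.
have m0 : m != 0%MM by case/andP: hm.
have [A2 [B2 [Z2 [hA2 hB2 hZ2 e2 hl2]]]] := good hm'.
have ov n : S0 c n -> om m n = wt (sig c Y) n.
  by move=> hn; rewrite -vE // -em om_tau // Sb_S0.
have win1 (P Q : pred mon) w : (forall l, l \in w -> predI (Sb c) P l.1) ->
    (forall n, Sb c n -> P n -> Q n) -> win Q w.
  by move=> h hPQ; apply/allP => l /h /andP[h1 h2]; rewrite hPQ ?orbT.
have kA : win (neg (vom m)) A1.
  by apply: win1 sA _ => n /Sb_S0 hn; rewrite neg_vom ov // /neg lead_coefC.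
have kB : win (zer (vom m)) B1.
  by apply: win1 sB _ => n /Sb_S0 hn; rewrite zer_vom ov // /zer polyC_eq0.
have kZ : win (pos (vom m)) Z1.
  by apply: win1 sZ _ => n /Sb_S0 hn; rewrite pos_vom ov // /pos lead_coefC.
have md : (mdeg m <= d)%N by have := mdeg_tau ck (Sb_S0 hm); rewrite em.
have [_ eB12 _] := factor_uniq skewW (addv_vom W m) hA2 hB2 hZ2 kA kB kZ
  (Keq_trans (Keq_sym e2) (Keq_le md e1)).
have l1 : lam m B1 = lam m inik by rewrite -(lam_Keq skewW m0 hB2 kB eB12).
have wm : wt Dk m = wt Dk m'.
  by rewrite -em -(wt_sig ck Dk (Sb_S0 hm)); apply: eq_wt => i; rewrite sig_Dk.
have wm0 : wt Dk m != 0 by rewrite gt_eqF // (Sb_D ck hm).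
rewrite -(lam_inik_tau ck cc cok hm' le) -/m -l1; apply: (mulfI wm0).
rewrite -(K_lam (W := W) Dk); last by apply: win_sub kB => n; rewrite zer_vom (omC skewW n) oppr_eq0.
rewrite wm -(K_lam (W := W') Dk); last first.
  by apply: win_sub hB1 => n; rewrite zer_vom (omC skW' n) oppr_eq0.
rewrite -em -(K_tau skewW ck Dk) ?Sb_S0 //; last by move=> l /sB /andP[/Sb_S0].
by apply: eq_K => i; rewrite sig_Dk.
Qed.

End TransportedFactor.

Section MutationInvariance.
Variables (r : nat) (W : 'I_r -> 'I_r -> rat).
Hypothesis skewW : forall i j, W i j = - W j i.
Notation mon := 'X_{1..r}.
Notation letter := (letter r).
Notation om := (om W).
Implicit Types (m n u p q : mon) (l : letter) (w : seq letter).
Implicit Types (phi psi : 'I_r -> rat).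
Notation K := (K W).
Notation Keq := (Keq W).
Notation dg := (@dg r).
Notation vfun := (vfun r).
Implicit Types (v : vfun).
Variables (k : 'I_r) (dd : 'I_r -> nat) (U : seq 'I_r).
Notation beta := (@beta r).
Notation Sb c := (Sb k c).
Notation S0 c := (S0 k c).
Notation Ek := (Ek k).
Notation tau := (tau k).
Notation tw := (tw k).
Notation Dk := (Dk k).
Notation inis := (@inis r dd U).
Notation dk := ((dd k)%:R : rat).
Hypothesis uU : uniq U.
Hypothesis kU : k \in U.
Hypothesis dk0 : (0 < dd k)%N.
Variables (b bp : 'I_r -> nat).
Hypothesis hb : forall i, (b i)%:R - (bp i)%:R = W i k * dk.
Hypothesis bk : b k = 0%N.
Hypothesis bpk : bp k = 0%N.
Hypothesis bb : forall i, (b i * bp i = 0)%N.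
Variables (g : seq letter) (d : nat).
(** Depth needed before the mutation to control degree d after it, by [mdeg_tau] for b and for
    bp. *)
Definition mdepth := ((1 + \sum_i b i + \sum_i bp i) * d)%N.
Notation D := mdepth.
Hypothesis good_g : Good W inis g D.
Notation H := (Ek (- dk) :: g).
Notation Hp := (g ++ [:: Ek (- dk)]).
Notation W' := (mutW W k b).

Lemma supp_word (c : 'I_r -> nat) h : c k = 0%N ->
  (forall m, (mdeg m <= D)%N -> K Dk h m != 0 -> Sb c m) ->
  (forall u, (mdeg u <= D)%N -> wt Dk u = 0 -> K dg h u = 0) ->
  exists2 h0, (forall l, l \in h0 -> Sb c l.1) & Keq D h h0.
Proof.
move=> ck hD h0.
have [|w hw e] := word_of_support (d := D) (w := h) skewW (@closed_Sb _ k c).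
  apply: (K_weight_supp skewW (@closed_Sb _ k c) hD) => m md z.
  by rewrite h0 ?eqxx.
have [s e'] := filter_nz skewW D hw.
by exists [seq l <- w | l.2 != 0] => //; apply: Keq_trans e e'.
Qed.

Lemma K0H u : (mdeg u <= D)%N -> wt Dk u = 0 -> K dg H u = 0.
Proof.
move=> ud z; case: (eqVneq u 0%MM) => [->|u0]; first by rewrite K0.
have [|A [B [Z [hA hB hZ e hl]]]] := goodH skewW uU kU good_g u0 ud.
  by rewrite (Dk_eq0 z) (omMl skewW) (om_id skewW) mulr0.
by apply: (K0_of_fact skewW u0 z hA hB hZ e); rewrite hl lam_inik //; left.
Qed.

Lemma K0Hp u : (mdeg u <= D)%N -> wt Dk u = 0 -> K dg Hp u = 0.
Proof.
move=> ud z; case: (eqVneq u 0%MM) => [->|u0]; first by rewrite K0.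
have [|A [B [Z [hA hB hZ e hl]]]] := goodHp skewW uU kU good_g u0 ud.
  by rewrite (Dk_eq0 z) (omMl skewW) (om_id skewW) mulr0.
by apply: (K0_of_fact skewW u0 z hA hB hZ e); rewrite hl lam_inik //; left.
Qed.

Lemma dkp : 0 < dk. Proof. by rewrite ltr0n. Qed.

Lemma sgb m : (om m U_(k)%MM <= 0) = (beta b m <= beta bp m)%N.
Proof. by rewrite -(pmulr_lle0 _ dkp) (om_beta hb) subr_le0 ler_nat. Qed.

Lemma sgb' m : (0 <= om m U_(k)%MM) = (beta bp m <= beta b m)%N.
Proof. by rewrite -(pmulr_lge0 _ dkp) (om_beta hb) subr_ge0 ler_nat. Qed.

Lemma skW' i j : W' i j = - W' j i. Proof. exact: mutW_skew. Qed.

Lemma mutWE : mutW W k bp = W'.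
Proof.
apply: functional_extensionality => i; apply: functional_extensionality => j.
exact/esym/(mutW_eq skewW bk bpk hb).
Qed.

Lemma om_mut m : omW W' m U_(k)%MM = - om m U_(k)%MM.
Proof.
rewrite om_coord [in RHS]om_coord -sumrN; apply: eq_bigr => i _.
rewrite !om1 /mutW bk (W0 skewW) /eta eqxx; case: (eqVneq i k) => [->|_].
  by rewrite (W0 skewW); ring.
by ring.
Qed.

Lemma om_mut' m : dk * omW W' U_(k)%MM m = (beta b m)%:R - (beta bp m)%:R.
Proof. by rewrite (omC skW') om_mut opprK mulrC (om_beta hb). Qed.

Lemma tau_depth c m : c k = 0%N -> (forall i, (c i <= b i + bp i)%N) -> S0 c m ->
  (mdeg m <= d)%N -> (mdeg (tau c m) <= D)%N.
Proof.
move=> ck le hm md; have := mdeg_tau ck (S0_tau ck m); rewrite tauK // => h.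
apply: leq_trans h _; apply: leq_mul => //; rewrite -addnA leq_add2l -big_split.
exact: leq_sum.
Qed.

Variables h0 hp0 : seq letter.
Hypothesis h0S : forall l, l \in h0 -> Sb b l.1.
Hypothesis h0e : Keq D H h0.
Hypothesis hp0S : forall l, l \in hp0 -> Sb bp l.1.
Hypothesis hp0e : Keq D Hp hp0.
Notation X := (KW W' Dk (tw bp hp0)).
Notation Y := (KW W' Dk (tw b h0)).

Lemma K_twE c w m : c k = 0%N -> mutW W k c = W' -> (forall l, l \in w -> Sb c l.1) ->
  KW W' Dk (tw c w) m = if S0 c m then K Dk w (tau c m) else 0.
Proof.
move=> ck <- hw; case: ifPn => hm; last exact: K_tau_out.
rewrite -(K_tau skewW ck Dk) ?S0_tau //; last by move=> l /hw/Sb_S0.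
by rewrite tauK //; apply: eq_K => i; rewrite sig_Dk.
Qed.

Lemma K_h0_out c w m : (forall l, l \in w -> Sb c l.1) -> ~~ S0 c m -> K Dk w m = 0.
Proof.
move=> hw hm; apply: (K_suppN _ _ (@closed_S0 _ k c) _ hm).
by apply/allP => l /hw/Sb_S0 ->; rewrite orbT.
Qed.

(** First half of the conjugation of the two transported words by e_k. The reversal needs a binomial
    with natural upper index, so each half-space has its own identity. *)
Lemma KX m : (mdeg m <= d)%N -> (beta b m <= beta bp m)%N ->
  X m = KW W' Dk (Ek (- dk) :: tw b h0) m.
Proof.
move=> md le; rewrite K_Ek Ek_act mulNr om_mut' opprB -natrB //.
rewrite (K_twE _ bpk mutWE hp0S) (palK bk bpk le (fun u hu => K_h0_out h0S hu)) => [|hm].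
  by apply: eq_bigr => j _; rewrite binr_nat (K_twE _ bk (erefl _) h0S).
have td : (mdeg (tau bp m) <= D)%N by apply: tau_depth => // i; apply: leq_addl.
rewrite -(K_det skewW Dk hp0e) // K_rcons_Ek (K_g_H skewW k dd).
rewrite -K_Ek (K_det skewW Dk (Keq_cons skewW _ h0e)) // K_Ek Ek_act.
rewrite (omC skewW) mulrN mulrC (om_beta hb) opprB !beta_tau2 // -natrB //.
by apply: eq_bigr => j _; rewrite binr_nat.
Qed.

Lemma KY m : (mdeg m <= d)%N -> (beta bp m <= beta b m)%N ->
  Y m = KW W' Dk (Ek dk :: tw bp hp0) m.
Proof.
move=> md le; rewrite K_Ek Ek_act om_mut' -natrB //.
rewrite (K_twE _ bk (erefl _) h0S) (palK bpk bk le (fun u hu => K_h0_out hp0S hu)) => [|hm].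
  by apply: eq_bigr => j _; rewrite binr_nat (K_twE _ bpk mutWE hp0S).
have td : (mdeg (tau b m) <= D)%N by apply: tau_depth => // i; apply: leq_addr.
rewrite -(K_det skewW Dk h0e) // K_Ek.
rewrite (@eq_actl _ W _ _ (K Dk hp0)) => [|u um]; last first.
  rewrite -(K_rcons_Ek W k (- dk) g); apply: (K_det skewW Dk hp0e).
  exact: leq_trans (mdeg_le um) td.
rewrite Ek_act mulNr (omC skewW) mulrN opprK mulrC (om_beta hb) !beta_tau2 // -natrB //.
by apply: eq_bigr => j _; rewrite binr_nat.
Qed.

(* Both sides are consistent for the mutated form, the left one on the exponents m with
   om(m, e_k) < 0 and the right one on the others. *)
Lemma conj_Keq : KeqW W' d (Ek dk :: tw bp hp0) (tw b h0 ++ [:: Ek dk]).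
Proof.
have subP m j : (j <= m k)%N -> [/\ (mdeg (m - U_(k) *+ j)%MM <= mdeg m)%N,
    beta b (m - U_(k) *+ j)%MM = beta b m & beta bp (m - U_(k) *+ j)%MM = beta bp m].
  by move=> jm; split; rewrite ?beta_sub // mdeg_sub ?Ek_le // leq_subr.
apply/KeqP; apply: (K_weight_det skW' (phi := Dk)) => m md; last first.
  move=> z; rewrite (K_Dk0 W' _ (Ek dk :: _) z) [RHS](K_Dk0 W' _ _ z) filter_cat.
  have nil c w : c k = 0%N -> (forall l, l \in w -> Sb c l.1) -> [seq l <- tw c w | wt Dk l.1 == 0] = [::].
    move=> ck hw; rewrite (@eq_in_filter _ _ pred0) ?filter_pred0 // => l /mapP[l' /hw h ->] /=.
    by rewrite gt_eqF // (Sb_D ck) // Sb_tau.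
  by rewrite (nil _ _ bk h0S) /= (nil _ _ bpk hp0S).
rewrite K_rcons_Ek; case: (leqP (beta bp m) (beta b m)) => [le|/ltnW le]; first by rewrite KY.
rewrite K_Ek Ek_act; transitivity (KW W' Dk (Ek dk :: Ek (- dk) :: tw b h0) m).
  rewrite [RHS]K_Ek Ek_act; apply: eq_bigr => -[j /= jm] _.
  have [h1 h2 h3] := subP m j jm.
  by rewrite KX ?h2 ?h3 // (leq_trans h1).
exact: (K_det skW' Dk (Keq_Ek skW' k (mdeg m) dk _)).
Qed.

(** Where om(m, e_k) <= 0 for W, the left-stripped word is good, and e_k returns at the right end
    because its sign is reversed for W'. On the other half-space the right-stripped word gets e_k on
    the left, and [conj_Keq] identifies the two results. *)
Lemma mut_good : Good W' inis (tw b h0 ++ [:: Ek dk]) d.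
Proof.
move=> m m0 md; case: (leqP (beta b m) (beta bp m)) => [le|/ltnW le].
  have [|A [B [Z [hA hB hZ e hl]]]] := side (dd := dd) (U := U) skewW bk bpk bb le m0 h0S.
    move=> hm; have td : (mdeg (tau b m) <= D)%N.
      by apply: tau_depth (Sb_S0 hm) md => // i; apply: leq_addr.
    have tm0 : tau b m != 0%MM by have /andP[] := Sb_tau bk hm.
    have [|A [B [Z [hA hB hZ e hl]]]] := goodH skewW uU kU good_g tm0 td.
      by rewrite sgb !beta_tau2.
    exists A, B, Z; split=> //; apply: Keq_trans e.
    exact/Keq_sym/(Keq_le td h0e).
  have pm : 0 <= omW W' m U_(k)%MM by rewrite om_mut oppr_ge0 sgb.
  have [B' [Z' [hB' hZ' e' hl']]] := fact_rcons skW' dk A (mdeg m) pm hB hZ.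
  exists A, B', Z'; split=> //; last by rewrite hl' hl -lam_ini.
  exact: Keq_trans (Keq_cat skW' e (Keq_refl _ _ _)) e'.
have bb' i : (bp i * b i = 0)%N by rewrite mulnC.
have [|A [B [Z [hA hB hZ e hl]]]] := side (dd := dd) (U := U) skewW bpk bk bb' le m0 hp0S.
  move=> hm; have td : (mdeg (tau bp m) <= D)%N.
    by apply: tau_depth (Sb_S0 hm) md => // i; apply: leq_addl.
  have tm0 : tau bp m != 0%MM by have /andP[] := Sb_tau bpk hm.
  have [|A [B [Z [hA hB hZ e hl]]]] := goodHp skewW uU kU good_g tm0 td.
    by rewrite sgb' !beta_tau2.
  exists A, B, Z; split=> //; apply: Keq_trans e.
  exact/Keq_sym/(Keq_le td hp0e).
rewrite mutWE in hA hB hZ e.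
have pm : omW W' m U_(k)%MM <= 0 by rewrite om_mut oppr_le0 sgb'.
have [A' [B' [hA' hB' e' hl']]] := fact_cons skW' dk Z (mdeg m) pm hA hB.
exists A', B', Z; split=> //; last by rewrite hl' hl -lam_ini.
apply: Keq_trans (Keq_sym (Keq_le md conj_Keq)) _.
exact: Keq_trans (Keq_cons skW' _ e) e'.
Qed.

End MutationInvariance.

(** * The expansion of a cluster variable *)

Section CoefficientExpansion.
Variables (r : nat) (W : 'I_r -> 'I_r -> rat).
Hypothesis skewW : forall i j, W i j = - W j i.
Notation mon := 'X_{1..r}.
Notation ser := (ser r).
Notation letter := (letter r).
Notation om := (om W).
Implicit Types (m n u p q : mon) (l : letter) (w : seq letter).
Implicit Types (phi psi : 'I_r -> rat).
Notation act := (act W).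
Notation K := (K W).
Notation Keq := (Keq W).
Notation dg := (@dg r).
Notation vfun := (vfun r).
Implicit Types (v : vfun).
Notation wadm := (wadm W).
Notation MT := (fun _ : mon => True).
Variables (o : 'I_r) (dd : 'I_r -> nat) (U : seq 'I_r).
Hypothesis uU : uniq U.
Hypothesis oU : o \in U.
Hypothesis dd0 : forall i, (0 < dd i)%N.
Notation inis := (@inis r dd U).
Definition Oo : 'I_r -> rat := fun i => (i == o)%:R.

Lemma Oo_ge0 i : 0 <= Oo i. Proof. exact: ler0n. Qed.

Lemma wt_Oo m : wt Oo m = (m o)%:R.
Proof.
rewrite wtE (bigD1 o) //= /Oo eqxx mulr1 big1 ?addr0 // => i /negbTE ->.
by rewrite mulr0.
Qed.

Lemma K_letters0 phi w m : (forall l, l \in w -> wt phi l.1 = 0) -> K phi w m = 0.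
Proof.
elim: w m => //= l w IH m h; rewrite (@eq_actl _ W _ _ (fun=> 0)) => [|u _]; last first.
  by apply: IH => l' h'; apply: h; rewrite inE h' orbT.
rewrite actl_zero addr0 /Kl big1 // => j _.
by rewrite h ?mem_head // mulr0 mul0r mulr0.
Qed.

Notation fo := (fun l : letter => wt Oo l.1 == 0).

Lemma Keq_fo d w w' : Keq d w w' -> Keq d (filter fo w) (filter fo w').
Proof.
move/KeqP => h; apply/KeqP => m md; case: (eqVneq (wt Oo m) 0) => e.
  by rewrite -!(K_wt_filter W _ _ Oo_ge0 e) h.
have cT : closed (fun q => wt Oo q == 0) by move=> p q /eqP a /eqP c; rewrite wtD a c addr0.
have z t : K dg (filter fo t) m = 0.
  apply: (K_suppN _ _ cT _ e); apply/allP => l; rewrite mem_filter => /andP[-> _].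
  by rewrite orbT.
by rewrite !z.
Qed.

Lemma wt_div phi m q i : m = (q *+ i.+1)%MM -> (wt phi m == 0) = (wt phi q == 0).
Proof. by move=> ->; rewrite wtMn mulf_eq0 pnatr_eq0. Qed.

Lemma lam_fo m w : lam m (filter fo w) = if wt Oo m == 0 then lam m w else 0.
Proof.
case: ifPn => e; last first.
  apply: (lam_out (T := fun q => wt Oo q == 0)) => [|q i em]; last by rewrite -(wt_div _ em).
  by apply/allP => l; rewrite mem_filter => /andP[-> _]; rewrite orbT.
rewrite /lam big_filter [RHS](bigID fo) /= [X in _ + X]big1 ?addr0 // => l nl.
rewrite big1 // => j _; case: eqP => [em|]; last by rewrite mul0r.
by rewrite -(wt_div _ em) e in nl.
Qed.

Lemma lam_o m : lam m [:: (U_(o)%MM, (dd o)%:R)] = if wt Oo m == 0 then 0 else lam m inis.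
Proof.
have w1 q : wt Oo (q : mon) == 0 -> q != U_(o)%MM by apply: contraTneq => ->; rewrite wt_Oo mnm1E eqxx.
case: ifPn => e.
  apply: (lam_out (T := fun q => wt Oo q != 0)) => [|q i em]; last by rewrite -(wt_div _ em) negbK.
  by rewrite /win /= wt_Oo mnm1E eqxx orbT.
rewrite (lam_ini dd uU oU) [X in _ = X + _](lam_out (T := fun q => wt Oo q == 0)) ?add0r // => [|q i em].
  apply/allP => l; rewrite mem_filter => /andP[h /mapP[i _ el]].
  by move: h; rewrite el wt_Oo /= mnm1E eq_mnm1 => /negbTE ->; rewrite orbT.
by rewrite -(wt_div _ em).
Qed.

(* As om(e_o, -) >= 0, the letter e_o can always be moved to the left. *)
Lemma Good_o g d : (forall j, 0 <= W o j) -> Good W inis g d ->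
  Good W inis ((U_(o)%MM, (dd o)%:R) :: filter fo g) d.
Proof.
move=> Wo good m m0 md; have [A [B [Z [hA hB hZ e hl]]]] := good m m0 md.
have wf (T : pred mon) w : win T w -> win T (filter fo w).
  by move=> /allP h; apply/allP => l; rewrite mem_filter => /andP[_ /h].
have mo : om m U_(o)%MM <= 0.
  rewrite (omC skewW) oppr_le0 (omC skewW) om_coord -sumrN; apply: sumr_ge0 => i _.
  by rewrite om1 (skewW i) mulrN opprK mulr_ge0 // ler0n.
have [A' [B' [hA' hB' e' hl']]] := fact_cons skewW (dd o)%:R (filter fo Z) (mdeg m) mo (wf _ _ hA) (wf _ _ hB).
exists A', B', (filter fo Z); split=> //.
- exact: wf.
- by apply: Keq_trans e'; apply: (Keq_cons skewW); rewrite -!filter_cat; apply: Keq_fo.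
by rewrite hl' lam_fo lam_o hl; case: ifP => _; rewrite ?addr0 ?add0r.
Qed.

(* P is the part of degree one in e_o of the cocycle, divided by the multiplicity of e_o. *)
Definition Inv (P : mon -> rat) := forall d g, Good W inis g d ->
  forall m, (mdeg m <= d)%N -> m o = 1%N -> K Oo g m = (dd o)%:R * P m.

(** By uniqueness the good element is the letter e_o followed by letters without e_o, and only the
    linear term of the logarithm of e_o has degree one in e_o. *)
Lemma Inv_init : (forall j, 0 <= W o j) -> Inv (delta U_(o)%MM).
Proof.
move=> Wo d g good m md mo.
rewrite (K_det skewW Oo (Good_uniq skewW good (Good_o Wo good)) md) /=.
rewrite (@eq_actl _ W _ _ (fun=> 0)) => [|u _]; last first.
  by apply: K_letters0 => l; rewrite mem_filter => /andP[/eqP].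
rewrite actl_zero addr0 /Kl /delta.
have -> : mdeg m = (mdeg m).-1.+1.
  by rewrite prednK // mdegE (bigD1 o) //= mo.
rewrite big_ord_recl big1 => [|j _].
  by rewrite addr0 mulm1n wt_Oo /= mnm1E eqxx expr0 invr1 !mulr1 mulrC.
case: eqP => [e|]; last by rewrite mul0r.
by have := congr1 (fun q : mon => q o) e; rewrite mo mulmnE mnm1E eqxx mul1n lift0.
Qed.

Hypothesis admW : forall i j, i \in U -> (dd i)%:R * W i j \is a Num.int.

Lemma om_int i m : i \in U -> (dd i)%:R * om U_(i)%MM m \is a Num.int.
Proof.
move=> iU; rewrite (omC skewW) om_coord mulrN mulr_sumr -sumrN; apply: rpred_sum => j _.
rewrite om1 skewW mulrN mulrN opprK mulrCA; apply: rpredM; [exact: rpred_nat|exact: admW].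
Qed.

Lemma adm_inis : wadm MT inis.
Proof. by move=> l /mapP[i iU ->] m _; apply: om_int. Qed.

Lemma mu_inis n : 0 <= mu inis n.
Proof. by apply: mu_ge0 => l /mapP[i _ ->]; apply: ler0n. Qed.

(** Letters and series both have degree at least one in e_o, so any correction has degree at least
    two. *)
Lemma act_o w (x : ser) (N : mon) : (forall l, l \in w -> (0 < l.1 o)%N) -> (forall u, u o = 0%N -> x u = 0) ->
  N o = 1%N -> act w x N = x N.
Proof.
move=> hw hx No; pose T : pred mon := fun q => q o != 0%N.
have cT : closed T by move=> p q hp hq; rewrite /T mnmDE addn_eq0 (negbTE hp).
have xT u : x u != 0 -> T u by rewrite /T => xu; apply: contraNneq xu => uo; rewrite hx.
elim: w hw => //= l w IH hw; have hw' l' : l' \in w -> (0 < l'.1 o)%N by move=> h; apply: hw; rewrite inE h orbT.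
have lo := hw _ (mem_head _ _); rewrite -(IH hw').
rewrite /actlW big_mkcond big_ord_recl big1 => [|j _].
  by rewrite /= mulm0n subm0 mul1r addr0 ifT //; apply/mnm_lepP => i; rewrite mnm0E.
case: ifP => // le; rewrite [X in _ * X](_ : _ = 0) ?mulr0 //; apply/eqP.
have : ~~ T (N - l.1 *+ lift ord0 j)%MM.
  rewrite /T negbK mnmBE mulmnE No lift0 subn_eq0 muln_gt0 lo //.
apply: contraR => h; apply: (act_supp cT _ xT h).
by apply/allP => l' /hw' h1; rewrite /T -lt0n h1 orbT.
Qed.

(* Positivity is applied to the line of sight with V_i = X^i for i <> o, and V_o chosen so
   that V vanishes on N: the letters of degree 0 in e_o are all positive for V. *)
Lemma coef_ge0 P (N : mon) : Inv P -> N o = 1%N -> 0 <= P N.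
Proof.
move=> inv No; have [g [good ag]] := Good_ex skewW adm_inis (mdeg N).
have N0 : N != 0%MM by apply: contraTneq isT => e; move: No; rewrite e mnm0E.
have e := inv _ _ good N (leqnn _) No.
suff : 0 <= K Oo g N by rewrite e pmulr_rge0 // ltr0n.
pose X i : {poly rat} := 'X^i.
pose V i : {poly rat} := if i == o then - \sum_(j < r | j != o) (N j)%:R *: 'X^j else 'X^i.
have linV f : lin V f = \sum_(j < r | j != o) (f j - f o * (N j)%:R) *: 'X^j.
  rewrite /lin (bigD1 o) //= {1}/V eqxx scalerN scaler_sumr -sumrN -big_split.
  by apply: eq_bigr => j jo; rewrite /V (negbTE jo) scalerBl scalerA addrC.
have gen : generic V N.
  split; first by rewrite /vl linV big1 // => j _; rewrite No mul1r subrr scale0r.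
  move=> f hf; exists (f o) => i; case: (eqVneq i o) => [->|io]; first by rewrite No mulr1.
  have := congr1 (fun p : {poly rat} => p`_i) hf; rewrite linV coef_sum coef0 (bigD1 i) //=.
  rewrite coefZ coefXn eqxx mulr1 big1 => [|j /andP[_ ji]]; last first.
    by rewrite coefZ coefXn eq_sym (inj_eq val_inj) (negbTE ji) mulr0.
  by rewrite addr0 => /eqP; rewrite subr_eq0 => /eqP.
have [A [B [Z lfABZ]]] := lf_ex skewW g (mdeg N) (addv_vl V).
have := positivity skewW good ag mu_inis (leqnn _) N0 gen lfABZ N0 (leqnn _).
have e1 := lf_proper skewW lfABZ; case: lfABZ => /prp_win hA /prp_win hB /prp_win hZ _.
rewrite -(mu_proper B N0 (leqnn _)) (K_det skewW Oo e1 (leqnn _)).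
have posV n : n != 0%MM -> n o = 0%N -> pos (vl V) n.
  move=> n0 no; rewrite /pos; have cf t : (vl V n)`_t = \sum_(j < r | j != o) (n j)%:R * (t == j :> nat)%:R.
    rewrite /vl linV coef_sum; apply: eq_bigr => j _.
    by rewrite no mul0r subr0 coefZ coefXn.
  rewrite lt_neqAle eq_sym lead_coef_eq0 lead_coefE cf sumr_ge0 ?andbT => [|j _]; last first.
    by rewrite mulr_ge0 ?ler0n.
  apply: contra n0 => /eqP z; apply/eqP/mnmP => i; rewrite mnm0E.
  case: (eqVneq i o) => [->//|io]; have := cf i; rewrite z coef0 (bigD1 i) //= eqxx mulr1.
  move/esym/eqP; rewrite paddr_eq0 ?ler0n ?sumr_ge0 // => [|j _]; last by rewrite mulr_ge0 ?ler0n.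
  by case/andP => /eqP/eqP; rewrite pnatr_eq0 => /eqP.
(* The letters of the left and middle parts all involve e_o, hence act trivially in degree one. The
   cocycle at N is therefore that of the middle part, whose only letters reaching N have exponent
   N. *)
have npo (T : pred mon) w : win T (filter (proper (mdeg N)) w) -> (forall n, T n -> ~~ pos (vl V) n) ->
    forall l, l \in filter (proper (mdeg N)) w -> (0 < l.1 o)%N.
  move=> /allP hw hT l lw; have := hw _ lw; move: lw; rewrite mem_filter => /andP[/and3P[l2 l1 _] _].
  rewrite (negbTE l2) /= => /hT; apply: contraNT; rewrite -eqn0Ngt => /eqP; exact: posV.
have z0 u t : u o = 0%N -> K Oo t u = 0.
  by move=> uo; apply: K_wt0; [exact: Oo_ge0|rewrite wt_Oo uo].
have zN : zer (vl V) N by rewrite /zer gen.1.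
set A1 := filter _ A; set B1 := filter _ B in hB *; set Z1 := filter _ Z.
rewrite !K_cat (K_suppN _ _ (closed_neg (addv_vl V)) hA); last first.
  by apply: contraL zN => h; rewrite (neg_zer h).
rewrite act_o //; first last.
- by move=> u; apply: z0.
- by apply: (npo _ _ hA) => n h; rewrite (neg_pos h).
rewrite K_cat act_o //; first last.
- by move=> u; apply: z0.
- by apply: (npo _ _ hB) => n h; apply: contraL h => /pos_zer ->.
rewrite (K_suppN _ _ (closed_pos (addv_vl V)) hZ); last by apply: contraL zN => h; rewrite (pos_zer h).
rewrite add0r addr0 (K_lam Oo); last first.
  apply: win_sub hB => n zn; rewrite (omC skewW) oppr_eq0; apply/eqP.
  exact: (generic_om skewW gen zn).
rewrite wt_Oo No mul1r; congr (0 <= _).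
rewrite /mu /lam big_mkcond; apply: eq_bigr => l _.
rewrite -(prednK (mdeg_gt0 N0)) big_ord_recl mulm1n big1 => [|j _].
  by rewrite addr0 eq_sym; case: eqP => _; rewrite ?mul0r // mul1r /lamc expr0 expr1n invr1 !mulr1.
case: eqP => [em|]; last by rewrite mul0r.
have := congr1 (fun q : mon => q o) em; rewrite No mulmnE lift0; move: (nat_of_ord j) (l.1 o); clear.
by move=> i [|a] //; rewrite mulnSr => /eqP; rewrite eqn_leq; lia.
Qed.

End CoefficientExpansion.

Notation OoW := Oo (only parsing).

(** * The expansion under one mutation *)

Section MutStep.
Variables (r : nat) (W : 'I_r -> 'I_r -> rat).
Hypothesis skewW : forall i j, W i j = - W j i.
Notation mon := 'X_{1..r}.
Notation ser := (ser r).
Notation letter := (letter r).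
Notation om := (om W).
Notation actl := (actl W).
Implicit Types (m n u p q : mon) (l : letter) (w : seq letter).
Implicit Types (phi psi : 'I_r -> rat).
Notation K := (K W).
Notation Keq := (Keq W).
Notation vfun := (vfun r).
Implicit Types (v : vfun).
Notation wadm := (wadm W).
Variables (o k : 'I_r) (dd : 'I_r -> nat) (U : seq 'I_r).
Notation beta := (@beta r).
Notation Sb c := (Sb k c).
Notation S0 c := (S0 k c).
Notation Ek := (Ek k).
Notation tau := (tau k).
Notation tw := (tw k).
Notation Oo := (Oo o).
Notation inis := (@inis r dd U).
Notation dk := ((dd k)%:R : rat).
Hypothesis uU : uniq U.
Hypothesis kU : k \in U.
Hypothesis ok : o != k.
Hypothesis dd0 : forall i, (0 < dd i)%N.
Hypothesis admW : forall i j, i \in U -> (dd i)%:R * W i j \is a Num.int.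
Variables (b bp : 'I_r -> nat).
Hypothesis hb : forall i, (b i)%:R - (bp i)%:R = W i k * dk.
Hypothesis bk : b k = 0%N.
Hypothesis bpk : bp k = 0%N.
Hypothesis bb : forall i, (b i * bp i = 0)%N.
Notation W' := (mutW W k b).

Lemma mut_ex g d : Good W inis g (mdepth b bp d) -> exists h0,
  [/\ forall l, l \in h0 -> Sb b l.1, Keq (mdepth b bp d) (Ek (- dk) :: g) h0 &
      Good W' inis (tw b h0 ++ [:: Ek dk]) d].
Proof.
move=> good; have ms m := mut_support skewW uU kU (dd0 k) hb bk bpk good (m := m).
have [|h0 h0S h0e] := supp_word skewW bk (fun m md => (ms m md).1).
  exact: (K0H skewW uU kU good).
have [||hp0 hp0S hp0e] := supp_word skewW (h := g ++ [:: Ek (- dk)]) (d := d) (b := b) (bp := bp) bpk.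
- by move=> m md; rewrite K_rcons_Ek; apply: (ms m md).2.
- exact: (K0Hp skewW uU kU good).
by exists h0; split=> //; apply: (mut_good skewW uU kU (dd0 k) hb bk bpk bb good h0S h0e hp0S hp0e).
Qed.

Lemma Kl_Ek0 phi a m : phi k = 0 -> Kl phi (Ek a) m = 0.
Proof. by move=> pk; rewrite /Kl big1 // => j _; rewrite wt1 pk mulr0 mul0r mulr0. Qed.

Lemma Oo_k : Oo k = 0. Proof. by rewrite /OoW eq_sym (negbTE ok). Qed.

Lemma Ek_actx a (x : ser) m : actl (Ek a) x m =
  \sum_(j < (m k).+1) binr (a * om U_(k)%MM m) j * x (m - U_(k) *+ j)%MM.
Proof.
rewrite /actlW /=; have mk : (m k <= mdeg m)%N by rewrite mdegE (bigD1 k) //= leq_addr.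
rewrite [RHS](@big_ord_widen _ _ _ _ (mdeg m).+1 (fun j => binr (a * om U_(k)%MM m) j * x (m - U_(k) *+ j)%MM)) //.
by apply: eq_bigl => j; rewrite Ek_le.
Qed.

(** The effect on the degree-one part of stripping e_k from the left end; [mutP] then relabels the
    exponents. *)
Definition mutQ (P : mon -> rat) : ser := actl (Ek (- dk)) P.
Definition mutP (P : mon -> rat) m : rat := if S0 b m then mutQ P (tau b m) else 0.

Lemma tau_o m : tau b m o = m o.
Proof. by rewrite tauE (negbTE ok). Qed.

Lemma sub_o m j : (m - U_(k) *+ j)%MM o = m o.
Proof. by rewrite mnmBE mulmnE mnm1E eq_sym (negbTE ok) mul0n subn0. Qed.

Lemma mutQ_K P g d m : Inv W o dd U P -> Good W inis g d -> (mdeg m <= d)%N -> m o = 1%N ->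
  K Oo (Ek (- dk) :: g) m = (dd o)%:R * mutQ P m.
Proof.
move=> inv good md mo; rewrite /= Kl_Ek0 ?Oo_k // add0r /mutQ !Ek_actx mulr_sumr.
apply: eq_bigr => -[j /= jm] _; rewrite (inv d g good) ?sub_o //; first by rewrite mulrCA.
by rewrite mdeg_sub ?Ek_le // (leq_trans (leq_subr _ _)).
Qed.

Lemma ini_adm : wadm (fun=> True) inis.
Proof. exact: adm_inis. Qed.

Lemma Inv_step P : Inv W o dd U P -> Inv W' o dd U (mutP P).
Proof.
move=> inv d g' good' m md mo.
have [g [good _]] := Good_ex skewW ini_adm (mdepth b bp d).
have [h0 [h0S h0e good2]] := mut_ex good.
have sW' i j : W' i j = - W' j i by apply: mutW_skew.
rewrite (K_det sW' Oo (Good_uniq sW' good' good2) md).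
rewrite K_cat (@eq_act _ W' _ _ (fun=> 0)) => [|u _]; last first.
  rewrite K1 /Kl big1 // => j _; by rewrite wt1 Oo_k mulr0 mul0r mulr0.
have -> : actW W' (tw b h0) (fun=> 0) m = 0.
  by elim: (tw b h0) m {md mo} => //= l w IH m; rewrite (@eq_actl _ W' _ _ (fun=> 0)) ?actl_zero.
rewrite addr0 /mutP; case: ifPn => hm; last by rewrite mulr0 K_tau_out.
have td : (mdeg (tau b m) <= mdepth b bp d)%N.
  by apply: tau_depth => // i; apply: leq_addr.
rewrite -(mutQ_K inv good td) ?tau_o // (K_det skewW Oo h0e td).
rewrite -(K_tau skewW bk Oo) ?S0_tau //; last by move=> l /h0S/Sb_S0.
rewrite tauK //; apply: eq_K => i; rewrite /sig Oo_k mulr0 addr0 /eta.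
by case: eqP => [->|_]; rewrite ?Oo_k ?mulr0 ?mul1r.
Qed.

(** The Laurent phenomenon: a priori powers of 1 + y^(e_k) in the denominator give infinite strings,
    but the support bound for the stripped word cuts them off. *)
Lemma mutQ_supp P m : Inv W o dd U P -> m o = 1%N -> mutQ P m != 0 -> S0 b m.
Proof.
move=> inv mo; apply: contraR => hm.
have [g [good _]] := Good_ex skewW ini_adm (mdepth b bp (mdeg m)).
have [h0 [h0S h0e _]] := mut_ex good.
have md : (mdeg m <= mdepth b bp (mdeg m))%N.
  by rewrite /mdepth -addnA mulnDl mul1n leq_addr.
have := mutQ_K inv good md mo; rewrite (K_det skewW Oo h0e md).
have -> : K Oo h0 m = 0.
  apply: (K_suppN _ _ (@closed_S0 _ k b) _ hm).
  by apply/allP => l /h0S/Sb_S0 ->; rewrite orbT.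
by move/esym/eqP; rewrite mulf_eq0 pnatr_eq0 gtn_eqF //=.
Qed.

Definition Pok (P : mon -> rat) M := [/\ forall m, P m \is a Num.int,
  forall m, P m != 0 -> (mdeg m <= M)%N, forall m, P m != 0 -> m o = 1%N &
  forall m i, P m != 0 -> i \notin U -> m i = 0%N].

Lemma mutQ_int P M m : Pok P M -> mutQ P m \is a Num.int.
Proof.
case=> hi _ _ _; rewrite /mutQ Ek_actx; apply: rpred_sum => j _; apply: rpredM => //.
by apply: binr_int; rewrite mulNr rpredN; apply: (om_int skewW admW).
Qed.

Lemma mutQ_nz P m : mutQ P m != 0 -> exists2 j, (j <= m k)%N & P (m - U_(k) *+ j)%MM != 0.
Proof.
rewrite /mutQ Ek_actx => h.
case: (pickP (fun j : 'I_(m k).+1 => P (m - U_(k) *+ j)%MM != 0)) => [j hj|no].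
  by exists j => //; rewrite -ltnS.
by rewrite big1 ?eqxx // in h => j _; move/negbFE/eqP: (no j) => ->; rewrite mulr0.
Qed.

Lemma mutQ_ok P M m : Pok P M -> mutQ P m != 0 ->
  [/\ m o = 1%N, forall i, i \notin U -> m i = 0%N & (mdeg m - m k <= M)%N].
Proof.
case=> _ hM ho hU /mutQ_nz[j jm nz]; split.
- by rewrite -(sub_o m j) ho.
- move=> i iU; have := hU _ i nz iU; rewrite mnmBE mulmnE mnm1E.
  by case: eqP => [e|_]; rewrite ?mul0n ?subn0 //; rewrite -e kU in iU.
have := hM _ nz; rewrite mdeg_sub ?Ek_le // mdegMn mdeg1 mul1n.
by move: jm; clear; lia.
Qed.

Lemma mdeg_subk m : (mdeg m - m k = \sum_(i < r | i != k) m i)%N.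
Proof. by rewrite mdegE (bigD1 k) //= addKn. Qed.

Lemma S0_depth m M : S0 b m -> (mdeg m - m k <= M)%N -> (mdeg m <= (1 + \sum_i b i) * M)%N.
Proof.
move=> hm h; have mk : (m k <= mdeg m)%N by rewrite mdegE (bigD1 k) //= leq_addr.
have bm : (beta b m <= (\sum_i b i) * M)%N.
  rewrite /betaW big_distrl; apply: leq_sum => i _ /=; rewrite mulnC.
  case: (eqVneq i k) => [->|ik]; first by rewrite bk !mul0n.
  by rewrite leq_mul // (leq_trans _ h) // mdeg_subk (bigD1 i) //= leq_addr.
rewrite mulnDl mul1n -(subnK mk) leq_add //; exact: leq_trans hm bm.
Qed.

Lemma mutP_ok P M : Pok P M -> Pok (mutP P) ((1 + \sum_i b i) * M)%N.
Proof.
move=> hP; have nz m : mutP P m != 0 -> S0 b m /\ mutQ P (tau b m) != 0.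
  by rewrite /mutP; case: ifP => //; rewrite eqxx.
split.
- by move=> m; rewrite /mutP; case: ifP => _; [apply: mutQ_int hP|apply: rpred0].
- move=> m /nz[hm /(mutQ_ok hP)[_ _ h]].
  have e : (mdeg (tau b m) - tau b m k = mdeg m - m k)%N.
    by rewrite !mdeg_subk; apply: eq_bigr => i ik; rewrite tauE (negbTE ik).
  by rewrite e in h; apply: S0_depth.
- by move=> m /nz[_ /(mutQ_ok hP)[<- _ _]]; rewrite tau_o.
- move=> m i /nz[_ /(mutQ_ok hP)[_ h _]] iU; rewrite -(h i iU) tauE.
  by case: eqP => // e; rewrite e kU in iU.
Qed.

End MutStep.

(** * Evaluation of expansions at a cluster *)

Section Iota.
Variable F : fieldType.
(* Only meaningful for integers, on which it is a ring morphism; ratr would require F to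
   have characteristic 0. *)
Definition iota (x : rat) : F := (numq x)%:~R.
Lemma iota_int (a : int) : iota a%:~R = a%:~R. Proof. by rewrite /iota numq_int. Qed.
Lemma iota0 : iota 0 = 0. Proof. exact: (iota_int 0). Qed.
Lemma iota_nat (a : nat) : iota a%:R = a%:R. Proof. exact: (iota_int a). Qed.
Lemma iotaD x y : x \is a Num.int -> y \is a Num.int -> iota (x + y) = iota x + iota y.
Proof. by move=> /intrP[a ->] /intrP[b ->]; rewrite -rmorphD !iota_int rmorphD. Qed.
Lemma iotaM x y : x \is a Num.int -> y \is a Num.int -> iota (x * y) = iota x * iota y.
Proof. by move=> /intrP[a ->] /intrP[b ->]; rewrite -rmorphM !iota_int rmorphM. Qed.
Lemma iota_sum (I : Type) (s : seq I) (P : pred I) (f : I -> rat) : (forall i, f i \is a Num.int) ->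
  iota (\sum_(i <- s | P i) f i) = \sum_(i <- s | P i) iota (f i).
Proof.
move=> h; elim: s => [|i s IH]; first by rewrite !big_nil iota0.
by rewrite !big_cons; case: ifP => _; rewrite ?iotaD ?IH // rpred_sum.
Qed.
Lemma numq_intE x : x \is a Num.int -> (numq x)%:~R = x.
Proof. by move=> /intrP[a ->]; rewrite numq_int. Qed.
End Iota.

Section Evaluation.
Variables (r : nat) (W : 'I_r -> 'I_r -> rat).
Hypothesis skewW : forall i j, W i j = - W j i.
Notation mon := 'X_{1..r}.
Notation letter := (letter r).
Notation om := (om W).
Notation actl := (actl W).
Implicit Types (m n u p q : mon) (l : letter) (w : seq letter).
Implicit Types (phi psi : 'I_r -> rat).
Notation vfun := (vfun r).
Implicit Types (v : vfun).
Variables (o k : 'I_r) (dd : 'I_r -> nat) (U : seq 'I_r).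
Notation S0 c := (S0 k c).
Notation Ek := (Ek k).
Notation tau := (tau k).
Notation dk := ((dd k)%:R : rat).
Hypothesis uU : uniq U.
Hypothesis kU : k \in U.
Hypothesis ok : o != k.
Hypothesis dd0 : forall i, (0 < dd i)%N.
Hypothesis admW : forall i j, i \in U -> (dd i)%:R * W i j \is a Num.int.
Hypothesis evW : forall i j, i \in U -> j != o -> W i j * (dd j)%:R \is a Num.int.
Variables (b bp : 'I_r -> nat).
Hypothesis hb : forall i, (b i)%:R - (bp i)%:R = W i k * dk.
Hypothesis bk : b k = 0%N.
Hypothesis bpk : bp k = 0%N.
Hypothesis bb : forall i, (b i * bp i = 0)%N.
Notation W' := (mutW W k b).
Variable F : fieldType.
Notation iota := (iota F).
Variable A : 'I_r -> F.
Hypothesis A0 : forall j, j != o -> A j != 0.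
Variables (pp pm : 'I_r -> nat).
Hypothesis hp : forall j, j != o -> (pp j)%:R - (pm j)%:R = W k j * (dd j)%:R.
Hypothesis pmk : pm k = 0%N.
Hypothesis bpm : forall j, j != o -> (b j * dd j = dd k * pm j)%N.

Section Ep.
Variable B : 'I_r -> F.
Hypothesis B0 : forall j, j != o -> B j != 0.
Definition Ep (z : 'I_r -> int) : F := \prod_(j | j != o) B j ^ z j.
Lemma eq_Ep z z' : (forall j, j != o -> z j = z' j) -> Ep z = Ep z'.
Proof. by move=> h; apply: eq_bigr => j jo; rewrite h. Qed.
Lemma Ep_add z z' : Ep (fun j => z j + z' j) = Ep z * Ep z'.
Proof. by rewrite -big_split; apply: eq_bigr => j jo; rewrite expfzDr ?B0. Qed.
Lemma Ep_scale z t : Ep (fun j => z j * t) = Ep z ^ t.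
Proof.
rewrite /Ep; apply: (big_rec2 (fun x y => x = y ^ t)) => [|j x y _ ->]; first by rewrite exp1rz.
by rewrite expfzMl exprz_exp.
Qed.
End Ep.

(** Exponents of the monomial in the cluster attached to y^m; for m = e_k it is the ratio of the two
    monomials of the exchange relation. *)
Definition zx (V : 'I_r -> 'I_r -> rat) m j : int := numq (omW V m U_(j)%MM * (dd j)%:R).
Definition Ev (V : 'I_r -> 'I_r -> rat) B m : F := Ep B (zx V m).
Definition US m := forall i, i \notin U -> m i = 0%N.

Lemma zx_int m j : US m -> j != o -> om m U_(j)%MM * (dd j)%:R \is a Num.int.
Proof.
move=> hm jo; rewrite om_coord mulr_suml; apply: rpred_sum => i _; rewrite om1 -mulrA.
case: (boolP (i \in U)) => iU; first by apply: rpredM; [apply: rpred_nat|apply: evW].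
by rewrite hm // mul0r.
Qed.

Lemma zxE m j : US m -> j != o -> (zx W m j)%:~R = om m U_(j)%MM * (dd j)%:R :> rat.
Proof. by move=> hm jo; apply/numq_intE/zx_int. Qed.

Lemma Ev_add m n : US m -> US n -> Ev W A (m + n)%MM = Ev W A m * Ev W A n.
Proof.
move=> hm hn; rewrite /Ev -(Ep_add A0); apply: eq_Ep => j jo.
have hmn : US (m + n)%MM by move=> i iU; rewrite mnmDE hm ?hn.
by apply: (@intr_inj rat); rewrite rmorphD /= !zxE // (omDl skewW) mulrDl.
Qed.

Lemma US_k : US U_(k)%MM.
Proof. by move=> i iU; rewrite mnm1E; case: eqP => // e; rewrite -e kU in iU. Qed.

Notation Y := (Ev W A U_(k)%MM).

Lemma US_addk m j : US m -> US (m + U_(k) *+ j)%MM.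
Proof. by move=> hm i iU; rewrite mnmDE mulmnE hm ?US_k. Qed.

Lemma Ev_addk m j : US m -> Ev W A (m + U_(k) *+ j)%MM = Ev W A m * Y ^+ j.
Proof.
move=> hm; elim: j => [|j IH]; first by rewrite mulm0n addm0 mulr1.
by rewrite mulmSr addmA Ev_add ?IH ?exprSr ?mulrA //; [apply: US_addk|apply: US_k].
Qed.

Definition sx m : int := numq (dk * om U_(k)%MM m).
Lemma sxE m : (sx m)%:~R = dk * om U_(k)%MM m :> rat.
Proof. by apply/numq_intE/(om_int skewW admW). Qed.

Lemma sx_shift m j : sx (m + U_(k) *+ j)%MM = sx m.
Proof. by rewrite /sx omDr omMr (om_id skewW) mulr0 addr0. Qed.

Lemma pp_pm j : j != o -> zx W U_(k)%MM j = (pp j)%:Z - (pm j)%:Z.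
Proof.
move=> jo; apply: (@intr_inj rat); rewrite zxE //; last exact: US_k.
by rewrite om1 -hp // rmorphB.
Qed.

Variable A' : 'I_r -> F.
Hypothesis hA' : forall j, j != o -> A' j = if j == k
  then (\prod_(i | i != o) A i ^+ pp i + \prod_(i | i != o) A i ^+ pm i) / A k else A j.
Hypothesis A'k : A' k != 0.

Lemma A'kE : A' k = Ep A (fun j => (pm j)%:Z) * (1 + Y) / A k.
Proof.
rewrite hA' ?eqxx 1?eq_sym //; congr (_ / _); rewrite mulrDr mulr1 addrC; congr (_ + _).
rewrite /Ev -(Ep_add A0); apply: eq_bigr => j jo.
by rewrite pp_pm // addrC subrK.
Qed.

Lemma Y1 : 1 + Y != 0.
Proof. by apply: contraNneq A'k => h; rewrite A'kE h mulr0 mul0r. Qed.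

(** The exchange relation reads A'_k A_k = (product of the A_j^(pm j)) times 1 + Y; [bpm] matches
    the powers of the A_j with the change of basis, and the power of 1 + Y remains. *)
Lemma Ev_tau m : US m -> S0 b m -> Ev W' A' (tau b m) = Ev W A m * (1 + Y) ^ sx m.
Proof.
move=> hm sm; have ko : k != o by rewrite eq_sym.
have skm : sx m = - zx W m k.
  apply: (@intr_inj rat); rewrite rmorphN /= sxE zxE // (omC skewW) mulrN mulrC //.
have z1 j : j != o -> j != k -> zx W' (tau b m) j = zx W m j - (pm j)%:Z * sx m.
  move=> jo jk; have e : omW W' (tau b m) U_(j)%MM * (dd j)%:R = (zx W m j - (pm j)%:Z * sx m)%:~R.
    rewrite rmorphB rmorphM /= sxE zxE // /omW wt1 (omv_tau skewW bk _ sm) /sig /eta (negbTE jk) mul1r.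
    rewrite mulrDl -/(om m U_(j)%MM) -{1}(wt1 (omv W m) j) -/(om m U_(j)%MM); congr (_ + _).
    have := congr1 (fun i : nat => i%:R : rat) (bpm jo); rewrite !natrM => e.
    rewrite mulrAC e -(wt1 (omv W m) k) -/(om m U_(k)%MM) (omC skewW m) -?pmulrn /omW; ring.
  by rewrite /zx e numq_int.
have z2 : zx W' (tau b m) k = sx m.
  have e : omW W' (tau b m) U_(k)%MM * (dd k)%:R = (sx m)%:~R.
    rewrite sxE /omW wt1 (omv_tau skewW bk _ sm) /sig /eta eqxx bk mul0r addr0.
    by rewrite -{1}(wt1 (omv W m) k) -/(om m U_(k)%MM) (omC skewW m) /omW; ring.
  by rewrite /zx e numq_int.
rewrite /Ev /Ep (bigD1 k) //= z2 A'kE.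
have -> : \prod_(j < r | (j != o) && (j != k)) A' j ^ zx W' (tau b m) j =
   \prod_(j < r | (j != o) && (j != k)) A j ^ (zx W m j - (pm j)%:Z * sx m).
  by apply: eq_bigr => j /andP[jo jk]; rewrite hA' // (negbTE jk) z1.
rewrite [in RHS](bigD1 k) //= !expfzMl -(Ep_scale A) exprz_inv.
rewrite {1}/Ep (bigD1 k) //= pmk mul0r expr0z mul1r.
have -> : \prod_(j < r | (j != o) && (j != k)) A j ^ (zx W m j - (pm j)%:Z * sx m) =
  \prod_(j < r | (j != o) && (j != k)) A j ^ zx W m j *
  (\prod_(j < r | (j != o) && (j != k)) A j ^ ((pm j)%:Z * sx m))^-1.
  rewrite -prodfV -big_split; apply: eq_bigr => j /andP[jo _] /=.
  by rewrite expfzDr ?A0 // invr_expz.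
set X := \prod_(j < r | _) A j ^ ((pm j)%:Z * sx m).
have X0 : X != 0 by apply/prodf_neq0 => j /andP[jo _]; rewrite expfz_neq0 ?A0.
have -> : zx W m k = - sx m by rewrite skm opprK.
by field.
Qed.

Lemma sum_monsF (M : nat) (u : mon) (G : mon -> F) :
  \sum_(m <- mons r M) (m == u)%:R * G m = if (mdeg u <= M)%N then G u else 0.
Proof.
case: ifP => h.
  rewrite (bigD1_seq u) ?mem_mons ?mons_uniq //= eqxx mul1r big1 ?addr0 // => m /negbTE ->.
  by rewrite mul0r.
rewrite big_seq big1 // => m; rewrite mem_mons => mM.
by case: eqP => [e|_]; [rewrite -e mM in h|rewrite mul0r].
Qed.

Lemma sum_mons_ext (M M' : nat) (C : pred mon) (G : mon -> F) : (M <= M')%N ->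
  (forall m, G m != 0 -> (mdeg m <= M)%N) ->
  \sum_(m <- mons r M' | C m) G m = \sum_(m <- mons r M | C m) G m.
Proof.
move=> le h; rewrite big_mkcond [RHS]big_mkcond.
rewrite (bigID (fun m => mdeg m <= M)%N) /= [X in _ + X]big1 ?addr0 => [|m hm]; last first.
  by case: ifP => // _; apply/eqP; apply: contraNT hm; apply: h.
rewrite -big_filter; apply: perm_big; apply: uniq_perm; rewrite ?filter_uniq ?mons_uniq // => m.
rewrite mem_filter !mem_mons; case: leqP => //= hm; exact: leq_trans hm le.
Qed.

(* The sum over a string m + N e_k is multiplied by (1 + Y)^nn when Ek a acts. *)
Lemma ev_shift (R : mon -> rat) (a : rat) (C : pred mon) (nn : mon -> nat) (w : mon -> F) M M' :
  (forall m, R m \is a Num.int) -> (forall m, R m != 0 -> (mdeg m <= M)%N /\ US m) ->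
  (forall p j, C (p + U_(k) *+ j)%MM = C p) -> (forall p j, w (p + U_(k) *+ j)%MM = w p) ->
  (forall p, C p -> a * om U_(k)%MM p = (nn p)%:R) ->
  (forall p, (mdeg p <= M)%N -> (M + nn p <= M')%N) ->
  \sum_(m <- mons r M' | C m) iota (actl (Ek a) R m) * (Ev W A m * w m) =
  \sum_(p <- mons r M | C p) iota (R p) * (Ev W A p * w p * (1 + Y) ^+ nn p).
Proof.
move=> Ri Rs Cs ws hn hM.
pose T (p : mon) (j : nat) (m : mon) : rat := (R p * 'C(nn p, j)%:R) * (m == p + U_(k) *+ j)%MM%:R.
have E1 m : C m -> (mdeg m <= M')%N -> actl (Ek a) R m = \sum_(p <- mons r M | C p) \sum_(j < M'.+1) T p j m.
  move=> Cm mM; rewrite (@eq_actl _ W _ _ (fun u => \sum_(p <- mons r M) R p * delta p u)) => [|u _]; last first.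
    case: (leqP (mdeg u) M) => hu; first exact: expand.
    have -> : R u = 0 by apply/eqP; apply: contraTT hu => /Rs[+ _]; rewrite -leqNgt.
    rewrite big_seq big1 // => p; rewrite mem_mons /delta => pM.
    by case: eqP => [e|_]; rewrite ?mulr0 //; rewrite -e leqNgt hu in pM.
  rewrite actl_sum [RHS]big_mkcond; apply: eq_bigr => p _; rewrite (actl_delta skewW _ _ mM) /=.
  case: ifPn => Cp; last first.
    rewrite big1 ?mulr0 // => j _; rewrite /delta; case: eqP => [e|_]; rewrite ?mulr0 //.
    by rewrite e Cs (negbTE Cp) in Cm.
  by rewrite mulr_sumr; apply: eq_bigr => j _; rewrite hn // binr_nat mulrA.
have Ti p j m : T p j m \is a Num.int by rewrite /T !rpredM ?rpred_nat.
have Tz p j m : iota (T p j m) = iota (R p) * 'C(nn p, j)%:R * (m == p + U_(k) *+ j)%MM%:R.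
  by rewrite /T !iotaM ?rpredM ?rpred_nat // !iota_nat.
transitivity (\sum_(m <- mons r M' | C m) \sum_(p <- mons r M | C p) \sum_(j < M'.+1)
    iota (R p) * 'C(nn p, j)%:R * ((m == p + U_(k) *+ j)%MM%:R * (Ev W A m * w m))).
  rewrite big_seq_cond [RHS]big_seq_cond; apply: eq_bigr => m; rewrite mem_mons => /andP[mM Cm].
  rewrite E1 // iota_sum => [|p]; last by apply: rpred_sum.
  rewrite mulr_suml; apply: eq_bigr => p _; rewrite iota_sum // mulr_suml.
  by apply: eq_bigr => j _; rewrite Tz -!mulrA.
rewrite exchange_big /= big_seq_cond [RHS]big_seq_cond; apply: eq_bigr => p; rewrite mem_mons => /andP[pM Cp].
rewrite exchange_big /=; case: (eqVneq (R p) 0) => [->|nz].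
  by rewrite iota0 mul0r; apply: big1 => j _; apply: big1 => m _; rewrite !mul0r.
have [_ up] := Rs _ nz.
transitivity (\sum_(j < M'.+1) (iota (R p) * (Ev W A p * w p)) * ('C(nn p, j)%:R * Y ^+ j)).
  apply: eq_bigr => -[j /= _] _; rewrite -mulr_sumr big_mkcond /=.
  rewrite (eq_bigr (fun m => (m == p + U_(k) *+ j)%MM%:R * (Ev W A m * w m))) => [|m _]; last first.
    by case: ifPn => // Cm; case: eqP => [e|_]; rewrite ?mul0r //; rewrite e Cs Cp in Cm.
  rewrite sum_monsF mdegD mdegMn mdeg1 mul1n Ev_addk // ws.
  case: (leqP j (nn p)) => hj; last by rewrite bin_small // !(mul0r, mulr0).
  rewrite ifT; last by apply: leq_trans (hM _ pM); apply: leq_add.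
  by ring.
rewrite -mulr_sumr [RHS]mulrA; congr (_ * _).
have nM : (nn p < M'.+1)%N by rewrite ltnS (leq_trans _ (hM _ pM)) // leq_addl.
rewrite exprDn [RHS](big_ord_widen _ (fun i => 1 ^+ (nn p - i) * Y ^+ i *+ 'C(nn p, i)) nM).
rewrite [RHS]big_mkcond; apply: eq_bigr => -[j /= _] _.
rewrite ltnS; case: leqP => hj; last by rewrite bin_small // mul0r.
by rewrite expr1n mul1r mulr_natl.
Qed.

Definition ev (V : 'I_r -> 'I_r -> rat) B (P : mon -> rat) M : F :=
  \sum_(m <- mons r M) iota (P m) * Ev V B m.

Lemma mutQ_inv P m : actl (Ek dk) (mutQ W k dd P) m = P m.
Proof.
have := act_det skewW (w := [:: Ek dk; Ek (- dk)]) (w' := [::]) (x := P) (y := P) (m := m) (d := mdeg m).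
by apply => //; have := Keq_Ek skewW k (mdeg m) dk [::].
Qed.

(** The factor (1 + Y)^(sx m) of [Ev_tau] undoes the power introduced by [mutQ]. Only finite
    expansions can be evaluated: for sx m >= 0 the series P is expanded from its stripped form, for
    sx m < 0 the stripped form from P. *)
Lemma ev_step P M : Inv W o dd U P -> Pok o U P M ->
  ev W' A' (mutP W k dd b P) ((1 + \sum_i b i) * M) = ev W A P M.
Proof.
move=> inv hP; have hP' := mutP_ok skewW kU ok admW bk hP.
set M2 := ((1 + _) * M)%N in hP' *.
pose Q := mutQ W k dd P.
have Qi m : Q m \is a Num.int by apply: (mutQ_int skewW kU admW m hP).
have Qs m : Q m != 0 -> [/\ S0 b m, US m & (mdeg m <= M2)%N].
  move=> nz; have [h1 h2 h3] := mutQ_ok kU ok hP nz.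
  have hm := mutQ_supp skewW uU kU ok dd0 admW hb bk bpk bb inv h1 nz.
  by split=> //; apply: (S0_depth bk hm).
transitivity (\sum_(m <- mons r M2) iota (Q m) * (Ev W A m * (1 + Y) ^ sx m)).
  have nz (f : mon -> rat) (G : mon -> F) : \sum_(m <- mons r M2) iota (f m) * G m =
     \sum_(m <- [seq m <- mons r M2 | f m != 0]) iota (f m) * G m.
    rewrite big_filter (bigID (fun m => f m != 0)) /= [X in _ + X]big1 ?addr0 //.
    by move=> m; rewrite negbK => /eqP ->; rewrite iota0 mul0r.
  have tQ m : S0 b m -> mutP W k dd b P (tau b m) = Q m by move=> hm; rewrite /mutP S0_tau // tauK.
  rewrite /ev nz [RHS]nz.
  have pe : perm_eq [seq m <- mons r M2 | mutP W k dd b P m != 0]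
      [seq tau b m | m <- [seq m <- mons r M2 | Q m != 0]].
    apply: uniq_perm; first by rewrite filter_uniq ?mons_uniq.
      rewrite map_inj_in_uniq ?filter_uniq ?mons_uniq // => p q.
      rewrite !mem_filter => /andP[/Qs[hp1 _ _] _] /andP[/Qs[hq _ _] _] e.
      by apply/eqP; rewrite -(tau_eq bk) // e.
    move=> m; rewrite mem_filter mem_mons; apply/andP/mapP => [[nzm md]|[q]].
      move: (nzm); rewrite /mutP; case: ifP => hm nzq; last by rewrite eqxx in nzq.
      exists (tau b m); last by rewrite tauK.
      by rewrite mem_filter nzq mem_mons; have [] := Qs _ nzq.
    rewrite mem_filter => /andP[nzq _] ->; have [hq _ _] := Qs _ nzq.
    by split; [rewrite tQ|case: hP' => _ h _ _; apply: h; rewrite tQ].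
  rewrite (perm_big _ pe) /= big_map !big_filter; apply: eq_bigr => m /Qs[hm um _].
  by rewrite tQ // Ev_tau.
have sN m : sx m < 0 -> - dk * om U_(k)%MM m = `|sx m|%N%:R.
  by move=> h; rewrite mulNr -sxE; case: (sx m) h => // t _; rewrite NegzE abszN rmorphN opprK.
have sP m : 0 <= sx m -> dk * om U_(k)%MM m = `|sx m|%N%:R.
  by move=> h; rewrite -sxE; case: (sx m) h.
(* A degree bound for both expansions: a string starting at p is prolonged by at most [|sx p|]. *)
pose M3 := (M2 + M + \sum_(p <- mons r (M2 + M)) `|sx p|)%N.
have M3le p : (mdeg p <= M2 + M)%N -> (M2 + M + `|sx p| <= M3)%N.
  move=> hp1; rewrite leq_add2l (bigD1_seq p) ?mem_mons ?mons_uniq //=; exact: leq_addr.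
have e1 : \sum_(m <- mons r M2 | 0 <= sx m) iota (Q m) * (Ev W A m * (1 + Y) ^ sx m) =
    \sum_(m <- mons r M | 0 <= sx m) iota (P m) * Ev W A m.
  transitivity (\sum_(m <- mons r M3 | 0 <= sx m) iota (actl (Ek dk) Q m) * (Ev W A m * 1)).
    rewrite (@ev_shift Q dk _ (fun m => `|sx m|%N) (fun=> 1) M2 M3) //.
    - by apply: eq_bigr => m hm; rewrite mulr1; case: (sx m) hm.
    - by move=> m /Qs[].
    - by move=> p j; rewrite sx_shift.
    - move=> p hp1; apply: leq_trans (M3le p _); last by rewrite (leq_trans hp1) ?leq_addr.
      by rewrite leq_add2r leq_addr.
  transitivity (\sum_(m <- mons r M3 | 0 <= sx m) iota (P m) * Ev W A m).
    by apply: eq_bigr => m _; rewrite mutQ_inv mulr1.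
  apply: sum_mons_ext => [|m]; first by rewrite /M3 -addnA addnCA leq_addr.
  by case: hP => _ h _ _ nzm; apply: h; apply: contraNneq nzm => ->; rewrite iota0 mul0r.
have e2 : \sum_(m <- mons r M2 | ~~ (0 <= sx m)) iota (Q m) * (Ev W A m * (1 + Y) ^ sx m) =
    \sum_(m <- mons r M | ~~ (0 <= sx m)) iota (P m) * Ev W A m.
  transitivity (\sum_(m <- mons r M3 | ~~ (0 <= sx m)) iota (actl (Ek (- dk)) P m) * (Ev W A m * (1 + Y) ^ sx m)).
    apply/esym/sum_mons_ext => [|m]; first by rewrite /M3 -addnA leq_addr.
    move=> nzm; have [] // : [/\ S0 b m, US m & (mdeg m <= M2)%N].
    by apply: Qs; apply: contraNneq nzm => e; rewrite (_ : actl _ _ _ = 0) ?iota0 ?mul0r.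
  rewrite (@ev_shift P (- dk) (fun m => ~~ (0 <= sx m)) (fun m => `|sx m|%N) (fun m => (1 + Y) ^ sx m) M M3) //.
  - apply: eq_bigr => m; rewrite -ltNge => hm; congr (_ * _); rewrite -mulrA.
    case: (sx m) hm => // t _.
    by rewrite NegzE abszN /= -exprnN mulVf ?mulr1 // expf_neq0 ?Y1.
  - by case: hP.
  - by move=> m nzm; case: hP => _ h _ hU; split; [apply: h|move=> i iU; apply: hU nzm iU].
  - by move=> p j; rewrite sx_shift.
  - by move=> p j; rewrite sx_shift.
  - by move=> p; rewrite -ltNge; apply: sN.
  - move=> p hp1; apply: leq_trans (M3le p _); last by rewrite (leq_trans hp1) ?leq_addl.
    by rewrite leq_add2r leq_addl.
rewrite (bigID (fun m => 0 <= sx m)) /= e1 e2.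
by rewrite /ev [RHS](bigID (fun m => 0 <= sx m)).
Qed.

End Evaluation.

Lemma pos_partE (a : rat) : a \is a Num.int -> (pos_part a)%:R = Num.max a 0 :> rat.
Proof.
move=> ai; rewrite /pos_part truncnK // natrEint le_max lexx orbT andbT.
by case: (lerP a 0) => _; [apply: rpred0|].
Qed.

Lemma pos_part_sub (a : rat) : a \is a Num.int -> (pos_part a)%:R - (pos_part (- a))%:R = a.
Proof.
move=> ai; rewrite !pos_partE ?rpredN //.
by case: (lerP a 0) => h; case: (lerP (- a) 0) => h'; lra.
Qed.

Lemma pos_part_mul0 (a : rat) : (pos_part a * pos_part (- a) = 0)%N.
Proof.
apply/eqP; rewrite muln_eq0 /pos_part; case: (lerP a 0) => h; first by rewrite truncn0.
by rewrite (max_r (x := - a)) ?truncn0 ?eqxx ?orbT // oppr_le0 ltW.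
Qed.

Lemma pos_part0 : pos_part 0 = 0%N. Proof. by rewrite /pos_part max_r // truncn0. Qed.

Lemma pos_part_scale (a c : nat) (x y : rat) : x \is a Num.int -> y \is a Num.int ->
  x * a%:R = y * c%:R -> (pos_part x * a = pos_part y * c)%N.
Proof.
move=> xi yi e; apply/eqP; rewrite -(eqr_nat rat) !natrM !pos_partE //.
have h (z : rat) (i : nat) : Num.max z 0 * i%:R = Num.max (z * i%:R) 0.
  by rewrite maxr_pMl ?ler0n // mul0r.
by rewrite !h e.
Qed.

(** * Seeds *)

Section Matrices.
Variables (r : nat) (W : 'I_r -> 'I_r -> rat) (k : 'I_r) (dd : 'I_r -> nat) (U J : pred 'I_r).
Hypothesis skewW : forall i j, W i j = - W j i.
Hypothesis kU : U k.
Hypothesis kJ : J k.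
Hypothesis dd0 : forall i, (0 < dd i)%N.
Hypothesis admW : forall i j, U i -> (dd i)%:R * W i j \is a Num.int.
Hypothesis evW : forall i j, U i -> J j -> W i j * (dd j)%:R \is a Num.int.
Definition posb (V : 'I_r -> 'I_r -> rat) i : nat := pos_part (V i k * (dd k)%:R).
Definition negb_part (V : 'I_r -> 'I_r -> rat) i : nat := pos_part (- (V i k * (dd k)%:R)).
Notation b := (posb W).
Notation bp := (negb_part W).
Notation W' := (mutW W k b).

Lemma eps_int i : W i k * (dd k)%:R \is a Num.int.
Proof. by rewrite skewW mulNr rpredN mulrC; apply: admW. Qed.

Lemma posb_sub i : (b i)%:R - (bp i)%:R = W i k * (dd k)%:R.
Proof. exact: pos_part_sub (eps_int i). Qed.

Lemma posb_k : b k = 0%N. Proof. by rewrite /posb (W0 skewW) mul0r pos_part0. Qed.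
Lemma negb_k : bp k = 0%N. Proof. by rewrite /negb_part (W0 skewW) mul0r oppr0 pos_part0. Qed.
Lemma posb_mul0 i : (b i * bp i = 0)%N. Proof. exact: pos_part_mul0. Qed.

(** Taken along row k, as in the exchange relation, whereas [posb] is taken along column k, as in
    the change of basis; [posb_posm] relates them through the multipliers. *)
Definition posp (V : 'I_r -> 'I_r -> rat) j : nat := pos_part (V k j * (dd j)%:R).
Definition posm (V : 'I_r -> 'I_r -> rat) j : nat := pos_part (- (V k j * (dd j)%:R)).

Lemma posb_posm j : J j -> (b j * dd j = dd k * posm W j)%N.
Proof.
move=> jJ; rewrite [RHS]mulnC; apply: pos_part_scale; first exact: eps_int.
  by rewrite rpredN; apply: evW.
by rewrite (skewW j); ring.
Qed.

Lemma eta_int i : eta k i \is a Num.int.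
Proof. by rewrite /eta; case: eqP => _; rewrite ?rpredN rpred1. Qed.

(** The term with b_i is integral because b_i d_i = d_k [d_i W(i, k)]_+, which moves the multiplier
    from i to k. *)
Lemma adm_mut i j : U i -> (dd i)%:R * W' i j \is a Num.int.
Proof.
move=> iU; rewrite /mutW !mulrDr.
have h : (b i * dd i = dd k * pos_part ((dd i)%:R * W i k))%N.
  rewrite [RHS]mulnC; apply: pos_part_scale; [exact: eps_int|exact: admW|by ring].
apply: rpredD; first apply: rpredD.
- by rewrite mulrCA; apply: rpredM; rewrite ?admW // rpredM ?eta_int.
- have -> : (dd i)%:R * (eta k i * (b j)%:R * W i k) = eta k i * (b j)%:R * ((dd i)%:R * W i k) by ring.
  by apply: rpredM; [rewrite rpredM ?eta_int ?rpred_nat|exact: admW].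
have -> : (dd i)%:R * ((b i)%:R * eta k j * W k j) = (b i * dd i)%:R * (eta k j * W k j) by rewrite natrM; ring.
have -> : (b i * dd i)%:R * (eta k j * W k j) = (pos_part ((dd i)%:R * W i k))%:R * eta k j * ((dd k)%:R * W k j).
  by rewrite h natrM; ring.
by apply: rpredM; [rewrite rpredM ?eta_int ?rpred_nat|exact: admW].
Qed.

Lemma ev_mut i j : U i -> J j -> W' i j * (dd j)%:R \is a Num.int.
Proof.
move=> iU jJ; rewrite /mutW !mulrDl; have h := posb_posm jJ.
apply: rpredD; first apply: rpredD.
- by rewrite -mulrA; apply: rpredM; rewrite ?evW // rpredM ?eta_int.
- have -> : eta k i * (b j)%:R * W i k * (dd j)%:R = eta k i * W i k * (b j * dd j)%:R by rewrite natrM; ring.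
  have -> : eta k i * W i k * (b j * dd j)%:R = eta k i * (posm W j)%:R * (W i k * (dd k)%:R).
    by rewrite h natrM; ring.
  by apply: rpredM; [rewrite rpredM ?eta_int ?rpred_nat|exact: evW].
have -> : (b i)%:R * eta k j * W k j * (dd j)%:R = (b i)%:R * eta k j * (W k j * (dd j)%:R) by ring.
by apply: rpredM; [rewrite rpredM ?eta_int ?rpred_nat|exact: evW].
Qed.

Lemma mutW_ik i : W' i k = - eta k i * W i k.
Proof. by rewrite /mutW posb_k (W0 skewW) /eta eqxx; ring. Qed.

Lemma mutW_kj j : W' k j = - eta k j * W k j.
Proof. by rewrite /mutW posb_k (W0 skewW) /eta eqxx; ring. Qed.

Lemma posb_mut i : posb W' i = bp i.
Proof.
rewrite /posb /negb_part mutW_ik /eta; case: (eqVneq i k) => [->|_]; first by rewrite (W0 skewW) mulr0 mul0r oppr0.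
by rewrite mulN1r mulNr.
Qed.

Lemma posp_mut j : posp W' j = posm W j.
Proof.
rewrite /posp /posm mutW_kj /eta; case: (eqVneq j k) => [->|_]; first by rewrite (W0 skewW) mulr0 mul0r oppr0.
by rewrite mulN1r mulNr.
Qed.

Lemma posm_mut j : posm W' j = posp W j.
Proof.
rewrite /posp /posm mutW_kj /eta; case: (eqVneq j k) => [->|_]; first by rewrite (W0 skewW) mulr0 mul0r oppr0.
by rewrite mulN1r mulNr opprK.
Qed.

(** The second mutation takes the opposite positive part, which by [mutW_eq] defines the same form;
    computed with it, the two changes of basis are inverse to each other. *)
Lemma mutWK i j : mutW W' k (posb W') i j = W i j.
Proof.
have e := mutW_eq skewW posb_k negb_k posb_sub.
rewrite {1}/mutW !posb_mut mutW_ik mutW_kj e /mutW /eta.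
case: (eqVneq i k) => [->|_]; case: (eqVneq j k) => [->|_]; rewrite ?negb_k ?(W0 skewW); ring.
Qed.

End Matrices.

(** * Expansions attached to a matrix and a cluster *)

Section Pack.
Variables (n : nat) (d : 'I_n -> nat) (Iu : {set 'I_n}) (i0 : 'I_n) (F : fieldType) (x : F).
Hypothesis d0 : forall i, (0 < d i)%N.
Notation mat := ('I_n -> 'I_n -> rat).
Notation s := (lift ord0).
Implicit Types (w : mat) (A : 'I_n -> F).

Definition okmat w := [/\ forall i j, w i j = - w j i,
  forall i j, i \in Iu -> (d i)%:R * w i j \is a Num.int &
  forall i j, i \in Iu -> w i j * (d j)%:R \is a Num.int].

(** A relation on Gram matrices and clusters, with the exchange relation kept as a product: in this
    form it is symmetric, while the mutation of bases is not an involution. *)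
Definition Step w A k (w' : mat) (A' : 'I_n -> F) :=
  [/\ forall i j, w' i j = mutW w k (posb k d w) i j, forall j, j != k -> A' j = A j &
      A' k * A k = \prod_j A j ^+ posp k d w j + \prod_j A j ^+ posm k d w j].

Lemma okmat_mut w k : okmat w -> k \in Iu -> okmat (mutW w k (posb k d w)).
Proof.
case=> sk ad ev ku; split.
- exact: mutW_skew.
- exact: (adm_mut (U := mem Iu) sk ku ad).
- move=> i j iu; exact: (ev_mut (U := mem Iu) (J := predT) sk ku isT ad (fun i j iu _ => ev i j iu)).
Qed.

Lemma Step_okmat w A k w' A' : k \in Iu -> okmat w -> Step w A k w' A' -> okmat w'.
Proof.
move=> ku ok [h _ _]; have -> : w' = mutW w k (posb k d w).
  by apply: functional_extensionality => i; apply: functional_extensionality => j.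
exact: okmat_mut.
Qed.

Lemma Step_sym w A k w' A' : k \in Iu -> okmat w -> Step w A k w' A' -> Step w' A' k w A.
Proof.
move=> ku [sk ad _] [h hA hk]; have -> : w' = mutW w k (posb k d w).
  by apply: functional_extensionality => i; apply: functional_extensionality => j.
split=> [i j|j jk|]; first by rewrite (mutWK (U := mem Iu) sk ku ad).
  by rewrite hA.
have z : posp k d w k = 0%N by rewrite /posp (W0 sk) mul0r pos_part0.
have z' : posm k d w k = 0%N by rewrite /posm (W0 sk) mul0r oppr0 pos_part0.
rewrite mulrC hk addrC; congr (_ + _); apply: eq_bigr => j _.
  by rewrite posp_mut //; case: (eqVneq j k) => [->|jk]; rewrite ?z' ?expr0 // hA.
by rewrite posm_mut //; case: (eqVneq j k) => [->|jk]; rewrite ?z ?expr0 // hA.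
Qed.

(* The exponents are extended by ord0, which plays the part of o; A_o does not occur in the
   evaluation of monomials, and its value 1 is irrelevant. *)
Definition dx (i : 'I_n.+1) : nat := if unlift ord0 i is Some j then d j else d i0.
Definition Ux : seq 'I_n.+1 := ord0 :: [seq s j | j <- enum Iu].
Definition Aext A (i : 'I_n.+1) : F := if unlift ord0 i is Some j then A j else 1.

Lemma dx_s j : dx (s j) = d j. Proof. by rewrite /dx liftK. Qed.
Lemma dx_0 : dx ord0 = d i0. Proof. by rewrite /dx unlift_none. Qed.
Lemma Aext_s A j : Aext A (s j) = A j. Proof. by rewrite /Aext liftK. Qed.
Lemma dx_gt0 i : (0 < dx i)%N. Proof. by rewrite /dx; case: unlift. Qed.
Lemma s_neq0 (j : 'I_n) : s j != ord0. Proof. by rewrite eq_sym neq_lift. Qed.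
Lemma s_eq (i j : 'I_n) : (s i == s j :> 'I_n.+1) = (i == j).
Proof. exact: (inj_eq (@lift_inj _ _)). Qed.
Lemma s_Ux j : (s j \in Ux) = (j \in Iu).
Proof. by rewrite inE (negbTE (s_neq0 j)) /= mem_map ?mem_enum //; apply: lift_inj. Qed.
Lemma Ux_uniq : uniq Ux.
Proof.
rewrite /= map_inj_uniq ?enum_uniq ?andbT //; last exact: lift_inj.
by apply/mapP => -[j _ e]; have := s_neq0 j; rewrite -e eqxx.
Qed.
Lemma ordP (P : 'I_n.+1 -> Prop) : P ord0 -> (forall j, P (s j)) -> forall i, P i.
Proof. by move=> h0 hs i; case: (unliftP ord0 i) => [j ->|->]. Qed.

Lemma prod_lift (G : 'I_n.+1 -> F) : \prod_(j | j != ord0) G j = \prod_j G (s j).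
Proof.
rewrite big_mkcond big_ord_recl /= mul1r; apply: eq_bigr => j _.
by [].
Qed.

(** The extended form W depends on the seed where e_o was adjoined and on the mutations since then,
    hence the existential; only its restriction to the seed is prescribed. No sign is recorded. *)
Definition pack w A := exists (W : 'I_n.+1 -> 'I_n.+1 -> rat) (P : 'X_{1..n.+1} -> rat) (M : nat),
  [/\ forall i j, W i j = - W j i, forall i j, W (s i) (s j) = w i j,
      forall i j, i \in Ux -> (dx i)%:R * W i j \is a Num.int,
      forall i j, i \in Ux -> j != ord0 -> W i j * (dx j)%:R \is a Num.int &
      [/\ Inv W ord0 dx Ux P, Pok ord0 Ux P M & @ev n.+1 ord0 dx F W (Aext A) P M = x]].

Lemma pack_step w A k w' A' : k \in Iu -> (forall j, A j != 0) -> (forall j, A' j != 0) ->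
  Step w A k w' A' -> pack w A -> pack w' A'.
Proof.
move=> ku A0 A'0 [hw hA hk] [W [P [M [sk eW ad evW [inv hP hev]]]]].
have skU : s k \in Ux by rewrite s_Ux.
have eb j : posb (s k) dx W (s j) = posb k d w j by rewrite /posb eW dx_s.
have sb := posb_sub (U := mem Ux) sk skU ad.
have b0 := posb_k (s k) dx sk; have b1 := negb_k (s k) dx sk; have b2 := posb_mul0 W (s k) dx.
have evW' := evW : forall i j, mem Ux i -> (predC1 ord0) j -> _.
have ok : ord0 != s k by rewrite eq_sym s_neq0.
have Ax0 j : j != ord0 -> Aext A j != 0.
  by elim/ordP: j => [|j]; rewrite ?eqxx // Aext_s.
exists (mutW W (s k) (posb (s k) dx W)), (mutP W (s k) dx (posb (s k) dx W) P), ((1 + \sum_i posb (s k) dx W i) * M)%N.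
split.
- exact: mutW_skew.
- by move=> i j; rewrite hw /mutW !eW !eb /eta !s_eq.
- exact: (adm_mut (U := mem Ux) sk skU ad).
- exact: (ev_mut (U := mem Ux) (J := predC1 ord0) sk skU (s_neq0 k) ad evW').
split.
- exact: (Inv_step sk Ux_uniq skU ok dx_gt0 ad sb b0 b1 b2 inv).
- exact: (mutP_ok sk skU ok ad b0 hP).
rewrite -hev; apply: (ev_step sk Ux_uniq skU ok dx_gt0 ad evW sb b0 b1 b2 Ax0
  (pp := posp (s k) dx W) (pm := posm (s k) dx W)) => //.
- by move=> j jo; apply: pos_part_sub; apply: evW.
- exact: (posb_posm (U := mem Ux) (J := predC1 ord0) sk skU ad evW').
- elim/ordP => [|j _]; first by rewrite eqxx.
  rewrite !Aext_s s_eq !prod_lift; case: (eqVneq j k) => [->|jk]; last by rewrite hA.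
  apply: (mulIf (A0 k)); rewrite divfK // hk; congr (_ + _); apply: eq_bigr => i _.
    by rewrite Aext_s /posp eW dx_s.
  by rewrite Aext_s /posm eW dx_s.
by rewrite Aext_s.
Qed.

Lemma pack_init w A : okmat w -> (forall j, A j != 0) -> x = A i0 -> pack w A.
Proof.
move=> [sk ad evw] A0 ex.
(* With these pairings y^(e_o) evaluates to [A i0], and they are nonnegative as [Inv_init]
   requires. *)
pose f j : rat := (j == i0)%:R / (d i0)%:R.
pose W (i j : 'I_n.+1) : rat := match unlift ord0 i, unlift ord0 j with
  | Some i', Some j' => w i' j' | None, Some j' => f j' | Some i', None => - f i' | None, None => 0 end.
have Wss i j : W (s i) (s j) = w i j by rewrite /W !liftK.
have W0s j : W ord0 (s j) = f j by rewrite /W liftK unlift_none.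
have Ws0 j : W (s j) ord0 = - f j by rewrite /W liftK unlift_none.
have W00 : W ord0 ord0 = 0 by rewrite /W unlift_none.
have dn j : (d j)%:R != 0 :> rat by rewrite pnatr_eq0 gtn_eqF.
have fd j : (d j)%:R * f j = (j == i0)%:R.
  by rewrite /f; case: eqP => [->|_]; rewrite ?mul0r ?mulr0 // mul1r divff.
have fd0 j : (d i0)%:R * f j = (j == i0)%:R by rewrite /f mulrC divfK.
have Wsk i j : W i j = - W j i.
  elim/ordP: i => [|i]; elim/ordP: j => [|j]; rewrite ?W00 ?W0s ?Ws0 ?Wss ?oppr0 ?opprK //.
have oU : ord0 \in Ux by rewrite mem_head.
exists W, (delta U_(ord0)%MM), 1%N; split => //.
- move=> i j; elim/ordP: i => [_|i].
    rewrite dx_0; elim/ordP: j => [|j]; first by rewrite W00 mulr0 rpred0.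
    by rewrite W0s fd0 rpred_nat.
  rewrite s_Ux dx_s => iu; elim/ordP: j => [|j]; last by rewrite Wss ad.
  by rewrite Ws0 mulrN rpredN fd rpred_nat.
- move=> i j; elim/ordP: j => [_|j]; first by rewrite eqxx.
  rewrite dx_s => + _; elim/ordP: i => [_|i]; first by rewrite W0s mulrC fd rpred_nat.
  by rewrite s_Ux Wss => iu; apply: evw.
split.
- apply: (Inv_init Wsk Ux_uniq oU); elim/ordP => [|j]; first by rewrite W00.
  by rewrite W0s /f divr_ge0 ?ler0n.
- have nz m : delta U_(ord0)%MM m != 0 :> rat -> m = U_(ord0)%MM.
    by move=> h; apply/eqP; apply: contraNT h => ne; rewrite /delta (negbTE ne).
  split=> [m|m /nz ->|m /nz ->|m i /nz -> iU].
  + exact: rpred_nat.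
  + by rewrite mdeg1.
  + by rewrite mnm1E eqxx.
  by rewrite mnm1E; case: eqP iU => // <-; rewrite oU.
rewrite /ev (bigD1_seq U_(ord0)%MM) ?mem_mons ?mdeg1 ?mons_uniq //= [X in _ + X]big1 => [|m ne]; last first.
  by rewrite /delta (negbTE ne) iota0 mul0r.
rewrite addr0 /delta eqxx iota_nat mul1r /Ev /Ep prod_lift (bigD1 i0) //= big1 => [|j ji].
  by rewrite /zx om1 dx_s W0s [f _ * _]mulrC fd eqxx Aext_s mulr1 -ex expr1z.
by rewrite /zx om1 dx_s W0s [f _ * _]mulrC fd (negbTE ji) expr0z.
Qed.

(** Different exponents may give the same monomial in A, so coefficients are summed over the fibres
    of z; [coef_ge0] makes each of them a natural number. *)
Lemma pack_positive w A : pack w A -> positive_Laurent A x.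
Proof.
case=> W [P [M [sk eW ad evW [inv [Pi _ Po _] <-]]]].
pose z m : {ffun 'I_n -> int} := [ffun j => zx dx W m (s j)].
pose L := [seq m <- mons n.+1 M | P m != 0].
exists (undup [seq z m | m <- L]), (fun f => \sum_(m <- L | z m == f) `|numq (P m)|)%N.
split; first exact: undup_uniq.
have -> : @ev n.+1 ord0 dx F W (Aext A) P M = \sum_(m <- L) (`|numq (P m)|%N)%:R * \prod_j A j ^ z m j.
  rewrite /ev big_filter (bigID (fun m => P m != 0)) /= [X in _ + X]big1 ?addr0 => [|m]; last first.
    by rewrite negbK => /eqP ->; rewrite iota0 mul0r.
  apply: eq_bigr => m nz; congr (_ * _).
    have P0 : 0 <= P m by apply: (coef_ge0 sk dx_gt0 ad inv (Po _ nz)).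
    rewrite /iota; have : 0 <= numq (P m) by rewrite numq_ge0.
    by case: (numq (P m)).
  by rewrite /Ev /Ep prod_lift; apply: eq_bigr => j _; rewrite Aext_s ffunE.
have -> : \sum_(f <- undup [seq z m | m <- L]) (\sum_(m <- L | z m == f) `|numq (P m)|)%N%:R * \prod_i A i ^ f i =
  \sum_(f <- undup [seq z m | m <- L]) \sum_(m <- L) (if z m == f then (`|numq (P m)|%N)%:R * \prod_i A i ^ z m i else 0) :> F.
  apply: eq_bigr => f _; rewrite -big_mkcond natr_sum mulr_suml; apply: eq_bigr => m /eqP -> //.
rewrite exchange_big big_seq_cond [RHS]big_seq_cond; apply: eq_bigr => m /andP[mL _].
rewrite (bigD1_seq (z m)) ?undup_uniq ?mem_undup ?map_f //= eqxx [X in _ = _ + X]big1 ?addr0 // => f ne.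
by rewrite eq_sym (negbTE ne).
Qed.

End Pack.

(** * Cluster variables are nonzero *)

Lemma frac_mul (F : fieldType) (x y q q' : F) : x * y * (q * q') = (x * q) * (y * q').
Proof. ring. Qed.
Lemma frac_add (F : fieldType) (x y q q' : F) : (x + y) * (q * q') = (x * q) * q' + (y * q') * q.
Proof. ring. Qed.
Lemma frac_div (F : fieldType) (x y q q' : F) : y != 0 -> x / y * (q * (y * q')) = (x * q) * q'.
Proof. by move=> y0; field. Qed.

Section SubtractionFree.
Variables (K : fieldType) (n : nat) (A : 'I_n -> ratfun K n).
Hypothesis charK : [pchar K] =i pred0.
Hypothesis indepA : alg_independent A.
Notation phi := (mmap (@tofrac {mpoly K[n]} \o @mpolyC n K) A).

Definition natp (p : {mpoly K[n]}) := forall m, exists c : nat, p@_m = c%:R.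
(** Subtraction-free expressions in A. In characteristic 0 sums of polynomials with natural
    coefficients do not cancel, so this class is closed under the exchange relation and avoids
    zero. *)
Definition sf (x : ratfun K n) := exists p q,
  [/\ natp p /\ natp q, p != 0, q != 0 & x * phi q = phi p].

Lemma natrK_eq0 (c : nat) : (c%:R == 0 :> K) = (c == 0)%N.
Proof. exact: (pcharf0P _).1 charK c. Qed.

Lemma phi_neq0 p : p != 0 -> phi p != 0.
Proof. by apply: contra => /eqP h; apply/eqP/indepA. Qed.

Lemma sf_neq0 x : sf x -> x != 0.
Proof.
case=> p [q [_ p0 _ e]]; apply: contraNneq (phi_neq0 p0) => x0.
by rewrite -e x0 mul0r.
Qed.

Lemma natp_add p q : natp p -> natp q -> natp (p + q).
Proof.
move=> hp hq m; have [a ea] := hp m; have [c ec] := hq m.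
by exists (a + c)%N; rewrite mcoeffD ea ec natrD.
Qed.

Lemma natp_mul p q : natp p -> natp q -> natp (p * q).
Proof.
move=> hp hq m; rewrite mcoeffM; apply: (big_ind (fun y : K => exists c : nat, y = c%:R)).
- by exists 0%N.
- by move=> _ _ [a ->] [c ->]; exists (a + c)%N; rewrite natrD.
by move=> i _; have [a ->] := hp i.1; have [c ->] := hq i.2; exists (a * c)%N; rewrite natrM.
Qed.

Lemma natp_add_neq0 p q : natp p -> natp q -> p != 0 -> p + q != 0.
Proof.
move=> hp hq; apply: contraNneq => e; apply/eqP/mpolyP => m; rewrite mcoeff0; apply/eqP.
have := congr1 (mcoeff m) e; rewrite mcoeffD mcoeff0.
have [a ->] := hp m; have [c ->] := hq m; rewrite -natrD => /eqP.
by rewrite !natrK_eq0 addn_eq0 => /andP[].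
Qed.

Lemma natp1 : natp 1.
Proof. by move=> m; rewrite mcoeff1; exists (m == 0%MM). Qed.

Lemma sf1 : sf 1.
Proof. by exists 1, 1; rewrite !oner_neq0 mul1r; split=> //; split; apply: natp1. Qed.

Lemma sf_var i : sf (A i).
Proof.
exists 'X_i, 1; rewrite oner_neq0 rmorph1 mulr1; split=> //.
- by split; [move=> m; rewrite mcoeffX; eexists|apply: natp1].
- by apply/eqP => /(congr1 (mcoeff U_(i)%MM)); rewrite mcoeffX eqxx mcoeff0 => /eqP; rewrite oner_eq0.
by rewrite [RHS]mmapX mmap1U.
Qed.

Lemma sf_mul x y : sf x -> sf y -> sf (x * y).
Proof.
move=> [p [q [[hp hq] p0 q0 e]]] [p' [q' [[hp' hq'] p'0 q'0 e']]].
exists (p * p'), (q * q'); split; try exact: mulf_neq0; first by split; apply: natp_mul.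
by rewrite !rmorphM /= -e -e' frac_mul.
Qed.

Lemma sf_div x y : sf x -> sf y -> sf (x / y).
Proof.
move=> sx sy; have y0 := sf_neq0 sy; case: sx sy => p [q [[hp hq] p0 q0 e]] [p' [q' [[hp' hq'] p'0 q'0 e']]].
exists (p * q'), (q * p'); split; try exact: mulf_neq0; first by split; apply: natp_mul.
by rewrite !rmorphM /= -e -e' frac_div.
Qed.

Lemma sf_add x y : sf x -> sf y -> sf (x + y).
Proof.
move=> [p [q [[hp hq] p0 q0 e]]] [p' [q' [[hp' hq'] p'0 q'0 e']]].
exists (p * q' + p' * q), (q * q'); split; try exact: mulf_neq0.
- by split; [apply: natp_add|]; apply: natp_mul.
- by apply: natp_add_neq0; try exact: natp_mul; apply: mulf_neq0.
by rewrite rmorphD !rmorphM /= -e -e' frac_add.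
Qed.

Lemma sf_prod (I : Type) (s : seq I) (G : I -> ratfun K n) (a : I -> nat) :
  (forall i, sf (G i)) -> sf (\prod_(i <- s) G i ^+ a i).
Proof.
move=> h; apply: big_ind => [||i _]; [exact: sf1|exact: sf_mul|].
elim: (a i) => [|c IH]; first by rewrite expr0; apply: sf1.
by rewrite exprS; apply: sf_mul.
Qed.

End SubtractionFree.

(** * Gram matrices of seeds *)

Section Seeds.
Variables (N : zmodType) (n : nat) (D : fixed_data N n).
Notation fm := (Defs.form D).
Notation d := (dmult D).

Lemma form0l y : fm 0 y = 0.
Proof. by have := Defs.formDl D 0 0 y; rewrite addr0 => h; lra. Qed.
Lemma formNl x y : fm (- x) y = - fm x y.
Proof. by apply/eqP; rewrite -addr_eq0 -(Defs.formDl D) addNr form0l. Qed.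
Lemma formMnl x y a : fm (x *+ a) y = a%:R * fm x y.
Proof.
elim: a => [|a IH]; first by rewrite mulr0n form0l mul0r.
by rewrite mulrS Defs.formDl IH -natr1; ring.
Qed.
Lemma formNr x y : fm x (- y) = - fm x y.
Proof. by rewrite Defs.form_skew formNl [in RHS](Defs.form_skew D x). Qed.
Lemma formMnr x y a : fm x (y *+ a) = a%:R * fm x y.
Proof. by rewrite Defs.form_skew formMnl [in RHS](Defs.form_skew D x) mulrN. Qed.

Definition gram (e : 'I_n -> N) i j : rat := fm (e i) (e j).

Lemma gram_ok e : is_seed D e -> okmat d (Iuf D) (gram e).
Proof.
case=> _ [uf _] [ci _] _; split=> [i j|i j iu|i j iu].
- exact: Defs.form_skew.
- have eu := uf (exist _ i iu); rewrite /= in eu.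
  rewrite /gram -formMnl Defs.form_skew rpredN; apply: form_ufcirc; last exact: ci.
  by rewrite rpredMn.
- have eu := uf (exist _ i iu); rewrite /= in eu.
  by rewrite /gram mulrC -formMnr; apply: form_uf_circ.
Qed.

Lemma gram_mutate e k i j :
  gram (mutate_basis D k e) i j = mutW (gram e) k (posb k d (gram e)) i j.
Proof.
have skg i' j' : gram e i' j' = - gram e j' i' by apply: Defs.form_skew.
have g0 := W0 skg k; have b0 := posb_k k d skg.
rewrite /mutW {1}/gram /mutate_basis /eta.
case: (eqVneq i k) => [->|ik]; case: (eqVneq j k) => [->|jk]; rewrite ?b0 ?g0.
- by rewrite formNl formNr -/(gram e k k) g0; ring.
- rewrite formNl Defs.formDr formMnr -/(gram e k k) -/(gram e k j) g0; ring.
- rewrite formNr Defs.formDl formMnl -/(gram e k k) -/(gram e i k) g0; ring.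
rewrite Defs.formDl !Defs.formDr !formMnl !formMnr -/(gram e k k) -/(gram e i j) -/(gram e i k) -/(gram e k j) g0.
rewrite /posb /epsilon -/(gram e i k) -/(gram e j k); ring.
Qed.

Variable F : fieldType.
Implicit Types (s : cluster_seed N n F).

Lemma mutate_Step s k : (forall j, seed_vars s j != 0) ->
  Step d (gram (seed_basis s)) (seed_vars s) k
    (gram (seed_basis (mutate D s k))) (seed_vars (mutate D s k)).
Proof.
move=> A0; split=> [i j|j jk|]; first exact: gram_mutate.
  by rewrite /= /mutate_cluster (negbTE jk).
by rewrite /= /mutate_cluster eqxx divfK.
Qed.
End Seeds.

Section Main.
Variables (N : zmodType) (n : nat) (D : fixed_data N n) (K : fieldType).
Hypothesis charK : [pchar K] =i pred0.
Variable A : 'I_n -> ratfun K n.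
Hypothesis indepA : alg_independent A.
Implicit Types (s : cluster_seed N n (ratfun K n)).

Definition good_seed s := okmat (dmult D) (Iuf D) (gram D (seed_basis s)) /\
  forall j, sf A (seed_vars s j).

Lemma good_seed_mutate s k : k \in Iuf D -> good_seed s -> good_seed (mutate D s k).
Proof.
move=> ku [ok sv]; split.
  apply: (Step_okmat ku ok (mutate_Step D k (s := s) _)) => j; exact: (sf_neq0 indepA (sv j)).
move=> j; rewrite /= /mutate_cluster; case: eqP => // _.
by apply: (sf_div indepA) => //; apply: (sf_add charK); apply: sf_prod.
Qed.

Lemma good_seed_foldl ks s : all (fun k => k \in Iuf D) ks -> good_seed s ->
  good_seed (foldl (@mutate N n D _) s ks).
Proof.
elim: ks s => //= k ks IH s /andP[ku kus] gs.
by apply: IH => //; apply: good_seed_mutate.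
Qed.

Definition spack (i0 : 'I_n) (x : ratfun K n) s :=
  pack (dmult D) (Iuf D) i0 x (gram D (seed_basis s)) (seed_vars s).

(** An equivalence because every [Step] is reversible, although the underlying seeds need not be
    recovered by mutating back. *)
Lemma spack_foldl i0 x ks s : all (fun k => k \in Iuf D) ks -> good_seed s ->
  (spack i0 x s <-> spack i0 x (foldl (@mutate N n D _) s ks)).
Proof.
elim: ks s => //= k ks IH s /andP[ku kus] gs.
have gs' := good_seed_mutate ku gs; rewrite -(IH _ kus gs').
have n0 s' : good_seed s' -> forall j, seed_vars s' j != 0 by move=> [_ h] j; apply: (sf_neq0 indepA).
have st := mutate_Step D k (n0 _ gs).
split; first exact: (pack_step (@dmult_gt0 _ _ D) ku (n0 _ gs) (n0 _ gs') st).
apply: (pack_step (@dmult_gt0 _ _ D) ku (n0 _ gs') (n0 _ gs)).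
exact: (Step_sym ku gs.1 st).
Qed.

End Main.

Theorem corollary0p4 (N : zmodType) (n : nat) (D : fixed_data N n)
    (K : fieldType) (charK : [pchar K] =i pred0)
    (e : 'I_n -> N) (seed_e : is_seed D e)
    (A : 'I_n -> ratfun K n) (indepA : alg_independent A)
    (x : ratfun K n)
    (cluster_x : is_cluster_variable D (ClusterSeed e A) x)
    (s : cluster_seed N n (ratfun K n))
    (reach_s : mutation_reachable D (ClusterSeed e A) s) :
  positive_Laurent (seed_vars s) x.
Proof.
case: cluster_x => t [[kt [ut et]] [i ex]]; case: reach_s => ks [us es].
have g0 : good_seed D A (ClusterSeed e A) by split; [exact: gram_ok|exact: sf_var].
have gt : good_seed D A t by rewrite et; apply: good_seed_foldl.
have pt : spack D i x t.
  apply: pack_init => //; [exact: dmult_gt0|exact: gt.1|].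
  by move=> j; apply: (sf_neq0 indepA); apply: gt.2.
(* The expansion, trivial at the seed t containing x, is carried back to the initial seed and from
   there forward to s. *)
rewrite et in pt; move/(spack_foldl charK indepA i x ut g0): pt.
move/(spack_foldl charK indepA i x us g0); rewrite -es.
exact/pack_positive/(@dmult_gt0 _ _ D).
Qed.
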